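(* Let $x(t)$ and $\widehat x(t)$, $t\in[0,\tau]$, be two absolutely continuous curves in a connected, simply connected, oriented Riemannian manifold $M$ of constant sectional curvature. Then there is a rolling $q(t)$ of $M$ on itself along $x(t)$ and $\widehat x(t)$ (i.e. with $\pi q(t)=x(t)$ and $\widehat\pi q(t)=\widehat x(t)$ for all $t$) if and only if there is an orientation preserving isometry $\iota$ of $M$ such that $\iota(x(t))=\widehat x(t)$.
   Context: Rolling. Let $M,\widehat M$ be connected, oriented Riemannian manifolds of the same dimension $n$ (here $\widehat M=M$). Let $Q=\{q\in \mathrm{SO}(T_xM,T_{\widehat x}\widehat M): x\in M,\ \widehat x\in\widehat M\}$, where $\mathrm{SO}(V,W)$ is the set of orientation preserving linear isometries between oriented inner product spaces $V$ and $W$; $Q$ is a smooth fiber bundle over $M\times\widehat M$, with projections $\pi\colon Q\to M$ (first factor) and $\widehat\pi\colon Q\to\widehat M$ (second factor). A rolling (without slipping or twisting) of $M$ on $\widehat M$ is an absolutely continuous curve $q\colon[0,\tau]\to Q$ such that, with $x(t)=\pi q(t)$ and $\widehat x(t)=\widehat\pi q(t)$: (I) no slip: $\dot{\widehat x}(t)=q(t)\dot x(t)$ for almost all $t$; (II) no twist: $q(t)\frac{D}{dt}Z(t)=\frac{D}{dt}\big(q(t)Z(t)\big)$ for any vector field $Z(t)$ along $x(t)$ and almost every $t$. Here $\frac{D}{dt}$ is the covariant derivative along the curve for the Levi-Civita connection of the respective manifold.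
   Formalization: The manifold M is additionally assumed (geodesically) complete; without this the claim fails, e.g. for the flat open unit disc with the constant curves x(t)=0 and x̂(t)=p≠0, which admit a rolling but no isometry taking 0 to p. *)

(* Defs.v *)
From HB Require Import structures.
From mathcomp Require Import all_boot all_order all_algebra.
From mathcomp Require Import all_classical all_reals all_analysis.
Set Implicit Arguments.
Unset Strict Implicit.
Unset Printing Implicit Defensive.
Import Order.TTheory GRing.Theory Num.Theory.
Import numFieldNormedType.Exports.
Local Open Scope classical_set_scope.
Local Open Scope ring_scope.

(* Tangent vectors are row vectors, so a linear map v |-> v *m A acts from the
   right, in accordance with deriveEjacobian: 'D_v f a = v *m 'J f a. *)

Section Euclidean.
Context {R : realType} {n : nat}.

Definition basis_vec (a : 'I_n) : 'rV[R]_n := delta_mx 0 a.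

Definition partial (a : 'I_n) (f : 'rV[R]_n -> R) : 'rV[R]_n -> R :=
  fun x => 'D_(basis_vec a) f x.

(* U is always open in the uses below. *)
Fixpoint Ck (k : nat) (U : set 'rV[R]_n) (f : 'rV[R]_n -> R) : Prop :=
  match k with
  | 0%N => forall x, U x -> {for x, continuous f}
  | k'.+1 => forall a : 'I_n,
      (forall x, U x -> derivable f x (basis_vec a)) /\ Ck k' U (partial a f)
  end.

Definition smooth_on (U : set 'rV[R]_n) (f : 'rV[R]_n -> R) : Prop :=
  forall k, Ck k U f.

Definition smooth_map_on m (U : set 'rV[R]_n) (f : 'rV[R]_n -> 'rV[R]_m) :=
  forall k : 'I_m, smooth_on U (fun x => f x 0 k).

Definition inner (G : 'M[R]_n) (u v : 'rV[R]_n) : R := (u *m G *m v^T) 0 0.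

(* The k-th component of nabla_(d_a) d_b for the Levi-Civita connection of the
   coordinate metric G. *)
Definition christoffel (G : 'rV[R]_n -> 'M[R]_n) (a b k : 'I_n)
    (x : 'rV[R]_n) : R :=
  2^-1 * \sum_(l < n) invmx (G x) k l *
    (partial a (fun y => G y l b) x + partial b (fun y => G y l a) x
     - partial l (fun y => G y a b) x).

(* The l-th component of R(d_a, d_b) d_c, where
   R(X, Y) = [nabla_X, nabla_Y] - nabla_[X, Y]. *)
Definition riemann (G : 'rV[R]_n -> 'M[R]_n) (a b c l : 'I_n)
    (x : 'rV[R]_n) : R :=
  partial a (christoffel G b c l) x - partial b (christoffel G a c l) x
  + \sum_(m < n) (christoffel G a m l x * christoffel G b c m x
                  - christoffel G b m l x * christoffel G a c m x).

Definition curvature (G : 'rV[R]_n -> 'M[R]_n) (x u v w : 'rV[R]_n) :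
    'rV[R]_n :=
  \row_l \sum_(a < n) \sum_(b < n) \sum_(c < n)
     u 0 a * v 0 b * w 0 c * riemann G a b c l x.

Definition sectional_curvature (G : 'rV[R]_n -> 'M[R]_n) (x u v : 'rV[R]_n) :
    R :=
  inner (G x) (curvature G x u v v) u /
  (inner (G x) u u * inner (G x) v v - inner (G x) u v ^+ 2).

End Euclidean.

Definition abs_continuous {R : realType} {V : normedModType R} (a b : R)
    (f : R -> V) : Prop :=
  forall e : R, 0 < e -> exists2 d : R, 0 < d &
    forall (m : nat) (u v : 'I_m -> R),
      (forall k, a <= u k /\ u k <= v k /\ v k <= b) ->
      trivIset [set: 'I_m] (fun k => `]u k, v k[%classic) ->
      \sum_(k < m) (v k - u k) < d ->
      \sum_(k < m) `|f (v k) - f (u k)| < e.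

Record chart (R : realType) (n : nat) (T : topologicalType) := Chart {
  dom : set T;
  phi : T -> 'rV[R]_n;
  phi_inv : 'rV[R]_n -> T;
  dom_open : open dom;
  img_open : open (phi @` dom);
  phiK : forall p, dom p -> phi_inv (phi p) = p;
  phi_cont : forall p, dom p -> {for p, continuous phi};
  phi_inv_cont : forall y, (phi @` dom) y -> {for y, continuous phi_inv}
}.

Definition transition {R : realType} {n : nat} {T : topologicalType}
    (c d : chart R n T) : 'rV[R]_n -> 'rV[R]_n := phi d \o phi_inv c.

(* Orientations are encoded by atlases whose transitions have positive
   Jacobian determinant.  The metric is given by its coordinate matrices:
   metric i y is the Gram matrix of the coordinate frame of chart i at the
   point with coordinates y. *)
Record oriented_riemannian_manifold (R : realType) (n : nat) := ORManifold {
  carrier :> topologicalType;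
  hausdorff_carrier : hausdorff_space carrier;
  second_countable_carrier : @second_countable carrier;
  idx : Type;
  chart_of : idx -> chart R n carrier;
  atlas_cover : forall p, exists i, dom (chart_of i) p;
  atlas_smooth : forall i j,
    smooth_map_on
      (phi (chart_of i) @` (dom (chart_of i) `&` dom (chart_of j)))
      (transition (chart_of i) (chart_of j));
  atlas_oriented : forall i j p,
    dom (chart_of i) p -> dom (chart_of j) p ->
    0 < \det ('J (transition (chart_of i) (chart_of j))
                (phi (chart_of i) p));
  metric : idx -> 'rV[R]_n -> 'M[R]_n;
  metric_smooth : forall i a b,
    smooth_on (phi (chart_of i) @` dom (chart_of i))
      (fun y => metric i y a b);
  metric_sym : forall i p, dom (chart_of i) p ->
    (metric i (phi (chart_of i) p))^T = metric i (phi (chart_of i) p);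
  metric_posdef : forall i p v, dom (chart_of i) p -> v != 0 ->
    0 < inner (metric i (phi (chart_of i) p)) v v;
  metric_compat : forall i j p,
    dom (chart_of i) p -> dom (chart_of j) p ->
    let J := 'J (transition (chart_of i) (chart_of j))
               (phi (chart_of i) p) in
    metric i (phi (chart_of i) p)
      = J *m metric j (phi (chart_of j) p) *m J^T
}.

Section Manifold.
Context {R : realType} {n : nat}.
Implicit Types M : oriented_riemannian_manifold R n.

Definition domain M (i : idx M) : set M := dom (chart_of i).
Definition coord M (i : idx M) (p : M) : 'rV[R]_n := phi (chart_of i) p.

Definition coord_change M (i j : idx M) (p : M) : 'M[R]_n :=
  'J (transition (chart_of i) (chart_of j)) (coord i p).

Definition metric_at M (i : idx M) (p : M) : 'M[R]_n := metric i (coord i p).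

Definition some_chart M (p : M) : idx M := projT1 (cid (atlas_cover p)).

(* A tangent vector at p is the family v of its components in all charts
   around p; the values of v at charts not containing p are irrelevant. *)
Definition components M := idx M -> 'rV[R]_n.

Definition is_tangent M (p : M) (v : components M) : Prop :=
  forall i j, domain i p -> domain j p -> v j = v i *m coord_change i j p.

Definition has_constant_sectional_curvature M : Prop :=
  exists kappa : R, forall (i : idx M) (p : M), domain i p ->
    forall u v : 'rV[R]_n, row_free (col_mx u v) ->
    sectional_curvature (metric i) (coord i p) u v = kappa.

Definition simply_connected M : Prop :=
  forall g : R -> M, {within `[0, 1], continuous g} -> g 0 = g 1 ->
  exists H : R * R -> M,
    [/\ {within `[0, 1] `*` `[0, 1], continuous H},
        forall t, t \in `[0, 1] -> H (0, t) = g t,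
        forall t, t \in `[0, 1] -> H (1, t) = g 0 &
        forall s, s \in `[0, 1] -> H (s, 0) = g 0 /\ H (s, 1) = g 0].

Definition velocity M (g : R -> M) (t : R) : components M :=
  fun i => derive1 (fun s => coord i (g s)) t.

(* The covariant derivative DZ/dt of a vector field Z along g. *)
Definition covariant_derivative M (g : R -> M) (Z : R -> components M)
    (t : R) : components M :=
  fun i => derive1 (fun s => Z s i) t
    + \row_k \sum_(a < n) \sum_(b < n)
        christoffel (metric i) a b k (coord i (g t))
        * velocity g t i 0 a * Z t i 0 b.

Definition is_geodesic M (g : R -> M) : Prop :=
  continuous g /\
  forall t i, domain i (g t) ->
    [/\ derivable (fun s => coord i (g s)) t 1,
        derivable (fun s => velocity g s i) t 1 &
        covariant_derivative g (velocity g) t i = 0].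

Definition geodesically_complete M : Prop :=
  forall (p : M) (v : components M), is_tangent p v ->
  exists g : R -> M, [/\ is_geodesic g, g 0 = p &
    forall i, domain i p -> velocity g 0 i = v i].

(* Absolute continuity on [0, tau], for curves in M and for vector fields
   along them, is tested in charts. *)
Definition ac_curve M (tau : R) (g : R -> M) : Prop :=
  {within `[0, tau], continuous g} /\
  forall i a b, 0 <= a -> a <= b -> b <= tau ->
    (forall s, s \in `[a, b] -> domain i (g s)) ->
    abs_continuous a b (fun s => coord i (g s)).

Definition ac_field M (tau : R) (g : R -> M) (Z : R -> components M) : Prop :=
  (forall t, t \in `[0, tau] -> is_tangent (g t) (Z t)) /\
  forall i a b, 0 <= a -> a <= b -> b <= tau ->
    (forall s, s \in `[a, b] -> domain i (g s)) ->
    abs_continuous a b (fun s => Z s i).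

Definition local_rep M (f : M -> M) (i j : idx M) : 'rV[R]_n -> 'rV[R]_n :=
  phi (chart_of j) \o f \o phi_inv (chart_of i).

Definition smooth_self_map M (f : M -> M) : Prop :=
  continuous f /\
  forall i j, smooth_map_on (phi (chart_of i) @` (domain i `&` f @^-1` domain j))
                (local_rep f i j).

Definition preserves_metric M (f : M -> M) : Prop :=
  forall i j p, domain i p -> domain j (f p) ->
  let J := 'J (local_rep f i j) (coord i p) in
  metric_at i p = J *m metric_at j (f p) *m J^T.

Definition preserves_orientation M (f : M -> M) : Prop :=
  forall i j p, domain i p -> domain j (f p) ->
  0 < \det ('J (local_rep f i j) (coord i p)).

Definition orientation_preserving_isometry M (f : M -> M) : Prop :=
  [/\ exists g : M -> M,
        [/\ cancel f g, cancel g f, smooth_self_map f & smooth_self_map g],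
      preserves_metric f &
      preserves_orientation f].

(* A point of Q: an orientation preserving linear isometry from T_(src) M to
   T_(tgt) M', where mx i j is its matrix for the coordinate frames of the
   charts i around src and j around tgt. *)
Record config M M' := Config {
  src : M;
  tgt : M';
  mx : idx M -> idx M' -> 'M[R]_n;
  mx_compat : forall i i' j j',
    domain i src -> domain i' src -> domain j tgt -> domain j' tgt ->
    mx i j *m coord_change j j' tgt = coord_change i i' src *m mx i' j';
  mx_isometry : forall i j, domain i src -> domain j tgt ->
    mx i j *m metric_at j tgt *m (mx i j)^T = metric_at i src;
  mx_oriented : forall i j, domain i src -> domain j tgt -> 0 < \det (mx i j)
}.

(* By mx_compat the choice of the chart around src q is immaterial. *)
Definition config_app M M' (q : config M M') (v : components M) :
    components M' :=
  fun j => v (some_chart (src q)) *m mx q (some_chart (src q)) j.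

Definition ac_config M M' (tau : R) (q : R -> config M M') : Prop :=
  [/\ ac_curve tau (fun t => src (q t)),
      ac_curve tau (fun t => tgt (q t)) &
      forall i j a b, 0 <= a -> a <= b -> b <= tau ->
        (forall s, s \in `[a, b] ->
           domain i (src (q s)) /\ domain j (tgt (q s))) ->
        abs_continuous a b (fun s => mx (q s) i j)].

Definition no_slip M M' (tau : R) (q : R -> config M M') : Prop :=
  {ae @lebesgue_measure R, forall t, t \in `[0, tau] ->
    forall j, domain j (tgt (q t)) ->
    velocity (fun s => tgt (q s)) t j
      = config_app (q t) (velocity (fun s => src (q s)) t) j}.

Definition no_twist M M' (tau : R) (q : R -> config M M') : Prop :=
  forall Z : R -> components M, ac_field tau (fun s => src (q s)) Z ->
  {ae @lebesgue_measure R, forall t, t \in `[0, tau] ->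
    forall j, domain j (tgt (q t)) ->
    config_app (q t) (covariant_derivative (fun s => src (q s)) Z t) j
      = covariant_derivative (fun s => tgt (q s))
          (fun s => config_app (q s) (Z s)) t j}.

Definition is_rolling M M' (tau : R) (q : R -> config M M') : Prop :=
  [/\ ac_config tau q, no_slip tau q & no_twist tau q].

End Manifold.

(* Main.v *)
From Pilot Require Import Defs.
From HB Require Import structures.
From mathcomp Require Import all_boot all_order all_algebra.
From mathcomp Require Import all_classical all_reals all_analysis.
From mathcomp Require Import ring lra.
Set Implicit Arguments.
Unset Strict Implicit.
Unset Printing Implicit Defensive.
Import Order.TTheory GRing.Theory Num.Theory.
Import numFieldNormedType.Exports.
Local Open Scope classical_set_scope.
Local Open Scope ring_scope.
Import Pilot.Defs.

(* If the sectional curvature is kappa, the system df = <X, .>,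
   nabla X = - kappa f id for a function f and a vector field X is a flat linear
   connection; equivalently, X = grad f and f satisfies Obata's equation
   Hess f = - kappa f <., .>.  Since M is simply connected, a solution with a
   prescribed jet (f, X) at one point exists on all of M.  Given a rolling q, choose
   a basis f_0, ..., f_n of solutions, and let g_0, ..., g_n be the solutions whose
   jets at xhat(0) are those of the f_k at x(0) transported by q(0).  A map iota with
   g_k o iota = f_k exists along geodesics by completeness, hence globally by
   monodromy, and is an orientation preserving isometry, because
   kappa f_a f_b + <grad f_a, grad f_b> is constant on M and the same for the g_k.
   By no slip and no twist, the jets (f_k(x), q grad f_k) along xhat satisfy the same
   linear differential equation as the jets of g_k, for almost every time; absolute
   continuity forces equality, so g_k(xhat(t)) = f_k(x(t)), that is
   iota(x(t)) = xhat(t).  Conversely q(t) = d iota at x(t) is a rolling, since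
   isometries preserve the Levi-Civita connection. *)

(** * Differential calculus in coordinates *)

(** Neither an exponential map nor a nonlinear differential equation is ever solved: geodesics come
    from the completeness hypothesis, and the rest is linear. Along a geodesic a solution of Obata's
    equation obeys psi'' = - kappa |v|^2 psi, so suitable combinations of f_0, ..., f_n straighten
    the geodesics from a point and serve as normal coordinates there. The relation g_k(q) = f_k(p)
    between p and q then behaves like a covering: its continuous local solutions extend over a
    neighbourhood that depends on p alone. One monodromy theorem thus serves twice, with jets as
    fibres for the solutions and with points of M as fibres for iota. The map obtained is at first
    only continuous; it is differentiated implicitly, and its Jacobian is a smooth function of its
    values, which makes it smooth. The other obstacle is that a rolling has derivatives only almost
    everywhere: the two families of jets are compared through a matrix quotient with derivative zero
    almost everywhere, whose constancy rests on densities of absolutely continuous functions,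
    obtained from Radon-Nikodym. *)

Lemma subrBB (V : zmodType) (p a b : V) : p - a - (p - b) = b - a.
Proof. by rewrite opprB addrC addrA subrK. Qed.

Section DerivativeRules.
Context {R : realType}.

Lemma is_diff_of_estimate (V W : normedModType R) (f : V -> W) (x : V)
    (L : {linear V -> W}) : continuous L ->
  (forall e, 0 < e ->
     \forall h \near (0 : V), `|f (h + x) - f x - L h| <= e * `|h|) ->
  is_diff x f L.
Proof.
move=> cL fL.
have E : f \o shift x = cst (f x) + L +o_ (0 : V) id.
  apply/eqaddoP => _/posnumP[e] /=.
  near=> h; rewrite /= opprD addrA.
  by near: h; exact: fL.
have dE := diff_unique cL E.
by split => //; apply/diff_locallyP; rewrite dE.
Unshelve. all: by end_near. Qed.

Lemma is_derive_mxP (V : normedModType R) m n (F : V -> 'M[R]_(m, n)) x v dF :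
  is_derive x v F dF <-> forall i j, is_derive x v (fun y => F y i j) (dF i j).
Proof.
split=> [[dF1 <-] i j|H].
  split; first exact/(derivable_mxP F x v).1.
  by rewrite derive_mx// mxE.
have dF1 : derivable F x v by apply/derivable_mxP => i j; case: (H i j).
split => //; rewrite derive_mx//; apply/matrixP => i j; rewrite mxE.
by have := H i j; case.
Qed.

Lemma is_derive_sumP (V W : normedModType R) (I : finType) (h : I -> V -> W)
    (x v : V) (dh : I -> W) : (forall i, is_derive x v (h i) (dh i)) ->
  is_derive x v (fun y => \sum_i h i y) (\sum_i dh i).
Proof.
move=> H; rewrite -[X in is_derive _ _ X](fct_sumE).
elim/big_ind2 : _ => //; first exact: is_derive_cst.
by move=> f df g dg; exact: is_deriveD.
Qed.

Lemma is_derive_mulmx (V : normedModType R) m n p (A : V -> 'M[R]_(m, n))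
    (B : V -> 'M[R]_(n, p)) x v dA dB :
  is_derive x v A dA -> is_derive x v B dB ->
  is_derive x v (fun y => A y *m B y) (dA *m B x + A x *m dB).
Proof.
move=> /is_derive_mxP HA /is_derive_mxP HB; apply/is_derive_mxP => i j.
under [X in is_derive _ _ X _]eq_fun do rewrite mxE.
rewrite !mxE -big_split/=; apply: is_derive_sumP => k.
apply: (is_derive_eq (is_deriveM (HA i k) (HB k j))).
by rewrite addrC; congr (_ + _); rewrite /GRing.scale/= mulrC.
Qed.

Lemma is_derive_mulr (V : normedModType R) (f g : V -> R) x v df dg :
  is_derive x v f df -> is_derive x v g dg ->
  is_derive x v (fun y => f y * g y) (df * g x + f x * dg).
Proof.
move=> Hf Hg; have := is_deriveM Hf Hg.
by rewrite /GRing.scale/= addrC (mulrC (g x)).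
Qed.

Lemma is_derive_add (V W : normedModType R) (f g : V -> W) x v df dg :
  is_derive x v f df -> is_derive x v g dg ->
  is_derive x v (fun y => f y + g y) (df + dg).
Proof. by move=> Hf Hg; exact: is_deriveD. Qed.

Lemma is_derive_const (V W : normedModType R) (a : W) (x v : V) :
  is_derive x v (fun=> a) 0.
Proof. exact: is_derive_cst. Qed.

Lemma is_derive_opp (V W : normedModType R) (f : V -> W) x v df :
  is_derive x v f df -> is_derive x v (fun y => - f y) (- df).
Proof. by move=> Hf; exact: is_deriveN. Qed.

Lemma is_derive_sub (V W : normedModType R) (f g : V -> W) x v df dg :
  is_derive x v f df -> is_derive x v g dg ->
  is_derive x v (fun y => f y - g y) (df - dg).
Proof. by move=> Hf Hg; exact: is_deriveB. Qed.

Lemma is_derive_trmx (V : normedModType R) m n (A : V -> 'M[R]_(m, n)) x v dA :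
  is_derive x v A dA -> is_derive x v (fun y => (A y)^T) dA^T.
Proof.
move=> /is_derive_mxP HA; apply/is_derive_mxP => i j.
under [X in is_derive _ _ X _]eq_fun do rewrite mxE.
by rewrite mxE.
Qed.

Lemma is_derive1P (V W : normedModType R) (f : V -> W) x v df :
  is_derive x v f df <-> is_derive (0 : R) 1 (fun h : R => f (h *: v + x)) df.
Proof.
have E : (fun h : R => h^-1 *: ((f \o shift x) (h *: v) - f x)) =
    (fun h => h^-1 *: (((fun h : R => f (h *: v + x)) \o shift 0) (h *: 1)
       - (fun h : R => f (h *: v + x)) 0)).
  by apply/funext => h /=; rewrite addr0 scale0r add0r [_%:A]mulr1.
split=> -[d e]; split.
- exact: (derivable1P f x v).1.
- by rewrite -e /derive E.
- exact: (derivable1P f x v).2.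
- by rewrite -e /derive E.
Qed.

(** The inner function needs only a derivative in the one direction v: it is restricted to the line
    through x along v, where a directional derivative is a differential. *)
Lemma is_derive_comp_diff (U V W : normedModType R) (g : U -> V) (f : V -> W)
    x v dg : is_derive x v g dg -> differentiable f (g x) ->
  is_derive x v (fun y => f (g y)) ('d f (g x) dg).
Proof.
move=> /is_derive1P [dg1 dgE] df.
apply/is_derive1P; pose g0 := fun h : R => g (h *: v + x).
have g00 : g0 0 = g x by rewrite /g0 scale0r add0r.
have dg0 : differentiable g0 0 by exact/derivable1_diffP.
have dfg : differentiable f (g0 0) by rewrite g00.
have dd : differentiable (f \o g0) 0 by exact: differentiable_comp.
split; first exact/derivable1_diffP.
have -> : (fun h : R => f (g (h *: v + x))) = f \o g0 by [].
rewrite deriveE// diff_comp//=.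
by have -> : 'd g0 0 1 = dg by [rewrite -deriveE]; rewrite g00.
Qed.

Lemma is_derive_diff (V W : normedModType R) (f : V -> W) x v :
  differentiable f x -> is_derive x v f ('d f x v).
Proof. by move=> df; split; [exact: diff_derivable|exact: deriveE]. Qed.

Lemma is_derive_unique (V W : normedModType R) (f : V -> W) x v d1 d2 :
  is_derive x v f d1 -> is_derive x v f d2 -> d1 = d2.
Proof. by move=> [_ <-] [_ <-]. Qed.

Lemma is_derive_shiftline (V W : normedModType R) (f : V -> W) (x v : V) (s : R) df :
  is_derive (x + s *: v) v f df -> is_derive s 1 (fun t : R => f (x + t *: v)) df.
Proof.
move=> /is_derive1P H; apply/is_derive1P.
suff -> : (fun h : R => f (x + (h *: 1 + s) *: v)) =
  (fun h : R => f (h *: v + (x + s *: v))) by [].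
by apply/funext => h; rewrite [h *: 1]mulr1 scalerDl addrCA.
Qed.

Lemma line_MVT (V : normedModType R) (f : V -> R) (x v : V) :
  (forall s : R, 0 <= s <= 1 -> derivable f (x + s *: v) v) ->
  exists2 s : R, 0 < s < 1 & f (x + v) - f x = 'D_v f (x + s *: v).
Proof.
move=> df; pose g (s : R) := f (x + s *: v).
have dg (s : R) : 0 <= s <= 1 -> is_derive s 1 g ('D_v f (x + s *: v)).
  by move=> s01; apply: is_derive_shiftline; apply: derivableP; exact: df.
have [|||s s01 E] := @MVT R g (fun s => 'D_v f (x + s *: v)) 0 1.
- exact: ltr01.
- by move=> s; rewrite in_itv/= => /andP[s0 s1]; apply: dg; rewrite !ltW.
- apply: derivable_within_continuous => s; rewrite in_itv/= => s01.
  by case: (dg s s01).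
exists s; first by rewrite in_itv in s01.
by move: E; rewrite /g scale1r scale0r addr0 subr0 mulr1.
Qed.

End DerivativeRules.

Section MatrixNorm.
Context {R : realType}.

Lemma mxE_le_norm m n (A : 'M[R]_(m, n)) i j : `|A i j| <= `|A|.
Proof. by rewrite [leRHS]/Num.Def.normr/= mx_normrE; exact: (le_bigmax _ _ (i, j)). Qed.

Lemma mx_norm_le m n (A : 'M[R]_(m, n)) (c : R) : 0 <= c ->
  (forall i j, `|A i j| <= c) -> `|A| <= c.
Proof.
by move=> c0 H; rewrite [leLHS]/Num.Def.normr/= mx_normrE bigmax_le// => -[i j] _; exact: H.
Qed.

Lemma mx_norm_lt m n (A : 'M[R]_(m, n)) (c : R) : 0 < c ->
  (forall i j, `|A i j| < c) -> `|A| < c.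
Proof.
by move=> c0 H; rewrite [ltLHS]/Num.Def.normr/= mx_normrE bigmax_lt// => -[i j] _; exact: H.
Qed.

Lemma norm_mulmx_le m n p (A : 'M[R]_(m, n)) (B : 'M[R]_(n, p)) :
  `|A *m B| <= n%:R * `|A| * `|B|.
Proof.
apply: mx_norm_le => [|i j]; first by rewrite !mulr_ge0.
rewrite mxE (le_trans (ler_norm_sum _ _ _))//.
apply: (@le_trans _ _ (\sum_(k < n) `|A| * `|B|)).
  by apply: ler_sum => k _; rewrite normrM ler_pM ?mxE_le_norm.
by rewrite sumr_const card_ord -mulrA mulr_natl.
Qed.

Lemma norm_basis_vec n (a : 'I_n) : `|basis_vec a : 'rV[R]_n| = 1.
Proof.
apply/eqP; rewrite eq_le; apply/andP; split.
  apply: mx_norm_le => // i j; rewrite mxE.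
  by case: (_ && _); rewrite ?normr1 ?normr0.
by apply: le_trans (mxE_le_norm _ 0 a); rewrite mxE !eqxx normr1.
Qed.

Lemma row_sum_basis n (v : 'rV[R]_n) : v = \sum_a v 0 a *: basis_vec a.
Proof. exact: row_sum_delta. Qed.

Lemma near_forall_fin (T : topologicalType) (I : finType) (P : I -> T -> Prop)
    (x : T) : (forall i, \forall y \near x, P i y) ->
  \forall y \near x, forall i, P i y.
Proof. by move=> H; apply: filter_forall => i; exact: H. Qed.

Lemma open_near (T : topologicalType) (U : set T) x : open U -> U x ->
  \forall y \near x, U y.
Proof. by move=> oU Ux; exact: open_nbhs_nbhs. Qed.

Lemma continuous_epsP (T : topologicalType) (V : normedModType R) (f : T -> V) x :
  {for x, continuous f} <->
  forall e, 0 < e -> \forall y \near x, `|f x - f y| < e.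
Proof.
split=> [cf e e0|H]; first exact: (cvgrPdist_lt _ _).1 cf e e0.
by apply/cvgrPdist_lt.
Qed.

Lemma near_dist (V : normedModType R) (x : V) e : 0 < e ->
  \forall y \near x, `|x - y| < e.
Proof. by move=> e0; apply/nbhs_ballP; exists e => //= y; rewrite -ball_normE. Qed.

Lemma near0_add (V : normedModType R) (x : V) (P : set V) :
  (\forall y \near x, P y) -> \forall h \near (0 : V), P (x + h).
Proof.
move=> /nbhs_ballP[e /= e0 H]; apply/nbhs_ballP; exists e => //= h.
rewrite -ball_normE/= sub0r => he; apply: H.
by rewrite -ball_normE/= opprD addNKr.
Qed.

Lemma continuous_mx (T : topologicalType) m n (F : T -> 'M[R]_(m, n)) x :
  (forall i j, {for x, continuous (fun y => F y i j)}) -> {for x, continuous F}.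
Proof.
move=> H; apply/cvgrPdist_lt => e e0.
have : \forall y \near x, forall ij : 'I_m * 'I_n,
    `|F x ij.1 ij.2 - F y ij.1 ij.2| < e.
  by apply: filter_forall => -[i j] /=; exact: (cvgrPdist_lt _ _).1 (H i j) e e0.
apply: filterS => y Hy; apply: mx_norm_lt => // i j.
by rewrite !mxE; exact: (Hy (i, j)).
Qed.

Lemma continuous_mxE (T : topologicalType) m n (F : T -> 'M[R]_(m, n)) x i j :
  {for x, continuous F} -> {for x, continuous (fun y => F y i j)}.
Proof.
by move=> cF; apply: (@continuous_comp _ _ _ F (fun A => A i j)) => //; exact: coord_continuous.
Qed.

Lemma continuous_sum_fin (T : topologicalType) (I : finType) (f : I -> T -> R) x :
  (forall i, {for x, continuous (f i)}) ->
  {for x, continuous (fun y => \sum_i f i y)}.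
Proof.
move=> H; have -> : (fun y => \sum_i f i y) = \sum_i f i.
  by apply/funext => y; rewrite fct_sumE.
elim/big_ind : _ => //; first exact: cst_continuous.
by move=> g h cg ch; exact: continuousD.
Qed.

Lemma continuous_mulmx (T : topologicalType) m n p (A : T -> 'M[R]_(m, n))
    (B : T -> 'M[R]_(n, p)) x : {for x, continuous A} -> {for x, continuous B} ->
  {for x, continuous (fun y => A y *m B y)}.
Proof.
move=> cA cB; apply: continuous_mx => i j.
have -> : (fun t => (A t *m B t) i j) = fun t => \sum_k A t i k * B t k j.
  by apply/funext => s; rewrite mxE.
apply: continuous_sum_fin => k.
by apply: continuousM; exact: continuous_mxE.
Qed.

Lemma differentiable_mx (V : normedModType R) m n (F : V -> 'M[R]_(m, n)) x :
  (forall i j, differentiable (fun y => F y i j) x) -> differentiable F x.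
Proof.
move=> dF.
have -> : F = fun y => \sum_i \sum_j (F y i j) *: delta_mx i j.
  by apply/funext => y; exact: matrix_sum_delta.
pose H i := fun y => \sum_j (F y i j) *: (delta_mx i j : 'M[R]_(m, n)).
have dH i : differentiable (H i) x.
  have -> : H i = \sum_j (fun y => (F y i j) *: (delta_mx i j : 'M[R]_(m, n))).
    by apply/funext => y; rewrite fct_sumE.
  by apply: differentiable_sum => j; apply: differentiableZl.
have -> : (fun y => \sum_i \sum_j (F y i j) *: delta_mx i j) = \sum_i H i.
  by apply/funext => y; rewrite fct_sumE.
exact: differentiable_sum.
Qed.

Lemma differentiable_mxE (V : normedModType R) m n (F : V -> 'M[R]_(m, n)) x i j :
  differentiable F x -> differentiable (fun y => F y i j) x.
Proof.
move=> dF; apply: (@differentiable_comp _ _ _ _ F (fun A => A i j)) => //.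
exact: differentiable_coord.
Qed.

Lemma mul_jacobian m n (f : 'rV[R]_m -> 'rV[R]_n) x v :
  v *m 'J f x = 'd f x v.
Proof. exact: mul_rV_lin1. Qed.

End MatrixNorm.

Section RowForm.
Context {R : realType} {n : nat}.

Definition row_form (p : 'I_n -> R) (v : 'rV[R]_n) : R := \sum_a v 0 a * p a.

Fact row_form_is_linear p : linear (row_form p).
Proof.
move=> c u v; rewrite /row_form scaler_sumr -big_split/=.
by apply: eq_bigr => a _; rewrite !mxE mulrDl -mulrA.
Qed.
HB.instance Definition _ p := GRing.isLinear.Build _ _ _ _ (row_form p)
  (row_form_is_linear p).

Lemma row_form_continuous p : continuous (row_form p).
Proof.
move=> x; apply: differentiable_continuous.
have -> : (row_form p : 'rV[R]_n -> R) = \sum_a (fun v : 'rV[R]_n => v 0 a * p a).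
  by apply/funext => v; rewrite fct_sumE.
apply: differentiable_sum => a.
by apply: differentiableM => //; exact: differentiable_coord.
Qed.

End RowForm.

(** * Functions of class C^k on open sets *)

Section C1.
Context {R : realType} {n : nat}.
Implicit Types (U : set 'rV[R]_n) (f : 'rV[R]_n -> R).

Lemma is_derive_scalev (V W : normedModType R) (f : V -> W) x v (c : R) df :
  is_derive x v f df -> is_derive x (c *: v) f (c *: df).
Proof.
move=> /is_derive1P H; apply/is_derive1P.
have Hc : is_derive (0 : R) 1 (fun h : R => h * c) c.
  by apply: (is_derive_eq (is_derive_mulr (is_derive_id (0 : R) 1)
    (is_derive_cst c (0 : R) 1))); rewrite mulr0 addr0 mul1r.
have dH : differentiable (fun h : R => f (h *: v + x)) (0 * c).
  by rewrite mul0r; apply/derivable1_diffP; case: H.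
have := is_derive_comp_diff Hc dH.
have -> : 'd (fun h : R => f (h *: v + x)) (0 * c) c = c *: df.
  rewrite -[c in X in X = _]mulr1 [LHS]linearZ/= -deriveE// mul0r.
    by congr (_ *: _); case: H.
  by apply/derivable1_diffP; case: H.
suff -> : (fun h : R => f (h *: (c *: v) + x)) =
  (fun y : R => f ((y * c) *: v + x)) by [].
by apply/funext => h; rewrite scalerA.
Qed.

(** The point moves from x to h + x one coordinate at a time, with the mean value theorem on every
    leg; continuity of the partial derivatives at x compares the intermediate slopes with those at
    x. *)
Lemma C1_is_diff U f x : open U -> U x ->
  (forall a y, U y -> derivable f y (basis_vec a)) ->
  (forall a, {for x, continuous (partial a f)}) ->
  is_diff x f (row_form (partial^~ f ^~ x)).
Proof.
move=> oU Ux df cf.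
apply: is_diff_of_estimate; first exact: row_form_continuous.
(* The n increments add up to n e' |h|; the denominator [n.+1] stays nonzero in dimension 0. *)
move=> e e0; pose e' := e / n.+1%:R.
have e'0 : 0 < e' by rewrite divr_gt0.
have : \forall y \near x, U y /\ forall a, `|partial a f x - partial a f y| < e'.
  have H2 : \forall y \near x, forall a : 'I_n, `|partial a f x - partial a f y| < e'.
    by apply: near_forall_fin => a; exact: (cvgrPdist_lt _ _).1 (cf a) e' e'0.
  by apply: filterI H2; exact: open_nbhs_nbhs.
move=> /nbhs_ballP[d /= d0 dP].
apply/nbhs_ballP; exists d => //= h; rewrite -ball_normE/= sub0r normrN => hd.
(* [hk k] keeps the first k coordinates of h, so that consecutive points differ along one basis
   vector. *)
pose hk k : 'rV[R]_n := \row_j (if (j < k)%N then h 0 j else 0).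
have hk_ball k (s : R) (a : 'I_n) : 0 <= s <= 1 -> (k <= a)%N ->
    ball x d (x + hk k + s *: (h 0 a *: basis_vec a)).
  move=> /andP[s0 s1] ka; rewrite -ball_normE/= -addrA opprD addNKr normrN.
  apply: mx_norm_lt => // i j; rewrite !mxE !ord1 /=.
  apply: le_lt_trans hd; apply: le_trans (mxE_le_norm _ 0 j).
  case: ifPn => jk.
    by rewrite (_ : (j == a) = false) ?mulr0 ?addr0//; apply/negbTE;
      rewrite -val_eqE/= neq_ltn (leq_trans jk ka).
  rewrite add0r; case: eqVneq => [->|_]; last by rewrite !mulr0 normr0.
  by rewrite mulr1 normrM ler_piMl// ger0_norm.
have step (k : 'I_n) : exists2 y, ball x d y &
    f (x + hk k.+1) - f (x + hk k) = h 0 k * partial k f y.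
  have hkS : x + hk k.+1 = x + hk k + h 0 k *: basis_vec k.
    rewrite -addrA; congr (_ + _); apply/rowP => j; rewrite !mxE eqxx/=.
    rewrite ltnS leq_eqVlt; case: (eqVneq j k) => [->|jk].
      by rewrite eqxx ltnn mulr1 add0r.
    by rewrite val_eqE (negbTE jk)/= mulr0 addr0.
  have [|s /andP[s0 s1] E] := @line_MVT R _ f (x + hk k) (h 0 k *: basis_vec k).
    move=> s s01; have [] := is_derive_scalev (h 0 k)
      (derivableP (df k _ (dP _ (hk_ball k s k s01 (leqnn _))).1)) => //.
  have s01 : 0 <= s <= 1 by rewrite !ltW.
  exists (x + hk k + s *: (h 0 k *: basis_vec k)); first exact: hk_ball.
  rewrite hkS E; have [] := is_derive_scalev (h 0 k)
      (derivableP (df k _ (dP _ (hk_ball k s k s01 (leqnn _))).1)) => //.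
have fE : f (h + x) - f x = \sum_(k < n) (f (x + hk k.+1) - f (x + hk k)).
  rewrite -(big_mkord xpredT (fun k => f (x + hk k.+1) - f (x + hk k))).
  rewrite telescope_sumr//; congr (f _ - f _).
    by rewrite addrC; congr (_ + _); apply/rowP => j; rewrite mxE ltn_ord.
  by rewrite -[LHS]addr0; congr (_ + _); apply/rowP => j; rewrite !mxE.
rewrite fE /= /row_form -sumrB.
apply: (le_trans (ler_norm_sum _ _ _)).
apply: (@le_trans _ _ (\sum_(k < n) e' * `|h|)).
  apply: ler_sum => k _; have [y yd ->] := step k.
  rewrite -mulrBr normrM mulrC ler_pM ?mxE_le_norm//.
  by rewrite distrC ltW//; exact: (dP _ yd).2.
rewrite sumr_const card_ord -mulrnAl ler_wpM2r// -mulr_natr /e'.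
by rewrite -mulrA ler_piMr ?(ltW e0)// mulrC ler_pdivrMr// mul1r ler_nat.
Qed.

Lemma Ck_eq k U f g : open U -> (forall x, U x -> f x = g x) ->
  Ck k U f -> Ck k U g.
Proof.
move=> oU; elim: k f g => [|k IH] f g fg /=.
  move=> cf x Ux; apply: (@cvg_trans _ (f @ x)).
    have E : {near x, f =1 g}.
      have : \forall y \near x, U y by exact: open_nbhs_nbhs.
      by apply: filterS => y; exact: fg.
    exact: near_eq_cvg E.
  by rewrite -fg//; exact: cf.
have E x : U x -> \forall y \near x, f y = g y.
  by move=> Ux; apply: filterS (open_nbhs_nbhs (conj oU Ux)); exact: fg.
move=> H a; have [d1 d2] := H a; split.
  by move=> x Ux; apply: near_eq_derivable (d1 x Ux); exact: E.
by apply: IH d2 => x Ux; apply: near_eq_derive; exact: E.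
Qed.

Lemma Ck_sub k U V f : V `<=` U -> Ck k U f -> Ck k V f.
Proof.
move=> VU; elim: k f => [|k IH] f /= H; first by move=> x /VU; exact: H.
by move=> a; have [h1 h2] := H a; split=> [x /VU/h1//|]; exact: IH.
Qed.

Lemma C1_differentiable U f x : open U -> Ck 1 U f -> U x -> differentiable f x.
Proof.
move=> oU H Ux.
have [] // := @C1_is_diff U f x oU Ux.
  by move=> a y Uy; exact: (H a).1.
by move=> a; exact: (H a).2.
Qed.

(** [Ck k.+1] asks for continuity of the derivatives of top order only, not of f itself, so already
    the first case needs that continuous partial derivatives imply differentiability. *)
Lemma CkW k U f : open U -> Ck k.+1 U f -> Ck k U f.
Proof.
move=> oU; elim: k f => [|k IH] f H.
  by move=> x Ux; apply: differentiable_continuous; exact: C1_differentiable H Ux.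
by move=> a; have [h1 h2] := H a; split => //; exact: IH.
Qed.

Lemma Ck_le j k U f : open U -> (j <= k)%N -> Ck k U f -> Ck j U f.
Proof.
move=> oU; elim: k => [|k IH]; first by rewrite leqn0 => /eqP ->.
by rewrite leq_eqVlt => /predU1P[->//|jk /(CkW oU)]; exact: IH.
Qed.

Lemma Ck_differentiable k U f x : open U -> Ck k.+1 U f -> U x -> differentiable f x.
Proof.
by move=> oU H; apply: (C1_differentiable oU); exact: (@Ck_le 1 k.+1).
Qed.

Lemma Ck_continuous k U f x : open U -> Ck k U f -> U x -> {for x, continuous f}.
Proof. by move=> oU H Ux; apply: (@Ck_le 0 k U f). Qed.

Lemma diff_row_form f x v : differentiable f x ->
  'd f x v = row_form (partial^~ f ^~ x) v.
Proof.
move=> df; rewrite {1}[v]row_sum_basis linear_sum; apply: eq_bigr => a _.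
by rewrite linearZ/= /partial deriveE.
Qed.

Lemma derive_row_form f x v : differentiable f x ->
  'D_v f x = \sum_a v 0 a * partial a f x.
Proof. by move=> df; rewrite deriveE// diff_row_form. Qed.

Lemma partialE_jacobian m (F : 'rV[R]_n -> 'rV[R]_m) x a k :
  differentiable F x -> 'J F x a k = partial a (fun y => F y 0 k) x.
Proof.
move=> dF; have := is_derive_diff (basis_vec a) dF => /is_derive_mxP/(_ 0 k)[_].
rewrite /partial => ->; rewrite -mul_jacobian.
by rewrite /basis_vec -rowE [RHS]mxE.
Qed.

Lemma Ck_cst k U c : Ck k U (fun=> c).
Proof.
elim: k c => [|k IH] c /=; first by move=> x _; exact: cst_continuous.
move=> a; split; first by move=> x _; exact: derivable_cst.
by rewrite (_ : partial a _ = fun=> 0) ?IH//; apply/funext => x; exact: derive_cst.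
Qed.

Lemma CkD k U f g : open U -> Ck k U f -> Ck k U g -> Ck k U (fun x => f x + g x).
Proof.
move=> oU; elim: k f g => [|k IH] f g /= Hf Hg.
  by move=> x Ux; apply: continuousD; [exact: Hf|exact: Hg].
move=> a; have [f1 f2] := Hf a; have [g1 g2] := Hg a; split.
  by move=> x Ux; apply: derivableD; [exact: f1|exact: g1].
apply: (Ck_eq oU _ (IH _ _ f2 g2)) => x Ux; rewrite /partial.
by rewrite [RHS]deriveD//; [exact: f1|exact: g1].
Qed.

Lemma CkM k U f g : open U -> Ck k U f -> Ck k U g -> Ck k U (fun x => f x * g x).
Proof.
move=> oU; elim: k f g => [|k IH] f g Hf Hg.
  by move=> x Ux; apply: continuousM; [exact: Hf|exact: Hg].
have Hf' := CkW oU Hf; have Hg' := CkW oU Hg.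
move=> a; have [f1 f2] := Hf a; have [g1 g2] := Hg a; split.
  by move=> x Ux; apply: derivableM; [exact: f1|exact: g1].
apply: (Ck_eq oU _ (CkD oU (IH _ _ Hf' g2) (IH _ _ Hg' f2))) => x Ux.
by rewrite /partial [RHS]deriveM//; [exact: f1|exact: g1].
Qed.

Lemma CkN k U f : open U -> Ck k U f -> Ck k U (fun x => - f x).
Proof.
move=> oU H; apply: (Ck_eq oU _ (CkM oU (@Ck_cst k U (-1)) H)) => x _.
by rewrite mulN1r.
Qed.

Lemma CkB k U f g : open U -> Ck k U f -> Ck k U g -> Ck k U (fun x => f x - g x).
Proof. by move=> oU Hf Hg; apply: CkD => //; exact: CkN. Qed.

Lemma Ck_sum k U (I : Type) (r : seq I) (P : pred I) (F : I -> 'rV[R]_n -> R) :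
  open U -> (forall i, P i -> Ck k U (F i)) ->
  Ck k U (fun x => \sum_(i <- r | P i) F i x).
Proof.
move=> oU H; elim: r => [|i r IH].
  by apply: (Ck_eq oU _ (@Ck_cst k U 0)) => x _; rewrite big_nil.
case Pi : (P i).
  by apply: (Ck_eq oU _ (CkD oU (H i Pi) IH)) => x _; rewrite big_cons Pi.
by apply: (Ck_eq oU _ IH) => x _; rewrite big_cons Pi.
Qed.

Lemma Ck_prod k U (I : Type) (r : seq I) (P : pred I) (F : I -> 'rV[R]_n -> R) :
  open U -> (forall i, P i -> Ck k U (F i)) ->
  Ck k U (fun x => \prod_(i <- r | P i) F i x).
Proof.
move=> oU H; elim: r => [|i r IH].
  by apply: (Ck_eq oU _ (@Ck_cst k U 1)) => x _; rewrite big_nil.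
case Pi : (P i).
  by apply: (Ck_eq oU _ (CkM oU (H i Pi) IH)) => x _; rewrite big_cons Pi.
by apply: (Ck_eq oU _ IH) => x _; rewrite big_cons Pi.
Qed.

Lemma CkV k U f : open U -> (forall x, U x -> f x != 0) ->
  Ck k U f -> Ck k U (fun x => (f x)^-1).
Proof.
move=> oU f0; elim: k => [|k IH] H.
  by move=> x Ux; apply: continuousV; [exact: f0|exact: H].
have IH' := IH (CkW oU H).
move=> a; have [f1 f2] := H a; split.
  by move=> x Ux; apply: derivableV; [exact: f0|exact: f1].
apply: (Ck_eq oU _ (CkN oU (CkM oU (CkM oU IH' IH') f2))) => x Ux.
rewrite /partial [RHS]deriveV//; [|exact: f0|exact: f1].
by rewrite /GRing.scale/= -exprVn expr2 mulNr.
Qed.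

Lemma Ck_coord k U b : open U -> Ck k U (fun x : 'rV[R]_n => x 0 b).
Proof.
move=> oU; case: k => [|k]; first by move=> x _; exact: coord_continuous.
have H x a : is_derive x (basis_vec a) (fun y : 'rV[R]_n => y 0 b) (basis_vec a 0 b).
  by apply: (is_derive_mxP _ _ _ _).1; exact: is_derive_id.
move=> a; split; first by move=> x _; case: (H x a).
apply: (Ck_eq oU _ (@Ck_cst k U (basis_vec a 0 b))) => x _.
by rewrite /partial; case: (H x a).
Qed.

Lemma Ck_det k U m (A : 'rV[R]_n -> 'M[R]_m) : open U ->
  (forall i j, Ck k U (fun x => A x i j)) -> Ck k U (fun x => \det (A x)).
Proof.
move=> oU H; apply: Ck_sum => // s _; apply: CkM => //; first exact: Ck_cst.
exact: Ck_prod.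
Qed.

(** Cramer's rule reduces the inverse to determinants, which are polynomials in the entries. *)
Lemma Ck_invmx k U m (A : 'rV[R]_n -> 'M[R]_m) i j : open U ->
  (forall x, U x -> A x \in unitmx) ->
  (forall i j, Ck k U (fun x => A x i j)) -> Ck k U (fun x => invmx (A x) i j).
Proof.
move=> oU uA H.
apply: (@Ck_eq _ _ (fun x => (\det (A x))^-1 * cofactor (A x) j i)) => //.
  by move=> x Ux; rewrite /invmx uA// !mxE.
apply: CkM => //.
  by apply: CkV => //; [move=> x /uA; rewrite unitmxE unitfE|exact: Ck_det].
apply: CkM => //; first exact: Ck_cst.
apply: Ck_det => // p q; apply: (Ck_eq oU _ (H (lift j p) (lift i q))) => x _.
by rewrite !mxE.
Qed.

Lemma Ck_mulmx k U m p q (A : 'rV[R]_n -> 'M[R]_(m, p))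
    (B : 'rV[R]_n -> 'M[R]_(p, q)) i j : open U ->
  (forall i j, Ck k U (fun x => A x i j)) ->
  (forall i j, Ck k U (fun x => B x i j)) -> Ck k U (fun x => (A x *m B x) i j).
Proof.
move=> oU HA HB.
apply: (@Ck_eq _ _ (fun x => \sum_l A x i l * B x l j)) => //.
  by move=> x _; rewrite mxE.
by apply: Ck_sum => // l _; apply: CkM.
Qed.

End C1.

(** * Mixed derivatives, strict differentiability, composition *)

Section Schwarz.
Context {R : realType} {n : nat}.
Implicit Types (U : set 'rV[R]_n) (f : 'rV[R]_n -> R).

Lemma is_derive_translate (V W : normedModType R) (f : V -> W) x w v df :
  is_derive (x + w) v f df -> is_derive x v (fun y => f (y + w)) df.
Proof.
move=> /is_derive1P H; apply/is_derive1P.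
suff -> : (fun h : R => f (h *: v + x + w)) = (fun h : R => f (h *: v + (x + w))).
  by [].
by apply/funext => h; rewrite addrA.
Qed.

Lemma ball_segment (V : normedModType R) (c x y : V) (r s : R) : 0 <= s <= 1 ->
  ball c r x -> ball c r y -> ball c r (x + s *: (y - x)).
Proof.
move=> /andP[s0 s1]; rewrite -ball_normE/= => xr yr.
have -> : c - (x + s *: (y - x)) = (1 - s) *: (c - x) + s *: (c - y).
  rewrite scalerBl scale1r -addrA [- _ + _]addrC -scalerBr.
  have -> : c - y - (c - x) = - (y - x).
    by rewrite !opprB addrC addrA subrK.
  by rewrite scalerN opprD addrA.
rewrite (le_lt_trans (ler_normD _ _))// !normrZ.
rewrite (ger0_norm s0) ger0_norm ?subr_ge0//.
have r0 : 0 < r by exact: le_lt_trans xr.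
have := ler_wpM2l s0 (ltW yr).
have := s0; rewrite le_eqVlt => /predU1P[<-|s00].
  by rewrite subr0 mul1r mul0r addr0.
have A : s * `|c - y| < s * r by rewrite ltr_pM2l.
have B : (1 - s) * `|c - x| <= (1 - s) * r by rewrite ler_wpM2l ?subr_ge0// ltW.
by move=> _; rewrite -[r in _ < r]mul1r -{2}(subrK s 1) (mulrDl _ _ r) ler_ltD.
Qed.

(** The mean value theorem is applied in direction a to the increment of f in direction b, then in
    direction b to [partial a f]. The intermediate point is at distance at most 2s from x; 3s puts
    it in an open ball. *)
Lemma second_difference U f x (a b : 'I_n) (s d : R) : open U ->
  Ck 2 U f -> ball x d `<=` U -> 0 < s -> s + s < d ->
  exists2 y, ball x (s + s + s) y &
    f (x + s *: basis_vec a + s *: basis_vec b) - f (x + s *: basis_vec a)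
    - (f (x + s *: basis_vec b) - f x) = s * (s * partial b (partial a f) y).
Proof.
move=> oU Hf xdU s0 sd.
set A : 'rV[R]_n := basis_vec a; set B : 'rV[R]_n := basis_vec b.
have nb (t u : R) : 0 <= t <= 1 -> 0 <= u <= 1 ->
    `|t *: (s *: A) + u *: (s *: B)| <= s + s.
  move=> /andP[t0 t1] /andP[u0 u1].
  rewrite (le_trans (ler_normD _ _))// !normrZ !norm_basis_vec !mulr1.
  by rewrite !ger0_norm ?(ltW s0)// lerD// ler_piMl// ltW.
have inU (t u : R) : 0 <= t <= 1 -> 0 <= u <= 1 ->
    U (x + t *: (s *: A) + u *: (s *: B)).
  move=> ht hu; apply: xdU; rewrite -ball_normE/= -addrA opprD addNKr normrN.
  exact: le_lt_trans (nb _ _ ht hu) sd.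
have z01 : 0 <= (0 : R) <= 1 by rewrite lexx ler01.
have o01 : 0 <= (1 : R) <= 1 by rewrite ler01 lexx.
have dg y : U y -> U (y + s *: B) ->
    is_derive y (s *: A) (fun z => f (z + s *: B) - f z)
      (s *: (partial a f (y + s *: B) - partial a f y)).
  move=> Uy UyB; apply: is_derive_scalev; apply: is_derive_sub.
    by apply: is_derive_translate; apply: derivableP; exact: (Hf a).1.
  by apply: derivableP; exact: (Hf a).1.
have [|t /andP[t0 t1] E1] := @line_MVT R _ (fun z => f (z + s *: B) - f z) x (s *: A).
  move=> t t01; case: (dg (x + t *: (s *: A))) => //.
    by have := inU t 0 t01 z01; rewrite scale0r addr0.
  by have := inU t 1 t01 o01; rewrite scale1r.
have t01 : 0 <= t <= 1 by rewrite !ltW.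
have [] := dg (x + t *: (s *: A)).
  by have := inU t 0 t01 z01; rewrite scale0r addr0.
  by have := inU t 1 t01 o01; rewrite scale1r.
move=> _ E2.
have dh u : 0 <= u <= 1 -> is_derive (x + t *: (s *: A) + u *: (s *: B)) (s *: B)
    (partial a f) (s *: partial b (partial a f) (x + t *: (s *: A) + u *: (s *: B))).
  move=> u01; apply: is_derive_scalev; apply: derivableP.
  exact: ((Hf a).2 b).1 (inU _ _ t01 u01).
have [|u /andP[u0 u1] E3] := @line_MVT R _ (partial a f) (x + t *: (s *: A)) (s *: B).
  by move=> u u01; case: (dh u u01).
have u01 : 0 <= u <= 1 by rewrite !ltW.
exists (x + t *: (s *: A) + u *: (s *: B)).
  rewrite -ball_normE/= -addrA opprD addNKr normrN.
  by apply: le_lt_trans (nb _ _ t01 u01) _; rewrite ltrDl.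
rewrite E1 E2 E3; have [_ ->] := dh u u01.
by [].
Qed.

(** The second difference is symmetric in a and b, so the two mixed derivatives take a common value
    at two points arbitrarily close to x; continuity concludes. *)
Lemma schwarz U f x (a b : 'I_n) : open U -> Ck 2 U f -> U x ->
  partial a (partial b f) x = partial b (partial a f) x.
Proof.
move=> oU Hf Ux; apply/eqP; rewrite -subr_eq0 -normr_le0.
apply/ler_addgt0Pr => e e0; rewrite add0r.
have cab c d : {for x, continuous (partial c (partial d f))} by exact: ((Hf d).2 c).2 x Ux.
have : \forall y \near x, U y /\
    (`|partial a (partial b f) x - partial a (partial b f) y| < e / 2 /\
     `|partial b (partial a f) x - partial b (partial a f) y| < e / 2).
  apply: (filterI (open_near oU Ux)).
  have e2 : 0 < e / 2 by rewrite divr_gt0.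
  by apply: filterI; [exact: (cvgrPdist_lt _ _).1 (cab a b) _ e2
                     |exact: (cvgrPdist_lt _ _).1 (cab b a) _ e2].
move=> /nbhs_ballP[d /= d0 H].
(* A quarter of d gives both 2s < d, which keeps the parallelogram in U, and 3s <= d, which keeps
   the intermediate points where the mixed derivatives are controlled. *)
pose s := d / 4.
have s0 : 0 < s by rewrite divr_gt0.
have sd : s + s < d by rewrite /s; lra.
have s3 : s + s + s <= d by rewrite /s; lra.
have xdU : ball x d `<=` U by move=> y /H[].
have [y yd Ey] := second_difference a b oU Hf xdU s0 sd.
have [z zd Ez] := second_difference b a oU Hf xdU s0 sd.
have E : partial b (partial a f) y = partial a (partial b f) z.
  have s0' : s != 0 by rewrite gt_eqF.
  suff : s * (s * partial b (partial a f) y) = s * (s * partial a (partial b f) z).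
    by move=> /(mulfI s0')/(mulfI s0').
  apply: etrans (esym Ey) _; apply: etrans _ Ez.
  by rewrite (addrAC x); lra.
have /H[_ [_ Hy]] := le_ball s3 yd.
have /H[_ [Hz _]] := le_ball s3 zd.
have split3 (p q r : R) : p - q = (p - r) - (q - r) by ring.
rewrite (split3 _ _ (partial a (partial b f) z)) -[X in _ - (_ - X)]E.
apply: (le_trans (ler_normB _ _)); rewrite [e]splitr.
by apply: lerD; apply: ltW; [exact: Hz|exact: Hy].
Qed.

(** Strict differentiability: the increment between two moving points is compared with the
    differential at the fixed point c. The inverse function theorem and the local Lipschitz bounds
    need this uniformity. *)
Lemma strict_diff U f c (e : R) : open U -> Ck 1 U f -> U c -> 0 < e ->
  \forall d \near 0^'+, forall x y, ball c d x -> ball c d y ->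
    U x /\ `|f y - f x - 'd f c (y - x)| <= e * `|y - x|.
Proof.
move=> oU Hf Uc e0.
pose e' := e / n.+1%:R.
have e'0 : 0 < e' by rewrite divr_gt0.
have : \forall y \near c, U y /\ forall a, `|partial a f c - partial a f y| < e'.
  have H2 : \forall y \near c, forall a : 'I_n, `|partial a f c - partial a f y| < e'.
    apply: near_forall_fin => a.
    exact: (cvgrPdist_lt _ _).1 ((Hf a).2 c Uc) e' e'0.
  by exact: filterI (open_near oU Uc) H2.
move=> /nbhs_ballP[d /= d0 H].
near=> r => x y xr yr.
have rd : r <= d by near: r; exact: nbhs_right_le.
have Ur z : ball c r z -> U z by move=> /(le_ball rd)/H[].
split; first exact: Ur.
have dl z v : U z -> is_derive z v f ('d f z v).
  by move=> Uz; apply: is_derive_diff; exact: C1_differentiable Hf Uz.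
have [|s /andP[s0 s1] E] := @line_MVT R _ f x (y - x).
  move=> s s01; case: (dl (x + s *: (y - x)) (y - x)) => //.
  exact/Ur/ball_segment.
have s01 : 0 <= s <= 1 by rewrite !ltW.
have zr := ball_segment s01 xr yr.
rewrite (addrC x) subrK in E; rewrite {}E.
have [_ ->] := dl _ (y - x) (Ur _ zr).
rewrite [X in `|_ - X|](diff_row_form _ (C1_differentiable oU Hf Uc)).
rewrite [X in `|X - _|](diff_row_form _ (C1_differentiable oU Hf (Ur _ zr))).
rewrite /row_form -sumrB (le_trans (ler_norm_sum _ _ _))//.
apply: (@le_trans _ _ (\sum_(k < n) e' * `|y - x|)).
  apply: ler_sum => k _; rewrite -mulrBr normrM mulrC ler_pM ?mxE_le_norm//.
  by rewrite distrC ltW//; exact: (H _ (le_ball rd zr)).2.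
rewrite sumr_const card_ord -mulrnAl ler_wpM2r// -mulr_natr /e'.
by rewrite -mulrA ler_piMr ?(ltW e0)// mulrC ler_pdivrMr// mul1r ler_nat.
Unshelve. all: by end_near. Qed.

Lemma norm_row_form (p : 'I_n -> R) v :
  `|row_form p v| <= (\sum_a `|p a|) * `|v|.
Proof.
rewrite /row_form (le_trans (ler_norm_sum _ _ _))// mulr_suml.
by apply: ler_sum => a _; rewrite normrM mulrC ler_wpM2l// mxE_le_norm.
Qed.

Lemma C1_lipschitz U f c : open U -> Ck 1 U f -> U c ->
  exists2 L, 0 <= L & \forall d \near 0^'+, forall x y, ball c d x -> ball c d y ->
    `|f y - f x| <= L * `|y - x|.
Proof.
move=> oU Hf Uc; exists (1 + \sum_a `|partial a f c|).
  by rewrite addr_ge0// sumr_ge0.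
have := strict_diff oU Hf Uc ltr01; apply: filterS => d H x y xd yd.
have [_ E] := H x y xd yd.
rewrite -[f y - f x](subrK ('d f c (y - x))) (le_trans (ler_normD _ _))//.
rewrite mulrDl lerD// diff_row_form; last exact: C1_differentiable Hf Uc.
exact: norm_row_form.
Qed.

(** Induction on k with f generalised: by the chain rule a partial derivative of the composite
    involves the functions [partial j f] composed with F, one class lower. *)
Lemma Ck_comp k m U (V : set 'rV[R]_m) (F : 'rV[R]_n -> 'rV[R]_m) (f : 'rV[R]_m -> R) :
  open U -> open V -> (forall x, U x -> V (F x)) ->
  (forall j, Ck k U (fun x => F x 0 j)) -> Ck k V f -> Ck k U (fun x => f (F x)).
Proof.
move=> oU oV FUV; elim: k f => [|k IH] f HF Hf.
  move=> x Ux; apply: (@continuous_comp _ _ _ F f).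
    by apply: continuous_mx => i j; rewrite ord1; exact: HF.
  exact/Hf/FUV.
have dF x : U x -> differentiable F x.
  move=> Ux; apply: differentiable_mx => i j; rewrite ord1.
  exact: Ck_differentiable (HF j) Ux.
have D a x : U x -> is_derive x (basis_vec a) (fun x => f (F x))
    (\sum_j partial a (fun x => F x 0 j) x * partial j f (F x)).
  move=> Ux; have df := Ck_differentiable oV Hf (FUV _ Ux).
  have := is_derive_comp_diff (is_derive_diff (basis_vec a) (dF x Ux)) df.
  rewrite diff_row_form//; congr (is_derive _ _ _ _); apply: eq_bigr => j _.
  congr (_ * _).
  have /is_derive_mxP/(_ 0 j)[_ E] := is_derive_diff (basis_vec a) (dF x Ux).
  by rewrite -E.
move=> a; split; first by move=> x Ux; case: (D a x Ux).
apply: (@Ck_eq _ _ _ _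
  (fun x => \sum_j partial a (fun x => F x 0 j) x * partial j f (F x))) => //.
  by move=> x Ux; rewrite [RHS]/partial; case: (D a x Ux) => _ ->.
apply: Ck_sum => // j _; apply: CkM => //; first exact: (HF j a).2.
by apply: IH; [move=> j'; apply: CkW|exact: (Hf j).2].
Qed.

End Schwarz.

(** * Linear differential equations on the unit interval *)

Section Analysis.
Context {R : realType}.

(** The bound is proved in the form 2C/2^k - 2C/2^(k+j), which makes the induction on j close. The
    limit with its explicit rate serves Newton's and Picard's iterations. *)
Lemma geometric_limit m n (y : nat -> 'M[R]_(m, n)) (C : R) : 0 <= C ->
  (forall k, `|y k.+1 - y k| <= C / 2 ^+ k) ->
  exists l, forall k, `|l - y k| <= 2 * C / 2 ^+ k.
Proof.
move=> C0 H.
have H2 k j : `|y (k + j)%N - y k| <= 2 * C / 2 ^+ k - 2 * C / 2 ^+ (k + j).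
  elim: j => [|j IH]; first by rewrite addn0 !subrr normr0.
  rewrite addnS -(subrKA (y (k + j)%N)) (le_trans (ler_normD _ _))//.
  have := H (k + j)%N; have := IH.
  rewrite exprS invfM; set a := _ / _ ^+ k; set b := _ ^- (k + j).
  by move=> h1 h2; move: h1 h2; lra.
have H3 k j : `|y (k + j)%N - y k| <= 2 * C / 2 ^+ k.
  by apply: le_trans (H2 k j) _; rewrite lerBlDr lerDl divr_ge0// ?mulr_ge0// exprn_ge0.
have pow0 : (fun k => 2 * C / 2 ^+ k) @ \oo --> (0 : R).
  have := @cvg_geometric R (2 * C) (2^-1) _.
  rewrite ger0_norm ?invr_ge0// invf_lt1// ltr1n => /(_ isT).
  suff -> : geometric (2 * C) 2^-1 = (fun k => 2 * C / 2 ^+ k) by [].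
  by apply/funext => k; rewrite /geometric/= exprVn.
have cy : cvgn y.
  apply/cauchy_cvgP/cauchy_ballP => e e0.
  have /(cvgrPdist_lt _ _).1/(_ (e / 2)) := pow0; rewrite divr_gt0// => /(_ isT)[N _ HN].
  have HN' p : (N <= p)%N -> `|y p - y N| < e / 2.
    move=> Np; rewrite -(subnKC Np); apply: le_lt_trans (H3 _ _) _.
    have := HN N (leqnn N); rewrite sub0r normrN ger0_norm//.
    by rewrite divr_ge0// ?mulr_ge0// exprn_ge0.
  exists ([set z | `|z - y N| < e / 2], [set z | `|z - y N| < e / 2]) => /=.
    by split; exists N => // p /=; exact: HN'.
  case=> a b [/= ha hb]; rewrite -ball_normE/= -(subrKA (y N)).
  by rewrite (le_lt_trans (ler_normD _ _))// [e]splitr ltrD// distrC.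
exists (limn y) => k.
have : (fun j => `|y (k + j)%N - y k|) @ \oo --> `|limn y - y k|.
  apply: cvg_norm; apply: cvgB; last exact: cvg_cst.
  have := cy; rewrite -[X in X -> _](cvg_shiftn k).
  suff -> : [sequence y (j + k)%N]_j = (fun j => y (k + j)%N) by [].
  by apply/funext => j; rewrite addnC.
move=> Hc; rewrite -(cvg_lim (@Rhausdorff R) Hc); apply: limr_le.
  by apply/cvg_ex; eexists; exact: Hc.
by apply: nearW => j; exact: H3.
Qed.

(** At a maximum of |D| the mean value theorem gives max <= max/2 + e. The coefficient 1/2 on an
    interval of length 1 thus replaces the exponential of Gronwall's inequality; the balls used
    later are shrunk until it is available. *)
Lemma half_gronwall N (D D' : R -> 'rV[R]_N) (e : R) :
  (forall t : R, 0 <= t <= 1 -> is_derive t 1 D (D' t)) -> D 0 = 0 ->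
  (forall t : R, 0 <= t <= 1 -> `|D' t| <= `|D t| / 2 + e) ->
  forall t : R, 0 <= t <= 1 -> `|D t| <= 2 * e.
Proof.
move=> dD D0 HD.
have cD : {within `[0, 1], continuous (fun t => `|D t|)}.
  have cD1 : {within `[0, 1], continuous D}.
    by apply: derivable_within_continuous => t; rewrite in_itv/= => /dD[].
  by move=> t; apply: continuous_comp; [exact: cD1|exact: norm_continuous].
have [c c01 Hc] := EVT_max ler01 cD.
rewrite in_itv/= in c01.
have e0 : 0 <= e.
  by have := HD 0; rewrite D0 normr0 mul0r add0r lexx ler01 => /(_ isT); apply: le_trans.
have Hsup t : 0 <= t <= 1 -> `|D' t| <= `|D c| / 2 + e.
  move=> t01; apply: le_trans (HD _ t01) _; rewrite lerD2r ler_pM2r ?invr_gt0//.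
  by apply: Hc; rewrite in_itv.
have Dc : `|D c| <= `|D c| / 2 + e.
  apply: mx_norm_le; first by rewrite addr_ge0// divr_ge0.
  move=> i j; rewrite ord1.
  have dDj (t : R) : 0 <= t <= 1 -> is_derive t 1 (fun t => D t 0 j) (D' t 0 j).
    by move=> /dD/is_derive_mxP.
  have /andP[c0 c1] := c01.
  have [||s] := @MVT_segment R (fun t => D t 0 j) (fun t => D' t 0 j) 0 c c0.
  - move=> t; rewrite in_itv/= => /andP[t0 tc]; apply: dDj.
    by rewrite !ltW//= (lt_le_trans tc).
  - apply: derivable_within_continuous => t; rewrite in_itv/= => /andP[t0 tc].
    by case: (dDj t) => //; rewrite t0 (le_trans tc).
  rewrite in_itv/= D0 mxE !subr0 => /andP[s0 sc] ->.
  have s01 : 0 <= s <= 1 by rewrite s0 (le_trans sc).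
  rewrite normrM -[leRHS]mulr1 ler_pM ?(ger0_norm c0)//.
  by apply: le_trans (Hsup s s01); exact: mxE_le_norm.
move=> t t01; apply: (@le_trans _ _ `|D c|); first by apply: Hc; rewrite in_itv.
by move: Dc; lra.
Qed.

(** Retraction of the line onto [0, 1]: composing with it makes functions that are controlled only
    on [0, 1] continuous on the whole line. *)
Definition clamp01 (t : R) : R := Num.max 0 (Num.min 1 t).

Lemma clamp01_in t : 0 <= clamp01 t <= 1.
Proof. by rewrite /clamp01 le_max lexx/= ge_max ler01 ge_min lexx. Qed.

Lemma clamp01_id t : 0 <= t <= 1 -> clamp01 t = t.
Proof. by move=> /andP[t0 t1]; rewrite /clamp01 min_r// max_r. Qed.

Lemma clamp01_continuous : continuous clamp01.
Proof.
move=> t; apply: continuous_max; first exact: cst_continuous.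
by apply: continuous_min; [exact: cst_continuous|exact: id].
Qed.

Lemma exists_primitive (f : R -> R) : continuous f ->
  exists F : R -> R, forall t : R, 0 <= t <= 1 -> is_derive t 1 F (f t).
Proof.
(* The integral starts at -1 and integrability is taken up to 2, so that 0 and 1 are interior points
   and the derivative exists on both sides there. *)
move=> cf; pose F x := (\int[@lebesgue_measure R]_(t in `[- 1, x]) f t)%R.
exists F => t /andP[t0 t1].
have If : (@lebesgue_measure R).-integrable `[- 1, 2] (EFin \o f).
  apply: continuous_compact_integrable; first exact: segment_compact.
  exact: continuous_subspaceT.
have t2 : t < 2 by rewrite (le_lt_trans t1)// ltr1n.
have t_1 : -1 < t by rewrite (lt_le_trans _ t0)// oppr_lt0.
have [d e] := continuous_FTC1_closed t2 If t_1 (cf t).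
by split; [exact: d|rewrite -derive1E].
Qed.

Lemma exists_primitive_row N (f : R -> 'rV[R]_N) (u0 : 'rV[R]_N) : continuous f ->
  exists F : R -> 'rV[R]_N, F 0 = u0 /\
    forall t : R, 0 <= t <= 1 -> is_derive t 1 F (f t).
Proof.
move=> cf.
have H j : exists F : R -> R, forall t : R, 0 <= t <= 1 -> is_derive t 1 F (f t 0 j).
  by apply: exists_primitive => t; exact: continuous_mxE (cf t).
have [F HF] := choice H.
exists (fun t => \row_j (F j t - F j 0 + u0 0 j)); split.
  by apply/rowP => j; rewrite mxE subrr add0r.
move=> t t01; apply/is_derive_mxP => i j; rewrite ord1.
under [X in is_derive _ _ X _]eq_fun do rewrite mxE.
rewrite -[f t 0 j]addr0.
rewrite -[f t 0 j]subr0.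
exact: (is_derive_add (is_derive_sub (HF j t t01) (is_derive_const (F j 0) t 1))
  (is_derive_const (u0 0 j) t 1)).
Qed.

(** The norm of a matrix is the maximum of its entries, so the scalar mean value theorem entry by
    entry loses no dimensional constant. *)
Lemma MVT_norm N (D D' : R -> 'rV[R]_N) (e : R) : 0 <= e ->
  (forall t : R, 0 <= t <= 1 -> is_derive t 1 D (D' t)) -> D 0 = 0 ->
  (forall t : R, 0 <= t <= 1 -> `|D' t| <= e) ->
  forall t : R, 0 <= t <= 1 -> `|D t| <= e.
Proof.
move=> e0 dD D0 HD c c01.
apply: mx_norm_le => // i j; rewrite ord1.
have dDj (t : R) : 0 <= t <= 1 -> is_derive t 1 (fun t => D t 0 j) (D' t 0 j).
  by move=> /dD/is_derive_mxP.
have /andP[c0 c1] := c01.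
have [||s] := @MVT_segment R (fun t => D t 0 j) (fun t => D' t 0 j) 0 c c0.
- move=> t; rewrite in_itv/= => /andP[t0 tc]; apply: dDj.
  by rewrite !ltW//= (lt_le_trans tc).
- apply: derivable_within_continuous => t; rewrite in_itv/= => /andP[t0 tc].
  by case: (dDj t) => //; rewrite t0 (le_trans tc).
rewrite in_itv/= D0 mxE !subr0 => /andP[s0 sc] ->.
have s01 : 0 <= s <= 1 by rewrite s0 (le_trans sc).
rewrite normrM -[leRHS]mulr1 ler_pM ?(ger0_norm c0)//.
by apply: le_trans (HD s s01); exact: mxE_le_norm.
Qed.

(** Picard iteration; the hypothesis that [B t] at least halves every vector makes it a contraction
    on all of [0, 1], so the solution needs no gluing of small intervals. *)
Lemma linear_ODE N (B : R -> 'M[R]_N) (u0 : 'rV[R]_N) : continuous B ->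
  (forall (t : R) (x : 'rV[R]_N), 0 <= t <= 1 -> `|x *m B t| <= `|x| / 2) ->
  exists u : R -> 'rV[R]_N, u 0 = u0 /\
    forall t : R, 0 <= t <= 1 -> is_derive t 1 u (u t *m B t).
Proof.
move=> cB HB.
have cmul (v : R -> 'rV[R]_N) : continuous v -> continuous (fun t => v t *m B t).
  by move=> cv t; exact: continuous_mulmx (cv t) (cB t).
have cont01 (v v' : R -> 'rV[R]_N) :
    (forall t : R, 0 <= t <= 1 -> is_derive t 1 v (v' t)) -> continuous (v \o clamp01).
  move=> dv t; apply: continuous_comp; first exact: clamp01_continuous.
  apply: differentiable_continuous; apply/derivable1_diffP.
  by case: (dv _ (clamp01_in t)).
(* Picard's operator. A primitive is available only for continuous integrands; the default value v
   is never reached on the iterates, which remain continuous. *)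
pose step (v : R -> 'rV[R]_N) : R -> 'rV[R]_N :=
  if pselect (continuous (v \o clamp01)) is left cv then
    projT1 (cid (exists_primitive_row u0 (cmul _ cv))) else v.
have stepP v : continuous (v \o clamp01) ->
  step v 0 = u0 /\ forall t : R, 0 <= t <= 1 -> is_derive t 1 (step v) (v t *m B t).
  rewrite /step; case: pselect => // cv _; case: cid => F /= [F0 FE]; split => //.
  by move=> t t01; have := FE t t01; rewrite /= clamp01_id.
pose y k := iter k step (fun=> u0).
have cy k : continuous (y k \o clamp01).
  elim: k => [|k IH]; first exact: cst_continuous.
  by have [_] := stepP _ IH; exact: cont01.
have yS k : y k.+1 0 = u0 /\
    forall t : R, 0 <= t <= 1 -> is_derive t 1 (y k.+1) (y k t *m B t).
  exact: stepP.
have y0 k : y k 0 = u0 by case: k => // k; case: (yS k).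
have dy k (t : R) : 0 <= t <= 1 -> `|y k.+1 t - y k t| <= `|u0| / 2 ^+ k.
  elim: k t => [|k IH] t t01.
    rewrite expr0 divr1; apply: (@MVT_norm N (fun t => y 1%N t - u0)
      (fun t => u0 *m B t)) t01 => //; last 1 first.
    - by move=> s s01; apply: le_trans (HB _ _ s01) _; rewrite ler_piMr// invf_le1// ler1n.
    - move=> s s01; rewrite -[_ *m _]subr0.
      exact: (is_derive_sub ((yS 0%N).2 s s01) (is_derive_const u0 s 1)).
    - by rewrite y0 subrr.
  have e0 : 0 <= `|u0| / 2 ^+ k.+1 by rewrite divr_ge0// exprn_ge0.
  apply: (@MVT_norm N (fun t => y k.+2 t - y k.+1 t)
    (fun t => y k.+1 t *m B t - y k t *m B t)) t01 => //.
  - by move=> s s01; exact: (is_derive_sub ((yS k.+1).2 s s01) ((yS k).2 s s01)).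
  - by rewrite !y0 subrr.
  move=> s s01; rewrite -mulmxBl (le_trans (HB _ _ s01))//.
  by rewrite exprSr invfM mulrA ler_pM2r ?invr_gt0// IH.
have lim (t : R) : exists l, 0 <= t <= 1 -> forall k, `|l - y k t| <= 2 * `|u0| / 2 ^+ k.
  have [t01|nt01] := boolP (0 <= t <= 1); last by exists 0.
  have [l Hl] := geometric_limit (normr_ge0 u0) (fun k => dy k t t01).
  by exists l => _.
have {lim}[u Hu] := choice lim.
have pow0 : (fun k => 2 * `|u0| / 2 ^+ k) @ \oo --> (0 : R).
  have := @cvg_geometric R (2 * `|u0|) (2^-1) _.
  rewrite ger0_norm ?invr_ge0// invf_lt1// ltr1n => /(_ isT).
  suff -> : geometric (2 * `|u0|) 2^-1 = (fun k => 2 * `|u0| / 2 ^+ k) by [].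
  by apply/funext => k; rewrite /geometric/= exprVn.
have small e : 0 < e -> exists k, 2 * `|u0| / 2 ^+ k < e.
  move=> e0; have /(cvgrPdist_lt _ _).1/(_ e e0)[N0 _ HN] := pow0.
  by exists N0; have := HN N0 (leqnn N0); rewrite sub0r normrN ger0_norm.
have cu : continuous (u \o clamp01).
  move=> t; apply/cvgrPdist_lt => e e0.
  have [|k Hk] := small (e / 3); first by rewrite divr_gt0.
  have /(cvgrPdist_lt _ _).1/(_ (e / 3)) := cy k t.
  rewrite divr_gt0// => /(_ isT); apply: filterS => s /= Hs.
  have h1 := Hu _ (clamp01_in t) k; have h2 := Hu _ (clamp01_in s) k.
  have -> : u (clamp01 t) - u (clamp01 s) = (u (clamp01 t) - y k (clamp01 t))
     + (y k (clamp01 t) - y k (clamp01 s)) - (u (clamp01 s) - y k (clamp01 s)).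
    by rewrite opprB !addrA !subrK.
  apply: le_lt_trans (ler_normB _ _) _; apply: le_lt_trans (lerD (ler_normD _ _) (lexx _)) _.
  by move: h1 h2 Hk Hs; lra.
(* The uniform limit u is so far only continuous; it becomes differentiable by coinciding with the
   primitive [step u], which is within a multiple of 2^-k of the iterates. *)
have [F0 dF] := stepP _ cu; pose F := step u.
have Fu (t : R) : 0 <= t <= 1 -> F t = u t.
  move=> t01; apply/eqP; rewrite -subr_eq0 -normr_le0; apply/ler_addgt0Pr => e e0.
  rewrite add0r; have [|k Hk] := small (e / 2); first by rewrite divr_gt0.
  have h1 := Hu t t01 k.+1.
  have h3 : 2 * `|u0| / 2 ^+ k.+1 <= 2 * `|u0| / 2 ^+ k.
    rewrite ler_wpM2l ?mulr_ge0// lef_pV2 ?posrE ?exprn_gt0//.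
    by rewrite ler_eXn2l// ltr1n.
  have c0 : 0 <= 2 * `|u0| / 2 ^+ k by rewrite !mulr_ge0// invr_ge0 exprn_ge0.
  have h2 : `|F t - y k.+1 t| <= 2 * `|u0| / 2 ^+ k.
    apply: (@MVT_norm N (fun t => F t - y k.+1 t)
       (fun t => u t *m B t - y k t *m B t)) t01 => //.
    - by move=> s s01; exact: (is_derive_sub (dF s s01) ((yS k).2 s s01)).
    - by rewrite y0 /F F0 subrr.
    move=> s s01; rewrite -mulmxBl (le_trans (HB _ _ s01))//.
    have := Hu s s01 k; have := normr_ge0 (u s - y k s); lra.
  have -> : F t - u t = (F t - y k.+1 t) - (u t - y k.+1 t).
    by rewrite opprB addrA subrK.
  by apply: le_trans (ler_normB _ _) _; move: h1 h2 h3 Hk; lra.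
by exists F; split=> // t t01; rewrite Fu//; exact: dF.
Qed.

End Analysis.

(** * Inverse functions and implicit differentiation *)

Section InverseFunction.
Context {R : realType}.

Lemma diff_estimate (V W : normedModType R) (f : V -> W) x (e : R) :
  differentiable f x -> 0 < e ->
  \forall h \near (0 : V), `|f (h + x) - f x - 'd f x h| <= e * `|h|.
Proof.
move=> /diff_locallyP[_ /eqaddoP/(_ e)] H e0; have := H e0.
apply: filterS => h /=; suff -> : f (h + x) - f x - 'd f x h =
  (f \o shift x - (cst (f x) + 'd f x)) h by [].
by rewrite [RHS]/= opprD addrA.
Qed.

Lemma geometric_eq0 (V : normedModType R) (v : V) (C : R) :
  (forall k, `|v| <= C / 2 ^+ k) -> v = 0.
Proof.
move=> H; apply/eqP; rewrite -normr_le0.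
have pow0 : (fun k => C / 2 ^+ k) @ \oo --> (0 : R).
  have := @cvg_geometric R C (2^-1) _.
  rewrite ger0_norm ?invr_ge0// invf_lt1// ltr1n => /(_ isT).
  suff -> : geometric C 2^-1 = (fun k => C / 2 ^+ k) by [].
  by apply/funext => k; rewrite /geometric/= exprVn.
rewrite -(cvg_lim (@Rhausdorff R) pow0); apply: limr_ge.
  by apply/cvg_ex; eexists; exact: pow0.
by apply: nearW => k; exact: H.
Qed.

Lemma norm_row_mulmx_le n p (v : 'rV[R]_n) (A : 'M[R]_(n, p)) :
  `|v *m A| <= n%:R * `|A| * `|v|.
Proof. by have := norm_mulmx_le v A; rewrite mulrAC. Qed.

Lemma strict_diff_row n m (U : set 'rV[R]_n) (F : 'rV[R]_n -> 'rV[R]_m) c (e : R) :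
  open U -> (forall j, Ck 1 U (fun x => F x 0 j)) -> U c -> 0 < e ->
  \forall d \near 0^'+, forall x y, ball c d x -> ball c d y ->
    U x /\ `|F y - F x - (y - x) *m 'J F c| <= e * `|y - x|.
Proof.
move=> oU HF Uc e0.
have dF : differentiable F c.
  apply: differentiable_mx => i j; rewrite ord1.
  exact: C1_differentiable (HF j) Uc.
have Hj : \forall d \near (0 : R)^'+, forall j x y, ball c d x -> ball c d y ->
    U x /\ `|F y 0 j - F x 0 j - 'd (fun x => F x 0 j) c (y - x)| <= e * `|y - x|.
  by apply: filter_forall => j; exact: strict_diff.
have H0 : \forall d \near (0 : R)^'+, forall x, ball c d x -> U x.
  have /nbhs_ballP[d0 /= d00 Hd] := open_near oU Uc.
  near=> d => x xd; apply: Hd; apply: le_ball xd.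
  by near: d; exact: nbhs_right_le.
near=> d => x y xd yd.
have H0d : forall x, ball c d x -> U x by near: d; exact: H0.
split; first exact: H0d.
have Hd : forall j x y, ball c d x -> ball c d y ->
    U x /\ `|F y 0 j - F x 0 j - 'd (fun x => F x 0 j) c (y - x)| <= e * `|y - x|.
  by near: d; exact: Hj.
apply: mx_norm_le => [|i j]; first by rewrite mulr_ge0// ltW.
rewrite ord1 mul_jacobian !mxE.
have -> : ('d F c (y - x)) 0 j = 'd (fun x => F x 0 j) c (y - x).
  have /is_derive_mxP/(_ 0 j) h1 := is_derive_diff (y - x) dF.
  have h2 := is_derive_diff (y - x) (C1_differentiable oU (HF j) Uc).
  exact: is_derive_unique h1 h2.
by have [] := Hd j x y xd yd.
Unshelve. all: by end_near. Qed.

(** Newton's iteration with the derivative frozen at c. Injectivity on the ball and continuity of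
    the inverse come from the same Lipschitz bound [lip]. *)
Lemma inverse_function n (U : set 'rV[R]_n) (F : 'rV[R]_n -> 'rV[R]_n) c :
  open U -> (forall j, Ck 1 U (fun x => F x 0 j)) -> U c -> 'J F c \in unitmx ->
  exists (g : 'rV[R]_n -> 'rV[R]_n) (r rho : R), [/\ 0 < r /\ 0 < rho,
    ball c r `<=` U,
    forall x y, ball c r x -> ball c r y -> F x = F y -> x = y,
    forall y, ball (F c) rho y -> ball c r (g y) /\ F (g y) = y &
    forall y, ball (F c) rho y -> {for y, continuous g}].
Proof.
move=> oU HF Uc uA; set A := 'J F c; pose Ai := invmx A.
have AAi (v : 'rV[R]_n) : v *m A *m Ai = v by exact: mulmxK.
have AiA (v : 'rV[R]_n) : v *m Ai *m A = v by exact: mulmxKV.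
pose K := n%:R * `|Ai| + 1.
have K1 : 1 <= K by rewrite /K lerDr mulr_ge0.
have K0 : 0 < K by exact: lt_le_trans K1.
have KP (v : 'rV[R]_n) : `|v *m Ai| <= K * `|v|.
  by apply: le_trans (norm_row_mulmx_le _ _) _; rewrite ler_wpM2r// /K lerDl.
(* With this e the map x -> x + (y0 - F x) A^-1 contracts distances by 1/2 on the ball; this is the
   estimate [star]. *)
pose e := (2 * K)^-1.
have e0 : 0 < e by rewrite invr_gt0 mulr_gt0.
have [r [r0 Hr]] : exists r, 0 < r /\ forall x y, ball c r x -> ball c r y ->
    U x /\ `|F y - F x - (y - x) *m A| <= e * `|y - x|.
  have H := strict_diff_row oU HF Uc e0.
  near (0 : R)^'+ => r; exists r; split; first by near: r; exact: nbhs_right_gt.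
  by near: r; exact: H.
have star x y : ball c r x -> ball c r y ->
    `|(F y - F x) *m Ai - (y - x)| <= `|y - x| / 2.
  move=> xr yr; have [_ h] := Hr _ _ xr yr.
  have -> : (F y - F x) *m Ai - (y - x) = (F y - F x - (y - x) *m A) *m Ai.
    by rewrite [in RHS]mulmxBl AAi.
  apply: le_trans (KP _) _; apply: (@le_trans _ _ (K * (e * `|y - x|))).
    by rewrite ler_pM2l.
  by rewrite /e invfM (mulrC 2^-1) !mulrA mulfV ?gt_eqF// mul1r mulrC.
have lip x y : ball c r x -> ball c r y -> `|y - x| <= 2 * K * `|F y - F x|.
  move=> xr yr; have h := star _ _ xr yr.
  have -> : y - x = (F y - F x) *m Ai - ((F y - F x) *m Ai - (y - x)).
    by rewrite subKr.
  have := KP (F y - F x); have := ler_normB ((F y - F x) *m Ai) ((F y - F x) *m Ai - (y - x)).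
  have E : `|(F y - F x) *m Ai - ((F y - F x) *m Ai - (y - x))| = `|y - x|.
    by rewrite subKr.
  rewrite E; set a := `|y - x| in h *; set b := `|_ *m Ai| in h *.
  by move: h; lra.
(* For y0 within rho the first step is shorter than r/4; the steps halve, so all iterates remain in
   the ball of radius r. *)
pose rho := r / (4 * K).
have rho0 : 0 < rho by rewrite divr_gt0// mulr_gt0.
have surj y0 : exists x, ball (F c) rho y0 -> ball c r x /\ F x = y0.
  have [y0r|ny0r] := pselect (ball (F c) rho y0); last by exists 0.
  pose step x := x + (y0 - F x) *m Ai.
  pose x k := iter k step c.
  pose C := `|(y0 - F c) *m Ai|.
  have C0 : 0 <= C by exact: normr_ge0.
  have Cr : 2 * C < r.
    have : `|y0 - F c| < rho by rewrite distrC; move: y0r; rewrite -ball_normE.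
    rewrite /rho ltr_pdivlMr ?mulr_gt0// => h.
    by have := KP (y0 - F c); rewrite -/C; lra.
  have xP k : `|x k.+1 - x k| <= C / 2 ^+ k /\
      `|x k - c| <= 2 * C - 2 * C / 2 ^+ k /\ `|x k.+1 - c| <= 2 * C - 2 * C / 2 ^+ k.+1.
    elim: k => [|k [IH1 [IH2 IH3]]].
      rewrite /x /= /step (addrC c) addrK expr0 expr1 divr1 subrr normr0; split=> //.
      by split; [lra|rewrite -/C; lra].
    have P0 j : 0 <= 2 * C / 2 ^+ j by rewrite divr_ge0// ?mulr_ge0// exprn_ge0.
    have inb z j : `|z - c| <= 2 * C - 2 * C / 2 ^+ j -> ball c r z.
      move=> h; rewrite -ball_normE/= distrC; apply: le_lt_trans h _.
      by apply: le_lt_trans Cr; rewrite gerBl.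
    have h : `|x k.+2 - x k.+1| <= C / 2 ^+ k.+1.
      have -> : x k.+2 - x k.+1 = - ((F (x k.+1) - F (x k)) *m Ai - (x k.+1 - x k)).
        have -> : x k.+2 = x k.+1 + (y0 - F (x k.+1)) *m Ai by [].
        have -> : x k.+1 - x k = (y0 - F (x k)) *m Ai.
          by rewrite {1}/x/= /step (addrC (iter _ _ _)) addrK.
        rewrite (addrC (x k.+1)) addrK -mulmxBl -mulNmx; congr (_ *m _).
        by rewrite !opprB addrA subrK.
      rewrite normrN; apply: le_trans (star _ _ (inb _ _ IH2) (inb _ _ IH3)) _.
      by rewrite exprSr invfM mulrA ler_pM2r ?invr_gt0.
    split=> //; split=> //.
    rewrite -[x k.+2](subrK (x k.+1)) -addrA (le_trans (ler_normD _ _))//.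
    have E : (2 ^+ k.+2)^-1 = (2 ^+ k.+1)^-1 / 2 :> R by rewrite exprSr invfM.
    by rewrite E; move: h IH3; set a := _ ^- _; lra.
  have [l Hl] := geometric_limit C0 (fun k => (xP k).1).
  have lr : ball c r l.
    rewrite -ball_normE/= distrC; have := Hl 0%N; rewrite expr0 divr1 => h.
    exact: le_lt_trans h Cr.
  exists l => _; split=> //.
  have xr k : ball c r (x k).
    rewrite -ball_normE/= distrC; apply: le_lt_trans (xP k).2.1 _.
    by apply: le_lt_trans Cr; rewrite gerBl divr_ge0// ?mulr_ge0// exprn_ge0.
  apply/eqP; rewrite -subr_eq0; apply/eqP.
  (* F l - F (x k), by strict differentiability, and y0 - F (x k), which is the k-th step multiplied
     by A, both decrease like 2^-k. *)
  pose C' := (n%:R * `|A| + e) * (2 * C) + n%:R * `|A| * C.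
  apply: (@geometric_eq0 _ _ C') => k.
  have -> : F l - y0 = (F l - F (x k)) - (y0 - F (x k)) by rewrite opprB addrA subrK.
  have h1 : `|F l - F (x k)| <= (n%:R * `|A| + e) * (2 * C / 2 ^+ k).
    have [_ h] := Hr _ _ (xr k) lr.
    rewrite -[F l - F (x k)](subrK ((l - x k) *m A)) (le_trans (ler_normD _ _))//.
    rewrite mulrDl addrC lerD//.
      apply: le_trans (norm_row_mulmx_le _ _) _; rewrite ler_wpM2l ?mulr_ge0//.
    by apply: le_trans h _; rewrite ler_pM2l.
  have h2 : `|y0 - F (x k)| <= n%:R * `|A| * (C / 2 ^+ k).
    have -> : y0 - F (x k) = (x k.+1 - x k) *m A.
      by rewrite {1}/x/= /step (addrC (iter _ _ _)) addrK AiA.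
    apply: le_trans (norm_row_mulmx_le _ _) _; rewrite ler_wpM2l ?mulr_ge0//.
    exact: (xP k).1.
  apply: le_trans (ler_normB _ _) _; apply: le_trans (lerD h1 h2) _.
  by rewrite le_eqVlt; apply/orP; left; apply/eqP; rewrite /C'; ring.
have {surj}[g Hg] := choice surj.
exists g, r, rho; split => //.
- by move=> x xr; have [] := Hr _ _ xr xr.
- move=> x y xr yr Fxy; have := lip _ _ xr yr; rewrite Fxy subrr normr0 mulr0.
  by rewrite normr_le0 subr_eq0 => /eqP.
move=> y yr; apply/continuous_epsP => eps eps0.
have h1 := open_near (ball_open (F c) rho) yr.
have e2K : 0 < eps / (2 * K) by rewrite divr_gt0// mulr_gt0.
have h2 := near_dist y e2K.
apply: filterS2 h1 h2 => z zr yz.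
have [gy Fgy] := Hg _ yr; have [gz Fgz] := Hg _ zr.
apply: le_lt_trans (lip _ _ gz gy) _; rewrite Fgy Fgz.
by move: yz; rewrite ltr_pdivlMr ?mulr_gt0// mulrC.
Unshelve. all: by end_near. Qed.

(** Continuity of h suffices: the expansions of F and G bound k - v J, for the increment k of h, by
    small multiples of |v| and |k|, and the |k| term is absorbed. This supplies the
    differentiability of the developing map, which is constructed as a continuous map. *)
Lemma implicit_diff m n (h : 'rV[R]_m -> 'rV[R]_n) (F : 'rV[R]_n -> 'rV[R]_n)
    (G : 'rV[R]_m -> 'rV[R]_n) x :
  {for x, continuous h} -> differentiable F (h x) -> 'J F (h x) \in unitmx ->
  differentiable G x -> (\forall y \near x, F (h y) = G y) ->
  differentiable h x /\ 'J h x = 'J G x *m invmx ('J F (h x)).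
Proof.
move=> ch dF uA dG FG; set A := 'J F (h x); set B := 'J G x; pose Ai := invmx A.
have dL : continuous (mulmxr (B *m Ai) : 'rV[R]_m -> 'rV[R]_n).
  move=> v; apply: (@continuous_mulmx R _ 1 m n (fun v : 'rV[R]_m => v)
    (fun=> B *m Ai) v); [exact: cvg_id|exact: cst_continuous].
suff H : is_diff x h (mulmxr (B *m Ai)).
  split; first by case: H.
  case: H => dh E; apply/row_matrixP => i; rewrite !rowE mul_jacobian.
  by rewrite E.
apply: is_diff_of_estimate => // e e0.
have AAi (v : 'rV[R]_n) : v *m A *m Ai = v by exact: mulmxK.
have AiA (v : 'rV[R]_n) : v *m Ai *m A = v by exact: mulmxKV.
pose K := n%:R * `|Ai| + 1.
have K1 : 1 <= K by rewrite /K lerDr mulr_ge0.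
have K0 : 0 < K by exact: lt_le_trans K1.
have KP (v : 'rV[R]_n) : `|v *m Ai| <= K * `|v|.
  by apply: le_trans (norm_row_mulmx_le _ _) _; rewrite ler_wpM2r// /K lerDl.
pose C := 2 * (m%:R * `|B *m Ai| + 1).
have C1 : 1 <= C.
  have : 0 <= m%:R * `|B *m Ai| by rewrite mulr_ge0.
  rewrite /C; lra.
(* The second entry gives K eps <= 1/2, which absorbs |k| and yields |k| <= C |v|; the first turns
   the final bound K eps (C + 1) |v| into e |v|. *)
pose eps := Num.min (e / (K * (C + 1))) (2 * K)^-1.
have C10 : 0 < C + 1 by lra.
have eps0 : 0 < eps.
  by rewrite /eps lt_min divr_gt0 ?mulr_gt0//= invr_gt0 mulr_gt0.
have epsK : K * eps <= 2^-1.
  have : eps <= (2 * K)^-1 by rewrite /eps ge_min lexx orbT.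
  rewrite -(ler_pM2l K0); congr (_ <= _) => //.
  by rewrite invfM mulrCA mulfV ?gt_eqF// mulr1.
have epse : K * eps * (C + 1) <= e.
  have : eps <= e / (K * (C + 1)) by rewrite /eps ge_min lexx.
  by rewrite ler_pdivlMr ?mulr_gt0// mulrA (mulrC eps).
have shx : (fun v => v + x) @ (0 : 'rV[R]_m) --> x.
  have c1 : differentiable (id + cst x : 'rV[R]_m -> 'rV[R]_m) 0 by [].
  have E : (id + cst x : 'rV[R]_m -> 'rV[R]_m) 0 = x by exact: add0r.
  by have := differentiable_continuous c1; rewrite /prop_for /continuous_at E.
have hx0 : (fun v => h (v + x) - h x) @ (0 : 'rV[R]_m) --> (0 : 'rV[R]_n).
  have : (fun v => h (v + x) - h x) @ (0 : 'rV[R]_m) --> h x - h x.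
    have hc : (fun v => h (v + x)) @ (0 : 'rV[R]_m) --> h x.
      by apply: (@cvg_comp _ _ _ (fun v : 'rV[R]_m => v + x) h _ _ _ shx); exact: ch.
    exact: (cvgB hc (cvg_cst (h x))).
  by rewrite subrr.
have n1 : \forall v \near (0 : 'rV[R]_m), F (h (v + x)) = G (v + x).
  exact: (shx _ FG).
have n2 := diff_estimate dG eps0.
have n3 : \forall v \near (0 : 'rV[R]_m), `|F (h (v + x)) - F (h x) -
    (h (v + x) - h x) *m A| <= eps * `|h (v + x) - h x|.
  have H : \forall v \near (0 : 'rV[R]_m),
      `|F ((h (v + x) - h x) + h x) - F (h x) - 'd F (h x) (h (v + x) - h x)|
      <= eps * `|h (v + x) - h x| := hx0 _ (diff_estimate dF eps0).
  apply: filterS H => v.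
  by rewrite subrK mul_jacobian.
have Fx : F (h x) = G x by exact: (nbhs_singleton FG).
move: n1 n2 n3; apply: filterS3 => v E1; rewrite -mul_jacobian -/B => E2.
rewrite E1 Fx; set k := h (v + x) - h x => E3.
rewrite [X in `|_ - X|]/=.
have Ek : k - v *m (B *m Ai) = (G (v + x) - G x - v *m B) *m Ai
    - (G (v + x) - G x - k *m A) *m Ai.
  by rewrite -mulmxBl subrBB mulmxBl AAi mulmxA.
have b1 : `|k - v *m (B *m Ai)| <= K * (eps * `|v|) + K * (eps * `|k|).
  rewrite Ek; apply: le_trans (ler_normB _ _) _; apply: lerD;
    by apply: le_trans (KP _) _; rewrite ler_pM2l.
have b2 : `|k| <= C * `|v|.
  have b3 : `|v *m (B *m Ai)| <= m%:R * `|B *m Ai| * `|v| by exact: norm_row_mulmx_le.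
  have b4 : `|k| <= `|k - v *m (B *m Ai)| + `|v *m (B *m Ai)|.
    by rewrite -{1}[k](subrK (v *m (B *m Ai))) ler_normD.
  have b5 : K * (eps * `|k|) <= 2^-1 * `|k| by rewrite mulrA ler_wpM2r.
  have b6 : K * (eps * `|v|) <= 2^-1 * `|v| by rewrite mulrA ler_wpM2r.
  have v0 : 0 <= `|v| by [].
  rewrite /C; move: b1 b3 b4 b5 b6.
  set p := m%:R * _; set q := `|v| in v0 *; nra.
apply: le_trans b1 _; rewrite -mulrDr -mulrDr mulrA.
apply: (@le_trans _ _ (K * eps * ((C + 1) * `|v|))).
  rewrite ler_pM2l ?mulr_gt0//; move: b2; lra.
by rewrite mulrA ler_wpM2r.
Qed.

End InverseFunction.

(** * Parallel sections of a flat linear connection on a ball *)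

Section TotalDifferential.
Context {R : realType}.

Lemma is_derive_scal (V : normedModType R) m n (f : V -> R) (F : V -> 'M[R]_(m, n))
    x v df dF : is_derive x v f df -> is_derive x v F dF ->
  is_derive x v (fun y => f y *: F y) (df *: F x + f x *: dF).
Proof.
move=> Hf /is_derive_mxP HF; apply/is_derive_mxP => i j.
have -> : (fun y => (f y *: F y) i j) = fun y => f y * F y i j.
  by apply/funext => y; rewrite mxE.
by rewrite !mxE; exact: is_derive_mulr.
Qed.

Lemma is_derive_line (V : normedModType R) (x v : V) (t : R) :
  is_derive t 1 (fun t : R => x + t *: v) v.
Proof.
have := @is_derive_shiftline R V V id x v t v (is_derive_id _ _).
by [].
Qed.

Variables (n N : nat) (conn : 'rV[R]_n -> 'rV[R]_n -> 'M[R]_N).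
Variable dconn : 'rV[R]_n -> 'rV[R]_n -> 'rV[R]_n -> 'M[R]_N.
Variables (c : 'rV[R]_n) (d K : R).
Hypothesis K0 : 0 <= K.
Hypothesis connD : forall x v w, conn x (v + w) = conn x v + conn x w.
Hypothesis connZ : forall x s v, conn x (s *: v) = s *: conn x v.
Hypothesis dconnDr : forall x h v w, dconn x h (v + w) = dconn x h v + dconn x h w.
Hypothesis dconnZl : forall x s h v, dconn x (s *: h) v = s *: dconn x h v.
Hypothesis conn_bound : forall x v, ball c d x -> `|conn x v| <= K * `|v|.
Hypothesis conn_lip : forall x y v, ball c d x -> ball c d y ->
  `|conn y v - conn x v| <= K * `|y - x| * `|v|.
Hypothesis conn_taylor : forall x y v, ball c d x -> ball c d y ->
  `|conn y v - conn x v - dconn x (y - x) v| <= K * `|y - x| ^+ 2 * `|v|.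
Hypothesis dconn_bound : forall x h v, ball c d x -> `|dconn x h v| <= K * `|h| * `|v|.
Hypothesis conn_small : forall x y z (u : 'rV[R]_N),
  ball c d x -> ball c d y -> ball c d z ->
  `|u *m conn z (y - x)| <= `|u| / 2.
Hypothesis conn_cont : forall x v, ball c d x -> {for x, continuous (conn^~ v)}.
Hypothesis conn_deriv : forall x h v, ball c d x ->
  is_derive x h (conn^~ v) (dconn x h v).
Hypothesis conn_flat : forall x v w, ball c d x ->
  conn x v *m conn x w + dconn x v w = conn x w *m conn x v + dconn x w v.

(** The total differential equation du = u conn: parallel sections of the connection d - conn on row
    vectors. *)
Definition parallel_on (W : set 'rV[R]_n) (u : 'rV[R]_n -> 'rV[R]_N) :=
  forall x, W x -> differentiable u x /\ forall v, 'd u x v = u x *m conn x v.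

(** On the segment from x0 to x the difference solves a linear equation with coefficient at most 1/2
    by [conn_small], so [half_gronwall] applies with e = 0. *)
Lemma parallel_unique u1 u2 x0 : parallel_on (ball c d) u1 ->
  parallel_on (ball c d) u2 -> ball c d x0 -> u1 x0 = u2 x0 ->
  forall x, ball c d x -> u1 x = u2 x.
Proof.
move=> P1 P2 x0d E x xd.
pose D (t : R) := u1 (x0 + t *: (x - x0)) - u2 (x0 + t *: (x - x0)).
have dD (t : R) : 0 <= t <= 1 ->
    is_derive t 1 D (D t *m conn (x0 + t *: (x - x0)) (x - x0)).
  move=> t01; have td := ball_segment t01 x0d xd.
  rewrite mulmxBl; have [d1 e1] := P1 _ td; have [d2 e2] := P2 _ td.
  rewrite -e1 -e2; exact: (is_derive_sub
    (is_derive_shiftline (is_derive_diff _ d1)) (is_derive_shiftline (is_derive_diff _ d2))).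
have D0 : D 0 = 0 by rewrite /D scale0r addr0 E subrr.
have H := @half_gronwall R N D _ 0 dD D0 _ 1.
apply/eqP; rewrite -subr_eq0 -normr_le0.
have := H _ _; rewrite mulr0 /D scale1r (addrC x0) subrK; apply.
  move=> t t01; rewrite addr0; apply: conn_small => //.
  exact: ball_segment.
by rewrite ler01 lexx.
Qed.

Lemma ray_solution x0 x (u0 : 'rV[R]_N) : ball c d x0 -> ball c d x ->
  exists u : R -> 'rV[R]_N, u 0 = u0 /\ forall t : R, 0 <= t <= 1 ->
    is_derive t 1 u (u t *m conn (x0 + t *: (x - x0)) (x - x0)).
Proof.
move=> x0d xd.
have [||u [u00 du]] := @linear_ODE R N
    (fun t => conn (x0 + clamp01 t *: (x - x0)) (x - x0)) u0.
- move=> t; apply: (@continuous_comp _ _ _ (fun t => x0 + clamp01 t *: (x - x0))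
    (conn^~ (x - x0))); last first.
    by apply: conn_cont; apply: ball_segment => //; exact: clamp01_in.
  apply: (@continuous_comp _ _ _ clamp01 (fun t : R => x0 + t *: (x - x0))).
    exact: clamp01_continuous.
  apply: differentiable_continuous; apply/derivable1_diffP.
  by case: (is_derive_line x0 (x - x0) (clamp01 t)).
- by move=> t u t01; apply: conn_small => //; apply: ball_segment => //; exact: clamp01_in.
exists u; split=> // t t01; have := du t t01.
by rewrite clamp01_id.
Qed.

Lemma norm_row_mul_conn (u : 'rV[R]_N) (A : 'M[R]_N) (a b : R) :
  0 <= a -> `|u| <= a -> `|A| <= b -> `|u *m A| <= N%:R * a * b.
Proof.
move=> a0 ua Ab; apply: le_trans (norm_mulmx_le _ _) _.
by rewrite ler_pM ?mulr_ge0// ler_wpM2l.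
Qed.

(** The derivative of the defect [D] in [parallel_exists], regrouped: once flatness has exchanged
    the order of the two directions, every term except the defect times the connection is of second
    order in h. *)
Lemma flat_rearrange (P Q : 'rV[R]_N) (By Bw Bh T Tw S : 'M[R]_N) (t : R) :
  Bw *m Bh + Tw = Bh *m Bw + T ->
  P *m By - Q *m Bw - (Q *m Bh + t *: (Q *m Bw *m Bh + Q *m Tw)) =
  (P - Q - t *: (Q *m Bh)) *m Bw + ((P - Q) *m (By - (Bw + Bh)) + (P - Q) *m Bh
   + Q *m (By - (Bw + Bh) - t *: (T + S)) + t *: (Q *m S)).
Proof.
move=> flat; rewrite -[Q *m Bw *m Bh]mulmxA -mulmxDr flat.
rewrite !(mulmxBl, mulmxBr, mulmxDl, mulmxDr) -!scalemxAl -!scalemxAr.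
rewrite !(mulmxBl, mulmxBr, mulmxDl, mulmxDr) !mulmxA.
move: (P *m By) (P *m Bw) (P *m Bh) (Q *m By) (Q *m Bw) (Q *m Bh)
  (Q *m Bh *m Bw) (Q *m T) (Q *m S) => a1 a2 a3 a4 a5 a6 a7 a8 a9.
by apply/rowP => j; rewrite !mxE; ring.
Qed.

Lemma lip_rearrange (P Q : 'rV[R]_N) (By Bw Bh : 'M[R]_N) :
  P *m By - Q *m Bw = (P - Q) *m By + Q *m (By - (Bw + Bh)) + Q *m Bh.
Proof.
rewrite !(mulmxBl, mulmxBr, mulmxDl, mulmxDr).
move: (P *m By) (Q *m By) (Q *m Bw) (Q *m Bh) => a1 a2 a3 a4.
by apply/rowP => j; rewrite !mxE; ring.
Qed.

(** The equation is solved along the segment from x0 to each x, and u x is the value at its end. On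
    a single ray this is an ordinary differential equation; flatness is what makes u differentiable
    with the prescribed differential in all directions. *)
Lemma parallel_exists x0 (u0 : 'rV[R]_N) : 0 < d -> ball c d x0 ->
  exists2 u, u x0 = u0 & parallel_on (ball c d) u.
Proof.
move=> d0 x0d.
have Hray x : exists U : R -> 'rV[R]_N, ball c d x -> U 0 = u0 /\
    forall t : R, 0 <= t <= 1 ->
    is_derive t 1 U (U t *m conn (x0 + t *: (x - x0)) (x - x0)).
  have [xd|nxd] := pselect (ball c d x); last by exists (fun=> 0).
  by have [U HU] := ray_solution u0 x0d xd; exists U.
have {Hray}[U HU] := choice Hray.
have U_bound x (t : R) : ball c d x -> 0 <= t <= 1 -> `|U x t| <= 2 * `|u0| + `|u0|.
  move=> xd t01; have [U0 dU] := HU x xd.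
  have H : `|U x t - u0| <= 2 * `|u0|.
    apply: (@half_gronwall R N (fun t => U x t - u0)
      (fun t => U x t *m conn (x0 + t *: (x - x0)) (x - x0))) t01.
    - by move=> s s01; have := is_derive_sub (dU s s01) (is_derive_const u0 s 1);
        rewrite subr0.
    - by rewrite U0 subrr.
    move=> s s01; have sd := ball_segment s01 x0d xd.
    apply: le_trans (conn_small _ x0d xd sd) _.
    have := ler_normD (U x s - u0) u0; rewrite subrK.
    have := normr_ge0 u0; lra.
  by have := ler_normD (U x t - u0) u0; rewrite subrK; lra.
pose M := 2 * `|u0| + `|u0|.
have M0 : 0 <= M by rewrite /M addr_ge0// mulr_ge0.
have wd x : ball c d x -> `|x - x0| <= 2 * d.
  move: x0d; rewrite -ball_normE/= => h1 h2.
  by have := ler_normB (c - x0) (c - x); rewrite subrBB; lra.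
(* [M] bounds all the solutions. The factor 2 d bounds |y - x0|, the 1 stands for the term where
   only the direction changes, and the outer 2 comes from [half_gronwall]. *)
pose C1 := 2 * (N%:R * M * (K * (2 * d + 1))).
have C10 : 0 <= C1 by rewrite /C1 !mulr_ge0// addr_ge0// mulr_ge0// ltW.
have U_lip x y (t : R) : ball c d x -> ball c d y -> 0 <= t <= 1 ->
    `|U y t - U x t| <= C1 * `|y - x|.
  move=> xd yd t01; have [Ux0 dUx] := HU x xd; have [Uy0 dUy] := HU y yd.
  rewrite /C1 -mulrA.
  apply: (@half_gronwall R N (fun t => U y t - U x t) _ _
    (fun s s01 => is_derive_sub (dUy s s01) (dUx s s01))) t01.
    by rewrite Ux0 Uy0 subrr.
  move=> s s01; set X := x0 + s *: (x - x0); set Y := x0 + s *: (y - x0).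
  have Xd : ball c d X by exact: ball_segment.
  have Yd : ball c d Y by exact: ball_segment.
  have YX : Y - X = s *: (y - x).
    by rewrite /X /Y opprD addrACA subrr add0r -scalerBr opprB addrA subrK.
  have -> : U y s *m conn Y (y - x0) - U x s *m conn X (x - x0) =
     (U y s - U x s) *m conn Y (y - x0) + U x s *m (conn Y (y - x0) - conn X (y - x0))
     + U x s *m conn X (y - x).
    have -> : conn X (y - x0) = conn X (x - x0) + conn X (y - x).
      by rewrite -connD [in RHS]addrC addrA subrK.
    exact: lip_rearrange.
  have s1 : `|s| <= 1 by case/andP: s01 => s0 s1; rewrite ger0_norm.
  rewrite -addrA; apply: le_trans (ler_normD _ _) _; rewrite lerD//.
    exact: conn_small.
  apply: le_trans (ler_normD _ _) _.
  have b1 : `|U x s *m (conn Y (y - x0) - conn X (y - x0))| <=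
      N%:R * M * (K * `|y - x| * (2 * d)).
    apply: norm_row_mul_conn => //; first exact: U_bound.
    apply: le_trans (conn_lip _ Xd Yd) _; rewrite YX normrZ.
    rewrite ler_pM ?mulr_ge0//; last exact: wd.
    by rewrite ler_wpM2l// ler_piMl.
  have b2 : `|U x s *m conn X (y - x)| <= N%:R * M * (K * `|y - x|).
    by apply: norm_row_mul_conn => //; [exact: U_bound|exact: conn_bound].
  apply: le_trans (lerD b1 b2) _; rewrite le_eqVlt; apply/orP; left; apply/eqP.
  by ring.
pose E := N%:R * C1 * (K * (2 * d + 1)) + N%:R * M * (K * (2 * d + 1)).
have E0 : 0 <= E by rewrite /E addr_ge0 ?mulr_ge0// addr_ge0// mulr_ge0// ltW.
have U_diff x h : ball c d x -> ball c d (x + h) ->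
    `|U (x + h) 1 - U x 1 - U x 1 *m conn x h| <= 2 * (E * `|h| ^+ 2).
  move=> xd yd; set y := x + h in yd *.
  have [Ux0 dUx] := HU x xd; have [Uy0 dUy] := HU y yd.
  pose X (t : R) := x0 + t *: (x - x0).
  pose Y (t : R) := x0 + t *: (y - x0).
  (* The field t U conn(h) along the ray is the expected variation of the solution when the endpoint
     moves by h; its defect [D] solves a linear equation up to an error of order |h|^2, so D(1) is
     of that order. *)
  pose D (t : R) := U y t - U x t - t *: (U x t *m conn (X t) h).
  have yx : y - x = h by rewrite /y addrC addKr.
  have yx0 : y - x0 = (x - x0) + h by rewrite /y addrAC.
  have dD (t : R) : 0 <= t <= 1 -> is_derive t 1 D
      (U y t *m conn (Y t) (y - x0) - U x t *m conn (X t) (x - x0)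
       - (1 *: (U x t *m conn (X t) h) + t *: ((U x t *m conn (X t) (x - x0)) *m conn (X t) h
          + U x t *m dconn (X t) (x - x0) h))).
    move=> t01.
    have dc : is_derive t 1 (fun t => conn (X t) h) (dconn (X t) (x - x0) h).
      apply: (@is_derive_shiftline R _ _ (conn^~ h)); apply: conn_deriv.
      exact: ball_segment.
    exact: (is_derive_sub (is_derive_sub (dUy t t01) (dUx t t01))
      (is_derive_scal (is_derive_id t 1) (is_derive_mulmx (dUx t t01) dc))).
  have D0 : D 0 = 0 by rewrite /D Ux0 Uy0 subrr scale0r subr0.
  have D1 : D 1 = U y 1 - U x 1 - U x 1 *m conn x h.
    by rewrite /D /X !scale1r (addrC x0) subrK.
  rewrite -D1; apply: (half_gronwall dD D0); last by rewrite ler01 lexx.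
  move=> t t01.
  have Xd : ball c d (X t) by exact: ball_segment.
  have Yd : ball c d (Y t) by exact: ball_segment.
  have YX : Y t - X t = t *: h.
    by rewrite /X /Y opprD addrACA subrr add0r -scalerBr opprB addrA subrK yx.
  have t1 : `|t| <= 1 by case/andP: t01 => t0 t1; rewrite ger0_norm.
  set z := y - x0; set w := x - x0.
  have -> : U y t *m conn (Y t) z - U x t *m conn (X t) w
       - (1 *: (U x t *m conn (X t) h) + t *: ((U x t *m conn (X t) w) *m conn (X t) h
          + U x t *m dconn (X t) w h)) =
     D t *m conn (X t) w + ((U y t - U x t) *m (conn (Y t) z - conn (X t) z)
     + (U y t - U x t) *m conn (X t) h
     + U x t *m (conn (Y t) z - conn (X t) z - dconn (X t) (Y t - X t) z)
     + t *: (U x t *m dconn (X t) h h)).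
    rewrite YX dconnZl /D /z yx0 -/w scale1r (connD (X t) w h) (dconnDr (X t) h w h).
    exact: flat_rearrange (conn_flat w h Xd).
  have h0 : 0 <= `|h| by [].
  have zb : `|z| <= 2 * d by exact: wd.
  apply: le_trans (ler_normD _ _) _; apply: lerD; first exact: conn_small.
  have d20 : 0 <= 2 * d by rewrite mulr_ge0// ltW.
  have Ch0 : 0 <= C1 * `|h| by rewrite mulr_ge0.
  have Ul : `|U y t - U x t| <= C1 * `|h| by rewrite -yx; exact: U_lip.
  have th : `|t *: h| <= `|h| by rewrite normrZ ler_piMl.
  have b1 : `|(U y t - U x t) *m (conn (Y t) z - conn (X t) z)| <=
      N%:R * (C1 * `|h|) * (K * `|h| * (2 * d)).
    apply: norm_row_mul_conn => //; apply: le_trans (conn_lip _ Xd Yd) _.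
    by rewrite YX ler_pM ?mulr_ge0// ler_wpM2l.
  have b2 : `|(U y t - U x t) *m conn (X t) h| <= N%:R * (C1 * `|h|) * (K * `|h|).
    by apply: norm_row_mul_conn => //; exact: conn_bound.
  have b3 : `|U x t *m (conn (Y t) z - conn (X t) z - dconn (X t) (Y t - X t) z)| <=
      N%:R * M * (K * `|h| ^+ 2 * (2 * d)).
    apply: norm_row_mul_conn => //; first exact: U_bound.
    apply: le_trans (conn_taylor _ Xd Yd) _.
    by rewrite YX ler_pM ?mulr_ge0 ?exprn_ge0// ler_wpM2l// lerXn2r// nnegrE.
  have b4 : `|t *: (U x t *m dconn (X t) h h)| <= N%:R * M * (K * `|h| * `|h|).
    rewrite normrZ; apply: le_trans (ler_piMl _ t1) _ => //.
    by apply: norm_row_mul_conn => //; [exact: U_bound|exact: dconn_bound].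
  apply: le_trans (ler_normD _ _) _; apply: le_trans (lerD (ler_normD _ _) b4) _.
  apply: le_trans (lerD (lerD (ler_normD _ _) b3) (lexx _)) _.
  apply: le_trans (lerD (lerD (lerD b1 b2) (lexx _)) (lexx _)) _.
  by rewrite le_eqVlt; apply/orP; left; apply/eqP; rewrite /E; ring.
exists (U^~ 1).
  have [Ux0 dUx] := HU _ x0d.
  apply/eqP; rewrite -subr_eq0 -normr_le0.
  apply: (@MVT_norm R N (fun t => U x0 t - u0)
    (fun t => U x0 t *m conn (x0 + t *: (x0 - x0)) (x0 - x0)) 0) => //.
  - by move=> s s01; have := is_derive_sub (dUx s s01) (is_derive_const u0 s 1);
      rewrite subr0.
  - by rewrite Ux0 subrr.
  - by move=> s s01; rewrite subrr -(scale0r (0 : 'rV[R]_n)) connZ scale0r mulmx0 normr0.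
  - by rewrite ler01 lexx.
move=> x xd.
pose C := \matrix_(a < n, j < N) (U x 1 *m conn x (basis_vec a)) 0 j.
have LE v : v *m C = U x 1 *m conn x v.
  rewrite {2}[v]row_sum_basis.
  have -> : conn x (\sum_a v 0 a *: basis_vec a) = \sum_a v 0 a *: conn x (basis_vec a).
    elim/big_rec2 : _ => [|a p q _ <-]; last by rewrite connD connZ.
    by rewrite -(scale0r (0 : 'rV[R]_n)) connZ scale0r.
  rewrite mulmx_sumr; apply/rowP => j; rewrite mxE summxE.
  by apply: eq_bigr => a _; rewrite -scalemxAr !mxE.
suff [dux duE] : is_diff x (U^~ 1) (mulmxr C).
  by split=> // v; rewrite duE/= LE.
apply: is_diff_of_estimate.
  move=> v; apply: (@continuous_mulmx R _ 1 n N (fun v : 'rV[R]_n => v)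
    (fun=> C) v); [exact: cvg_id|exact: cst_continuous].
move=> e e0.
have e1 : 0 < e / (2 * E + 1) by rewrite divr_gt0// ltr_wpDl// mulr_ge0.
have n1 := near0_add (open_near (ball_open c d) xd).
have n2 : \forall h \near (0 : 'rV[R]_n), `|h| < e / (2 * E + 1).
  apply/nbhs_ballP; exists (e / (2 * E + 1)) => //= h.
  by rewrite -ball_normE/= sub0r normrN.
apply: filterS2 n1 n2 => h hd he.
rewrite (addrC h) [X in `|_ - X|](LE h); apply: le_trans (U_diff x h xd hd) _.
rewrite expr2 !mulrA ler_wpM2r//.
have := normr_ge0 h; move: he; rewrite ltr_pdivlMr ?ltr_wpDl ?mulr_ge0//; lra.
Qed.

End TotalDifferential.

Section C2Bounds.
Context {R : realType} {n : nat}.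

(** One constant for all the bounds that [parallel_exists] demands of a connection form. The Taylor
    estimate is the mean value theorem followed by the Lipschitz bound on the first derivatives. *)
Lemma C2_bounds (U : set 'rV[R]_n) (f : 'rV[R]_n -> R) c : open U -> Ck 2 U f -> U c ->
  exists2 K, 0 <= K & \forall d \near (0 : R)^'+, forall x y, ball c d x -> ball c d y ->
    [/\ `|f x| <= K, `|f y - f x| <= K * `|y - x|,
       forall a, `|partial a f x| <= K &
       `|f y - f x - \sum_a (y - x) 0 a * partial a f x| <= K * `|y - x| ^+ 2].
Proof.
move=> oU Hf Uc.
have Hf1 : Ck 1 U f by apply: Ck_le Hf.
have [K1 K10 HK1] := C1_lipschitz oU Hf1 Uc.
have H a : exists K, 0 <= K /\ \forall d \near (0 : R)^'+, forall x y,
    ball c d x -> ball c d y -> `|partial a f y - partial a f x| <= K * `|y - x|.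
  by have [K K0 HK] := C1_lipschitz oU (Hf a).2 Uc; exists K.
have [Ka HKa] := choice H.
have HKa' : \forall d \near (0 : R)^'+, forall a x y,
    ball c d x -> ball c d y -> `|partial a f y - partial a f x| <= Ka a * `|y - x|.
  by apply: filter_forall => a; exact: (HKa a).2.
have Ka0 a : 0 <= Ka a by exact: (HKa a).1.
pose S := \sum_a (`|partial a f c| + Ka a).
have S0 a : `|partial a f c| + Ka a <= S.
  rewrite /S (bigD1 a)//= lerDl sumr_ge0// => i _; exact: addr_ge0.
have Sp : 0 <= S by apply: sumr_ge0 => a _; exact: addr_ge0.
have SK : \sum_a Ka a <= S by apply: ler_sum => a _; rewrite lerDr.
have /nbhs_ballP[d0 /= d00 Hd0] := open_near oU Uc.
exists (`|f c| + K1 + S); first by rewrite !addr_ge0.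
near=> d => x y xd yd.
have d1 : d <= 1 by near: d; exact: nbhs_right_le.
have dd0 : d <= d0 by near: d; exact: nbhs_right_le.
have dpos : 0 < d by near: d; exact: nbhs_right_gt.
have h1 : forall x y, ball c d x -> ball c d y -> `|f y - f x| <= K1 * `|y - x|.
  by near: d; exact: HK1.
have h2 : forall a x y,
    ball c d x -> ball c d y -> `|partial a f y - partial a f x| <= Ka a * `|y - x|.
  by near: d; exact: HKa'.
have cd : ball c d c by exact: ballxx.
have xc : `|x - c| <= 1.
  by rewrite distrC; move: (xd); rewrite -ball_normE/= => /ltW/le_trans; apply.
have fc0 : 0 <= `|f c| by [].
split.
- have := h1 _ _ cd xd; have := ler_normD (f x - f c) (f c); rewrite subrK.
  have : K1 * `|x - c| <= K1 by rewrite ler_piMr.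
  lra.
- apply: le_trans (h1 _ _ xd yd) _; rewrite ler_wpM2r//; lra.
- move=> a; have := h2 a _ _ cd xd.
  have := ler_normD (partial a f x - partial a f c) (partial a f c); rewrite subrK.
  have : Ka a * `|x - c| <= Ka a by rewrite ler_piMr.
  have := S0 a; lra.
have Ud z : ball c d z -> U z by move=> zd; apply: Hd0; exact: le_ball zd.
have dl z v : U z -> is_derive z v f ('d f z v).
  by move=> Uz; apply: is_derive_diff; exact: C1_differentiable Hf1 Uz.
have [|s /andP[s0 s1] E] := @line_MVT R _ f x (y - x).
  move=> s s01; case: (dl (x + s *: (y - x)) (y - x)) => //.
  exact/Ud/ball_segment.
have s01 : 0 <= s <= 1 by rewrite !ltW.
have zd := ball_segment s01 xd yd.
rewrite (addrC x) subrK in E; rewrite {}E.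
rewrite derive_row_form; last exact: C1_differentiable Hf1 (Ud _ zd).
rewrite -sumrB (le_trans (ler_norm_sum _ _ _))//.
apply: (@le_trans _ _ ((\sum_a Ka a) * `|y - x| ^+ 2)); last first.
  by rewrite ler_wpM2r ?exprn_ge0//; lra.
rewrite mulr_suml; apply: ler_sum => a _.
rewrite -mulrBr normrM expr2 mulrCA ler_pM ?mxE_le_norm//.
apply: le_trans (h2 a _ _ xd zd) _; rewrite ler_wpM2l//.
rewrite (addrC x) addrK normrZ ger0_norm ?ler_piMl//; exact: ltW.
Unshelve. all: by end_near. Qed.

End C2Bounds.

(** * The linear Frobenius theorem *)

Section Frobenius.
Context {R : realType} {n N : nat}.
Variable B : 'I_n -> 'rV[R]_n -> 'M[R]_N.

Definition lconn (x v : 'rV[R]_n) : 'M[R]_N := \sum_a v 0 a *: B a x.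

Definition dB (a b : 'I_n) (x : 'rV[R]_n) : 'M[R]_N :=
  \matrix_(i, j) partial a (fun y => B b y i j) x.

Definition dlconn (x h v : 'rV[R]_n) : 'M[R]_N :=
  \sum_a \sum_b (h 0 a * v 0 b) *: dB a b x.

Lemma lconnD x v w : lconn x (v + w) = lconn x v + lconn x w.
Proof. by rewrite /lconn -big_split; apply: eq_bigr => a _; rewrite mxE scalerDl. Qed.

Lemma lconnZ x s v : lconn x (s *: v) = s *: lconn x v.
Proof. by rewrite /lconn scaler_sumr; apply: eq_bigr => a _; rewrite mxE scalerA. Qed.

Lemma dlconnDr x h v w : dlconn x h (v + w) = dlconn x h v + dlconn x h w.
Proof.
rewrite /dlconn -big_split; apply: eq_bigr => a _ /=.
by rewrite -big_split; apply: eq_bigr => b _ /=; rewrite mxE mulrDr scalerDl.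
Qed.

Lemma dlconnZl x s h v : dlconn x (s *: h) v = s *: dlconn x h v.
Proof.
rewrite /dlconn scaler_sumr; apply: eq_bigr => a _.
by rewrite scaler_sumr; apply: eq_bigr => b _; rewrite mxE scalerA mulrA.
Qed.

Lemma lconnE x v i j : lconn x v i j = \sum_a v 0 a * B a x i j.
Proof. by rewrite /lconn summxE; apply: eq_bigr => a _; rewrite mxE. Qed.

Lemma dlconnE x h v i j : dlconn x h v i j =
  \sum_a \sum_b h 0 a * v 0 b * partial a (fun y => B b y i j) x.
Proof.
rewrite /dlconn summxE; apply: eq_bigr => a _; rewrite summxE.
by apply: eq_bigr => b _; rewrite !mxE.
Qed.

Variable U : set 'rV[R]_n.
Hypothesis oU : open U.
Hypothesis HB : forall a i j, Ck 2 U (fun x => B a x i j).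
Hypothesis flatB : forall x a b, U x ->
  B a x *m B b x + dB a b x = B b x *m B a x + dB b a x.

Lemma dB_differentiable a i j x : U x -> differentiable (fun y => B a y i j) x.
Proof. by move=> Ux; exact: Ck_differentiable (HB a i j) Ux. Qed.

Lemma lconn_deriv x h v : U x -> is_derive x h (lconn^~ v) (dlconn x h v).
Proof.
move=> Ux; apply/is_derive_mxP => i j.
have -> : (fun y => lconn y v i j) = fun y => \sum_a v 0 a * B a y i j.
  by apply/funext => y; exact: lconnE.
rewrite dlconnE exchange_big/=; apply: is_derive_sumP => b.
have H : is_derive x h (fun y => B b y i j)
    (\sum_a h 0 a * partial a (fun y => B b y i j) x).
  have D := dB_differentiable b i j Ux.
  by split; [exact: diff_derivable|exact: derive_row_form].
have := is_derive_mulr (is_derive_const (v 0 b) x h) H.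
rewrite mul0r add0r mulr_sumr; congr (is_derive _ _ _ _).
by apply: eq_bigr => a _; rewrite mulrCA mulrA.
Qed.

Lemma lconn_cont x v : U x -> {for x, continuous (lconn^~ v)}.
Proof.
move=> Ux; apply: continuous_mx => i j.
have -> : (fun y => lconn y v i j) = fun y => \sum_a v 0 a * B a y i j.
  by apply/funext => y; exact: lconnE.
apply: continuous_sum_fin => a; apply: continuousM; first exact: cst_continuous.
exact/differentiable_continuous/dB_differentiable.
Qed.

Lemma lconn_flat x v w : U x ->
  lconn x v *m lconn x w + dlconn x v w = lconn x w *m lconn x v + dlconn x w v.
Proof.
move=> Ux.
have E p q : lconn x p *m lconn x q + dlconn x p q =
    \sum_a \sum_b (p 0 a * q 0 b) *: (B a x *m B b x + dB a b x).
  rewrite /lconn /dlconn mulmx_suml -big_split; apply: eq_bigr => a _ /=.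
  rewrite mulmx_sumr -big_split; apply: eq_bigr => b _ /=.
  by rewrite -scalemxAl -scalemxAr scalerA scalerDr.
rewrite !E exchange_big/=; apply: eq_bigr => a _; apply: eq_bigr => b _.
by rewrite flatB// mulrC.
Qed.

Lemma row_sum_bound (v : 'rV[R]_n) (f : 'I_n -> R) (K : R) : 0 <= K ->
  (forall a, `|f a| <= K) -> `|\sum_a v 0 a * f a| <= n%:R * K * `|v|.
Proof.
move=> K0 H; apply: le_trans (ler_norm_sum _ _ _) _.
apply: (@le_trans _ _ (\sum_(a < n) K * `|v|)).
  by apply: ler_sum => a _; rewrite normrM mulrC ler_pM ?mxE_le_norm.
by rewrite sumr_const card_ord -mulrA mulr_natl.
Qed.

(** The constants of the finitely many entries are added up to one K. The radius is then shrunk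
    until the connection, applied across the ball, at least halves every vector, as integration
    along rays demands. *)
Theorem frobenius c : U c -> exists d, [/\ 0 < d, ball c d `<=` U,
  forall x0 u0, ball c d x0 -> exists2 u, u x0 = u0 & parallel_on lconn (ball c d) u &
  forall u1 u2 x0, parallel_on lconn (ball c d) u1 -> parallel_on lconn (ball c d) u2 ->
    ball c d x0 -> u1 x0 = u2 x0 -> forall x, ball c d x -> u1 x = u2 x].
Proof.
move=> Uc.
have H (aij : 'I_n * ('I_N * 'I_N)) := C2_bounds oU (HB aij.1 aij.2.1 aij.2.2) Uc.
have H' aij : exists K, 0 <= K /\ \forall d \near (0 : R)^'+,
    forall x y, ball c d x -> ball c d y ->
    [/\ `|B aij.1 x aij.2.1 aij.2.2| <= K,
       `|B aij.1 y aij.2.1 aij.2.2 - B aij.1 x aij.2.1 aij.2.2| <= K * `|y - x|,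
       forall a, `|partial a (fun y => B aij.1 y aij.2.1 aij.2.2) x| <= K &
       `|B aij.1 y aij.2.1 aij.2.2 - B aij.1 x aij.2.1 aij.2.2
         - \sum_a (y - x) 0 a * partial a (fun y => B aij.1 y aij.2.1 aij.2.2) x|
       <= K * `|y - x| ^+ 2].
  by have [K K0 HK] := H aij; exists K.
have {H H'}[Kf HKf] := choice H'.
have HK : \forall d \near (0 : R)^'+, forall aij,
    forall x y, ball c d x -> ball c d y ->
    [/\ `|B aij.1 x aij.2.1 aij.2.2| <= Kf aij,
       `|B aij.1 y aij.2.1 aij.2.2 - B aij.1 x aij.2.1 aij.2.2| <= Kf aij * `|y - x|,
       forall a, `|partial a (fun y => B aij.1 y aij.2.1 aij.2.2) x| <= Kf aij &
       `|B aij.1 y aij.2.1 aij.2.2 - B aij.1 x aij.2.1 aij.2.2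
         - \sum_a (y - x) 0 a * partial a (fun y => B aij.1 y aij.2.1 aij.2.2) x|
       <= Kf aij * `|y - x| ^+ 2].
  by apply: filter_forall => aij; exact: (HKf aij).2.
pose K1 := \sum_aij Kf aij.
have Kf0 aij : 0 <= Kf aij by exact: (HKf aij).1.
have K10 : 0 <= K1 by exact: sumr_ge0.
have KfK aij : Kf aij <= K1 by rewrite /K1 (bigD1 aij)//= lerDl sumr_ge0.
pose K := n%:R * K1 + n%:R * (n%:R * K1).
have nK : 0 <= n%:R * K1 by rewrite mulr_ge0.
have nnK : 0 <= n%:R * (n%:R * K1) by rewrite !mulr_ge0.
have K0 : 0 <= K by rewrite addr_ge0.
have nKK : n%:R * K1 <= K by rewrite lerDl.
have nnKK : n%:R * (n%:R * K1) <= K by rewrite lerDr.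
have /nbhs_ballP[d0 /= d00 Hd0] := open_near oU Uc.
(* Gives N K (2 d) <= 1/2, where 2 d bounds the distance of two points of the ball; the [+ 1] keeps
   the inverse positive when N K = 0. *)
pose eps := (4 * N%:R * K + 1)^-1.
have eps0 : 0 < eps by rewrite invr_gt0 ltr_wpDl// !mulr_ge0.
near (0 : R)^'+ => d.
have dpos : 0 < d by near: d; exact: nbhs_right_gt.
have dd0 : d <= d0 by near: d; exact: nbhs_right_le.
have deps : d <= eps by near: d; exact: nbhs_right_le.
have HKd : forall aij, forall x y, ball c d x -> ball c d y ->
    [/\ `|B aij.1 x aij.2.1 aij.2.2| <= Kf aij,
       `|B aij.1 y aij.2.1 aij.2.2 - B aij.1 x aij.2.1 aij.2.2| <= Kf aij * `|y - x|,
       forall a, `|partial a (fun y => B aij.1 y aij.2.1 aij.2.2) x| <= Kf aij &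
       `|B aij.1 y aij.2.1 aij.2.2 - B aij.1 x aij.2.1 aij.2.2
         - \sum_a (y - x) 0 a * partial a (fun y => B aij.1 y aij.2.1 aij.2.2) x|
       <= Kf aij * `|y - x| ^+ 2].
  by near: d; exact: HK.
have Ud : ball c d `<=` U by move=> x xd; apply: Hd0; exact: le_ball xd.
have b1 x v : ball c d x -> `|lconn x v| <= K * `|v|.
  move=> xd; apply: mx_norm_le => [|i j]; first by rewrite mulr_ge0.
  rewrite lconnE; apply: le_trans (row_sum_bound v K10 _) _.
    by move=> a; have [h _ _ _] := HKd (a, (i, j)) x x xd xd; exact: le_trans h (KfK _).
  by rewrite ler_wpM2r.
have b2 x y v : ball c d x -> ball c d y -> `|lconn y v - lconn x v| <= K * `|y - x| * `|v|.
  move=> xd yd; apply: mx_norm_le => [|i j]; first by rewrite !mulr_ge0.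
  have -> : (lconn y v - lconn x v) i j = \sum_a v 0 a * (B a y i j - B a x i j).
    by rewrite !mxE !lconnE -sumrB; apply: eq_bigr => a _; rewrite mulrBr.
  apply: le_trans (row_sum_bound v (mulr_ge0 K10 (normr_ge0 (y - x))) _) _.
    move=> a; have [_ h _ _] := HKd (a, (i, j)) x y xd yd; apply: le_trans h _.
    by rewrite ler_wpM2r.
  by rewrite mulrA ler_wpM2r// ler_wpM2r.
have b3 x y v : ball c d x -> ball c d y ->
    `|lconn y v - lconn x v - dlconn x (y - x) v| <= K * `|y - x| ^+ 2 * `|v|.
  move=> xd yd; apply: mx_norm_le => [|i j]; first by rewrite !mulr_ge0// exprn_ge0.
  have -> : (lconn y v - lconn x v - dlconn x (y - x) v) i j =
      \sum_a v 0 a * (B a y i j - B a x i j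
        - \sum_b (y - x) 0 b * partial b (fun y => B a y i j) x).
    rewrite [LHS]mxE [X in X + _]mxE [X in _ + X]mxE [X in _ + X + _]mxE.
    rewrite !lconnE dlconnE exchange_big/= -!sumrB; apply: eq_bigr => a _.
    rewrite !mulrBr; congr (_ - _); rewrite mulr_sumr; apply: eq_bigr => b _.
    by rewrite mulrA; congr (_ * _); rewrite mulrC.
  apply: le_trans (row_sum_bound v
    (mulr_ge0 K10 (exprn_ge0 2 (normr_ge0 (y - x)))) _) _.
    move=> a; have [_ _ _ h] := HKd (a, (i, j)) x y xd yd; apply: le_trans h _.
    by rewrite ler_wpM2r// exprn_ge0.
  by rewrite mulrA ler_wpM2r// ler_wpM2r// exprn_ge0.
have b4 x h v : ball c d x -> `|dlconn x h v| <= K * `|h| * `|v|.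
  move=> xd; apply: mx_norm_le => [|i j]; first by rewrite !mulr_ge0.
  have -> : dlconn x h v i j =
      \sum_b v 0 b * (\sum_a h 0 a * partial a (fun y => B b y i j) x).
    rewrite dlconnE exchange_big/=; apply: eq_bigr => b _; rewrite mulr_sumr.
    by apply: eq_bigr => a _; rewrite mulrCA mulrA.
  apply: le_trans (row_sum_bound v (mulr_ge0 nK (normr_ge0 h)) _) _.
    move=> b; apply: row_sum_bound => // a.
    by have [_ _ h' _] := HKd (b, (i, j)) x x xd xd; exact: le_trans (h' a) (KfK _).
  by rewrite mulrA ler_wpM2r// ler_wpM2r.
have b5 x y z (u : 'rV[R]_N) : ball c d x -> ball c d y -> ball c d z ->
    `|u *m lconn z (y - x)| <= `|u| / 2.
  move=> xd yd zd; apply: le_trans (norm_mulmx_le _ _) _.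
  have yx : `|y - x| <= 2 * d.
    move: xd yd; rewrite -ball_normE/= => h1 h2.
    by have := ler_normB (c - x) (c - y); rewrite subrBB; lra.
  have h := b1 z (y - x) zd.
  have h2 : `|lconn z (y - x)| <= K * (2 * d).
    by apply: le_trans h _; rewrite ler_wpM2l.
  have h3 : N%:R * (K * (2 * d)) <= 2^-1.
    have : d * (4 * N%:R * K + 1) <= 1.
      by rewrite -ler_pdivlMr ?mul1r// ltr_wpDl// !mulr_ge0.
    have -> : N%:R * (K * (2 * d)) = N%:R * K * d * 2 by ring.
    have -> : d * (4 * N%:R * K + 1) = 4 * (N%:R * K * d) + d by ring.
    lra.
  rewrite mulrAC mulrC ler_wpM2l//; apply: le_trans h3.
  by rewrite ler_wpM2l.
exists d; split => //.
- move=> x0 u0 x0d.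
  apply: (@parallel_exists R n N lconn dlconn c d K) => //.
  + exact: lconnD.
  + exact: lconnZ.
  + exact: dlconnDr.
  + exact: dlconnZl.
  + by move=> x v /Ud; exact: lconn_cont.
  + by move=> x h v /Ud; exact: lconn_deriv.
  + by move=> x v w /Ud; exact: lconn_flat.
- move=> u1 u2 x0 P1 P2 x0d E x xd.
  by apply: (@parallel_unique R n N lconn c d b5 u1 u2 x0).
Unshelve. all: by end_near. Qed.

End Frobenius.

(** * Riemannian geometry in one chart *)

Section Inner.
Context {R : realType} {n : nat}.
Implicit Types (G : 'M[R]_n) (u v w : 'rV[R]_n).

Lemma innerDl G u v w : inner G (u + v) w = inner G u w + inner G v w.
Proof. by rewrite /inner !mulmxDl mxE. Qed.
Lemma innerDr G u v w : inner G w (u + v) = inner G w u + inner G w v.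
Proof. by rewrite /inner linearD/= mulmxDr mxE. Qed.
Lemma innerNl G u v : inner G (- u) v = - inner G u v.
Proof. by rewrite /inner !mulNmx mxE. Qed.
Lemma innerNr G u v : inner G u (- v) = - inner G u v.
Proof. by rewrite /inner linearN/= mulmxN mxE. Qed.
Lemma innerZl G s u v : inner G (s *: u) v = s * inner G u v.
Proof. by rewrite /inner -!scalemxAl mxE. Qed.
Lemma innerZr G s u v : inner G u (s *: v) = s * inner G u v.
Proof. by rewrite /inner linearZ/= -scalemxAr mxE. Qed.
Lemma innerBl G u v w : inner G (u - v) w = inner G u w - inner G v w.
Proof. by rewrite innerDl innerNl. Qed.
Lemma innerBr G u v w : inner G w (u - v) = inner G w u - inner G w v.
Proof. by rewrite innerDr innerNr. Qed.
Lemma inner0l G u : inner G 0 u = 0.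
Proof. by rewrite /inner !mul0mx mxE. Qed.
Lemma inner0r G u : inner G u 0 = 0.
Proof. by rewrite /inner trmx0 mulmx0 mxE. Qed.

Lemma inner_tr G u v : inner G^T u v = inner G v u.
Proof.
rewrite /inner; have -> : v *m G *m u^T = (u *m G^T *m v^T)^T.
  by rewrite !trmx_mul !trmxK mulmxA.
by rewrite [in RHS]mxE.
Qed.

Lemma inner_sym G u v : G^T = G -> inner G u v = inner G v u.
Proof. by move=> GT; rewrite -{1}GT inner_tr. Qed.

Lemma inner_sum G u v : inner G u v = \sum_a \sum_b u 0 a * G a b * v 0 b.
Proof.
rewrite /inner mxE exchange_big/=; apply: eq_bigr => b _.
by rewrite !mxE mulr_suml.
Qed.

Lemma inner_mulmx m (A : 'M[R]_(m, n)) (H : 'M[R]_n) (p q : 'rV[R]_m) :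
  inner H (p *m A) (q *m A) = (p *m (A *m H *m A^T) *m q^T) 0 0.
Proof. by rewrite /inner trmx_mul !mulmxA. Qed.

Lemma inner_eq0 G u : G \in unitmx -> (forall w, inner G u w = 0) -> u = 0.
Proof.
move=> uG H; rewrite -[u](mulmxK uG).
have -> : u *m G = 0.
  apply/rowP => j; have := H (basis_vec j).
  by rewrite /inner /basis_vec trmx_delta -colE !mxE.
by rewrite mul0mx.
Qed.

Lemma inner_inj G u v : G \in unitmx -> (forall w, inner G u w = inner G v w) -> u = v.
Proof.
move=> uG H; apply/eqP; rewrite -subr_eq0; apply/eqP; apply: (inner_eq0 uG) => w.
by rewrite innerBl H subrr.
Qed.

Lemma posdef_unitmx G : (forall v, v != 0 -> 0 < inner G v v) -> G \in unitmx.
Proof.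
move=> pd; rewrite -row_free_unit; apply: inj_row_free => v vG.
apply/eqP; apply: contraT => /pd; rewrite /inner vG mul0mx mxE ltxx.
by [].
Qed.

End Inner.

Section MatrixDerivative.
Context {R : realType} {n : nat}.
Implicit Types (U : set 'rV[R]_n).

Definition smooth_mx p q U (F : 'rV[R]_n -> 'M[R]_(p, q)) :=
  forall i j, smooth_on U (fun x => F x i j).

(** The directional derivative spelled out by partial derivatives: it is linear in h without any
    differentiability, and its entries are sums to which the [Ck] lemmas apply. *)
Definition mderiv p q (F : 'rV[R]_n -> 'M[R]_(p, q)) (x h : 'rV[R]_n) : 'M[R]_(p, q) :=
  \matrix_(i, j) \sum_a h 0 a * partial a (fun y => F y i j) x.

Lemma smooth_mx_diff p q U (F : 'rV[R]_n -> 'M[R]_(p, q)) x :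
  open U -> smooth_mx U F -> U x -> differentiable F x.
Proof.
move=> oU HF Ux; apply: differentiable_mx => i j.
exact: (Ck_differentiable oU (HF i j 1%N)).
Qed.

Lemma mderiv_diff p q (F : 'rV[R]_n -> 'M[R]_(p, q)) x h :
  differentiable F x -> 'd F x h = mderiv F x h.
Proof.
move=> dF; apply/matrixP => i j; rewrite mxE.
have /is_derive_mxP/(_ i j) h1 := is_derive_diff h dF.
have dFij := differentiable_mxE i j dF.
have h2 : is_derive x h (fun y => F y i j) (\sum_a h 0 a * partial a (fun y => F y i j) x).
  by split; [exact: diff_derivable|exact: derive_row_form].
exact: is_derive_unique h1 h2.
Qed.

Lemma mderiv_is_derive p q U (F : 'rV[R]_n -> 'M[R]_(p, q)) x h :
  open U -> smooth_mx U F -> U x -> is_derive x h F (mderiv F x h).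
Proof.
move=> oU HF Ux; have dF := smooth_mx_diff oU HF Ux.
by rewrite -mderiv_diff//; exact: is_derive_diff.
Qed.

Lemma mderiv_val p q (F : 'rV[R]_n -> 'M[R]_(p, q)) x h dF :
  differentiable F x -> is_derive x h F dF -> mderiv F x h = dF.
Proof.
by move=> d1 H; rewrite -mderiv_diff//; exact: is_derive_unique (is_derive_diff h d1) H.
Qed.

Lemma mderivD p q (F : 'rV[R]_n -> 'M[R]_(p, q)) x h k :
  mderiv F x (h + k) = mderiv F x h + mderiv F x k.
Proof.
apply/matrixP => i j; rewrite !mxE -big_split; apply: eq_bigr => a _ /=.
by rewrite mxE mulrDl.
Qed.

Lemma smooth_partial U (f : 'rV[R]_n -> R) a : smooth_on U f -> smooth_on U (partial a f).
Proof. by move=> H k; exact: (H k.+1 a).2. Qed.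

Lemma smooth_mderiv p q U (F : 'rV[R]_n -> 'M[R]_(p, q)) h : open U ->
  smooth_mx U F -> smooth_mx U (fun x => mderiv F x h).
Proof.
move=> oU HF i j k.
apply: (@Ck_eq _ _ k U (fun x => \sum_a h 0 a * partial a (fun y => F y i j) x)) => //.
  by move=> x _; rewrite mxE.
apply: Ck_sum => // a _; apply: CkM => //; first exact: Ck_cst.
exact: smooth_partial (HF i j) k.
Qed.

Lemma mderiv_sym p q U (F : 'rV[R]_n -> 'M[R]_(p, q)) x u v : open U ->
  smooth_mx U F -> U x ->
  mderiv (fun y => mderiv F y u) x v = mderiv (fun y => mderiv F y v) x u.
Proof.
move=> oU HF Ux; apply/matrixP => i j; rewrite !mxE.
have E h b : partial b (fun y => mderiv F y h i j) x =
    \sum_a h 0 a * partial b (partial a (fun y => F y i j)) x.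
  have -> : (fun y => mderiv F y h i j) = fun y => \sum_a h 0 a * partial a (fun y => F y i j) y.
    by apply/funext => y; rewrite mxE.
  rewrite /partial; apply: (@derive_val _ _ _ _ _ _ _ _).
  apply: is_derive_sumP => a.
  have d := ((HF i j 2%N) a).2 b.
  have := is_derive_mulr (is_derive_const (h 0 a) x (basis_vec b)) (derivableP (d.1 x Ux)).
  by rewrite mul0r add0r.
transitivity (\sum_b \sum_a v 0 b * u 0 a * partial b (partial a (fun y => F y i j)) x).
  by apply: eq_bigr => b _; rewrite E mulr_sumr; apply: eq_bigr => a _; rewrite mulrA.
rewrite exchange_big/=; apply: eq_bigr => b _; rewrite E mulr_sumr; apply: eq_bigr => a _.
by rewrite (schwarz a b oU (HF i j 2%N) Ux) mulrA (mulrC (u 0 b)).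
Qed.

Lemma is_derive_inner (V : normedModType R) (A : V -> 'M[R]_n) (p q : V -> 'rV[R]_n)
    x h dA dp dq : is_derive x h A dA -> is_derive x h p dp -> is_derive x h q dq ->
  is_derive x h (fun y => inner (A y) (p y) (q y))
    (inner dA (p x) (q x) + inner (A x) dp (q x) + inner (A x) (p x) dq).
Proof.
move=> HA Hp Hq.
have := is_derive_mulmx (is_derive_mulmx Hp HA) (is_derive_trmx Hq).
move=> /is_derive_mxP/(_ 0 0); congr (is_derive _ _ _ _).
by rewrite /inner mulmxDl [LHS]mxE [X in X + _]mxE; congr (_ + _); rewrite addrC.
Qed.

End MatrixDerivative.

(** * The Levi-Civita connection in coordinates *)

Section LeviCivita.
Context {R : realType} {n : nat}.
Implicit Types (u v w z : 'rV[R]_n).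

(** The Christoffel symbols as a bilinear map: the covariant derivative of a field V along u is
    dV(u) + gamma(u, V). *)
Definition gamma (G : 'rV[R]_n -> 'M[R]_n) (x u v : 'rV[R]_n) : 'rV[R]_n :=
  \row_k \sum_(a < n) \sum_(b < n) christoffel G a b k x * u 0 a * v 0 b.

Record metric_on (U : set 'rV[R]_n) (G : 'rV[R]_n -> 'M[R]_n) : Prop := MetricOn {
  mo_open : open U;
  mo_smooth : smooth_mx U G;
  mo_sym : forall x, U x -> (G x)^T = G x;
  mo_pos : forall x v, U x -> v != 0 -> 0 < inner (G x) v v }.

Variables (U : set 'rV[R]_n) (G : 'rV[R]_n -> 'M[R]_n).
Hypothesis HG : metric_on U G.

Let oU : open U := mo_open HG.
Let sG : smooth_mx U G := mo_smooth HG.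

Lemma mo_unit x : U x -> G x \in unitmx.
Proof. by move=> Ux; apply: posdef_unitmx => v; exact: (mo_pos HG). Qed.

Lemma mo_innerC x u v : U x -> inner (G x) u v = inner (G x) v u.
Proof. by move=> Ux; apply: inner_sym; exact: (mo_sym HG). Qed.

Lemma smooth_christoffel a b k : smooth_on U (christoffel G a b k).
Proof.
move=> r; apply: CkM => //; first exact: Ck_cst.
apply: Ck_sum => // l _; apply: CkM => //.
  by apply: Ck_invmx => //; [exact: mo_unit|move=> i j; exact: sG].
apply: CkB => //; last exact: smooth_partial (sG _ _) r.
by apply: CkD => //; exact: smooth_partial (sG _ _) r.
Qed.

Lemma smooth_gamma u v : smooth_mx U (fun x => gamma G x u v).
Proof.
move=> i j k; apply: (@Ck_eq _ _ k U
  (fun x => \sum_(a < n) \sum_(b < n) christoffel G a b j x * u 0 a * v 0 b)) => //.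
  by move=> x _; rewrite mxE.
apply: Ck_sum => // a _; apply: Ck_sum => // b _.
do 2 (apply: CkM => //; last exact: Ck_cst).
exact: smooth_christoffel.
Qed.

Lemma gammaDr x u v w : gamma G x u (v + w) = gamma G x u v + gamma G x u w.
Proof.
apply/rowP => k; rewrite !mxE -big_split; apply: eq_bigr => a _ /=.
by rewrite -big_split; apply: eq_bigr => b _ /=; rewrite mxE mulrDr.
Qed.

Lemma gammaZr x s u v : gamma G x u (s *: v) = s *: gamma G x u v.
Proof.
apply/rowP => k; rewrite !mxE mulr_sumr; apply: eq_bigr => a _ /=.
by rewrite mulr_sumr; apply: eq_bigr => b _ /=; rewrite mxE mulrCA.
Qed.

Lemma gammaDl x u v w : gamma G x (u + v) w = gamma G x u w + gamma G x v w.
Proof.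
apply/rowP => k; rewrite !mxE -big_split; apply: eq_bigr => a _ /=.
by rewrite -big_split; apply: eq_bigr => b _ /=; rewrite mxE mulrDr mulrDl.
Qed.

Lemma gammaZl x s u v : gamma G x (s *: u) v = s *: gamma G x u v.
Proof.
apply/rowP => k; rewrite !mxE mulr_sumr; apply: eq_bigr => a _ /=.
by rewrite mulr_sumr; apply: eq_bigr => b _ /=; rewrite mxE mulrA mulrA (mulrC _ s) -!mulrA.
Qed.

Lemma mderiv_inner x h u v : inner (mderiv G x h) u v =
  \sum_c h 0 c * \sum_a \sum_b u 0 a * partial c (fun y => G y a b) x * v 0 b.
Proof.
rewrite inner_sum.
under eq_bigr => a _ do (under eq_bigr => b _ do
  (rewrite mxE mulr_sumr mulr_suml); rewrite exchange_big/=).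
rewrite exchange_big/=; apply: eq_bigr => c _; rewrite mulr_sumr.
apply: eq_bigr => a _; rewrite mulr_sumr; apply: eq_bigr => b _.
by rewrite !mulrA (mulrC (u 0 a)).
Qed.

(** Contracting the definition of [christoffel] with G cancels the inverse metric and leaves
    Koszul's formula for constant fields. Symmetry, metric compatibility and naturality of [gamma]
    are all read off from it. *)
Lemma koszul x u v w : U x -> inner (G x) (gamma G x u v) w =
  2^-1 * (inner (mderiv G x u) w v + inner (mderiv G x v) w u - inner (mderiv G x w) u v).
Proof.
move=> Ux; have uG := mo_unit Ux.
pose c : 'rV[R]_n := \row_l \sum_a \sum_b u 0 a * v 0 b *
  (partial a (fun y => G y l b) x + partial b (fun y => G y l a) x
   - partial l (fun y => G y a b) x).
have -> : gamma G x u v = 2^-1 *: (c *m (invmx (G x))^T).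
  apply/rowP => k; rewrite !mxE.
  transitivity (\sum_a \sum_b \sum_l 2^-1 * (u 0 a * v 0 b *
     (partial a (fun y => G y l b) x + partial b (fun y => G y l a) x
     - partial l (fun y => G y a b) x) * invmx (G x) k l)).
    apply: eq_bigr => a _; apply: eq_bigr => b _.
    rewrite /christoffel mulr_sumr !mulr_suml; apply: eq_bigr => l _.
    by rewrite -!mulrA; congr (_ * _); ring.
  rewrite mulr_sumr.
  under eq_bigr => a _ do rewrite exchange_big/=.
  rewrite exchange_big/=; apply: eq_bigr => l _; rewrite !mxE mulr_suml mulr_sumr.
  apply: eq_bigr => a _; rewrite mulr_suml mulr_sumr; apply: eq_bigr => b _.
  by [].
rewrite innerZl; congr (_ * _).
have -> : inner (G x) (c *m (invmx (G x))^T) w = (c *m w^T) 0 0.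
  rewrite /inner; congr ((_ *m _) 0 0).
  rewrite -mulmxA -{2}(mo_sym HG Ux) -trmx_mul mulmxV// trmx1 mulmx1.
  by [].
rewrite mxE.
transitivity (\sum_l w 0 l * \sum_a \sum_b u 0 a * v 0 b *
   partial a (fun y => G y l b) x
  + \sum_l w 0 l * \sum_a \sum_b u 0 a * v 0 b * partial b (fun y => G y l a) x
  - \sum_l w 0 l * \sum_a \sum_b u 0 a * v 0 b * partial l (fun y => G y a b) x).
  rewrite -big_split -sumrB; apply: eq_bigr => l _ /=; rewrite !mxE mulrC.
  rewrite -mulrDr -mulrBr; congr (_ * _); rewrite -big_split -sumrB.
  apply: eq_bigr => a _ /=; rewrite -big_split -sumrB; apply: eq_bigr => b _ /=.
  by rewrite -mulrDr -mulrBr.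
rewrite !mderiv_inner; congr (_ + _ - _).
- under eq_bigr => l _ do rewrite mulr_sumr.
  rewrite exchange_big/=; apply: eq_bigr => a _; rewrite mulr_sumr.
  apply: eq_bigr => l _; rewrite !mulr_sumr; apply: eq_bigr => b _; ring.
- under eq_bigr => l _ do (rewrite mulr_sumr; under eq_bigr => a _ do rewrite mulr_sumr;
    rewrite exchange_big/=).
  rewrite exchange_big/=; apply: eq_bigr => b _; rewrite mulr_sumr.
  apply: eq_bigr => l _; rewrite !mulr_sumr; apply: eq_bigr => a _; ring.
- apply: eq_bigr => l _; congr (_ * _); apply: eq_bigr => a _; apply: eq_bigr => b _.
  ring.
Qed.

Lemma mderiv_metricC x h u v : U x -> inner (mderiv G x h) u v = inner (mderiv G x h) v u.
Proof.
move=> Ux; apply: inner_sym; apply/matrixP => a b; rewrite !mxE.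
apply: eq_bigr => c _; congr (_ * _); apply: near_eq_derive.
have : \forall y \near x, U y by exact: open_near.
by apply: filterS => y Uy; rewrite -[in LHS](mo_sym HG Uy) mxE.
Qed.

Lemma gammaC x u v : U x -> gamma G x u v = gamma G x v u.
Proof.
move=> Ux; apply: (inner_inj (mo_unit Ux)) => w; rewrite !koszul//.
by rewrite (mderiv_metricC w u v Ux) (addrC (inner (mderiv G x u) w v)).
Qed.

Lemma metric_compatible x h u v : U x -> inner (mderiv G x h) u v =
  inner (G x) (gamma G x h u) v + inner (G x) u (gamma G x h v).
Proof.
move=> Ux; rewrite (mo_innerC u _ Ux) !koszul//.
have e1 := mderiv_metricC h u v Ux; have e2 := mderiv_metricC u v h Ux.
have e3 := mderiv_metricC v u h Ux; lra.
Qed.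

(** The index-free form for constant fields, whose brackets vanish; later arguments on curvature
    start from it and never return to indices. *)
Lemma curvatureE x u v w : U x -> curvature G x u v w =
  mderiv (fun y => gamma G y v w) x u - mderiv (fun y => gamma G y u w) x v
  + (gamma G x u (gamma G x v w) - gamma G x v (gamma G x u w)).
Proof.
move=> Ux.
have E p q h l : mderiv (fun y => gamma G y p q) x h 0 l =
    \sum_a \sum_b \sum_c h 0 a * p 0 b * q 0 c * partial a (christoffel G b c l) x.
  rewrite mxE; apply: eq_bigr => a _.
  have -> : partial a (fun y => gamma G y p q 0 l) x =
      \sum_b \sum_c p 0 b * q 0 c * partial a (christoffel G b c l) x.
    have -> : (fun y => gamma G y p q 0 l) = fun y => \sum_b \sum_c
        christoffel G b c l y * (p 0 b * q 0 c).
      apply/funext => y; rewrite mxE; apply: eq_bigr => b _; apply: eq_bigr => c _.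
      by rewrite mulrA.
    apply: (@derive_val _ _ _ _ _ _ _ _); apply: is_derive_sumP => b.
    apply: is_derive_sumP => c.
    have D := derivableP ((smooth_christoffel b c l 1%N a).1 x Ux).
    have := is_derive_mulr D (is_derive_const (p 0 b * q 0 c) x (basis_vec a)).
    by rewrite mulr0 addr0 /partial; congr (is_derive _ _ _ _); exact: mulrC.
  rewrite mulr_sumr; apply: eq_bigr => b _; rewrite mulr_sumr; apply: eq_bigr => c _.
  by rewrite !mulrA.
have E2 p q h l : gamma G x h (gamma G x p q) 0 l =
    \sum_a \sum_b \sum_c h 0 a * p 0 b * q 0 c *
      \sum_m christoffel G a m l x * christoffel G b c m x.
  rewrite mxE; apply: eq_bigr => a _.
  under eq_bigr => m _ do (rewrite mxE mulr_sumr; under eq_bigr => b _ do rewrite mulr_sumr).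
  rewrite exchange_big/=; apply: eq_bigr => b _; rewrite exchange_big/=.
  apply: eq_bigr => c _; rewrite mulr_sumr; apply: eq_bigr => m _; ring.
apply/rowP => l.
have -> : (mderiv (fun y => gamma G y v w) x u - mderiv (fun y => gamma G y u w) x v
  + (gamma G x u (gamma G x v w) - gamma G x v (gamma G x u w))) 0 l =
  mderiv (fun y => gamma G y v w) x u 0 l - mderiv (fun y => gamma G y u w) x v 0 l
  + (gamma G x u (gamma G x v w) 0 l - gamma G x v (gamma G x u w) 0 l).
  move: (mderiv _ _ _) (mderiv _ _ _) (gamma G x u (gamma G x v w))
    (gamma G x v (gamma G x u w)) => A1 A2 A3 A4.
  by rewrite !mxE.
rewrite !E !E2 mxE.
rewrite [X in _ - X + _]exchange_big/= [X in _ + (_ - X)]exchange_big/=.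
rewrite -!sumrB -big_split; apply: eq_bigr => a _ /=.
rewrite -!sumrB -big_split; apply: eq_bigr => b _ /=.
rewrite -!sumrB -big_split; apply: eq_bigr => c _ /=.
rewrite /riemann big_split/= sumrN.
move: (\sum_m _ * _) (\sum_m _ * _) (partial a _ x) (partial b _ x) => s1 s2 p1 p2.
ring.
Qed.

End LeviCivita.

(** * Algebraic curvature tensors and constant curvature *)

Section CurvatureAlgebra.
Context {R : realType} {V : lmodType R}.
Variable S : V -> V -> V -> V -> R.
Hypothesis S12 : forall u v w z, S v u w z = - S u v w z.
Hypothesis S34 : forall u v w z, S u v z w = - S u v w z.
Hypothesis bianchi : forall u v w z, S u v w z + S v w u z + S w u v z = 0.
Hypothesis SD1 : forall u u' v w z, S (u + u') v w z = S u v w z + S u' v w z.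
Hypothesis SD2 : forall u v v' w z, S u (v + v') w z = S u v w z + S u v' w z.
Hypothesis SD3 : forall u v w w' z, S u v (w + w') z = S u v w z + S u v w' z.
Hypothesis SD4 : forall u v w z z', S u v w (z + z') = S u v w z + S u v w z'.
Hypothesis Ssec : forall u v, S u v v u = 0.

(** The octahedron argument: four Bianchi identities, one for each choice of the last argument,
    combined through the skew symmetries. *)
Lemma curvature_pair_sym u v w z : S u v w z = S w z u v.
Proof.
have B1 := bianchi u v w z; have B2 := bianchi v w z u.
have B3 := bianchi w z u v; have B4 := bianchi z u v w.
have a1 := S34 v w z u; have a2 := S34 w z v u; have a3 := S12 z v w u.
have a4 := S12 u w z v; have a5 := S34 u w z v; have a6 := S12 z u w v.
have a7 := S34 z u v w; have a8 := S34 u v w z; have a9 := S34 v z u w.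
have b1 := S12 v z u w; have b2 := S34 v z w u; have b3 := S12 v z w u.
have b4 := S12 u w v z; have b5 := S34 w u v z; have b6 := S34 w u z v.
have b7 := S34 u z w v; have b8 := S12 u z w v; have b9 := S34 u v z w.
have c1 := S34 w z u v; have c2 := S34 z v w u; have c3 := S34 v w u z.
lra.
Qed.

(** Polarisation in the middle pair, then in the outer pair, shows that S is invariant under cyclic
    permutations of its first, second and fourth arguments; the Bianchi identity then reads 3 S =
    0. *)
Lemma curvature_zero_of_sectional u v w z : S u v w z = 0.
Proof.
have P a b c : S a b c a = 0.
  have := Ssec a (b + c); rewrite SD2 !SD3 !Ssec.
  have := curvature_pair_sym a c b a; have := S12 b a a c; have := S34 a b a c.
  have := S34 b a a c; have := S34 a b c a; have := S12 a b c a; have := S12 a b a c.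
  lra.
have Q a b c e : S a b c e = S b e c a.
  have := P (a + e) b c; rewrite SD1 !SD4 !P.
  have := S12 e b c a; lra.
have q1 := Q u v w z; have q2 := Q v z w u; have B := bianchi z u v w.
have p1 := curvature_pair_sym u v w z; have p2 := curvature_pair_sym v z w u.
have p3 := curvature_pair_sym z u w v.
have s1 := S34 z u w v; have s2 := S34 u v w z; have s3 := S34 v z w u.
lra.
Qed.

End CurvatureAlgebra.

Section ConstantCurvature.
Local Opaque christoffel inner partial mderiv gamma curvature derive.
Context {R : realType} {n : nat}.
Implicit Types (u v w z : 'rV[R]_n).
Variables (U : set 'rV[R]_n) (G : 'rV[R]_n -> 'M[R]_n).
Hypothesis HG : metric_on U G.
Variable x : 'rV[R]_n.
Hypothesis Ux : U x.

Let oU : open U := mo_open HG.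
Let sG : smooth_mx U G := mo_smooth HG.

Let D v w u := mderiv (fun y => gamma G y v w) x u.

Let dgamma v w u : is_derive x u (fun y => gamma G y v w) (D v w u).
Proof. exact: (mderiv_is_derive u oU (smooth_gamma HG v w)). Qed.

Lemma dgammaDr v w z u : D v (w + z) u = D v w u + D v z u.
Proof.
have H := is_derive_add (dgamma v w u) (dgamma v z u).
apply: mderiv_val; first exact: smooth_mx_diff oU (smooth_gamma HG v (w + z)) Ux.
suff -> : (fun y => gamma G y v (w + z)) = (fun y => gamma G y v w + gamma G y v z) by [].
by apply/funext => y; exact: gammaDr.
Qed.

Lemma dgammaDl v w z u : D (v + w) z u = D v z u + D w z u.
Proof.
have H := is_derive_add (dgamma v z u) (dgamma w z u).
apply: mderiv_val; first exact: smooth_mx_diff oU (smooth_gamma HG (v + w) z) Ux.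
suff -> : (fun y => gamma G y (v + w) z) = (fun y => gamma G y v z + gamma G y w z) by [].
by apply/funext => y; exact: gammaDl.
Qed.

Lemma dgammaC v w u : D v w u = D w v u.
Proof.
apply: mderiv_val; first exact: smooth_mx_diff oU (smooth_gamma HG v w) Ux.
apply: near_eq_is_derive (dgamma w v u).
have : \forall y \near x, U y by exact: open_near.
by apply: filterS => y Uy; exact: (gammaC HG).
Qed.

Let Rm u v w z := inner (G x) (curvature G x u v w) z.

Lemma curvatureDr u v w z : curvature G x u v (w + z) = curvature G x u v w + curvature G x u v z.
Proof.
rewrite !(curvatureE HG)// -!/(D _ _ _) !dgammaDr !gammaDr.
move: (D v w u) (D v z u) (D u w v) (D u z v) (gamma G x u (gamma G x v w))
  (gamma G x u (gamma G x v z)) (gamma G x v (gamma G x u w))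
  (gamma G x v (gamma G x u z)) => a1 a2 a3 a4 a5 a6 a7 a8.
by apply/rowP => j; rewrite !mxE; ring.
Qed.

Lemma curvatureC u v w : curvature G x v u w = - curvature G x u v w.
Proof.
rewrite !(curvatureE HG)// -!/(D _ _ _).
move: (D _ _ _) (D _ _ _) (gamma G x u (gamma G x v w)) (gamma G x v (gamma G x u w)) => a1 a2 a3 a4.
by apply/rowP => j; rewrite !mxE; ring.
Qed.

Lemma curvatureDl u v w z : curvature G x (u + v) w z = curvature G x u w z + curvature G x v w z.
Proof.
rewrite !(curvatureE HG)// -!/(D _ _ _) dgammaDl !gammaDl gammaDr.
have -> : D w z (u + v) = D w z u + D w z v by exact: mderivD.
move: (D w z u) (D w z v) (D u z w) (D v z w) (gamma G x u (gamma G x w z))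
  (gamma G x v (gamma G x w z)) (gamma G x w (gamma G x u z))
  (gamma G x w (gamma G x v z)) => a1 a2 a3 a4 a5 a6 a7 a8.
by apply/rowP => j; rewrite !mxE; ring.
Qed.

Lemma curvature_bianchi u v w :
  curvature G x u v w + curvature G x v w u + curvature G x w u v = 0.
Proof.
rewrite !(curvatureE HG)// -!/(D _ _ _).
rewrite (dgammaC w u) (dgammaC w v) (dgammaC v u).
rewrite (gammaC HG w u Ux) (gammaC HG w v Ux) (gammaC HG v u Ux).
move: (D _ _ _) (D _ _ _) (D _ _ _) (gamma G x u (gamma G x v w))
  (gamma G x w (gamma G x u v)) (gamma G x v (gamma G x u w)) => a1 a2 a3 a4 a5 a6.
by apply/rowP => j; rewrite !mxE; ring.
Qed.

(** Second derivatives of the metric commute. When both are expanded by metric compatibility, the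
    products of two [gamma] are symmetric in the directions and what remains is <R(u, v) w, z> + <w,
    R(u, v) z> = 0. *)
Lemma curvature_skew u v w z : Rm u v z w = - Rm u v w z.
Proof.
pose H a b := mderiv (fun y => mderiv G y a) x b.
have HC a b : H a b = H b a by exact: mderiv_sym oU sG Ux.
have key a b : inner (H a b) w z =
   inner (G x) (gamma G x b (gamma G x a w) + D a w b) z
   + inner (G x) (gamma G x b (gamma G x a z) + D a z b) w
   + inner (G x) (gamma G x a w) (gamma G x b z)
   + inner (G x) (gamma G x a z) (gamma G x b w).
  have L : is_derive x b (fun y => inner (mderiv G y a) w z) (inner (H a b) w z).
    have := is_derive_inner (mderiv_is_derive b oU (smooth_mderiv a oU sG) Ux)
      (is_derive_const w x b) (is_derive_const z x b).
    by rewrite inner0l inner0r !addr0.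
  have dG := mderiv_is_derive b oU sG Ux.
  have M := is_derive_add (is_derive_inner dG (dgamma a w b) (is_derive_const z x b))
     (is_derive_inner dG (is_derive_const w x b) (dgamma a z b)).
  have EQ : \forall y \near x, inner (G y) (gamma G y a w) z + inner (G y) w (gamma G y a z)
      = inner (mderiv G y a) w z.
    have : \forall y \near x, U y by exact: open_near.
    by apply: filterS => y Uy; rewrite (metric_compatible HG).
  have E := near_eq_is_derive EQ M.
  rewrite (is_derive_unique L E) !inner0l !inner0r !addr0 !(metric_compatible HG)// !innerDl.
  rewrite (mo_innerC HG w (D a z b) Ux) (mo_innerC HG w (gamma G x b (gamma G x a z)) Ux).
  rewrite (mo_innerC HG (gamma G x b w) (gamma G x a z) Ux).
  move: (inner _ _ _) (inner _ _ _) (inner _ _ _) (inner _ _ _) => r1 r2 r3 r4.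
  by rewrite ?addr0; lra.
have k1 := key u v; have k2 := key v u; rewrite HC in k1.
rewrite k2 in k1; move: k1.
rewrite /Rm !(curvatureE HG)// -!/(D _ _ _) !innerDl !innerNl.
rewrite (mo_innerC HG (gamma G x v w) (gamma G x u z) Ux).
rewrite (mo_innerC HG (gamma G x v z) (gamma G x u w) Ux).
lra.
Qed.

Variable kappa : R.
Hypothesis sec : forall u v, row_free (col_mx u v) -> sectional_curvature G x u v = kappa.

Let area u v := inner (G x) u u * inner (G x) v v - inner (G x) u v ^+ 2.

Lemma row_free_area u v : area u v != 0 -> row_free (col_mx u v).
Proof.
move=> a0; apply: inj_row_free => c.
rewrite -[c]hsubmxK mul_row_col; set a := lsubmx c; set b := rsubmx c.
rewrite [a]mx11_scalar [b]mx11_scalar !mul_scalar_mx.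
move: (a 0 0) (b 0 0) => {a b c} a b /eqP; rewrite addr_eq0 => /eqP E.
have A s p q : area (s *: p) q = s ^+ 2 * area p q.
  by rewrite /area !innerZl !innerZr; ring.
have A' s p q : area p (s *: q) = s ^+ 2 * area p q.
  by rewrite /area !innerZl !innerZr; ring.
have A0 p : area p p = 0 by rewrite /area; ring.
have Z1 : a ^+ 2 * area u v = 0.
  by rewrite -A E -scaleNr A A0 mulr0.
have Z2 : b ^+ 2 * area u v = 0.
  rewrite -A'; have -> : b *: v = - (a *: u) by rewrite E opprK.
  by rewrite -scaleNr A' A0 mulr0.
have -> : a = 0.
  by move/eqP: Z1; rewrite mulf_eq0 (negbTE a0) orbF expf_eq0/= => /eqP.
have -> : b = 0.
  by move/eqP: Z2; rewrite mulf_eq0 (negbTE a0) orbF expf_eq0/= => /eqP.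
by rewrite (_ : 0%:M = 0) ?row_mx0//; apply/matrixP => i j; rewrite !mxE mul0rn.
Qed.

(** The curvature hypothesis speaks of independent pairs only. If the area vanishes, equality in the
    Cauchy-Schwarz inequality makes u a multiple of v unless v = 0, and the left side vanishes by
    skew symmetry. *)
Lemma sectional_quadratic u v : Rm u v v u = kappa * area u v.
Proof.
have [a0|a0] := eqVneq (area u v) 0; last first.
  rewrite -(sec (row_free_area a0)) /sectional_curvature -/(area u v).
  by rewrite divfK.
rewrite a0 mulr0.
have skew0 a b : Rm a b b b = 0 by have := curvature_skew a b b b; lra.
have [->|v0] := eqVneq v 0.
  rewrite /Rm (_ : curvature G x u 0 0 = 0) ?inner0l//.
  by apply: (addrI (curvature G x u 0 0)); rewrite -curvatureDr !addr0.
have vv := mo_pos HG Ux v0.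
pose s := inner (G x) u v / inner (G x) v v.
have p0 : u - s *: v = 0.
  apply/eqP; apply: contraT => /(mo_pos HG Ux); suff -> : inner (G x) (u - s *: v) (u - s *: v) = 0.
    by rewrite ltxx.
  rewrite !innerBl !innerBr !innerZl !innerZr (mo_innerC HG v u Ux).
  apply: (mulIf (lt0r_neq0 vv)); rewrite mul0r.
  have E : s * inner (G x) v v = inner (G x) u v by rewrite /s divfK// lt0r_neq0.
  move: a0 E; rewrite /area.
  move: (s) (inner (G x) u v) (inner (G x) u u) (inner (G x) v v) => r p q m E' E.
  rewrite E; have -> : (q - r * p - (r * p - r * p)) * m = q * m - (r * m) * p by ring.
  by rewrite E -expr2.
have -> : u = s *: v by apply/eqP; rewrite -subr_eq0 p0.
rewrite /Rm innerZr.
have -> : inner (G x) (curvature G x (s *: v) v v) v = 0 by exact: skew0.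
by rewrite mulr0.
Qed.

(** The difference from the curvature tensor of the model with constant kappa has all the symmetries
    of a curvature tensor and no sectional curvature. *)
Lemma constant_curvatureE u v w :
  curvature G x u v w = kappa *: (inner (G x) v w *: u - inner (G x) u w *: v).
Proof.
pose S a b c e := Rm a b c e - kappa * (inner (G x) b c * inner (G x) a e
  - inner (G x) a c * inner (G x) b e).
apply: (inner_inj (mo_unit HG Ux)) => z.
apply/eqP; rewrite -subr_eq0; apply/eqP.
rewrite innerZl innerBl !innerZl -/(Rm u v w z) -/(S u v w z).
have Rm12 a b c e : Rm b a c e = - Rm a b c e by rewrite /Rm curvatureC innerNl.
have RmD1 a a' b c e : Rm (a + a') b c e = Rm a b c e + Rm a' b c e.
  by rewrite /Rm curvatureDl innerDl.
have RmD3 a b c c' e : Rm a b (c + c') e = Rm a b c e + Rm a b c' e.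
  by rewrite /Rm curvatureDr innerDl.
apply: (@curvature_zero_of_sectional R _ S); rewrite /S.
- move=> a b c e; rewrite (Rm12 a b); ring.
- move=> a b c e; rewrite curvature_skew; ring.
- move=> a b c e; have : Rm a b c e + Rm b c a e + Rm c a b e = 0.
    by rewrite /Rm -!innerDl curvature_bianchi inner0l.
  rewrite (mo_innerC HG b a Ux) (mo_innerC HG c a Ux) (mo_innerC HG c b Ux).
  move: (Rm _ _ _ _) (Rm _ _ _ _) (Rm _ _ _ _) => r1 r2 r3; lra.
- move=> a a' b c e; rewrite RmD1 !innerDl; ring.
- move=> a b b' c e; rewrite Rm12 RmD1 !innerDl (Rm12 a b) (Rm12 a b'); ring.
- move=> a b c c' e; rewrite RmD3 !innerDr; ring.
- move=> a b c e e'; rewrite /Rm !innerDr; ring.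
- move=> a b; rewrite sectional_quadratic /area (mo_innerC HG b a Ux); ring.
Qed.

End ConstantCurvature.

Lemma eq_mx_mull (R : nzRingType) m n (A B : 'M[R]_(m, n)) :
  (forall u : 'rV[R]_m, u *m A = u *m B) -> A = B.
Proof. by move=> H; apply/row_matrixP => i; rewrite !rowE. Qed.

(** * Jets and the flat connection behind Obata's equation *)

Section Jets.
Context {R : realType} {n : nat}.

(** A value and a vector in one row, so that Obata's equation becomes a linear system of size 1 +
    n. *)
Definition jet (f : R) (X : 'rV[R]_n) : 'rV[R]_(1 + n) := row_mx f%:M X.

Lemma jetD f g X Y : jet (f + g) (X + Y) = jet f X + jet g Y.
Proof. by rewrite /jet raddfD/= add_row_mx. Qed.

Lemma jetZ s f X : jet (s * f) (s *: X) = s *: jet f X.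
Proof. by rewrite /jet scale_row_mx scale_scalar_mx. Qed.

Lemma jet0 : jet 0 0 = 0.
Proof. by rewrite /jet raddf0 row_mx0. Qed.

Lemma jet_inj f g X Y : jet f X = jet g Y -> f = g /\ X = Y.
Proof.
move=> /eq_row_mx[/matrixP/(_ 0 0) + ->]; rewrite !mxE eqxx !mulr1n => ->.
by [].
Qed.

Lemma jet_submx (u : 'rV[R]_(1 + n)) : u = jet (lsubmx u 0 0) (rsubmx u).
Proof. by rewrite /jet -mx11_scalar hsubmxK. Qed.

Lemma jet0E f X : jet f X 0 (lshift n 0) = f.
Proof. by rewrite /jet row_mxEl mxE eqxx mulr1n. Qed.

Lemma jetSE f X a : jet f X 0 (rshift 1 a) = X 0 a.
Proof. by rewrite /jet row_mxEr. Qed.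

Lemma is_derive_jet (V : normedModType R) (f : V -> R) (X : V -> 'rV[R]_n) x v df dX :
  is_derive x v f df -> is_derive x v X dX ->
  is_derive x v (fun y => jet (f y) (X y)) (jet df dX).
Proof.
move=> Hf /is_derive_mxP HX; apply/is_derive_mxP => i j; rewrite ord1.
case: (split_ordP j) => k ->.
  rewrite (ord1 k); under [X in is_derive _ _ X _]eq_fun do rewrite jet0E.
  by rewrite jet0E.
by under [X in is_derive _ _ X _]eq_fun do rewrite jetSE; rewrite jetSE.
Qed.

Lemma is_derive_jetP (V : normedModType R) (u : V -> 'rV[R]_(1 + n)) x v df dX :
  is_derive x v u (jet df dX) ->
  is_derive x v (fun y => lsubmx (u y) 0 0) df /\ is_derive x v (fun y => rsubmx (u y)) dX.
Proof.
move=> /is_derive_mxP H; split.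
  have -> : (fun y => lsubmx (u y) 0 0) = fun y => u y 0 (lshift n 0).
    by apply/funext => y; rewrite mxE.
  by have := H 0 (lshift n 0); rewrite jet0E.
apply/is_derive_mxP => i j; rewrite ord1; have := H 0 (rshift 1 j); rewrite jetSE.
have -> // : (fun y => rsubmx (u y) 0 j) = fun y => u y 0 (rshift 1 j).
by apply/funext => y; rewrite mxE.
Qed.

End Jets.

Section Tractor.
Context {R : realType} {n : nat}.
Implicit Types (u v w : 'rV[R]_n).
Variables (U : set 'rV[R]_n) (G : 'rV[R]_n -> 'M[R]_n) (kappa : R).
Hypothesis HG : metric_on U G.

Let oU : open U := mo_open HG.
Let sG : smooth_mx U G := mo_smooth HG.

(* In coordinates, the connection (f, X) |-> (df - <X, .>, nabla X + kappa f id) on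
   functions paired with vector fields. *)
Definition tractor (a : 'I_n) (x : 'rV[R]_n) : 'M[R]_(1 + n) :=
  block_mx 0 (- kappa *: basis_vec a) (G x *m (basis_vec a)^T)
    (- \matrix_(b, k) christoffel G a b k x).

Lemma mul_jet_tractor f X a x : jet f X *m tractor a x =
  jet (inner (G x) X (basis_vec a)) (- gamma G x (basis_vec a) X - (kappa * f) *: basis_vec a).
Proof.
rewrite /jet /tractor mul_row_block mulmx0 add0r; congr row_mx.
  by rewrite mulmxA [LHS]mx11_scalar.
rewrite addrC mulmxN mul_scalar_mx scalerA mulrN scaleNr (mulrC f); congr (- _ - _).
apply/rowP => k; rewrite !mxE [in RHS](bigD1 a)//= [X in _ = _ + X]big1 ?addr0; last first.
  by move=> i ia; apply: big1 => b _; rewrite !mxE (negbTE ia) andbF mulr0 mul0r.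
by apply: eq_bigr => b _; rewrite !mxE !eqxx mulr1 mulrC.
Qed.

Lemma mul_jet_lconn f X x v : jet f X *m lconn tractor x v =
  jet (inner (G x) X v) (- gamma G x v X - (kappa * f) *: v).
Proof.
rewrite /lconn mulmx_sumr [v in RHS]row_sum_basis.
elim/big_rec2 : _ => [|a p q _ ->].
  have -> : gamma G x 0 X = 0 by have := @gammaZl R n G x 0 0 X; rewrite !scale0r.
  by rewrite inner0r scaler0 !subr0 oppr0 jet0.
rewrite -scalemxAr mul_jet_tractor -jetZ -jetD innerDr innerZr gammaDl gammaZl.
congr jet; rewrite scalerDr scalerDr !scalerN opprD !scalerA (mulrC (kappa * f)).
move: (v 0 a *: _) (gamma G x p X) (_ *: basis_vec a) (_ *: p) => a1 a2 a3 a4.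
by apply/rowP => j; rewrite !mxE; ring.
Qed.

Lemma tractor_smooth a i j k : Ck k U (fun x => tractor a x i j).
Proof.
rewrite /tractor; case: (split_ordP i) => i' ->; case: (split_ordP j) => j' ->.
- apply: (Ck_eq oU _ (@Ck_cst _ _ k U 0)) => x _.
  by rewrite block_mxEul mxE.
- apply: (Ck_eq oU _ (@Ck_cst _ _ k U ((- kappa *: basis_vec a) i' j'))) => x _.
  by rewrite block_mxEur.
- apply: (@Ck_eq _ _ k U (fun x => (G x *m (basis_vec a)^T) i' j')) => //.
    by move=> x _; rewrite block_mxEdl.
  apply: Ck_mulmx => // [p q|p q]; first exact: sG.
  exact: Ck_cst.
- apply: (@Ck_eq _ _ k U (fun x => - christoffel G a i' j' x)) => //.
    by move=> x _; rewrite block_mxEdr !mxE.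
  by apply: CkN => //; exact: (smooth_christoffel HG).
Qed.

Local Opaque christoffel inner partial mderiv gamma curvature derive tractor.

Hypothesis HK : forall x u v w, U x ->
  curvature G x u v w = kappa *: (inner (G x) v w *: u - inner (G x) u w *: v).

(** In the value component both sides reduce to <X, gamma(a, b)> - kappa f <e_a, e_b>, which is
    symmetric. In the vector component the difference is, up to sign, R(e_a, e_b) X minus its value
    in constant curvature kappa. *)
Lemma tractor_flat x a b : U x ->
  tractor a x *m tractor b x + dB tractor a b x =
  tractor b x *m tractor a x + dB tractor b a x.
Proof.
move=> Ux.
have key p q f X : jet f X *m (tractor p x *m tractor q x + dB tractor p q x) =
  jet (inner (G x) (- gamma G x (basis_vec p) X - (kappa * f) *: basis_vec p) (basis_vec q)
       + inner (mderiv G x (basis_vec p)) X (basis_vec q))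
   ((- gamma G x (basis_vec q) (- gamma G x (basis_vec p) X - (kappa * f) *: basis_vec p)
     - (kappa * inner (G x) X (basis_vec p)) *: basis_vec q)
    - mderiv (fun y => gamma G y (basis_vec q) X) x (basis_vec p)).
  rewrite mulmxDr mulmxA !mul_jet_tractor jetD; congr (_ + _).
  have d1 : is_derive x (basis_vec p) (tractor q) (dB tractor p q x).
    apply/is_derive_mxP => i j; rewrite mxE; apply: derivableP.
    exact: (tractor_smooth q i j 1 p).1.
  have d2 := is_derive_mulmx (is_derive_const (jet f X) x (basis_vec p)) d1.
  rewrite mul0mx add0r in d2; apply: is_derive_unique d2 _.
  have -> : (fun y => jet f X *m tractor q y) = fun y =>
    jet (inner (G y) X (basis_vec q)) (- gamma G y (basis_vec q) X - (kappa * f) *: basis_vec q).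
    by apply/funext => y; exact: mul_jet_tractor.
  apply: is_derive_jet.
    have := is_derive_inner (mderiv_is_derive (basis_vec p) oU sG Ux)
      (is_derive_const X x (basis_vec p)) (is_derive_const (basis_vec q) x (basis_vec p)).
    by rewrite inner0l inner0r !addr0.
  have := is_derive_sub (is_derive_opp
    (mderiv_is_derive (basis_vec p) oU (smooth_gamma HG (basis_vec q) X) Ux))
    (is_derive_const ((kappa * f) *: basis_vec q) x (basis_vec p)).
  by rewrite subr0.
apply: eq_mx_mull => u; rewrite [u]jet_submx; move: (lsubmx u 0 0) (rsubmx u) => f X {u}.
apply: etrans (key a b f X) _; apply: etrans _ (esym (key b a f X)).
set A := basis_vec a; set C := basis_vec b; apply: congr2.
  rewrite !(metric_compatible HG)// !innerBl !innerNl !innerZl.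
  rewrite (gammaC HG C A Ux) (mo_innerC HG C A Ux).
  move: (inner _ _ _) (inner _ _ _) (inner _ _ _) (inner _ _ _) => r1 r2 r3 r4; ring.
have E0 := etrans (esym (curvatureE HG A C X Ux)) (HK A C X Ux); move: E0.
have gammaN x' u v : gamma G x' u (- v) = - gamma G x' u v.
  by rewrite -scaleN1r gammaZr scaleN1r.
rewrite !gammaDr !gammaN !gammaZr (gammaC HG C A Ux).
rewrite (mo_innerC HG X A Ux) (mo_innerC HG X C Ux).
move: (mderiv _ _ _) (mderiv _ _ _) (gamma G x A (gamma G x C X))
  (gamma G x C (gamma G x A X)) (gamma G x A C) (inner (G x) C X) (inner (G x) A X)
  => m1 m2 g1 g2 g3 r1 r2 E.
have {}E j : m1 0 j = m2 0 j + (g1 0 j - g2 0 j) - kappa * (r1 * A 0 j - r2 * C 0 j).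
  by have /rowP/(_ j) := E; rewrite !mxE => E'; rewrite -E'; ring.
clearbody A C; by apply/rowP => j; rewrite !mxE E; ring.
Qed.

Lemma tractor_frobenius c : U c -> exists d, [/\ 0 < d, ball c d `<=` U,
  forall x0 s0, ball c d x0 -> exists2 s, s x0 = s0 &
    parallel_on (lconn tractor) (ball c d) s &
  forall s1 s2 x0, parallel_on (lconn tractor) (ball c d) s1 ->
    parallel_on (lconn tractor) (ball c d) s2 ->
    ball c d x0 -> s1 x0 = s2 x0 -> forall x, ball c d x -> s1 x = s2 x].
Proof.
move=> Uc; apply: (frobenius oU _ _ Uc).
  by move=> a i j; exact: tractor_smooth.
by move=> x a b; exact: tractor_flat.
Qed.

End Tractor.

(** * Naturality under isometries *)

Section Covariance.
Context {R : realType} {n : nat}.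
Implicit Types (u v w : 'rV[R]_n).
Variables (U V : set 'rV[R]_n) (G H : 'rV[R]_n -> 'M[R]_n) (phi : 'rV[R]_n -> 'rV[R]_n).
Hypotheses (HG : metric_on U G) (HH : metric_on V H).
Hypotheses (sphi : smooth_mx U phi) (phiUV : forall x, U x -> V (phi x)).
Hypothesis isom : forall x, U x -> G x = 'J phi x *m H (phi x) *m ('J phi x)^T.
Local Opaque christoffel inner partial mderiv gamma curvature derive.

Let oU : open U := mo_open HG.

Lemma mderiv_jacobian x v : U x -> v *m 'J phi x = mderiv phi x v.
Proof.
by move=> Ux; rewrite mul_jacobian mderiv_diff//; exact: smooth_mx_diff oU sphi Ux.
Qed.

Lemma isom_inner x u v : U x ->
  inner (G x) u v = inner (H (phi x)) (mderiv phi x u) (mderiv phi x v).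
Proof.
move=> Ux; rewrite -!mderiv_jacobian// inner_mulmx -isom//.
Qed.

Lemma isom_jacobian_unit x : U x -> 'J phi x \in unitmx.
Proof.
move=> Ux; have := mo_unit HG Ux; rewrite isom// !unitmx_mul => /andP[/andP[]].
by [].
Qed.

(** Koszul's formula on both sides, with the derivative of the isometry relation inserted: the
    second derivatives of [phi] are symmetric and cancel except for twice <h(u, v), J w>. *)
Lemma gamma_map x u v : U x ->
  mderiv phi x (gamma G x u v) =
  mderiv (fun y => mderiv phi y v) x u
  + gamma H (phi x) (mderiv phi x u) (mderiv phi x v).
Proof.
move=> Ux; have Vx := phiUV Ux.
pose h a b := mderiv (fun y => mderiv phi y b) x a.
have hC a b : h a b = h b a by exact: mderiv_sym oU sphi Ux.
pose J a := mderiv phi x a.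
have D a b c : inner (mderiv G x a) b c =
   inner (mderiv H (phi x) (J a)) (J b) (J c) + inner (H (phi x)) (h a b) (J c)
   + inner (H (phi x)) (J b) (h a c).
  have L := is_derive_inner (mderiv_is_derive a oU (mo_smooth HG) Ux)
    (is_derive_const b x a) (is_derive_const c x a).
  rewrite inner0l inner0r !addr0 in L.
  have dH : is_derive x a (fun y => H (phi y)) (mderiv H (phi x) (J a)).
    have dHx := smooth_mx_diff (mo_open HH) (mo_smooth HH) Vx.
    have := is_derive_comp_diff (mderiv_is_derive a oU sphi Ux) dHx.
    by rewrite mderiv_diff.
  have M := is_derive_inner dH (mderiv_is_derive a oU (smooth_mderiv b oU sphi) Ux)
    (mderiv_is_derive a oU (smooth_mderiv c oU sphi) Ux).
  have EQ : \forall y \near x, inner (H (phi y)) (mderiv phi y b) (mderiv phi y c)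
      = inner (G y) b c.
    have : \forall y \near x, U y by exact: open_near.
    by apply: filterS => y Uy; rewrite isom_inner.
  exact: is_derive_unique L (near_eq_is_derive EQ M).
apply: (inner_inj (mo_unit HH Vx)) => w'.
have [w ->] : exists w, w' = J w.
  exists (w' *m invmx ('J phi x)); rewrite /J -mderiv_jacobian//.
  by rewrite mulmxKV// isom_jacobian_unit.
rewrite -[LHS]isom_inner// (koszul HG)// innerDl (koszul HH)// !D -/(h u v) -!/(J _).
rewrite (hC w u) (hC w v) (hC v u).
rewrite (mo_innerC HH (J w) (h u v) Vx) (mo_innerC HH (J u) (h v w) Vx).
rewrite (mo_innerC HH (h u w) (J v) Vx).
set r1 := inner (H (phi x)) _ _; set r2 := inner (mderiv _ _ _) _ _.
set r3 := inner (mderiv _ _ _) _ _; set r4 := inner (mderiv _ _ _) _ _.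
set r5 := inner (H (phi x)) _ _; set r6 := inner (H (phi x)) _ _.
lra.
Qed.

End Covariance.

Lemma near_eq_differentiable {R : realType} (V W : normedModType R) (f g : V -> W) x :
  (\forall y \near x, f y = g y) -> differentiable f x -> differentiable g x.
Proof.
move=> fg df; have E := nbhs_singleton fg.
suff : is_diff x g ('d f x) by move=> [].
apply: is_diff_of_estimate; first exact: diff_continuous.
move=> e e0; have fg' := near0_add fg.
by apply: filterS2 fg' (diff_estimate df e0) => h; rewrite (addrC x h) => <-; rewrite -E.
Qed.

(** * Obata's equation in a chart *)

Section Obata.
Context {R : realType} {n : nat}.
Implicit Types (u v w : 'rV[R]_n) (f : 'rV[R]_n -> R).

Definition grad (G : 'rV[R]_n -> 'M[R]_n) f (x : 'rV[R]_n) : 'rV[R]_n :=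
  (\row_a partial a f x) *m invmx (G x).

(* Obata's equation [Hess f = - kappa f G], at one point. *)
Definition obata (kappa : R) G f x :=
  [/\ differentiable f x, differentiable (grad G f) x &
    forall v, 'd (grad G f) x v = - gamma G x v (grad G f x) - (kappa * f x) *: v].

Variables (kappa : R) (U : set 'rV[R]_n) (G : 'rV[R]_n -> 'M[R]_n).
Hypothesis HG : metric_on U G.
Let oU : open U := mo_open HG.

Lemma inner_grad f x v : U x -> differentiable f x ->
  inner (G x) (grad G f x) v = 'd f x v.
Proof.
move=> Ux df; rewrite /inner /grad mulmxKV ?(mo_unit HG)// diff_row_form//.
by rewrite /row_form mxE; apply: eq_bigr => a _; rewrite !mxE mulrC.
Qed.

Local Opaque christoffel inner partial mderiv gamma curvature derive.

Lemma grad_unique f x X : U x -> differentiable f x ->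
  (forall v, 'd f x v = inner (G x) X v) -> grad G f x = X.
Proof.
move=> Ux df H; apply: (inner_inj (mo_unit HG Ux)) => v.
by rewrite inner_grad// H.
Qed.

Lemma near_eq_grad f f' (x : 'rV[R]_n) : (\forall y \near x, f y = f' y) ->
  \forall y \near x, grad G f y = grad G f' y.
Proof.
move=> /near_join; apply: filterS => y Hy; rewrite /grad; congr (_ *m _).
by apply/rowP => a; rewrite !mxE; exact: near_eq_derive.
Qed.

Lemma near_eq_obata f f' (x : 'rV[R]_n) : (\forall y \near x, f y = f' y) ->
  obata kappa G f x -> obata kappa G f' x.
Proof.
move=> ff' [d1 d2 d3]; have gg' := near_eq_grad ff'.
have Ef := nbhs_singleton ff'; have Eg := nbhs_singleton gg'.
have D1 v : is_derive x v f' ('d f x v) by apply: near_eq_is_derive ff' (is_derive_diff _ d1).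
split.
- exact: near_eq_differentiable ff' d1.
- exact: near_eq_differentiable gg' d2.
- move=> v; rewrite -Ef -Eg -d3; apply: is_derive_unique (is_derive_diff v _) _.
    exact: near_eq_differentiable gg' d2.
  exact: near_eq_is_derive gg' (is_derive_diff _ d2).
Qed.

(** The value component of the equation, df = <X, .>, forces the vector part to be the gradient; the
    vector component is then Obata's equation. *)
Lemma parallel_obata W (u : 'rV[R]_n -> 'rV[R]_(1 + n)) x : open W -> W `<=` U ->
  parallel_on (lconn (tractor G kappa)) W u -> W x ->
  obata kappa G (fun y => lsubmx (u y) 0 0) x /\
  u x = jet (lsubmx (u x) 0 0) (grad G (fun y => lsubmx (u y) 0 0) x).
Proof.
move=> oW WU Pu; set f := fun y => lsubmx (u y) 0 0.
have D y v : W y -> is_derive y v f (inner (G y) (rsubmx (u y)) v) /\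
    is_derive y v (fun y => rsubmx (u y)) (- gamma G y v (rsubmx (u y)) - (kappa * f y) *: v).
  move=> Wy; have [du Hu] := Pu y Wy; apply: is_derive_jetP.
  by rewrite -mul_jet_lconn -jet_submx -Hu; exact: is_derive_diff.
have df y : W y -> differentiable f y.
  by move=> Wy; have [/(@differentiable_mxE _ _ _ _ u y 0 (lshift n 0)) + _] := Pu y Wy;
    rewrite /f; under [X in _ -> differentiable X _]eq_fun do rewrite mxE.
have gE y : W y -> grad G f y = rsubmx (u y).
  move=> Wy; apply: grad_unique => //; [exact: WU|exact: df|move=> v].
  exact: is_derive_unique (is_derive_diff _ (df _ Wy)) (D y v Wy).1.
move=> Wx; split; last by rewrite gE// -jet_submx.
have nW : \forall y \near x, rsubmx (u y) = grad G f y.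
  by apply: filterS (open_near oW Wx) => y Wy; rewrite gE.
have dg : differentiable (grad G f) x.
  apply: near_eq_differentiable nW _; apply: differentiable_mx => i j.
  have [/(@differentiable_mxE _ _ _ _ u x 0 (rshift 1 j)) + _] := Pu x Wx.
  by rewrite ord1; under [X in _ -> differentiable X _]eq_fun do rewrite mxE.
split=> //; first exact: df.
move=> v; rewrite gE//; apply: is_derive_unique (is_derive_diff _ dg) _.
exact: near_eq_is_derive nW (D x v Wx).2.
Qed.

Lemma obata_parallel W f : W `<=` U -> (forall x, W x -> obata kappa G f x) ->
  parallel_on (lconn (tractor G kappa)) W (fun x => jet (f x) (grad G f x)).
Proof.
move=> WU H x Wx; have [d1 d2 d3] := H x Wx.
have dj : differentiable (fun x => jet (f x) (grad G f x)) x.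
  apply: differentiable_mx => i j; rewrite ord1; case: (split_ordP j) => k ->.
    by rewrite (ord1 k); under eq_fun do rewrite jet0E.
  by under eq_fun do rewrite jetSE; exact: differentiable_mxE.
split=> // v; rewrite mul_jet_lconn inner_grad//; last exact: WU.
apply: is_derive_unique (is_derive_diff _ dj) _; apply: is_derive_jet.
  exact: is_derive_diff.
by rewrite -d3; exact: is_derive_diff.
Qed.

(** Bootstrap: the partial derivatives of u are u times the smooth coefficients, so each class of
    differentiability gives the next. For this reason [obata] may ask for first derivatives only. *)
Lemma parallel_smooth N (B : 'I_n -> 'rV[R]_n -> 'M[R]_N) W
    (u : 'rV[R]_n -> 'rV[R]_N) : open W ->
  (forall a, smooth_mx W (B a)) -> parallel_on (lconn B) W u -> smooth_mx W u.
Proof.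
move=> oW sB Pu i j k; rewrite ord1 {i}; elim: k j => [|k IH] j.
  move=> x Wx; apply: continuous_mxE; apply: differentiable_continuous.
  exact: (Pu x Wx).1.
move=> a; have E x : W x -> is_derive x (basis_vec a) (fun y => u y 0 j) ((u x *m B a x) 0 j).
  move=> Wx; have [du Hu] := Pu x Wx.
  have /is_derive_mxP/(_ 0 j) := is_derive_diff (basis_vec a) du.
  rewrite Hu /lconn (bigD1 a)//= big1 ?addr0 => [|b ba]; last first.
    by rewrite mxE (negbTE ba) andbF scale0r.
  by have -> : basis_vec a 0 a = 1 :> R by [rewrite mxE !eqxx]; rewrite scale1r.
split; first by move=> x Wx; have [] := E x Wx.
apply: (@Ck_eq _ _ k W (fun x => (u x *m B a x) 0 j)) => //.
  by move=> x Wx; have [_ <-] := E x Wx.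
by apply: Ck_mulmx => // [p q|p q]; [rewrite ord1; exact: IH|exact: sB].
Qed.

Lemma obata_smooth W f : open W -> W `<=` U -> (forall x, W x -> obata kappa G f x) ->
  smooth_on W f /\ smooth_mx W (grad G f).
Proof.
move=> oW WU H.
have S := parallel_smooth oW (fun a i j k => Ck_sub WU (tractor_smooth kappa HG a i j k))
  (obata_parallel WU H).
split=> [k|i j k].
  by have := S 0 (lshift n 0) k; under [X in Ck _ _ X]eq_fun do rewrite jet0E.
by rewrite ord1; have := S 0 (rshift 1 j) k; under [X in Ck _ _ X]eq_fun do rewrite jetSE.
Qed.

Let invariant_rate (A : 'M[R]_n) (a b da db m : R) X Y dX dY gX gY v :
  inner A X v = da -> inner A Y v = db -> dX = - gX - (kappa * a) *: v ->
  dY = - gY - (kappa * b) *: v -> m = inner A gX Y + inner A X gY ->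
  inner A v Y = inner A Y v ->
  0 * (a * b) + kappa * (da * b + a * db) + (m + inner A dX Y + inner A X dY) = 0.
Proof.
move=> <- <- -> -> -> C; rewrite innerBl innerNl innerZl innerBr innerNr innerZr C.
move: (inner _ _ _) (inner _ _ _) (inner _ _ _) (inner _ _ _) => r1 r2 r3 r4; ring.
Qed.

(** The two Hessian terms cancel the derivative of kappa f f', and metric compatibility absorbs the
    Christoffel terms. *)
Lemma obata_invariant f f' x v : U x -> obata kappa G f x -> obata kappa G f' x ->
  is_derive x v (fun y => kappa * (f y * f' y) + inner (G y) (grad G f y) (grad G f' y)) 0.
Proof.
move=> Ux [d1 d2 d3] [d1' d2' d3'].
have D := is_derive_add (is_derive_mulr (is_derive_const kappa x v)
    (is_derive_mulr (is_derive_diff v d1) (is_derive_diff v d1')))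
  (is_derive_inner (mderiv_is_derive v oU (mo_smooth HG) Ux)
    (is_derive_diff v d2) (is_derive_diff v d2')).
apply: (@eq_ind _ _ (fun d => is_derive x v _ d) D); apply: invariant_rate.
- exact: inner_grad.
- exact: inner_grad.
- exact: d3.
- exact: d3'.
- exact: (metric_compatible HG).
- exact: (mo_innerC HG).
Qed.

End Obata.

Section Pullback.
Context {R : realType} {n : nat}.
Implicit Types (u v w : 'rV[R]_n).
Variables (U V : set 'rV[R]_n) (G H : 'rV[R]_n -> 'M[R]_n) (phi : 'rV[R]_n -> 'rV[R]_n).
Hypotheses (HG : metric_on U G) (HH : metric_on V H).
Hypotheses (sphi : smooth_mx U phi) (phiUV : forall x, U x -> V (phi x)).
Hypothesis isom : forall x, U x -> G x = 'J phi x *m H (phi x) *m ('J phi x)^T.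
Variables (kappa : R) (h : 'rV[R]_n -> R).
Hypothesis Hh : forall x, U x -> obata kappa H h (phi x).
Let oU : open U := mo_open HG.

Local Opaque christoffel inner partial mderiv gamma curvature derive.

Lemma grad_map x : U x -> grad G (h \o phi) x *m 'J phi x = grad H h (phi x).
Proof.
move=> Ux; have Vx := phiUV Ux; have [dh _ _] := Hh Ux.
have dphi := smooth_mx_diff oU sphi Ux.
have dc : differentiable (h \o phi) x by exact: differentiable_comp.
have uJ := isom_jacobian_unit HG isom Ux.
apply: (inner_inj (mo_unit HH Vx)) => w.
rewrite -[w](mulmxKV uJ); move: (w *m invmx _) => {}w.
rewrite !(mderiv_jacobian HG sphi _ Ux).
apply: etrans (esym (isom_inner HG sphi isom _ _ Ux)) _.
apply: etrans (inner_grad HG _ Ux dc) _; apply: etrans _ (esym (inner_grad HH _ Vx dh)).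
apply: is_derive_unique (is_derive_diff w dc) _.
have := is_derive_comp_diff (is_derive_diff w dphi) dh.
by have -> := mderiv_diff w dphi.
Qed.

(** Obtained by differentiating the relation between the gradients of h and of its pullback and
    inserting the transformation law of [gamma]. It is applied to transition maps, to make the
    equation independent of the chart. *)
Lemma obata_map x : U x -> obata kappa G (h \o phi) x.
Proof.
move=> Ux; have Vx := phiUV Ux; have [dh dgh Eh] := Hh Ux.
have dphi := smooth_mx_diff oU sphi Ux.
have uJ y (Uy : U y) := isom_jacobian_unit HG isom Uy.
have sJ : smooth_mx U (fun y => 'J phi y).
  move=> i j k; apply: (@Ck_eq _ _ k U (partial i (fun y => phi y 0 j))) => //.
    move=> y Uy; rewrite partialE_jacobian//; exact: smooth_mx_diff oU sphi Uy.
  exact: (sphi 0 j k.+1 i).2.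
have sJV : smooth_mx U (fun y => invmx ('J phi y)).
  by move=> i j k; apply: Ck_invmx => // p q; exact: sJ.
have gE : \forall y \near x, grad H h (phi y) *m invmx ('J phi y) = grad G (h \o phi) y.
  apply: filterS (open_near oU Ux) => y Uy; rewrite -grad_map// mulmxK//; exact: uJ.
have dX : differentiable (grad G (h \o phi)) x.
  apply: near_eq_differentiable gE _; apply: differentiable_mx => i j.
  under eq_fun do rewrite mxE.
  have -> : (fun y => \sum_a grad H h (phi y) i a * invmx ('J phi y) a j) =
      \sum_a (fun y => grad H h (phi y) i a * invmx ('J phi y) a j).
    by apply/funext => y; rewrite fct_sumE.
  apply: differentiable_sum => a.
  apply: differentiableM.
    by apply: (@differentiable_comp _ _ _ _ phi (fun z => grad H h z i a)) => //;
      exact: differentiable_mxE.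
  by apply: (differentiable_mxE a j); exact: smooth_mx_diff oU sJV Ux.
split; [exact: differentiable_comp|exact: dX|].
move=> v; set X := grad G (h \o phi); set w := 'd X x v.
rewrite -[LHS](mulmxK (uJ _ Ux)) -[RHS](mulmxK (uJ _ Ux)); congr (_ *m _).
have dJ := mderiv_is_derive v oU sJ Ux.
have E1 := is_derive_mulmx (is_derive_diff v dX) dJ.
have E2 := is_derive_comp_diff (is_derive_diff v dphi) dgh.
have E3 : \forall y \near x, grad H h (phi y) = X y *m 'J phi y.
  by apply: filterS (open_near oU Ux) => y Uy; rewrite grad_map.
have := is_derive_unique E1 (near_eq_is_derive E3 E2).
have -> : X x *m mderiv (fun y => 'J phi y) x v = mderiv (fun y => mderiv phi y (X x)) x v.
  have E4 := is_derive_mulmx (is_derive_const (X x) x v) dJ.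
  rewrite mul0mx add0r in E4; apply: is_derive_unique E4 _.
  apply: near_eq_is_derive (mderiv_is_derive v oU (smooth_mderiv (X x) oU sphi) Ux).
  by apply: filterS (open_near oU Ux) => y Uy; rewrite (mderiv_jacobian HG sphi).
have e1 : 'd phi x v = mderiv phi x v := mderiv_diff v dphi.
have e2 : grad H h (phi x) = mderiv phi x (X x).
  by rewrite -(mderiv_jacobian HG sphi _ Ux) grad_map.
have Eh' := etrans (Eh ('d phi x v)) (congr2
  (fun p q => - gamma H (phi x) p q - (kappa * h (phi x)) *: p) e1 e2).
move=> E0; have {}E0 := etrans E0 Eh'.
have alg (p a g t q : 'rV[R]_n) : p + a = - g - t -> q = a + g -> p = - q - t.
  move=> E5 ->; rewrite -[LHS](addrK a) E5.
  by apply/rowP => j; rewrite !mxE; ring.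
have := alg _ _ _ _ _ E0 (gamma_map HG HH sphi phiUV isom v (X x) Ux).
by rewrite -!(mderiv_jacobian HG sphi _ Ux) mulmxBl mulNmx -scalemxAl.
Qed.

End Pullback.

(** * Monodromy *)

Section Topology.

(** Induction along a connected set: a property that is locally constant on K cuts out a subset that
    is both open and closed in K. Most passages from local to global below have this form. *)
Lemma connected_ind (X : topologicalType) (K : set X) (P : X -> Prop) a b :
  connected K ->
  (forall z, K z -> \forall y \near z, K y -> (P y <-> P z)) ->
  K a -> K b -> P a -> P b.
Proof.
move=> cK H Ka Kb Pa.
suff E : K `&` P = K by move: Kb; rewrite -E => -[].
  apply: cK.
  - by exists a.
  - exists (interior [set z | K z -> P z]); first exact: open_interior.
    apply/seteqP; split=> z [Kz].
      move=> Pz; split=> //; rewrite /interior/=.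
      have := H z Kz; apply: filterS => y Hy Ky.
      exact: (Hy Ky).2.
    by move=> /interior_subset/= /(_ Kz).
  - exists (~` (interior [set z | K z -> ~ P z])).
      by apply: open_closedC; exact: open_interior.
    apply/seteqP; split=> z [Kz].
      by move=> Pz; split=> // /interior_subset/= /(_ Kz).
    move=> nI; split=> //; apply: contrapT => nPz; apply: nI.
    have := H z Kz; apply: filterS => y Hy Ky Py.
    exact/nPz/(Hy Ky).1.
Qed.

Lemma within_continuous_near (X Y : topologicalType) (K : set X) (H : X -> Y) :
  {within K, continuous H} <->
  forall z, K z -> forall Q, nbhs (H z) Q -> \forall y \near z, K y -> Q (H y).
Proof.
split=> [/subspace_continuousP cH z Kz Q HQ|cH]; first exact: cH Kz Q HQ.
by apply/subspace_continuousP => z Kz Q HQ; exact: cH.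
Qed.

Lemma within_continuous_comp (X Y Z : topologicalType) (K : set X) (K' : set Y)
    (H : Y -> Z) (g : X -> Y) : continuous g -> (forall z, K z -> K' (g z)) ->
  {within K', continuous H} -> {within K, continuous (H \o g)}.
Proof.
move=> cg KK' /within_continuous_near cH; apply/within_continuous_near => z Kz Q HQ.
have := cg z _ (cH _ (KK' _ Kz) Q HQ); rewrite nbhs_filterE/=.
by apply: filterS => y Hy Ky; exact/Hy/KK'.
Qed.

Lemma within_continuous_eq (X Y : topologicalType) (K : set X) (f g : X -> Y) :
  (forall z, K z -> f z = g z) -> {within K, continuous f} -> {within K, continuous g}.
Proof.
move=> fg /within_continuous_near cf; apply/within_continuous_near => z Kz Q.
rewrite -fg// => /(cf z Kz); apply: filterS => y Hy Ky; rewrite -fg//; exact: Hy.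
Qed.

Context {R : realType}.

Lemma connected_itv01 : connected (`[0, 1]%classic : set R).
Proof. by apply/connected_intervalP; exact: interval_is_interval. Qed.

Definition paste (T : Type) (g1 g2 : R -> T) (t : R) : T :=
  if t <= 2^-1 then g1 (2 * t) else g2 (2 * t - 1).

Lemma paste_l (T : Type) (g1 g2 : R -> T) t : t <= 1 -> paste g1 g2 (t / 2) = g1 t.
Proof.
by move=> t1; rewrite /paste ler_piMl ?invr_ge0// mulrCA divff ?mulr1// pnatr_eq0.
Qed.

Lemma paste_r (T : Type) (g1 g2 : R -> T) t : g1 1 = g2 0 -> 0 <= t ->
  paste g1 g2 ((1 + t) / 2) = g2 t.
Proof.
move=> g12 t0; have E : 2 * ((1 + t) / 2) = 1 + t by rewrite mulrCA divff ?mulr1// pnatr_eq0.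
rewrite /paste E.
case: ifPn => [h|_]; last by congr g2; lra.
have -> : t = 0 by lra.
by rewrite -g12; congr g1; lra.
Qed.

Lemma paste_continuous (T : topologicalType) (g1 g2 : R -> T) : g1 1 = g2 0 ->
  {within `[0, 1], continuous g1} -> {within `[0, 1], continuous g2} ->
  {within `[0, 1], continuous (paste g1 g2)}.
Proof.
move=> g12 c1 c2.
have -> : `[0, 1]%classic = (`[0, 2^-1] `|` `[2^-1, 1])%classic :> set R.
  apply/seteqP; split=> t /=; rewrite !in_itv/=.
    by move=> /andP[-> ->]; rewrite andbT/=; case: (leP t 2^-1) => h; [left|right; exact: ltW].
  have h : 2^-1 <= 1 :> R by rewrite invf_le1// ler1n.
  have h' : 0 <= 2^-1 :> R by rewrite invr_ge0.
  by case=> /andP[h1 h2]; rewrite ?h1 ?h2 ?(le_trans h2 h) ?(le_trans h' h1).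
have m2 (c : R) : continuous (fun t : R => 2 * t + c).
  move=> t; apply: continuousD; last exact: cst_continuous.
  by apply: continuousM; [exact: cst_continuous|exact: cvg_id].
apply: withinU_continuous; [exact: itv_closed|exact: itv_closed| |].
  apply: (@within_continuous_eq _ _ _ (g1 \o (fun t : R => 2 * t + 0))).
    by move=> t /=; rewrite in_itv/= addr0 /paste => /andP[_ ->].
  apply: within_continuous_comp (m2 0) _ c1 => t /=; rewrite !in_itv/= addr0.
  by move=> /andP[t0 t1]; rewrite mulr_ge0//= mulrC -ler_pdivlMr// mul1r.
apply: (@within_continuous_eq _ _ _ (g2 \o (fun t : R => 2 * t - 1))).
  move=> t /=; rewrite in_itv/= /paste => /andP[t0 _]; case: ifPn => // t1.
  have -> : t = 2^-1 by apply/eqP; rewrite eq_le t0 t1.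
  by rewrite divff ?pnatr_eq0// subrr.
apply: within_continuous_comp (m2 (- 1)) _ c2 => t /=; rewrite !in_itv/=.
move=> /andP[t0 t1]; rewrite subr_ge0 lerBlDr mulrC -ler_pdivrMr// mul1r t0/=.
by rewrite -[leRHS]/(2%:R) -[leRHS]mul1r ler_pM2r.
Qed.

End Topology.

Section Monodromy.
Context {R : realType} {M : topologicalType} {T : Type}.
(* [F p] is the fibre over p, and [Sec U s] says that s is a local section over U; two
   local sections through the same point agree near it, as for a covering. *)
Variables (F : M -> T -> Prop) (Sec : set M -> (M -> T) -> Prop).
Hypothesis Sec_open : forall U s, Sec U s -> open U.
Hypothesis Sec_fib : forall U s p, Sec U s -> U p -> F p (s p).
Hypothesis Sec_agree : forall U V s s' p, Sec U s -> Sec V s' -> U p -> V p ->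
  \forall q \near p, s q = s' q <-> s p = s' p.

Definition itv01 : set R := `[0, 1]%classic.

(** A lift is required to follow local sections rather than to be continuous, so the fibre type
    carries no topology. *)
Definition lift_on (X : topologicalType) (K : set X) (H : X -> M) (e : X -> T) :=
  forall z, K z -> exists U s, [/\ Sec U s, U (H z) &
    \forall y \near z, K y -> e y = s (H y)].

Lemma lift_fib (X : topologicalType) (K : set X) H e z : lift_on K H e -> K z -> F (H z) (e z).
Proof.
move=> le Kz; have [U [s [Us UHz /nbhs_singleton/(_ Kz) ->]]] := le z Kz.
exact: Sec_fib Us UHz.
Qed.

Lemma lift_comp (X Y : topologicalType) (K : set X) (K' : set Y) H e (g : Y -> X) :
  continuous g -> (forall z, K' z -> K (g z)) ->
  lift_on K H e -> lift_on K' (H \o g) (e \o g).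
Proof.
move=> cg KK' le z K'z; have [U [s [Us UHz He]]] := le _ (KK' _ K'z).
exists U, s; split=> //; have := cg z _ He; rewrite nbhs_filterE/=.
by apply: filterS => y Hy K'y; exact/Hy/KK'.
Qed.

Lemma lift_eq (X : topologicalType) (K : set X) H H' e e' :
  (forall z, K z -> H z = H' z) -> (forall z, K z -> e z = e' z) ->
  lift_on K H e -> lift_on K H' e'.
Proof.
move=> HH' ee' le z Kz; have [U [s [Us UHz He]]] := le z Kz.
exists U, s; split=> //; first by rewrite -HH'.
by apply: filterS He => y Hy Ky; rewrite -HH'// -ee'//; exact: Hy.
Qed.

Lemma lift_section (X : topologicalType) (K : set X) H U s :
  Sec U s -> (forall z, K z -> U (H z)) -> lift_on K H (s \o H).
Proof.
move=> Us KU z Kz; exists U, s; split=> //; first exact: KU.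
by apply: nearW.
Qed.

(** By [Sec_agree] two lifts that agree at a point agree near it, and two that differ there differ
    near it. *)
Lemma lift_unique (X : topologicalType) (K : set X) (H : X -> M) e e' a b :
  connected K -> {within K, continuous H} -> lift_on K H e -> lift_on K H e' ->
  K a -> K b -> e a = e' a -> e b = e' b.
Proof.
move=> cK /within_continuous_near cH le le' Ka Kb E.
apply: (@connected_ind X K (fun z => e z = e' z) a b cK) => // z Kz.
have [U [s [Us UHz He]]] := le z Kz; have [V [s' [Vs' VHz He']]] := le' z Kz.
have Hn := cH z Kz _ (Sec_agree Us Vs' UHz VHz).
have E1 := nbhs_singleton He Kz; have E2 := nbhs_singleton He' Kz.
apply: filterS3 He He' Hn => y h1 h2 h3 Ky.
by rewrite (h1 Ky) (h2 Ky) E1 E2; exact: h3.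
Qed.

Hypothesis Sec_cover : forall p, exists U, [/\ open U, U p,
  forall q e, U q -> F q e -> exists2 s, Sec U s & s q = e &
  forall q r, U q -> U r -> exists g : R -> M,
    [/\ {within itv01, continuous g}, g 0 = q, g 1 = r &
        forall t, itv01 t -> U (g t)]].

(** The set of t for which a lift exists on [0, t] is open and closed: while g stays in one
    neighbourhood from [Sec_cover], a lift continues by the section through its last value. *)
Lemma path_lift (g : R -> M) (e0 : T) : {within `[0, 1], continuous g} -> F (g 0) e0 ->
  exists2 e, lift_on itv01 g e & e 0 = e0.
Proof.
move=> cg F0; have /within_continuous_near cg' := cg.
pose P t := exists2 e, lift_on (`[0, t]%classic : set R) g e & e 0 = e0.
suff : P 1 by [].
apply: (@connected_ind R `[0, 1]%classic P 0 1) => //=; last 3 first.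
- by rewrite in_itv/= lexx ler01.
- by rewrite in_itv/= lexx ler01.
- have [U [oU Ug0 HU _]] := Sec_cover (g 0); have [s Us s0] := HU _ _ Ug0 F0.
  exists (s \o g) => //; apply: (lift_section Us) => z /=.
  by rewrite in_itv/= => /le_anti <-.
- exact: connected_itv01.
move=> t t01.
have [U [oU Ugt HU _]] := Sec_cover (g t).
have /nbhs_ballP[d /= d0 Hd] := cg' t t01 U (open_nbhs_nbhs (conj oU Ugt)).
have key t1 t2 : ball t d t1 -> ball t d t2 -> t1 \in `[0, 1] -> t2 \in `[0, 1] ->
    P t1 -> P t2.
  move=> b1 b2 t101 t201 [e le e00]; move: (t101) (t201); rewrite !in_itv/=.
  move=> /andP[t10 t11] /andP[t20 t21].
  have [t21'|t12] := leP t2 t1.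
    exists e => //; apply: (lift_comp (g := id) _ _ le) => [?|z /=]; first exact: cvg_id.
    by rewrite !in_itv/= => /andP[-> /le_trans]; exact.
  have Ugt1 : U (g t1) by exact: Hd.
  have t1t1 : `[0, t1]%classic t1 by rewrite /= in_itv/= t10 lexx.
  have [s Us st1] := HU _ _ Ugt1 (lift_fib le t1t1).
  exists (fun z => if z <= t1 then e z else s (g z)); last by rewrite t10.
  move=> z /=; rewrite in_itv/= => /andP[z0 zt2].
  have z01 : `[0, 1]%classic z by rewrite /= in_itv/= z0 (le_trans zt2).
  case: (ltgtP z t1) => [zt1|t1z|->].
  - have zK : `[0, t1]%classic z by rewrite /= in_itv/= z0 ltW.
    have [V [s' [Vs' Vgz He]]] := le z zK; exists V, s'; split=> //.
    have zlt : \forall y \near z, y < t1 by exact: lt_nbhsl.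
    apply: filterS2 He zlt => y Hy yt1; rewrite in_itv/= => /andP[y0 _].
    by rewrite ltW//; apply: Hy; rewrite /= in_itv/= y0 ltW.
  - exists U, s; split=> //.
      apply: Hd => //; move: b1 b2; rewrite -ball_normE/= !ltr_distlC => /andP[h1 h2] /andP[h3 h4].
      by rewrite (lt_le_trans h1 (ltW t1z))/= (le_lt_trans zt2).
    have zgt : \forall y \near z, t1 < y by exact: lt_nbhsr.
    by apply: filterS zgt => y t1y _; rewrite leNgt t1y.
  (* At the junction t1 the old lift follows s' and the new one follows s; both have the value e t1
     there, hence agree nearby. *)
  - have [V [s' [Vs' Vgz He]]] := le t1 t1t1; exists U, s; split=> //.
    have E1 := nbhs_singleton He t1t1.
    have Hag := cg' t1 t101 _ (Sec_agree Us Vs' Ugt1 Vgz).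
    apply: filterS2 He Hag => y Hy Hag; rewrite in_itv/= => /andP[y0 yt2].
    case: ifPn => // yt1.
    have y01 : `[0, 1]%classic y by rewrite /= in_itv/= y0 (le_trans yt2).
    rewrite Hy; last by rewrite /= in_itv/= y0.
    by apply/esym/(Hag y01); rewrite st1 E1.
have td : ball t d t by exact: ballxx.
apply/nbhs_ballP; exists d => //= y yd y01.
by split; apply: key.
Qed.

(** The lift at z is the end value of the lift along the ray from 0 to z. Lifts along neighbouring
    rays must be shown to follow a common section at the end. *)
Lemma star_lift (W : normedModType R) (K : set W) (H : W -> M) (e0 : T) :
  (forall z t, K z -> 0 <= t <= 1 -> K (t *: z)) -> {within K, continuous H} ->
  (forall z, K z -> exists2 e, lift_on itv01 (fun t : R => H (t *: z)) e & e 0 = e0) ->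
  exists2 E, lift_on K H E & K 0 -> E 0 = e0.
Proof.
move=> starK cH rays; have /within_continuous_near cH' := cH.
have rays' z : exists e, K z ->
    lift_on itv01 (fun t : R => H (t *: z)) e /\ e 0 = e0.
  have [Kz|nKz] := pselect (K z); last by exists (fun=> e0).
  by have [e le e00] := rays z Kz; exists e.
have {rays rays'}[e He] := choice rays'.
have cray z : K z -> {within `[0, 1], continuous (fun t : R => H (t *: z))}.
  move=> Kz; apply: within_continuous_comp cH => //.
    by move=> t; apply: scalel_continuous.
  by move=> t /=; rewrite in_itv/= => t01; exact: starK.
have i0 : `[0, 1]%classic (0 : R) by rewrite /= in_itv/= lexx ler01.
have i1 : `[0, 1]%classic (1 : R) by rewrite /= in_itv/= lexx ler01.
exists (e^~ 1); last first.
  move=> K0; have [le <-] := He 0 K0; apply/esym.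
  have cst z : lift_on itv01 (fun t : R => H (t *: 0)) (e 0).
    exact: le.
  apply: (@connected_ind R `[0, 1]%classic (fun t => e 0 0 = e 0 t) 0 1) => //.
    exact: connected_itv01.
  move=> t t01; have [U [s [Us UH He']]] := le t t01.
  have Et := nbhs_singleton He' t01; apply: filterS He' => y Hy y01.
  by rewrite (Hy y01) Et !scaler0.
move=> z0 Kz0.
have [le0 e00] := He z0 Kz0.
(* At time t the lifts along all rays near z0 are values of one section. This holds at 0, where all
   rays start at the same point, and propagates in t; [P 1] is the claim. *)
pose P t := exists U s, [/\ Sec U s, U (H (t *: z0)), s (H (t *: z0)) = e z0 t &
  \forall z \near z0, K z -> e z t = s (H (t *: z))].
have : P 1; last first.
  move=> [U [s [Us UH _ Hn]]]; exists U, s; split => //; first by rewrite -[z0]scale1r.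
  by apply: filterS Hn => z Hz Kz; rewrite Hz// scale1r.
apply: (@connected_ind R `[0, 1]%classic P 0 1) => //; first exact: connected_itv01.
  move=> t t01.
  have [U [s [Us UH Hes]]] := le0 t t01.
  have t01' : 0 <= t <= 1 by move: t01; rewrite /= in_itv.
  have HU := cH' (t *: z0) (starK _ _ Kz0 t01') U (open_nbhs_nbhs (conj (Sec_open Us) UH)).
  have /= := @scale_continuous _ _ (t, z0) _ HU.
  move=> [[A B] /= [/nbhs_ballP[d1 /= d10 Ad] Bn] AB].
  have /nbhs_ballP[d2 /= d20 Ad2] := Hes.
  pose d := Num.min d1 d2.
  have d0 : 0 < d by rewrite lt_min d10.
  (* An interval, hence connected: uniqueness of lifts on [J] carries agreement with s from one of
     its times to any other. *)
  pose J := (ball t d `&` `[0, 1])%classic.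
  have cJ : connected J.
    apply/connected_intervalP => a b [ad a01] [bd b01] c /andP[ac cb]; split.
      move: ad bd; rewrite -ball_normE/= !ltr_distlC => /andP[h1 h2] /andP[h3 h4].
      by rewrite (lt_le_trans h1 ac)/= (le_lt_trans cb).
    move: a01 b01; rewrite /= !in_itv/= => /andP[h1 h2] /andP[h3 h4].
    by rewrite (le_trans h1 ac)/= (le_trans cb).
  have JU z y : K z -> B z -> J y -> U (H (y *: z)).
    move=> Kz Bz [yd y01].
    have := AB (y, z); apply => /=.
      by split=> //; apply: Ad; apply: le_ball yd; rewrite ge_min lexx.
    by apply: starK => //; move: y01; rewrite /= in_itv.
  have Js y : J y -> e z0 y = s (H (y *: z0)).
    by move=> [yd y01]; apply: Ad2 => //; apply: le_ball yd; rewrite ge_min lexx orbT.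
  have key t1 t2 : J t1 -> J t2 -> P t1 -> P t2.
    move=> J1 J2 [U1 [s1 [Us1 UH1 E1 N1]]].
    have B0 : B z0 by exact: nbhs_singleton Bn.
    exists U, s; split => //; [exact: JU|by rewrite -Js|].
    have t101 : 0 <= t1 <= 1 by case: J1 => _; rewrite /= in_itv.
    have Hag := Sec_agree Us1 Us UH1 (JU _ _ Kz0 B0 J1).
    have Hag' := cH' (t1 *: z0) (starK _ _ Kz0 t101) _ Hag.
    have c1 : continuous (fun z : W => t1 *: z) by move=> z; exact: scaler_continuous.
    have Hag2 := c1 z0 _ Hag'; rewrite nbhs_filterE/= in Hag2.
    apply: filterS3 N1 Bn Hag2 => z h1 Bz h2 Kz.
    have := h2 (starK _ _ Kz t101); rewrite E1 Js// => -[_ /(_ erefl) h3].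
    have [lez ez0] := He z Kz.
    apply: (@lift_unique R J (fun t => H (t *: z)) (e z) (s \o (fun t => H (t *: z))) t1 t2) => //.
    - apply: (@within_continuous_comp R R M J itv01 (fun t => H (t *: z)) id _ _ (cray z Kz)).
        by move=> ?; exact: cvg_id.
      by move=> y [].
    - by apply: (lift_comp (g := id) _ _ lez) => [?|y []//]; exact: cvg_id.
    - by apply: lift_section Us _ => y Jy; exact: JU.
    - by rewrite h1//= h3.
  have Jt : J t by split=> //; exact: ballxx.
  apply/nbhs_ballP; exists d => //= y yd y01.
  by split; apply: key.
have [U [s [Us UH Hes]]] := le0 0 i0; exists U, s; split=> //.
  by apply/esym/(nbhs_singleton Hes).
have E0 := nbhs_singleton Hes i0.
apply: nearW => z Kz; rewrite scale0r; have [_ ->] := He z Kz.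
by rewrite -e00 E0 scale0r.
Qed.

Lemma itv01_0 : itv01 0. Proof. by rewrite /itv01/= in_itv/= lexx ler01. Qed.
Lemma itv01_1 : itv01 1. Proof. by rewrite /itv01/= in_itv/= lexx ler01. Qed.

Lemma lift_const (X : topologicalType) (K : set X) (H : X -> M) (e : X -> T) a b :
  connected K -> lift_on K H e -> (forall z, K z -> H z = H a) -> K a -> K b ->
  e a = e b.
Proof.
move=> cK le Hc Ka Kb.
apply: (@connected_ind X K (fun t => e a = e t) a b) => // t Kt.
have [U [s [Us UH He]]] := le t Kt.
have Et := nbhs_singleton He Kt; apply: filterS He => y Hy Ky.
by rewrite (Hy Ky) Et !Hc.
Qed.

Let affine_continuous (a b : R) : continuous (fun t : R => a * t + b).
Proof.
move=> t; apply: continuousD; last exact: cst_continuous.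
by apply: continuousM; [exact: cst_continuous|exact: cvg_id].
Qed.

(** The square is star-shaped about its corner (0, 0), so the whole homotopy lifts. One side lifts
    g, and the homotopy is constant along the other three, so the lift of g has equal end values. *)
Lemma loop_monodromy (g : R -> M) (H : R * R -> M) (e : R -> T) :
  {within `[0, 1] `*` `[0, 1], continuous H} ->
  (forall t, t \in `[0, 1] -> H (0, t) = g t) ->
  (forall t, t \in `[0, 1] -> H (1, t) = g 0) ->
  (forall s, s \in `[0, 1] -> H (s, 0) = g 0 /\ H (s, 1) = g 0) ->
  {within itv01, continuous g} -> lift_on itv01 g e -> e 1 = e 0.
Proof.
move=> cH H0 H1 Hs cg le.
pose K : set (R^o * R^o) := (`[0, 1] `*` `[0, 1])%classic.
have starK z (t : R) : K z -> 0 <= t <= 1 -> K (t *: z).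
  case: z => z1 z2 [/=]; rewrite !in_itv/= => /andP[a1 b1] /andP[a2 b2] /andP[t0 t1].
  by split=> /=; rewrite in_itv/= mulr_ge0//= mulr_ile1.
have i0 : (0 : R) \in `[0, 1] by exact: itv01_0.
have i1 : (1 : R) \in `[0, 1] by exact: itv01_1.
have H00 : H (0 : R^o * R^o) = g 0 by exact: H0.
have [|E lE E0] := @star_lift (R^o * R^o)%type K H (e 0) starK cH.
  move=> z Kz; apply: path_lift.
    apply: (@within_continuous_comp R (R^o * R^o)%type M itv01 K H (fun t => t *: z)).
    - by move=> t; exact: scalel_continuous.
    - by move=> t /=; rewrite /itv01/= in_itv/= => t01; exact: starK.
    - exact: cH.
  by rewrite scale0r H00; apply: (lift_fib le); exact: itv01_0.
have {}E0 : E (0, 0) = e 0 by apply: E0; split; [exact: i0|exact: i0].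
have cpair1 (c : R) : continuous (fun t : R => (c, t) : R^o * R^o).
  by move=> t; exact: (cvg_pair (cvg_cst _ : (fun=> c) @ t --> c) cvg_id).
have cpair2 (c : R) : continuous (fun t : R => (t, c) : R^o * R^o).
  by move=> t; exact: (cvg_pair cvg_id (cvg_cst _ : (fun=> c) @ t --> c)).
have l1 c : c \in `[0, 1] -> lift_on itv01 (fun t => H (c, t)) (fun t => E (c, t)).
  by move=> c01; apply: (lift_comp (@cpair1 c) _ lE).
have l2 c : c \in `[0, 1] -> lift_on itv01 (fun t => H (t, c)) (fun t => E (t, c)).
  by move=> c01; apply: (lift_comp (@cpair2 c) _ lE).
have e1 : E (0, 1) = e 1.
  apply: (@lift_unique R itv01 g (fun t => E (0, t)) e 0 1 connected_itv01 cg _ le) => //.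
  exact: lift_eq H0 _ (l1 0 i0).
rewrite -e1 -E0.
transitivity (E (1, 1)).
  apply: (lift_const connected_itv01 (l2 1 i1)) => // z z01.
  by rewrite (Hs z z01).2 (Hs 0 i0).2.
transitivity (E (1, 0)); apply/esym.
  apply: (lift_const connected_itv01 (l1 1 i1)) => // z z01.
  by rewrite H1// H1.
apply: (lift_const connected_itv01 (l2 0 i0)) => // z z01.
by rewrite (Hs z z01).1 (Hs 0 i0).1.
Qed.

Lemma lift_paste_l (g1 g2 : R -> M) e : lift_on itv01 (paste g1 g2) e ->
  lift_on itv01 g1 (fun t => e (t / 2)).
Proof.
move=> le; apply: (@lift_eq R itv01 (paste g1 g2 \o (fun t : R => 2^-1 * t + 0)) g1
  (e \o (fun t : R => 2^-1 * t + 0))).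
- move=> t /=; rewrite /itv01/= in_itv/= addr0 mulrC => /andP[_ t1].
  exact: paste_l.
- by move=> t _ /=; rewrite addr0 mulrC.
- apply: lift_comp (@affine_continuous _ _) _ le => t.
  rewrite /itv01/= !in_itv/= => /andP[t0 t1]; apply/andP; split; lra.
Qed.

Lemma lift_paste_r (g1 g2 : R -> M) e : g1 1 = g2 0 ->
  lift_on itv01 (paste g1 g2) e -> lift_on itv01 g2 (fun t => e ((1 + t) / 2)).
Proof.
move=> g12 le; have E (t : R) : 2^-1 * t + 2^-1 = (1 + t) / 2 by lra.
apply: (@lift_eq R itv01 (paste g1 g2 \o (fun t : R => 2^-1 * t + 2^-1)) g2
  (e \o (fun t : R => 2^-1 * t + 2^-1))).
- by move=> t /=; rewrite /itv01/= in_itv/= E => /andP[t0 _]; exact: paste_r.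
- by move=> t _ /=; rewrite E.
- apply: lift_comp (@affine_continuous _ _) _ le => t.
  rewrite /itv01/= !in_itv/= => /andP[t0 t1]; apply/andP; split; lra.
Qed.

Variables (p0 : M) (e0 : T).
Hypothesis F0 : F p0 e0.
Hypothesis contractible_loops :
  forall g : R -> M, {within `[0, 1], continuous g} -> g 0 = g 1 ->
  exists H : R * R -> M,
    [/\ {within `[0, 1] `*` `[0, 1], continuous H},
        forall t, t \in `[0, 1] -> H (0, t) = g t,
        forall t, t \in `[0, 1] -> H (1, t) = g 0 &
        forall s, s \in `[0, 1] -> H (s, 0) = g 0 /\ H (s, 1) = g 0].
Hypothesis M_connected : connected [set: M].

(** Continuation of e0 along paths from p0, as a relation between end points and end values; simple
    connectedness makes it single-valued. *)
Let transport x v := exists g e, [/\ {within itv01, continuous g}, g 0 = p0, g 1 = x,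
  lift_on itv01 g e & e 0 = e0 /\ e 1 = v].

Let transport_fib x v : transport x v -> F x v.
Proof.
by move=> [g [e [_ _ <- le [_ <-]]]]; apply: (lift_fib le); exact: itv01_1.
Qed.

(** One path followed by the reverse of the other is a loop at p0, along which a lift returns to e0;
    by uniqueness its two halves are the given lifts. *)
Let transport_unique x v w : transport x v -> transport x w -> v = w.
Proof.
move=> [g1 [l1 [c1 g10 g11 L1 [l10 <-]]]] [g2 [l2 [c2 g20 g21 L2 [l20 <-]]]].
pose g2' (t : R) := g2 (- 1 * t + 1).
have r01 (t : R) : itv01 t -> itv01 (- 1 * t + 1).
  by rewrite /itv01/= !in_itv/= => /andP[t0 t1]; apply/andP; split; lra.
have c2' : {within itv01, continuous g2'}.
  exact: within_continuous_comp (@affine_continuous _ _) r01 c2.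
have g12 : g1 1 = g2' 0 by rewrite g11 /g2' mulr0 add0r g21.
have cg := paste_continuous g12 c1 c2'.
have E0 : paste g1 g2' 0 = p0.
  by rewrite -g10 -(@paste_l R M g1 g2' 0) ?ler01// mul0r.
have E1 : paste g1 g2' 1 = p0.
  have := @paste_r R M g1 g2' 1 g12 ler01; rewrite -[(1 + 1) / 2]/(2 / 2 : R).
  by rewrite divff ?pnatr_eq0// => ->; rewrite /g2' mulr1 addNr.
have [e le e00] : exists2 e, lift_on itv01 (paste g1 g2') e & e 0 = e0.
  by apply: path_lift => //; rewrite E0.
have [|H [cH H0 H1 Hs]] := contractible_loops cg; first by rewrite E0.
have e10 := loop_monodromy cH H0 H1 Hs cg le.
have i0 := itv01_0; have i1 := itv01_1.
have A := lift_unique connected_itv01 c1 (lift_paste_l le) L1 i0 i1.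
have B := lift_unique connected_itv01 c2' (lift_paste_r g12 le)
  (lift_comp (@affine_continuous _ _) r01 L2) i1 i0.
rewrite -A ?mul0r ?e00// mul1r.
have -> : l2 1 = (l2 \o (fun t : R => - 1 * t + 1)) 0 by rewrite /= mulr0 add0r.
rewrite -B; first by rewrite addr0 mul1r.
rewrite -[(1 + 1) / 2]/(2 / 2 : R) divff ?pnatr_eq0//= mulr1 addNr.
by rewrite e10 e00 l20.
Qed.

Let transport_extend x v (g : R -> M) e : transport x v -> {within itv01, continuous g} ->
  lift_on itv01 g e -> g 0 = x -> e 0 = v -> transport (g 1) (e 1).
Proof.
move=> [g1 [l1 [c1 g10 g11 L1 [l10 l11]]]] cg le gx ev.
have g12 : g1 1 = g 0 by rewrite g11.
have E0 : paste g1 g 0 = p0 by rewrite -g10 -(@paste_l R M g1 g 0) ?ler01// mul0r.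
have E1 : paste g1 g 1 = g 1.
  have := @paste_r R M g1 g 1 g12 ler01; rewrite -[(1 + 1) / 2]/(2 / 2 : R).
  by rewrite divff ?pnatr_eq0.
have cp := paste_continuous g12 c1 cg.
have [l ll l0] : exists2 e, lift_on itv01 (paste g1 g) e & e 0 = e0.
  by apply: path_lift => //; rewrite E0.
have i0 := itv01_0; have i1 := itv01_1.
have A := lift_unique connected_itv01 c1 (lift_paste_l ll) L1 i0 i1.
have B := lift_unique connected_itv01 cg (lift_paste_r g12 ll) le i0 i1.
exists (paste g1 g), l; split=> //; split=> //.
rewrite -B; first by rewrite -[(1 + 1) / 2]/(2 / 2 : R) divff ?pnatr_eq0.
by rewrite addr0 ev -l11 -A// mul0r l0.
Qed.

Let transport_near x v : transport x v -> exists U s, [/\ open U, Sec U s, U x &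
  forall y, U y -> transport y (s y)].
Proof.
move=> tx; have [U [oU Ux HU pU]] := Sec_cover x.
have [s Us sx] := HU x v Ux (transport_fib tx).
exists U, s; split=> // y Uy; have [g [cg g0 g1 gU]] := pU x y Ux Uy.
have := transport_extend tx cg (lift_section Us gU) g0; rewrite /= g0 g1; exact.
Qed.

Let transport_exists x : exists v, transport x v.
Proof.
apply: (@connected_ind M setT (fun x => exists v, transport x v) p0 x) => //.
  move=> z _; have [U [oU Uz HU pU]] := Sec_cover z.
  have : \forall y \near z, U y by exact: open_nbhs_nbhs.
  apply: filterS => y Uy _; split=> -[v tv].
    have [s Us sy] := HU y v Uy (transport_fib tv).
    have [g [cg g0 g1 gU]] := pU y z Uy Uz.
    by exists (s z); have := transport_extend tv cg (lift_section Us gU) g0; rewrite /= g0 g1; exact.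
  have [s Us sz] := HU z v Uz (transport_fib tv).
  have [g [cg g0 g1 gU]] := pU z y Uz Uy.
  by exists (s y); have := transport_extend tv cg (lift_section Us gU) g0; rewrite /= g0 g1; exact.
have cp : {within itv01, continuous (fun=> p0 : M)}.
  by apply: continuous_subspaceT => t; exact: cst_continuous.
have [e le e00] : exists2 e, lift_on itv01 (fun=> p0) e & e 0 = e0 by exact: path_lift.
by exists (e 1); exists (fun=> p0), e.
Qed.

(** Continuation is defined everywhere by connectedness and single-valued by simple connectedness;
    it follows a local section near x because the neighbourhoods of [Sec_cover] are path
    connected. *)
Theorem global_section : exists s : M -> T, s p0 = e0 /\
  forall x, exists U s', [/\ open U, Sec U s', U x & forall y, U y -> s y = s' y].
Proof.
have [s Hs] := choice transport_exists.
exists s; split; last first.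
  move=> x; have [U [s' [oU Us' Ux Ht]]] := transport_near (Hs x).
  by exists U, s'; split=> // y Uy; exact: transport_unique (Hs y) (Ht y Uy).
have cp : {within itv01, continuous (fun=> p0 : M)}.
  by apply: continuous_subspaceT => t; exact: cst_continuous.
have [e le e00] : exists2 e, lift_on itv01 (fun=> p0) e & e 0 = e0 by exact: path_lift.
rewrite -e00; have -> : e 0 = e 1 by
  apply: (lift_const connected_itv01 le) => //; [exact: itv01_0|exact: itv01_1].
by apply: transport_unique (Hs p0) _; exists (fun=> p0), e.
Qed.

End Monodromy.

(** * The oscillator equation y'' = - kappa y *)

Section Harmonic.
Context {R : realType}.
Implicit Types (d e s c : R -> R).

Lemma deriv_continuous (f df : R -> R) : (forall t : R, is_derive t 1 f (df t)) -> continuous f.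
Proof.
move=> H t; apply: differentiable_continuous; apply/derivable1_diffP.
by have [] := H t.
Qed.

Lemma deriv_le0 (f df : R -> R) (a b : R) : a <= b -> (forall t : R, is_derive t 1 f (df t)) ->
  (forall t, df t <= 0) -> f b <= f a.
Proof.
move=> ab H df0.
have [|c _ E] := @MVT_segment R f df a b ab (fun t _ => H t).
  by apply: continuous_subspaceT; exact: deriv_continuous H.
by rewrite -subr_le0 E mulr_le0_ge0// subr_ge0.
Qed.

Lemma is_derive_affine (f : R -> R) (a b t df : R) : is_derive (a * t + b) 1 f df ->
  is_derive t 1 (fun t => f (a * t + b)) (a * df).
Proof.
move=> [/derivable1_diffP df1 <-].
have dl : is_derive t 1 (fun t : R => a * t + b) a.
  have := is_derive_add (is_derive_mulr (is_derive_const a t 1) (is_derive_id t 1))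
    (is_derive_const b t 1); rewrite mul0r add0r addr0 mulr1.
  exact.
have := is_derive_comp_diff dl df1.
by rewrite -[a in 'd _ _ a]mulr1 -[_ * 1]/(a *: (1 : R^o)) linearZ -deriveE.
Qed.

(** The energy d^2 + e^2 has derivative 2 (1 + w) d e, at most (1 + |w|)(d^2 + e^2). It vanishes at
    a and does not increase after multiplication by exp(- (1 + |w|) t). *)
Lemma harmonic_unique_right w d e (a t : R) : (forall t : R, is_derive t 1 d (e t)) ->
  (forall t : R, is_derive t 1 e (w * d t)) -> d a = 0 -> e a = 0 -> a <= t -> d t = 0.
Proof.
move=> Hd He da ea at0; pose k := 1 + `|w|.
pose h t := (d t * d t + e t * e t) * expR (- k * t + 0).
pose dh t := (e t * d t + d t * e t + (w * d t * e t + e t * (w * d t))) * expR (- k * t + 0)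
  + (d t * d t + e t * e t) * (- k * expR (- k * t + 0)).
have Hh (s : R) : is_derive s 1 h (dh s).
  apply: is_derive_mulr.
    by apply: is_derive_add; apply: is_derive_mulr.
  by apply: is_derive_affine; exact: is_derive_expR.
have dh0 (s : R) : dh s <= 0.
  have -> : dh s = expR (- k * s + 0) *
    (2 * (1 + w) * (d s * e s) - k * (d s * d s + e s * e s)) by rewrite /dh; ring.
  rewrite pmulr_rle0 ?expR_gt0// subr_le0.
  have h1 : `|2 * (d s * e s)| <= d s * d s + e s * e s.
    rewrite ler_norml; have h1 := sqr_ge0 (d s + e s); have h2 := sqr_ge0 (d s - e s).
    rewrite sqrrD in h1; rewrite sqrrB in h2; rewrite !expr2 in h1 h2.
    move: h1 h2; move: (d s) (e s) => x y h1 h2; apply/andP; split; lra.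
  apply: le_trans (ler_norm _) _.
  rewrite [2 * _]mulrC -mulrA normrM; apply: ler_pM => //.
  by apply: le_trans (ler_normD _ _) _; rewrite normr1.
have := deriv_le0 at0 Hh dh0; rewrite /h da ea !(mul0r, addr0).
rewrite pmulr_lle0 ?expR_gt0// => h1; apply/eqP; rewrite -sqrf_eq0 eq_le.
by apply/andP; split; nra.
Qed.

Lemma harmonic_unique w d e (a t : R) : (forall t : R, is_derive t 1 d (e t)) ->
  (forall t : R, is_derive t 1 e (w * d t)) -> d a = 0 -> e a = 0 -> d t = 0.
Proof.
move=> Hd He da ea; have [at0|/ltW ta] := leP a t.
  exact: harmonic_unique_right Hd He da ea at0.
pose d' (s : R) := d (- 1 * s + 2 * a); pose e' (s : R) := - 1 * e (- 1 * s + 2 * a).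
have -> : d t = d' (2 * a - t) by congr d; ring.
apply: (@harmonic_unique_right w d' e' a).
- by move=> s; exact: is_derive_affine.
- move=> s; have := is_derive_mulr (is_derive_const (- 1 : R) s 1) (is_derive_affine (He (- 1 * s + 2 * a))).
  by rewrite mul0r add0r mulrA mulrNN mulr1 mul1r.
- by rewrite /d' -da; congr d; ring.
- by rewrite /e'; have -> : - 1 * a + 2 * a = a by [ring]; rewrite ea mulr0.
- by lra.
Qed.

(** The generalised sine and cosine of curvature k: hyperbolic, circular or affine according to the
    sign of k. *)
Lemma sn_exists (k : R) : exists s c, [/\ s 0 = 0, c 0 = 1,
  forall t : R, is_derive t 1 s (c t) & forall t : R, is_derive t 1 c (- k * s t)].
Proof.
have lin (f : R -> R) (m df t : R) : is_derive (m * t + 0) 1 f df ->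
    is_derive t 1 (fun t => f (m * t + 0)) (m * df) by exact: is_derive_affine.
have scal (f : R -> R) (m df t : R) : is_derive t 1 f df ->
    is_derive t 1 (fun t => m * f t) (m * df).
  by move=> H; have := is_derive_mulr (is_derive_const m t 1) H; rewrite mul0r add0r.
have [k0|k0|->] := ltgtP k 0.
- pose m := Num.sqrt (- k); have m0 : 0 < m by rewrite sqrtr_gt0 oppr_gt0.
  have mm : m * m = - k by rewrite -expr2 sqr_sqrtr// oppr_ge0 ltW.
  exists (fun t => (2 * m)^-1 * (expR (m * t + 0) - expR (- m * t + 0))),
         (fun t => 2^-1 * (expR (m * t + 0) + expR (- m * t + 0))).
  have m1 : m != 0 by rewrite gt_eqF.
  split.
  + by rewrite !mulr0 subrr mulr0.
  + by rewrite !mulr0 !add0r expR0 -[1 + 1]/(2 : R) mulVf// pnatr_eq0.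
  + move=> t; have := scal _ (2 * m)^-1 _ t (is_derive_sub (lin _ m _ t (is_derive_expR _)) (lin _ (- m) _ t (is_derive_expR _))).
    move/is_derive_eq; apply; move: (expR _) (expR _) => x y; field.
    exact: m1.
  + move=> t; have := scal _ 2^-1 _ t (is_derive_add (lin _ m _ t (is_derive_expR _)) (lin _ (- m) _ t (is_derive_expR _))).
    move/is_derive_eq; apply; rewrite -mm; move: (expR _) (expR _) => x y; field.
    exact: m1.
- pose m := Num.sqrt k; have m0 : 0 < m by rewrite sqrtr_gt0.
  have mm : m * m = k by rewrite -expr2 sqr_sqrtr// ltW.
  have m1 : m != 0 by rewrite gt_eqF.
  exists (fun t => m^-1 * sin (m * t + 0)), (fun t => cos (m * t + 0)).
  split.
  + by rewrite mulr0 add0r sin0 mulr0.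
  + by rewrite mulr0 add0r cos0.
  + move=> t; have := scal _ m^-1 _ t (lin _ m _ t (is_derive_sin _)).
    by rewrite mulrA mulVf// mul1r.
  + move=> t; have := lin _ m _ t (is_derive_cos _).
    by move/is_derive_eq; apply; rewrite -mm; move: (sin _) => x; field.
- exists id, (fun=> 1); split=> // t; first exact: is_derive_id.
  by rewrite oppr0 mul0r; exact: is_derive_const.
Qed.

(** s increases as long as c is positive. The inverse reparametrises geodesics so that a ray in
    normal coordinates is traversed linearly. *)
Lemma sn_inverse s c : s 0 = 0 -> c 0 = 1 -> (forall t : R, is_derive t 1 s (c t)) ->
  continuous c -> exists (l : R) (sigma : R -> R), [/\ 0 < l, sigma 0 = 0,
    {within `[0, l], continuous sigma} & forall y, y \in `[0, l] -> s (sigma y) = y].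
Proof.
move=> s0 c0 Hs cc.
have /nbhs_ballP[r /= r0 Hr] : \forall t \near (0 : R), 0 < c t.
  by apply: (cc 0 [set x | 0 < x]); rewrite c0; apply: lt_nbhsr; exact: ltr01.
pose b := r / 2; have b0 : 0 < b by rewrite divr_gt0.
have cpos t : 0 <= t <= b -> 0 < c t.
  move=> /andP[t0 tb]; apply: Hr; rewrite -ball_normE/= sub0r normrN ger0_norm//.
  by apply: le_lt_trans tb _; rewrite /b ltr_pdivrMr// ltr_pMr// ltr1n.
have inc x y : 0 <= x -> x < y -> y <= b -> s x < s y.
  move=> x0 xy yb; have [|t] := @MVT R s c x y xy (fun t _ => Hs t).
    by apply: continuous_subspaceT; exact: deriv_continuous Hs.
  rewrite in_itv/= => /andP[xt ty] E; rewrite -subr_gt0 E mulr_gt0 ?subr_gt0// cpos//.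
  by rewrite (le_trans x0 (ltW xt)) (le_trans (ltW ty)).
have sb : 0 < s b by rewrite -s0; apply: inc.
have cs : {within `[0, b], continuous s}.
  by apply: continuous_subspaceT; exact: deriv_continuous Hs.
pose A y := [set t | t \in `[0, b] /\ s t = y].
pose sigma y := xget 0 (A y).
have can t : t \in `[0, b] -> sigma (s t) = t.
  move=> tb; have /(xgetPex 0) [] : exists u, A (s t) u by exists t.
  rewrite -/(sigma _); move: tb (sigma _) => + u; rewrite !in_itv/= => /andP[t0 tb] /andP[u0 ub].
  have [/inc h|/inc h|//] := ltgtP u t => E; [have := h u0 tb|have := h t0 ub].
    by rewrite E ltxx.
  by rewrite E ltxx.
have surj y : y \in `[0, s b] -> A y (sigma y).
  rewrite in_itv/= => /andP[y0 yb]; apply: (xgetPex 0).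
  have [|t tb E] := @IVT R s 0 b y (ltW b0) cs; last by exists t.
  by rewrite s0 (min_idPl (ltW sb)) (max_idPr (ltW sb)) y0.
exists (s b), sigma; split=> //.
- by rewrite -{1}s0 can// in_itv/= lexx ltW.
- by have := segment_can_le_continuous (ltW b0) cs can; rewrite s0.
- by move=> y /surj[].
Qed.

End Harmonic.

(** * Global solutions of Obata's equation *)

Section Charts.
Context {R : realType} {n : nat}.
Variable M : oriented_riemannian_manifold R n.
Implicit Types (p q : M) (i j k : idx M) (u v w : 'rV[R]_n) (f : M -> R).

Definition coord_inv i : 'rV[R]_n -> M := phi_inv (chart_of i).
Definition cimage i (A : set M) : set 'rV[R]_n := @coord _ _ M i @` (domain i `&` A).

Lemma coordK i p : domain i p -> coord_inv i (coord i p) = p.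
Proof. exact: phiK. Qed.

Lemma domain_open i : open (domain i : set M).
Proof. exact: dom_open. Qed.

Lemma coord_continuous i p : domain i p -> {for p, continuous (@coord _ _ M i)}.
Proof. exact: phi_cont. Qed.

Lemma image_openT i : open (cimage i setT).
Proof. by rewrite /cimage setIT; exact: img_open. Qed.

Lemma imageP i A y : cimage i A y <->
  [/\ cimage i setT y, domain i (coord_inv i y), A (coord_inv i y) & coord i (coord_inv i y) = y].
Proof.
split=> [[p [ip Ap] <-]|[_ iy Ay <-]]; last by exists (coord_inv i y).
by rewrite coordK//; split=> //; exists p.
Qed.

Lemma coord_inv_continuous i y : cimage i setT y -> {for y, continuous (coord_inv i)}.
Proof. by rewrite /cimage setIT; exact: phi_inv_cont. Qed.

Lemma image_open i A : open A -> open (cimage i A).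
Proof.
move=> oA; rewrite openE => y /imageP[Ty iy Ay Ey].
have cy := coord_inv_continuous Ty.
have h1 : \forall z \near y, A (coord_inv i z) := cy _ (open_nbhs_nbhs (conj oA Ay)).
suff : \forall z \near y, cimage i A z by [].
have h2 := open_near (@image_openT i) Ty; apply: filterS2 h2 h1 => z Tz Az.
by have /imageP[_ iz _ Ez] := Tz; apply/imageP; split.
Qed.

Lemma coord_image i p (A : set M) : domain i p -> A p -> cimage i A (coord i p).
Proof. by move=> ip Ap; exists p. Qed.

Lemma image_nbhs i p (A : set M) : domain i p -> nbhs p A ->
  \forall y \near coord i p, cimage i A y.
Proof.
move=> ip; rewrite nbhsE => -[B [oB Bp] BA].
have := open_near (@image_open i _ oB) (coord_image ip Bp); apply: filterS => y /imageP[Ty iy By Ey].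
by apply/imageP; split=> //; exact: BA.
Qed.

Lemma coord_nbhs i p (A : set 'rV[R]_n) : domain i p -> nbhs (coord i p) A ->
  \forall q \near p, domain i q /\ A (coord i q).
Proof.
move=> ip An; have h : \forall q \near p, A (coord i q) := coord_continuous ip An.
by apply: filterS2 h (open_near (@domain_open i) ip) => q Aq iq.
Qed.

Lemma metric_on_image i : metric_on (cimage i setT) (metric i).
Proof.
split.
- exact: image_openT.
- by move=> a b; rewrite /cimage setIT; exact: metric_smooth.
- by move=> x [p [ip _] <-]; exact: metric_sym.
- by move=> x v [p [ip _] <-]; exact: metric_posdef.
Qed.

Lemma metric_on_sub i (A : set M) : open A -> metric_on (cimage i A) (metric i).
Proof.
move=> oA; have [h1 h2 h3 h4] := metric_on_image i.
have S : cimage i A `<=` cimage i setT by move=> y /imageP[].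
split.
- exact: image_open.
- by move=> a b k; apply: Ck_sub S _; exact: h2.
- by move=> x /S; exact: h3.
- by move=> x v /S; exact: h4.
Qed.

Definition trans i j : 'rV[R]_n -> 'rV[R]_n := transition (chart_of i) (chart_of j).

Lemma transE i j p : domain i p -> trans i j (coord i p) = coord j p.
Proof. by move=> ip; rewrite /trans /transition /= [phi_inv _ _]coordK. Qed.

Lemma trans_smooth i j (A : set M) : A `<=` domain j -> smooth_mx (cimage i A) (trans i j).
Proof.
move=> Aj a b k; rewrite ord1 {a}; have := @atlas_smooth _ _ M i j b k.
apply: Ck_sub => y [p [ip Ap] <-]; exists p => //; split=> //; exact: Aj.
Qed.

Lemma trans_image i j (A : set M) : A `<=` domain j -> forall y, cimage i A y ->
  cimage j A (trans i j y).
Proof.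
move=> Aj y [p [ip Ap] <-]; rewrite transE//; exists p => //; split=> //; exact: Aj.
Qed.

Lemma trans_isom i j (A : set M) : A `<=` domain j -> forall y, cimage i A y ->
  metric i y = 'J (trans i j) y *m metric j (trans i j y) *m ('J (trans i j) y)^T.
Proof.
by move=> Aj y [p [ip Ap] <-]; rewrite transE//; apply: metric_compat => //; exact: Aj.
Qed.

Lemma coord_change_unit i j p : domain i p -> domain j p -> coord_change i j p \in unitmx.
Proof.
move=> ip jp; rewrite unitmxE unitfE; rewrite gt_eqF//; exact: atlas_oriented.
Qed.

Lemma trans_differentiable i j p : domain i p -> domain j p ->
  differentiable (trans i j) (coord i p).
Proof.
move=> ip jp; have oj := @domain_open j.
exact: smooth_mx_diff (@image_open i _ oj) (@trans_smooth i j _ (@subset_refl _ _)) (coord_image ip jp).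
Qed.

Lemma near_coord i p (P : M -> Prop) : domain i p -> (\forall q \near p, P q) ->
  \forall y \near coord i p, P (coord_inv i y).
Proof.
by move=> ip /(image_nbhs ip); apply: filterS => y /imageP[].
Qed.

Definition rep i f : 'rV[R]_n -> R := f \o coord_inv i.
Definition gradient i f p : 'rV[R]_n := grad (metric i) (rep i f) (coord i p).

Variable kappa : R.

Definition obata_on (W : set M) f := forall i p, W p -> domain i p ->
  obata kappa (metric i) (rep i f) (coord i p).

Lemma near_rep i f f' p : domain i p -> (\forall q \near p, f q = f' q) ->
  \forall y \near coord i p, rep i f y = rep i f' y.
Proof. by move=> ip; exact: near_coord. Qed.

Lemma near_gradient i f f' p : domain i p -> (\forall q \near p, f q = f' q) ->
  gradient i f p = gradient i f' p.
Proof. by move=> ip /(near_rep ip)/(near_eq_grad (metric i))/nbhs_singleton. Qed.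

Lemma near_obata i f f' p : domain i p -> (\forall q \near p, f q = f' q) ->
  obata kappa (metric i) (rep i f) (coord i p) ->
  obata kappa (metric i) (rep i f') (coord i p).
Proof. by move=> ip /(near_rep ip) ff'; exact: near_eq_obata. Qed.

Lemma rep_trans i j f p : domain i p -> domain j p ->
  \forall y \near coord i p, (rep j f \o trans i j) y = rep i f y.
Proof.
move=> ip jp; have oj := @domain_open j.
apply: filterS (open_near (@image_open i _ oj) (coord_image ip jp)) => y [q [iq jq] <-].
by rewrite /rep /= transE// !coordK.
Qed.

(** In coordinates a transition map is an isometry of the metrics, so a solution has to be checked
    in one chart only. *)
Lemma obata_chart i j (W : set M) f : open W -> W `<=` domain i ->
  (forall p, W p -> obata kappa (metric i) (rep i f) (coord i p)) ->
  forall p, W p -> domain j p -> obata kappa (metric j) (rep j f) (coord j p) /\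
    gradient j f p *m coord_change j i p = gradient i f p.
Proof.
move=> oW Wi Hf p Wp jp.
have ip := Wi p Wp; have Wy := coord_image jp Wp.
have oU := metric_on_sub j oW; have oV := metric_on_sub i oW.
have tUV := @trans_image j i W Wi; have sm := @trans_smooth j i W Wi.
have iso := @trans_isom j i W Wi.
have Hh y : cimage j W y -> obata kappa (metric i) (rep i f) (trans j i y).
  by move=> [q [jq Wq] <-]; rewrite transE//; exact: Hf.
have r := @rep_trans j i f p jp ip.
split; first exact: near_eq_obata r (obata_map oU oV sm tUV iso Hh Wy).
have := grad_map oU oV sm tUV iso Hh Wy; rewrite transE//.
by have -> := nbhs_singleton (near_eq_grad (metric j) r).
Qed.

Lemma gradient_change i j (W : set M) f p : open W -> obata_on W f -> W p ->
  domain i p -> domain j p -> gradient i f p *m coord_change i j p = gradient j f p.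
Proof.
move=> oW Hf Wp ip jp.
have oWj := openI oW (@domain_open j).
have [|||//] := @obata_chart j i (W `&` domain j) f oWj _ _ p _ ip.
- by move=> q [].
- by move=> q [Wq jq]; exact: Hf.
- by [].
Qed.

Lemma rep_differentiable i (W : set M) f p : obata_on W f -> W p -> domain i p ->
  differentiable (rep i f) (coord i p).
Proof. by move=> Hf Wp ip; have [] := Hf i p Wp ip. Qed.

Lemma obata_continuous (W : set M) f p : obata_on W f -> W p ->
  {for p, continuous f}.
Proof.
move=> Hf Wp; have [i ip] := atlas_cover p.
have c := differentiable_continuous (rep_differentiable Hf Wp ip).
have := continuous_comp (coord_continuous ip) c.
move=> h A; rewrite -{1}(coordK ip) => /h h'.
have {}h' : \forall q \near p, A (f (coord_inv i (coord i q))) := h'.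
by apply: filterS2 h' (open_near (@domain_open i) ip) => q + iq; rewrite coordK.
Qed.

Lemma inner_gradient i (W : set M) f p v : obata_on W f -> W p -> domain i p ->
  inner (metric_at i p) (gradient i f p) v = 'd (rep i f) (coord i p) v.
Proof.
move=> Hf Wp ip; apply: (inner_grad (metric_on_image i)); first exact: coord_image.
exact: rep_differentiable Hf Wp ip.
Qed.

End Charts.

Section GlobalObata.
Context {R : realType} {n : nat}.
Variable M : oriented_riemannian_manifold R n.
Implicit Types (p q : M) (i j k : idx M) (u v w : 'rV[R]_n) (f : M -> R).
Variable kappa : R.
Hypothesis HK : forall i p u v w, domain i p ->
  curvature (metric i) (coord i p) u v w =
  kappa *: (inner (metric i (coord i p)) v w *: u - inner (metric i (coord i p)) u w *: v).
Local Notation obata_on := (@obata_on R n M kappa).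

Lemma some_chartP p : domain (some_chart p) p.
Proof. by rewrite /domain/some_chart; case: cid. Qed.

Definition jet_at i f p : 'rV[R]_(1 + n) := jet (f p) (gradient i f p).

Lemma jet_at_chart i j (W : set M) f f' p : open W -> obata_on W f -> obata_on W f' ->
  W p -> domain i p -> domain j p -> jet_at i f p = jet_at i f' p ->
  jet_at j f p = jet_at j f' p.
Proof.
move=> oW Hf Hf' Wp ip jp /jet_inj[E1 E2]; rewrite /jet_at E1.
by rewrite -(gradient_change oW Hf Wp ip jp) -(gradient_change oW Hf' Wp ip jp) E2.
Qed.

Lemma local_frobenius i (W : set M) p : open W -> W p -> domain i p -> exists d,
  [/\ 0 < d, ball (coord i p) d `<=` cimage i W,
  forall x0 s0, ball (coord i p) d x0 -> exists2 s, s x0 = s0 &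
    parallel_on (lconn (tractor (metric i) kappa)) (ball (coord i p) d) s &
  forall s1 s2 x0, parallel_on (lconn (tractor (metric i) kappa)) (ball (coord i p) d) s1 ->
    parallel_on (lconn (tractor (metric i) kappa)) (ball (coord i p) d) s2 ->
    ball (coord i p) d x0 -> s1 x0 = s2 x0 ->
    forall x, ball (coord i p) d x -> s1 x = s2 x].
Proof.
move=> oW Wp ip.
apply: (tractor_frobenius (metric_on_sub i oW)); last exact: coord_image.
by move=> x u v w [q [iq Wq] <-]; exact: HK.
Qed.

Lemma obata_on_parallel i (W : set M) f (B : set 'rV[R]_n) : obata_on W f ->
  B `<=` cimage i W -> parallel_on (lconn (tractor (metric i) kappa)) B
    (fun y => jet (rep i f y) (grad (metric i) (rep i f) y)).
Proof.
move=> Hf BW; apply: (obata_parallel (metric_on_image i)).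
  by move=> y /BW/imageP[].
by move=> y /BW[q [iq Wq] <-]; exact: Hf.
Qed.

(** Local uniqueness of parallel sections read in both directions, between the centre of a small
    ball and its points. The charts at both ends are arbitrary because equality of jets does not
    depend on them. *)
Lemma jet_agree_near (W : set M) f f' p : open W -> obata_on W f -> obata_on W f' -> W p ->
  \forall q \near p, W q /\ forall i j, domain i p -> domain j q ->
    jet_at j f q = jet_at j f' q <-> jet_at i f p = jet_at i f' p.
Proof.
move=> oW Hf Hf' Wp; set k := some_chart p; have kp : domain k p := some_chartP p.
have [d [d0 dW _ uniq]] := local_frobenius oW Wp kp.
have bd : ball (coord k p) d (coord k p) by exact: ballxx.
have Pf := obata_on_parallel Hf dW; have Pf' := obata_on_parallel Hf' dW.
have nB : \forall y \near coord k p, ball (coord k p) d y by exact: nbhsx_ballx.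
apply: filterS2 (open_near oW Wp) (coord_nbhs kp nB) => q Wq [kq bq]; split=> // i j ip jq.
have E (h : M -> R) r : domain k r ->
    jet (rep k h (coord k r)) (grad (metric k) (rep k h) (coord k r)) = jet_at k h r.
  by move=> kr; rewrite /rep /= coordK.
split=> H; [apply: (jet_at_chart oW Hf Hf' Wp kp ip _)|apply: (jet_at_chart oW Hf Hf' Wq kq jq _)].
- apply: etrans (esym (E f _ kp)) _; apply: etrans _ (E f' _ kp).
  apply: (uniq _ _ _ Pf Pf' bq _ _ bd).
  apply: etrans (E f _ kq) _; apply: etrans _ (esym (E f' _ kq)).
  exact: jet_at_chart oW Hf Hf' Wq jq kq H.
- apply: etrans (esym (E f _ kq)) _; apply: etrans _ (E f' _ kq).
  apply: (uniq _ _ _ Pf Pf' bd _ _ bq).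
  apply: etrans (E f _ kp) _; apply: etrans _ (esym (E f' _ kp)).
  exact: jet_at_chart oW Hf Hf' Wp ip kp H.
Qed.

Definition chart_ball i p d : set M := [set q | domain i q /\ ball (coord i p) d (coord i q)].

Lemma chart_ball_open i p d : open (chart_ball i p d).
Proof.
rewrite openE => q [iq bq]; suff : \forall r \near q, chart_ball i p d r by [].
exact: coord_nbhs iq (open_near (ball_open _ _) bq).
Qed.

Lemma chart_ball_path i p d q r : ball (coord i p) d `<=` cimage i setT ->
  chart_ball i p d q -> chart_ball i p d r -> exists g : R -> M,
    [/\ {within itv01, continuous g}, g 0 = q, g 1 = r &
        forall t, itv01 t -> chart_ball i p d (g t)].
Proof.
move=> dM [iq bq] [ir br].
pose l (t : R) := coord i q + t *: (coord i r - coord i q).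
have lb t : itv01 t -> ball (coord i p) d (l t).
  by rewrite /itv01/= in_itv/= => t01; exact: ball_segment.
exists (coord_inv i \o l); split.
- apply: continuous_in_subspaceT => t; rewrite inE => t01.
  have cl : {for t, continuous l}.
    by apply: differentiable_continuous; apply/derivable1_diffP; have [] := is_derive_line (coord i q) (coord i r - coord i q) t.
  apply: (continuous_comp cl); apply: coord_inv_continuous; exact/dM/lb.
- by rewrite /= /l scale0r addr0 coordK.
- by rewrite /= /l scale1r addrC subrK coordK.
- by move=> t /lb bt; have /imageP[_ h1 _ h2] := dM _ bt; split=> //=; rewrite h2.
Qed.

(** The value at p is the jet in the chart chosen at p, so values at nearby points refer to
    unrelated frames. This is harmless: sections are compared only at a common point. *)
Let Sec (U : set M) (s : M -> 'rV[R]_(1 + n)) := open U /\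
  exists2 f, obata_on U f & forall p, U p -> s p = jet_at (some_chart p) f p.

Lemma obata_local p : exists d, [/\ 0 < d, ball (coord (some_chart p) p) d `<=` cimage (some_chart p) setT &
  forall q i e, chart_ball (some_chart p) p d q -> domain i q ->
    exists2 f, obata_on (chart_ball (some_chart p) p d) f & jet_at i f q = e].
Proof.
set k := some_chart p; have kp : domain k p := some_chartP p.
have [d [d0 dM ex _]] := local_frobenius openT I kp.
exists d; split=> // q i e [kq bq] iq; rewrite [e]jet_submx.
move: (lsubmx e 0 0) (rsubmx e) => a X {e}.
(* The prescribed gradient is given in chart i, whereas the local equation is solved in chart k. *)
have [s sq Ps] := ex _ (jet a (X *m coord_change i k q)) bq.
pose f (r : M) := lsubmx (s (coord k r)) 0 0.
have ob y : ball (coord k p) d y -> ball (coord k p) d `<=` cimage k setT by [].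
have oB := ball_open (coord k p) d.
have repf y : ball (coord k p) d y ->
    \forall z \near y, lsubmx (s z) 0 0 = rep k f z.
  move=> yb; apply: filterS (open_near oB yb) => z zb.
  by have /imageP[_ _ _ E] := dM _ zb; rewrite /rep /f /= E.
have Pk y : ball (coord k p) d y -> obata kappa (metric k) (rep k f) y /\
    s y = jet (lsubmx (s y) 0 0) (grad (metric k) (rep k f) y).
  move=> yb; have [h1 h2] := parallel_obata (metric_on_image k) oB dM Ps yb.
  split; first exact: near_eq_obata (repf y yb) h1.
  by rewrite {1}h2; congr jet; exact: nbhs_singleton (near_eq_grad _ (repf y yb)).
have oU := @chart_ball_open k p d.
have Uk : chart_ball k p d `<=` domain k by move=> r [].
have Hk r : chart_ball k p d r -> obata kappa (metric k) (rep k f) (coord k r).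
  by move=> [kr br]; exact: (Pk _ br).1.
have Hf : obata_on (chart_ball k p d) f.
  by move=> j r Ur jr; exact: (obata_chart oU Uk Hk Ur jr).1.
exists f => //.
have Uq : chart_ball k p d q by split.
have := (Pk _ bq).2; rewrite sq => /jet_inj[E1 E2].
rewrite /jet_at /f sq; congr jet; first by rewrite /jet row_mxKl mxE eqxx mulr1n.
apply: (can_inj (mulmxK (coord_change_unit iq kq))).
by rewrite (gradient_change oU Hf Uq iq kq) E2.
Qed.

Hypothesis M_connected : connected [set: M].

Hypothesis M_simply_connected : simply_connected M.

(** Every jet is admissible, so the fibre condition of [global_section] is trivial. The solution is
    the first entry of the section of jets; locally it coincides with a solution having those
    jets. *)
Theorem obata_exists i p0 e : domain i p0 ->
  exists2 f, obata_on setT f & jet_at i f p0 = e.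
Proof.
move=> ip0; set k := some_chart p0; have kp0 : domain k p0 := some_chartP p0.
have [d0 [d00 _ /(_ p0 i e)]] := obata_local p0.
have Up0 : chart_ball (some_chart p0) p0 d0 p0 by split=> //; exact: ballxx.
case=> // f0 Hf0 f0e.
have [| | | | s [sp0 Hs]] := @global_section R M _ (fun _ _ => True) Sec _ _ _ _ p0
  (jet_at k f0 p0) I M_simply_connected M_connected.
- by move=> U s [].
- by [].
- move=> U V s s' p [oU [f Hf sf]] [oV [f' Hf' sf']] Up Vp.
  have oW := openI oU oV.
  have HfW : obata_on (U `&` V) f by move=> j q [Uq _]; exact: Hf.
  have HfW' : obata_on (U `&` V) f' by move=> j q [_ Vq]; exact: Hf'.
  have := jet_agree_near oW HfW HfW' (conj Up Vp); apply: filterS => q [[Uq Vq] H].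
  rewrite (sf q Uq) (sf' q Vq) (sf p Up) (sf' p Vp).
  by apply: H; exact: some_chartP.
- move=> p; have [d [d1 dM ex]] := obata_local p.
  exists (chart_ball (some_chart p) p d); split.
  + exact: chart_ball_open.
  + by split; [exact: some_chartP|exact: ballxx].
  + move=> q e' Uq _; have [f Hf fe] := ex q _ e' Uq (some_chartP q).
    exists (fun r => jet_at (some_chart r) f r) => //; split; first exact: chart_ball_open.
    by exists f.
  + by move=> q r; exact: chart_ball_path.
have loc p : exists U f', [/\ open U, U p, obata_on U f', forall q, U q -> f' q = s q 0 (lshift n 0) &
    s p = jet_at (some_chart p) f' p].
  have [U [s' [oU [_ [f Hf sf]] Up ss']]] := Hs p.
  exists U, f; split=> //; last by rewrite ss'// sf.
  by move=> q Uq; rewrite ss'// sf// jet0E.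
exists (fun q => s q 0 (lshift n 0)).
  move=> j p _ jp; have [U [f' [oU Up Hf' E _]]] := loc p.
  by apply: near_obata jp _ (Hf' _ _ Up jp); apply: filterS (open_near oU Up).
have [U [f' [oU Up Hf' E sp]]] := loc p0.
have Ep : \forall q \near p0, f' q = s q 0 (lshift n 0) by apply: filterS (open_near oU Up).
rewrite /jet_at -(near_gradient ip0 Ep) -(nbhs_singleton Ep) -/(jet_at i f' p0) -f0e.
set W := U `&` chart_ball (some_chart p0) p0 d0.
apply: (@jet_at_chart k i W) => //.
- by apply: openI => //; exact: chart_ball_open.
- by move=> j q [Uq _]; exact: Hf'.
- by move=> j q [_ Vq]; exact: Hf0.
- by rewrite -sp sp0.
Qed.

End GlobalObata.

Section LinearAlgebra.
Context {R : realType}.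

(** Two spanning families of vectors with the same Gram matrix differ by a linear isometry. The rows
    of X are the vectors, the left inverse L says that they span, and L X' carries the rows of X to
    those of X'. *)
Lemma gram_transfer m n (G G' : 'M[R]_n) (X X' : 'M[R]_(m, n)) (L L' : 'M[R]_(n, m)) :
  L *m X = 1%:M -> L' *m X' = 1%:M -> G' \in unitmx ->
  X *m G *m X^T = X' *m G' *m X'^T ->
  X *m (L *m X') = X' /\ (L *m X') *m G' *m (L *m X')^T = G.
Proof.
move=> LX LX' uG' E.
have T : X^T *m L^T = 1%:M by rewrite -trmx_mul LX trmx1.
have T' : X'^T *m L'^T = 1%:M by rewrite -trmx_mul LX' trmx1.
have E1 : X *m (L *m X') = X'.
  have E2 : X *m (L *m X') *m G' *m X'^T = X' *m G' *m X'^T.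
    by rewrite -!mulmxA (mulmxA X') -E !mulmxA -(mulmxA X L X) LX mulmx1 E.
  have := congr1 (mulmx^~ L'^T) E2; rewrite -!(mulmxA _ _ L'^T) T' !mulmx1.
  by move=> /(congr1 (mulmx^~ (invmx G'))); rewrite !mulmxK.
split=> //; set q := L *m X'.
have E3 : X *m (q *m G' *m q^T) *m X^T = X *m G *m X^T.
  transitivity ((X *m q) *m G' *m (X *m q)^T); first by rewrite [(X *m q)^T]trmx_mul !mulmxA.
  by rewrite E1 E.
have := congr1 (fun A => L *m A *m L^T) E3.
by rewrite !mulmxA LX !mul1mx -!mulmxA T !mulmx1.
Qed.

End LinearAlgebra.

Section Frames.
Context {R : realType} {n : nat}.
Variable M : oriented_riemannian_manifold R n.
Implicit Types (p q : M) (i j k : idx M) (u v w : 'rV[R]_n) (f : M -> R).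

Lemma coord_changeM i j k p : domain i p -> domain j p -> domain k p ->
  coord_change i j p *m coord_change j k p = coord_change i k p.
Proof.
move=> ip jp kp; apply: eq_mx_mull => v; rewrite mulmxA.
rewrite /coord_change [LHS]mul_jacobian [in LHS]mul_jacobian mul_jacobian.
have d1 := trans_differentiable ip jp; have d2 := trans_differentiable jp kp.
have d3 := trans_differentiable ip kp.
have E : \forall y \near coord i p, trans j k (trans i j y) = trans i k y.
  apply: filterS (near_coord ip (filterI (open_near (@domain_open R n M i) ip)
    (open_near (@domain_open R n M j) jp))) => y [iy jy].
  by rewrite /trans /transition /= [phi_inv _ (phi _ _)]coordK.
apply: is_derive_unique _ (is_derive_diff v d3).
apply: near_eq_is_derive E _.
rewrite -(transE j ip) in d2; have := is_derive_comp_diff (is_derive_diff v d1) d2.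
by rewrite transE.
Qed.

Lemma coord_change1 i p : domain i p -> coord_change i i p = 1%:M.
Proof.
move=> ip; apply: (can_inj (mulKmx (coord_change_unit ip ip))).
by rewrite mulmx1 coord_changeM.
Qed.

Lemma velocity_change (g : R -> M) (t : R) i j : {for t, continuous g} ->
  domain i (g t) -> domain j (g t) -> derivable (fun s => coord i (g s)) t 1 ->
  is_derive t 1 (fun s => coord j (g s)) (velocity g t i *m coord_change i j (g t)).
Proof.
move=> cg it jt di; have d := trans_differentiable it jt.
have Dg : is_derive t 1 (fun s => coord i (g s)) (velocity g t i).
  by rewrite /velocity derive1E; exact/derivableP.
rewrite /coord_change mul_jacobian.
have E : \forall s \near t, trans i j (coord i (g s)) = coord j (g s).
  have h : \forall s \near t, domain i (g s) := cg _ (open_near (@domain_open R n M i) it).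
  by apply: filterS h => s; exact: transE.
exact: near_eq_is_derive E (is_derive_comp_diff Dg d).
Qed.

Lemma inner_change i j p u v : domain i p -> domain j p ->
  inner (metric_at j p) (u *m coord_change i j p) (v *m coord_change i j p) =
  inner (metric_at i p) u v.
Proof.
move=> ip jp; rewrite inner_mulmx /metric_at (metric_compat ip jp).
by [].
Qed.

Variable kappa : R.
Local Notation obata_on := (@obata_on R n M kappa).

Lemma geodesic_derive (g : R -> M) (t : R) i : is_geodesic g -> domain i (g t) ->
  is_derive t 1 (fun s => coord i (g s)) (velocity g t i) /\
  is_derive t 1 (fun s => velocity g s i)
    (- gamma (metric i) (coord i (g t)) (velocity g t i) (velocity g t i)).
Proof.
move=> [cg Hg] it; have [d1 d2 E] := Hg t i it.
split; first exact: DeriveDef d1 (esym (derive1E _ _)).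
apply: (DeriveDef d2); rewrite -derive1E; apply/eqP; rewrite -addr_eq0 -E; apply/eqP.
by rewrite /covariant_derivative.
Qed.

Lemma geodesic_near (g : R -> M) (t : R) i : is_geodesic g -> domain i (g t) ->
  \forall s \near t, domain i (g s).
Proof. by move=> [cg _] it; exact: (cg t _ (open_near (@domain_open R n M i) it)). Qed.

Definition speed2 (g : R -> M) t :=
  let i := some_chart (g t) in inner (metric_at i (g t)) (velocity g t i) (velocity g t i).

Lemma velocity_chart (g : R -> M) (t : R) i j : is_geodesic g -> domain i (g t) ->
  domain j (g t) -> velocity g t j = velocity g t i *m coord_change i j (g t).
Proof.
move=> Hg it jt; have [d1 _] := geodesic_derive Hg it; have [d2 _] := geodesic_derive Hg jt.
apply: is_derive_unique d2 (velocity_change (Hg.1 t) it jt _).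
by case: d1.
Qed.

Lemma speed2E (g : R -> M) t i : is_geodesic g -> domain i (g t) ->
  speed2 g t = inner (metric_at i (g t)) (velocity g t i) (velocity g t i).
Proof.
move=> Hg it; rewrite /speed2; have jt := some_chartP (g t).
by rewrite (velocity_chart Hg it jt) inner_change.
Qed.

Lemma speed2_cst (g : R -> M) s t : is_geodesic g -> speed2 g s = speed2 g t.
Proof.
move=> Hg; apply: is_derive_0_is_cst => {s}t.
set i := some_chart (g t); have it : domain i (g t) := some_chartP (g t).
have E : \forall s \near t, inner (metric i (coord i (g s))) (velocity g s i) (velocity g s i) = speed2 g s.
  by apply: filterS (geodesic_near Hg it) => s si; rewrite (speed2E Hg si).
apply: near_eq_is_derive E _.
have [d1 d2] := geodesic_derive Hg it.
have Ui : cimage i setT (coord i (g t)) by exact: coord_image.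
have HG := metric_on_image i.
have sG := smooth_mx_diff (mo_open HG) (mo_smooth HG) Ui.
have := is_derive_inner (is_derive_comp_diff d1 sG) d2 d2.
have -> := mderiv_diff (velocity g t i) sG.
move/is_derive_eq; apply; rewrite (metric_compatible HG)// innerNl innerNr.
by move: (inner _ _ _) (inner _ _ _) => a b; ring.
Qed.

(** The second derivative along a geodesic is the Hessian on the velocity, since the acceleration
    vanishes; Obata's equation makes it an oscillator whose coefficient is kappa times the constant
    squared speed. *)
Lemma geodesic_obata (g : R -> M) f (t : R) i : is_geodesic g -> obata_on setT f -> domain i (g t) ->
  let psi s := 'D_1 (f \o g) s in
  psi t = inner (metric_at i (g t)) (gradient i f (g t)) (velocity g t i) /\
  is_derive t 1 (f \o g) (psi t) /\ is_derive t 1 psi (- kappa * speed2 g 0 * f (g t)).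
Proof.
move=> Hg Hf it psi.
have D (s : R) : domain i (g s) -> is_derive s 1 (f \o g)
    (inner (metric_at i (g s)) (gradient i f (g s)) (velocity g s i)).
  move=> si; have [d1 _] := geodesic_derive Hg si.
  have df := rep_differentiable Hf (I : setT (g s)) si.
  rewrite (inner_gradient _ Hf)//.
  have E : \forall r \near s, rep i f (coord i (g r)) = (f \o g) r.
    by apply: filterS (geodesic_near Hg si) => r ri; rewrite /rep/= coordK.
  exact: near_eq_is_derive E (is_derive_comp_diff d1 df).
have P (s : R) : domain i (g s) ->
    psi s = inner (metric_at i (g s)) (gradient i f (g s)) (velocity g s i).
  by move=> si; have [_ <-] := D s si.
split; [exact: P|split; first by rewrite P//; exact: D].
have E : \forall s \near t,
    inner (metric i (coord i (g s))) (grad (metric i) (rep i f) (coord i (g s))) (velocity g s i) = psi s.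
  by apply: filterS (geodesic_near Hg it) => s si; rewrite P.
apply: near_eq_is_derive E _.
have [d1 d2] := geodesic_derive Hg it.
have Ui : cimage i setT (coord i (g t)) by exact: coord_image.
have HG := metric_on_image i.
have sG := smooth_mx_diff (mo_open HG) (mo_smooth HG) Ui.
have [df dX EX] := Hf i _ I it.
have D1 := is_derive_comp_diff d1 sG; have D2 := is_derive_comp_diff d1 dX.
have := is_derive_inner D1 D2 d2.
have e1 := mderiv_diff (velocity g t i) sG.
have e2 := metric_compatible HG (velocity g t i)
  (grad (metric i) (rep i f) (coord i (g t))) (velocity g t i) Ui.
have fE : rep i f (coord i (g t)) = f (g t) by rewrite /rep/= coordK.
rewrite (EX (velocity g t i)) fE e1.
move/is_derive_eq; apply; rewrite e2 (speed2_cst 0 t Hg) (speed2E Hg it) /metric_at.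
rewrite innerBl innerNl innerZl innerNr.
by move: (inner _ _ _) (inner _ _ _) (inner _ _ _) => a b c; ring.
Qed.

End Frames.

(** * The developing isometry *)

Lemma parallel_sum {R : realType} n N (conn : 'rV[R]_n -> 'rV[R]_n -> 'M[R]_N) W m (c : 'I_m -> R)
    (us : 'I_m -> 'rV[R]_n -> 'rV[R]_N) :
  (forall k, parallel_on conn W (us k)) ->
  parallel_on conn W (fun x => \sum_k c k *: us k x).
Proof.
move=> H x Wx.
have D : differentiable (fun x => \sum_k c k *: us k x) x.
  have -> : (fun x => \sum_k c k *: us k x) = \sum_k (c k *: us k).
    by apply/funext => y; rewrite fct_sumE.
  by apply: differentiable_sum => k; apply: differentiableZ; have [] := H k x Wx.
split=> // v; rewrite mulmx_suml; apply: is_derive_unique (is_derive_diff v D) _.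
apply: is_derive_sumP => k; have [dk E] := H k x Wx.
have := is_derive_scal (is_derive_const (c k) x v) (is_derive_diff v dk).
by rewrite scale0r add0r E scalemxAl.
Qed.

(** * Bases of solutions and the invariant form *)

Section Frames.
Context {R : realType} {n : nat}.
Variable M : oriented_riemannian_manifold R n.
Implicit Types (p q : M) (i j : idx M) (u v w : 'rV[R]_n) (f g : 'I_(1 + n) -> M -> R).
Variable kappa : R.
Hypothesis HK : forall i p u v w, domain i p ->
  curvature (metric i) (coord i p) u v w =
  kappa *: (inner (metric i (coord i p)) v w *: u - inner (metric i (coord i p)) u w *: v).
Hypothesis M_connected : connected [set: M].
Local Notation obata_on := (@obata_on R n M kappa).

Definition values f p : 'rV[R]_(1 + n) := \row_k f k p.
Definition gradients f i p : 'M[R]_(1 + n, n) := \matrix_k gradient i (f k) p.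
Definition frame_jets f i p : 'M[R]_(1 + n) := row_mx (values f p)^T (gradients f i p).
(** A basis of the space of solutions, of dimension 1 + n, expressed by the independence of its jets
    at every point. *)
Definition is_frame f := (forall k, obata_on setT (f k)) /\
  forall i p, domain i p -> frame_jets f i p \in unitmx.

Lemma row_frame_jets f i p (k : 'I_(1 + n)) : row k (frame_jets f i p) = jet_at i (f k) p.
Proof.
rewrite /frame_jets row_row_mx rowK /jet_at /jet; congr row_mx.
by apply/rowP => a; rewrite !mxE (ord1 a) eqxx mulr1n.
Qed.

Lemma gradients_change f i j p : (forall k, obata_on setT (f k)) -> domain i p -> domain j p ->
  gradients f i p *m coord_change i j p = gradients f j p.
Proof.
move=> Hf ip jp; apply/row_matrixP => k; rewrite row_mul !rowK.
exact: gradient_change openT (Hf k) I ip jp.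
Qed.

Lemma frame_jets_change f i j p : (forall k, obata_on setT (f k)) -> domain i p -> domain j p ->
  frame_jets f i p \in unitmx -> frame_jets f j p \in unitmx.
Proof.
move=> Hf ip jp; rewrite -!row_free_unit => U; apply: inj_row_free => c H.
have /eq_row_mx[h1 h2] : row_mx (c *m (values f p)^T) (c *m gradients f j p) = row_mx 0 0.
  by rewrite -mul_mx_row row_mx0.
apply/eqP; rewrite -(mulmx_free_eq0 _ U) /frame_jets mul_mx_row h1.
by rewrite -(gradients_change Hf jp ip) mulmxA h2 mul0mx row_mx0.
Qed.

(** A combination of the f_k whose jet vanishes at one point of a small ball is the zero section on
    it, so independence of the jets propagates along the connected M. *)
Lemma frame_unit f i p0 : (forall k, obata_on setT (f k)) -> domain i p0 ->
  frame_jets f i p0 \in unitmx -> is_frame f.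
Proof.
move=> Hf ip0 U0; split=> // j p jp.
pose P p := forall j, domain j p -> frame_jets f j p \in unitmx.
suff : P p by exact.
apply: (@connected_ind M setT P p0 p) => // [z _|k kp0]; last exact: frame_jets_change Hf ip0 kp0 U0.
set k := some_chart z; have kz : domain k z := some_chartP z.
have [d [d0 dW _ uniq]] := local_frobenius HK openT I kz.
have nB : \forall y \near coord k z, ball (coord k z) d y by exact: nbhsx_ballx.
have key a b : domain k a -> domain k b -> ball (coord k z) d (coord k a) ->
    ball (coord k z) d (coord k b) -> frame_jets f k a \in unitmx -> frame_jets f k b \in unitmx.
  move=> ka kb ba bb; rewrite -!row_free_unit => Ua; apply: inj_row_free => c cb.
  pose u y := \sum_l c 0 l *: jet (rep k (f l) y) (grad (metric k) (rep k (f l)) y).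
  have uE q : domain k q -> u (coord k q) = c *m frame_jets f k q.
    move=> kq; rewrite mulmx_sum_row; apply: eq_bigr => l _.
    by rewrite row_frame_jets /jet_at /rep /= coordK.
  have Pu : parallel_on (lconn (tractor (metric k) kappa)) (ball (coord k z) d) u.
    by apply: parallel_sum => l; apply: obata_on_parallel (Hf l) dW.
  have P0 : parallel_on (lconn (tractor (metric k) kappa)) (ball (coord k z) d) (fun=> 0).
    move=> y _; split=> [|v]; first exact: differentiable_cst.
    by rewrite mul0mx; apply: is_derive_unique (is_derive_diff _ _) (is_derive_const _ _ _);
      exact: differentiable_cst.
  have := uniq _ _ _ Pu P0 bb _ _ ba; rewrite !uE// => /(_ cb)/eqP.
  by rewrite (mulmx_free_eq0 _ Ua) => /eqP.
apply: filterS (coord_nbhs kz nB) => q [kq bq] _.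
have bz : ball (coord k z) d (coord k z) by exact: ballxx.
by split=> H j' j'q; apply: (frame_jets_change Hf _ j'q);
  [exact: kz|exact: key _ _ kq kz bq bz (H k kq)|exact: kq|exact: key _ _ kz kq bz bq (H k kz)].
Qed.

(* The invariant form of the flat connection: it depends neither on the chart nor on p
   when f and f' are global solutions. *)
Definition hform i (f f' : M -> R) p := kappa * (f p * f' p) +
  inner (metric_at i p) (gradient i f p) (gradient i f' p).

Lemma hform_change (f f' : M -> R) i j p : obata_on setT f -> obata_on setT f' ->
  domain i p -> domain j p -> hform i f f' p = hform j f f' p.
Proof.
move=> Hf Hf' ip jp; rewrite /hform; congr (_ + _).
by rewrite -(inner_change _ _ ip jp) (gradient_change openT Hf I ip jp) (gradient_change openT Hf' I ip jp).
Qed.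

Lemma hform_cst (f f' : M -> R) i j p q : obata_on setT f -> obata_on setT f' ->
  domain i p -> domain j q -> hform i f f' p = hform j f f' q.
Proof.
move=> Hf Hf' ip jq; pose P r := forall k : idx M, domain k r -> hform i f f' p = hform k f f' r.
suff : P q by exact.
apply: (@connected_ind M setT P p q) => // [z _|k kp]; last exact: hform_change.
set k := some_chart z; have kz : domain k z := some_chartP z.
have Uz : cimage k setT (coord k z) by exact: coord_image.
have /nbhs_ballP[d /= d0 dW] := open_near (@image_openT _ _ _ k) Uz.
pose Phi y := kappa * (rep k f y * rep k f' y) +
  inner (metric k y) (grad (metric k) (rep k f) y) (grad (metric k) (rep k f') y).
have PhiE r : domain k r -> Phi (coord k r) = hform k f f' r.
  by move=> kr; rewrite /Phi /rep /= coordK.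
have dPhi y v : ball (coord k z) d y -> is_derive y v Phi 0.
  move=> /dW Uy; have [r [kr _] E] := Uy; apply: (obata_invariant (metric_on_image k) v Uy).
    by rewrite -E; exact: Hf.
  by rewrite -E; exact: Hf'.
apply: filterS (coord_nbhs kz (nbhsx_ballx _ _ d0)) => r [kr br] _.
have E : hform k f f' r = hform k f f' z.
  rewrite -!PhiE//; have bz : ball (coord k z) d (coord k z) by exact: ballxx.
  have [s s01|s s01] := @line_MVT R _ Phi (coord k z) (coord k r - coord k z).
    by have [] := dPhi _ (coord k r - coord k z) (ball_segment s01 bz br).
  have [s0 s1] := andP s01.
  have s01' : 0 <= s <= 1 by rewrite !ltW.
  have [_ ->] := dPhi _ (coord k r - coord k z) (ball_segment s01' bz br).
  by rewrite (addrC (coord k z)) subrK => /eqP; rewrite subr_eq0 => /eqP.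
split=> H l ls; [rewrite (H k kr) E|rewrite (H k kz) -E]; exact: hform_change.
Qed.

(** The rows of the inverse matrix are dual combinations: [A] yields the solution with value 1 and
    gradient 0 at p, [B] those that vanish at p and have the coordinate vectors as gradients. *)
Lemma frame_split f i p : is_frame f -> domain i p -> exists (A : 'M[R]_(1, 1 + n)) (B : 'M[R]_(n, 1 + n)),
  [/\ A *m (values f p)^T = 1%:M, A *m gradients f i p = 0,
      B *m (values f p)^T = 0 & B *m gradients f i p = 1%:M].
Proof.
move=> [_ U] ip; have := mulVmx (U i p ip).
rewrite -[invmx _]vsubmxK /frame_jets mul_col_row (@scalar_mx_block R 1 n 1).
move: (usubmx _) (dsubmx _) => A B /eq_block_mx[h1 h2 h3 h4].
by exists A, B.
Qed.

Variables f g : 'I_(1 + n) -> M -> R.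
Hypotheses (Ff : is_frame f) (Fg : is_frame g).
Hypothesis hfg : forall i j p q, domain i p -> domain j q ->
  forall a b, hform i (f a) (f b) p = hform j (g a) (g b) q.

Definition matched p q := forall k, g k q = f k p.

(** With equal values, equality of [hform] becomes equality of the Gram matrices of the two systems
    of gradients, and [gram_transfer] applies. *)
Lemma matched_isometry i j p q : domain i p -> domain j q -> matched p q ->
  exists A : 'M[R]_n, gradients f i p *m A = gradients g j q /\
    A *m metric_at j q *m A^T = metric_at i p.
Proof.
move=> ip jq pq.
have [_ [L [_ _ _ LX]]] := frame_split Ff ip; have [_ [L' [_ _ _ LX']]] := frame_split Fg jq.
have uG : metric_at j q \in unitmx.
  by apply: (mo_unit (metric_on_image j)); exact: coord_image.
have [|h1 h2] := gram_transfer LX LX' uG (G := metric_at i p); last by exists (L *m gradients g j q).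
apply/matrixP => a b.
have E (G : 'M[R]_n) (X : 'M[R]_(1 + n, n)) : (X *m G *m X^T) a b = inner G (row a X) (row b X).
  rewrite /inner -row_mul !mxE; apply: eq_bigr => c _.
  by rewrite !mxE; congr (_ * _); apply: eq_bigr => e _; rewrite !mxE.
have := hfg ip jq a b; rewrite /hform !pq => /addrI.
by rewrite !E !rowK.
Qed.

End Frames.

(** Agreement is open because N is injective near b z, and disagreement is open because T is
    Hausdorff. It identifies maps where N, in practice the values of a frame, is known to be
    injective only locally. *)
Lemma agree_on_connected (X T : topologicalType) (Z : Type) (K : set X) (a b : X -> T) (N : T -> Z) z0 :
  hausdorff_space T -> connected K -> {within K, continuous a} -> {within K, continuous b} ->
  (forall z, K z -> exists V, [/\ open V, V (b z) & forall x y, V x -> V y -> N x = N y -> x = y]) ->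
  (forall z, K z -> N (a z) = N (b z)) -> K z0 -> a z0 = b z0 ->
  forall z, K z -> a z = b z.
Proof.
move=> hT cK /within_continuous_near ca /within_continuous_near cb inj Nab Kz0 E z Kz.
apply: (@connected_ind X K (fun z => a z = b z) z0 z cK) => // {z0 Kz0 E} {}z {}Kz.
have [Eab|nE] := pselect (a z = b z).
  have [V [oV Vb iV]] := inj z Kz.
  have Va : V (a z) by rewrite Eab.
  apply: filterS2 (ca z Kz _ (open_near oV Va)) (cb z Kz _ (open_near oV Vb)) => y Ha Hb Ky.
  by split=> // _; apply: iV; [exact: Ha|exact: Hb|exact: Nab].
have hT' := hT; rewrite open_hausdorff in hT'.
have /hT' [[A B] /= [/set_mem Aa /set_mem Bb] [oA oB /eqP AB]] : a z != b z by apply/eqP.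
apply: filterS2 (ca z Kz _ (open_near oA Aa)) (cb z Kz _ (open_near oB Bb)) => y Ha Hb Ky.
split=> // Ey; exfalso; have := Ha Ky; have := Hb Ky; rewrite -Ey => h1 h2.
by have : (A `&` B) (a y) by []; rewrite AB.
Qed.

(** * Normal coordinates from solutions *)

Section Normal.
Context {R : realType} {n : nat}.
Variable M : oriented_riemannian_manifold R n.
Implicit Types (p q : M) (i j : idx M) (u v w : 'rV[R]_n) (f g : 'I_(1 + n) -> M -> R).
Variable kappa : R.
Hypothesis M_complete : geodesically_complete M.
Local Notation obata_on := (@obata_on R n M kappa).
Local Notation is_frame := (@is_frame R n M kappa).
Local Notation hform := (@hform R n M kappa).

Lemma geodesic_from i p v : domain i p -> exists gam : R -> M,
  [/\ is_geodesic gam, gam 0 = p & velocity gam 0 i = v].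
Proof.
move=> ip; have [|gam [Hg g0 gv]] := M_complete (p := p) (v := fun k => v *m coord_change i k p).
  by move=> k l kp lp; rewrite -mulmxA coord_changeM.
by exists gam; split=> //; rewrite gv// coord_change1// mulmx1.
Qed.

Lemma values_continuous f p : is_frame f -> {for p, continuous (values f)}.
Proof.
move=> [Hf _]; apply: continuous_mx => a k; rewrite ord1.
have -> : (fun q => values f q 0 k) = f k by apply/funext => q; rewrite mxE.
exact: obata_continuous (Hf k) I.
Qed.

Lemma valuesC_continuous f (C : 'M[R]_(1 + n, n)) p : is_frame f ->
  {for p, continuous (fun q => values f q *m C)}.
Proof.
move=> Ff; apply: continuous_mulmx; first exact: values_continuous.
exact: cst_continuous.
Qed.

(** [B] selects the combinations whose gradients at p are the coordinate vectors, and the inverse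
    metric compensates for the passage from gradients to differentials: [values f *m C] vanishes at
    p and has the identity as differential there. *)
Lemma normal_coordinates f i p (B : 'M[R]_(n, 1 + n)) : is_frame f -> domain i p ->
  B *m (values f p)^T = 0 -> B *m gradients f i p = 1%:M ->
  let C := B^T *m invmx (metric_at i p) in
  [/\ values f p *m C = 0,
   forall v, (\row_k inner (metric_at i p) (gradient i (f k) p) v) *m C = v &
   forall v, is_derive (coord i p) v (fun y => values f (coord_inv i y) *m C) v].
Proof.
move=> [Hf _] ip BV BX C.
have HG := metric_on_image i; have Ui : cimage i setT (coord i p) by exact: coord_image.
have uG : metric_at i p \in unitmx by exact: (mo_unit HG).
have E v : (\row_k inner (metric_at i p) (gradient i (f k) p) v) *m C = v.
  have -> : \row_k inner (metric_at i p) (gradient i (f k) p) v =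
      v *m metric_at i p *m (gradients f i p)^T.
    apply/rowP => k; rewrite mxE (mo_innerC HG)// /inner mxE [RHS]mxE.
    by apply: eq_bigr => a _; rewrite !mxE.
  rewrite /C !mulmxA -(mulmxA _ _ B^T) -trmx_mul BX trmx1 mulmx1.
  by rewrite mulmxK.
split=> //.
  by rewrite /C mulmxA -[values f p]trmxK -trmx_mul BV trmx0 mul0mx.
move=> v; have D : is_derive (coord i p) v (fun y => values f (coord_inv i y))
    (\row_k inner (metric_at i p) (gradient i (f k) p) v).
  apply/is_derive_mxP => a k; rewrite ord1 [X in is_derive _ _ _ X]mxE.
  under [X in is_derive _ _ X _]eq_fun do rewrite mxE.
  rewrite (inner_gradient v (Hf k) I ip).
  exact: is_derive_diff (rep_differentiable (Hf k) I ip).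
have := is_derive_mulmx D (is_derive_const C (coord i p) v).
by rewrite mulmx0 addr0 E.
Qed.

(** Each coordinate y solves y'' = - kappa y along a unit speed geodesic from p, with initial data 0
    and the component of v. The geodesic therefore runs on the straight line of direction v. *)
Lemma normal_geodesic f i p (C : 'M[R]_(1 + n, n)) (s c : R -> R) (gam : R -> M) :
  is_frame f -> domain i p -> values f p *m C = 0 ->
  (forall v, (\row_k inner (metric_at i p) (gradient i (f k) p) v) *m C = v) ->
  s 0 = 0 -> c 0 = 1 -> (forall t : R, is_derive t 1 s (c t)) ->
  (forall t : R, is_derive t 1 c (- kappa * s t)) ->
  is_geodesic gam -> gam 0 = p -> speed2 gam 0 = 1 ->
  forall t, values f (gam t) *m C = s t *: velocity gam 0 i.
Proof.
move=> [Hf _] ip z0 EC s0 c0 Ds Dc Hg g0 sp t; apply/rowP => l.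
set v := velocity gam 0 i.
pose d t := (\sum_k C k l * f k (gam t)) - s t * v 0 l.
pose e t := (\sum_k C k l * 'D_1 (f k \o gam) t) - c t * v 0 l.
have scal (F : R -> R) (m dF t' : R) : is_derive t' 1 F dF ->
    is_derive t' 1 (fun t => m * F t) (m * dF).
  by move=> H; have := is_derive_mulr (is_derive_const m t' 1) H; rewrite mul0r add0r.
have scalr (F : R -> R) (m dF t' : R) : is_derive t' 1 F dF ->
    is_derive t' 1 (fun t => F t * m) (dF * m).
  by move=> /(scal _ m); rewrite mulrC; under [X in is_derive _ _ X _]eq_fun do rewrite mulrC.
have Df k (t' : R) := geodesic_obata (t := t') Hg (Hf k) (some_chartP _).
have Dd (t' : R) : is_derive t' 1 d (e t').
  have A : is_derive t' 1 (fun t => \sum_k C k l * f k (gam t))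
      (\sum_k C k l * 'D_1 (f k \o gam) t').
    by apply: is_derive_sumP => k; apply: scal; have [_ []] := Df k t'.
  exact: (is_derive_sub A (scalr s (v 0 l) _ t' (Ds t'))).
have De (t' : R) : is_derive t' 1 e (- kappa * d t').
  have -> : - kappa * d t' = (\sum_k C k l * (- kappa * speed2 gam 0 * f k (gam t'))) - (- kappa * s t') * v 0 l.
    rewrite sp mulr1 /d mulrBr mulr_sumr; congr (_ - _); last by rewrite mulrA.
    by apply: eq_bigr => k _; rewrite mulrCA.
  have A : is_derive t' 1 (fun t => \sum_k C k l * 'D_1 (f k \o gam) t)
      (\sum_k C k l * (- kappa * speed2 gam 0 * f k (gam t'))).
    by apply: is_derive_sumP => k; apply: scal; have [_ []] := Df k t'.
  exact: (is_derive_sub A (scalr c (v 0 l) _ t' (Dc t'))).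
have d0 : d 0 = 0.
  rewrite /d s0 mul0r subr0 g0; have /rowP/(_ l) := z0; rewrite !mxE => E.
  by rewrite -[RHS]E; apply: eq_bigr => k _; rewrite mxE mulrC.
have e0 : e 0 = 0.
  rewrite /e c0 mul1r; apply/eqP; rewrite subr_eq0; apply/eqP.
  have /rowP/(_ l) := EC v; rewrite mxE => <-; apply: eq_bigr => k _.
  have ip' : domain i (gam 0) by rewrite g0.
  by have [-> _] := geodesic_obata Hg (Hf k) ip'; rewrite mxE mulrC g0.
have := harmonic_unique t Dd De d0 e0; rewrite /d => /eqP; rewrite subr_eq0 => /eqP E.
by rewrite [RHS]mxE -E mxE; apply: eq_bigr => k _; rewrite mxE mulrC.
Qed.

Lemma normal_nbhd f p : is_frame f -> exists (r : R) (C : 'M[R]_(1 + n, n)) (U : set M) (H : 'rV[R]_n -> M),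
  [/\ 0 < r, open U, U p & values f p *m C = 0] /\
  (forall q, U q -> ball 0 r (values f q *m C) /\ H (values f q *m C) = q) /\
  forall y, ball 0 r y -> [/\ U (H y), values f (H y) *m C = y, {for y, continuous H} &
    exists (gam : R -> M) (theta : R -> R), [/\ is_geodesic gam, {within itv01, continuous theta} &
      forall t, itv01 t -> H (t *: y) = gam (theta t)]].
Proof.
move=> Ff; set i := some_chart p; have ip : domain i p := some_chartP p.
have [_ [B [_ _ BV BX]]] := frame_split Ff ip.
have [z0 EC DC] := normal_coordinates Ff ip BV BX.
move: (B^T *m _) z0 EC DC => C z0 EC DC {B BV BX}.
have HG := metric_on_image i; have Ui : cimage i setT (coord i p) by exact: coord_image.
pose NC y := values f (coord_inv i y) *m C.
have NC0 : NC (coord i p) = 0 by rewrite /NC coordK.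
have sNC (j : 'I_n) : Ck 1 (cimage i setT) (fun y => NC y 0 j).
  apply: Ck_mulmx; [exact: image_openT| |by move=> *; apply: Ck_cst].
  move=> a k; rewrite ord1.
  have -> : (fun y => values f (coord_inv i y) 0 k) = rep i (f k).
    by apply/funext => y; rewrite mxE.
  have Hk y : cimage i setT y -> obata kappa (metric i) (rep i (f k)) y.
    by move=> [q [iq _] <-]; exact: Ff.1.
  exact: ((obata_smooth HG (@image_openT _ _ _ i) (@subset_refl _ _) Hk).1 1%N).
have dNC : differentiable NC (coord i p).
  apply: differentiable_mx => a j; rewrite ord1.
  exact: C1_differentiable (@image_openT _ _ _ i) (sNC j) Ui.
have uJ : 'J NC (coord i p) \in unitmx.
  suff -> : 'J NC (coord i p) = 1%:M by exact: unitmx1.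
  apply: eq_mx_mull => v; rewrite mul_jacobian mulmx1.
  exact: is_derive_unique (is_derive_diff v dNC) (DC v).
have [gI [r0 [rho [[r00 rho0] r0U inj gIP gIc]]]] := inverse_function (@image_openT _ _ _ i) sNC Ui uJ.
rewrite NC0 in gIP gIc.
have [s [c [s0 c0 Ds Dc]]] := sn_exists kappa.
have [l [sig [l0 sig0 csig sigP]]] := sn_inverse s0 c0 Ds (deriv_continuous Dc).
pose G := metric_at i p.
have cG : {for (0 : 'rV[R]_n), continuous (fun y => inner G y y)}.
  apply: (@Ck_continuous _ _ 0 setT) => //; first exact: openT.
  have -> : (fun y => inner G y y) = fun y => \sum_a \sum_b y 0 a * G a b * y 0 b.
    by apply/funext => y; exact: inner_sum.
  apply: Ck_sum => [|a _]; first exact: openT.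
  apply: Ck_sum => [|b _]; first exact: openT.
  by apply: CkM; [exact: openT|apply: CkM; [exact: openT|exact/Ck_coord/openT|exact/Ck_cst]|exact/Ck_coord/openT].
have nG : \forall y \near (0 : 'rV[R]_n), inner G y y < l ^+ 2.
  by apply: (cG [set x | x < l ^+ 2]); apply: lt_nbhsl; rewrite inner0l exprn_gt0.
have /nbhs_ballP[r1 /= r10 Hr1] := nG.
(* Within [rho] the coordinates are invertible; within [r1] the metric length of y is below l, so
   that [sig] inverts s along the whole ray. *)
pose r := Num.min rho r1.
have r_gt0 : 0 < r by rewrite lt_min rho0.
have brho (y : 'rV[R]_n) : ball 0 r y -> ball 0 rho y by apply: le_ball; rewrite ge_min lexx.
have br1 y : ball 0 r y -> inner G y y < l ^+ 2.
  by move=> yr; apply: Hr1; apply: le_ball yr; rewrite ge_min lexx orbT.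
pose U := chart_ball i p r0 `&` [set q | ball 0 r (values f q *m C)].
pose H := coord_inv i \o gI.
have oU : open U.
  apply: openI; first exact: chart_ball_open.
  rewrite openE => q bq; suff : \forall q' \near q, ball 0 r (values f q' *m C) by [].
  exact: (valuesC_continuous Ff (open_near (ball_open _ _) bq)).
have HP y : ball 0 r y -> [/\ U (H y), values f (H y) *m C = y & coord i (H y) = gI y].
  move=> yr; have [b1 E1] := gIP y (@brho y yr).
  have /imageP[_ iy _ Ey] := r0U _ b1.
  by split=> //; split; [split=> //=; rewrite Ey|rewrite /= [values _ _ *m _]E1].
have cH y : ball 0 r y -> {for y, continuous H}.
  move=> yr; apply: (continuous_comp (gIc y (@brho y yr))); apply: coord_inv_continuous.
  by have [b1 _] := gIP y (@brho y yr); exact: r0U.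
exists r, C, U, H; split; [|split].
- by split=> //; split; [split=> //; exact: ballxx|rewrite /= z0; exact: ballxx].
- move=> q [[iq bq] /= rq]; split=> //; rewrite /H/=.
  have [b1 E1] := gIP _ (@brho _ rq).
  have -> : gI (values f q *m C) = coord i q by apply: inj => //; rewrite E1 /NC coordK.
  exact: coordK.
- move=> y yr; have [h1 h2 h3] := @HP y yr; split=> //; first exact: cH.
  have H0 : H 0 = p.
    have b0 : ball (0 : 'rV[R]_n) r 0 by exact: ballxx.
    have [_ E0 _] := @HP 0 b0; have [b1 E1] := gIP _ (@brho _ b0).
    have -> : p = coord_inv i (coord i p) by rewrite coordK.
    by congr coord_inv; apply: inj => //; [exact: ballxx|rewrite E1 NC0].
  have [->|y0] := eqVneq y 0.
    have [gam [Hg g0 _]] := geodesic_from 0 ip.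
    exists gam, (fun=> 0); split=> //.
      by apply: continuous_subspaceT => t; exact: cst_continuous.
    by move=> t _; rewrite scaler0 H0 g0.
  have Gy : 0 < inner G y y by apply: (mo_pos HG).
  pose lam := Num.sqrt (inner G y y).
  have lam0 : 0 < lam by rewrite sqrtr_gt0.
  have laml : lam <= l.
    by rewrite -(ler_pXn2r (n := 2))// ?nnegrE ?ltW// sqr_sqrtr ?ltW//; exact: br1.
  (* The unit speed geodesic in the direction of y has coordinates s(t) y / lam, so the parameter
     theta with s(theta(t)) = lam t brings it to t y. *)
  have [gam [Hg g0 gv]] := geodesic_from (lam^-1 *: y) ip.
  have sp : speed2 gam 0 = 1.
    rewrite (speed2E (i := i) Hg) ?g0// gv innerZl innerZr -/G mulrA -expr2.
    by rewrite -[inner G y y]sqr_sqrtr ?ltW// -/lam exprVn mulVf// expf_neq0// gt_eqF.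
  have NG := normal_geodesic Ff ip z0 EC s0 c0 Ds Dc Hg g0 sp.
  have lt01 t : itv01 t -> lam * t \in `[0, l].
    rewrite /itv01/= !in_itv/= => /andP[t0 t1]; rewrite mulr_ge0//= ?(ltW lam0)//.
    by apply: le_trans laml; rewrite ler_piMr// ltW.
  have cth : {within itv01, continuous (sig \o (fun t => lam * t))}.
    apply: (@within_continuous_comp _ _ _ itv01 `[0, l]%classic) csig => //.
    by move=> t; exact: (@scaler_continuous R R^o lam t).
  exists gam, (sig \o (fun t => lam * t)); split=> // t t01; apply/esym.
  have rt t' : itv01 t' -> ball 0 r (t' *: y).
    rewrite /itv01/= in_itv/= => t'01.
    have b0 : ball (0 : 'rV[R]_n) r 0 by exact: ballxx.
    by have := ball_segment t'01 b0 yr; rewrite add0r subr0.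
  (* Equal coordinates do not yet identify the two curves, since the coordinates are injective on U
     only; the common start and injectivity around H (t y) do. *)
  apply: (@agree_on_connected R M _ itv01 (gam \o (sig \o (fun t => lam * t)))
    (fun t => H (t *: y)) (fun q => values f q *m C) 0) => //.
  + exact: hausdorff_carrier.
  + exact: connected_itv01.
  + apply/within_continuous_near => z Kz Q HQ.
    have /within_continuous_near cth' := cth.
    exact: cth' z Kz _ (Hg.1 _ _ HQ).
  + apply: continuous_in_subspaceT => t'; rewrite inE => /rt/cH ch.
    have c1 : {for t', continuous (fun t : R => t *: y)} by exact: scalel_continuous.
    exact: (continuous_comp c1 ch).
  + move=> z /rt bz; exists U; have [h _ _] := @HP _ bz; split=> //.
    move=> q q' [[iq bq] /= rq] [[iq' bq'] /= rq'] E.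
    by rewrite -(coordK iq) -(coordK iq'); congr coord_inv; apply: inj => //; rewrite /NC !coordK.
  + move=> z z01; have [_ -> _] := @HP _ (@rt z z01).
    rewrite /= NG sigP; last exact: lt01.
    by rewrite gv scalerA mulrAC mulfV ?mul1r// gt_eqF.
  + exact: itv01_0.
  + by rewrite /= mulr0 sig0 g0 scale0r H0.
Qed.

Variables f g : 'I_(1 + n) -> M -> R.
Hypotheses (Ff : is_frame f) (Fg : is_frame g).
Hypothesis hfg : forall i j p q, domain i p -> domain j q ->
  forall a b, hform i (f a) (f b) p = hform j (g a) (g b) q.
Local Notation matched := (matched f g).

(** The geodesic from q with velocity transported by the isometry of gradients has the same speed.
    Along the two curves f_k and g_k solve the same oscillator equation with the same data at a, so
    they match for all times, which completeness makes available. *)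
Lemma matched_geodesic (gam : R -> M) (a : R) q : is_geodesic gam -> matched (gam a) q ->
  exists gam' : R -> M, [/\ continuous gam', gam' a = q & forall t, matched (gam t) (gam' t)].
Proof.
move=> Hg mq; set i := some_chart (gam a); set j := some_chart q.
have ip : domain i (gam a) := some_chartP _; have jq : domain j q := some_chartP _.
have [A [XA AA]] := matched_isometry Ff Fg hfg ip jq mq.
set v := velocity gam a i.
have [gam0 [Hg0 g0 gv]] := geodesic_from (v *m A) jq.
have sp : speed2 gam 0 = speed2 gam0 0.
  have j0 : domain j (gam0 0) by rewrite g0.
  rewrite (speed2_cst 0 a Hg) (speed2E Hg ip) (speed2E Hg0 j0) gv g0 inner_mulmx AA.
  by [].
exists (fun t => gam0 (1 * t + (- a))); split.
- move=> t; have c1 : {for t, continuous (fun t : R => 1 * t + (- a))}.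
    apply: continuousD; last exact: cst_continuous.
    by apply: continuousM; [exact: cst_continuous|exact: cvg_id].
  exact: (continuous_comp c1 (Hg0.1 _)).
- by rewrite mul1r subrr.
move=> t k; pose d t := f k (gam t) - g k (gam0 (1 * t + (- a))).
pose e t := 'D_1 (f k \o gam) t - 1 * 'D_1 (g k \o gam0) (1 * t + (- a)).
have Of (s : R) := geodesic_obata (t := s) Hg (Ff.1 k) (some_chartP _).
have Og (s : R) := geodesic_obata (t := s) Hg0 (Fg.1 k) (some_chartP _).
have Dd (s : R) : is_derive s 1 d (e s).
  apply: is_derive_sub; first by have [_ []] := Of s.
  by apply: (@is_derive_affine _ (g k \o gam0)); have [_ []] := Og (1 * s + (- a)).
have De (s : R) : is_derive s 1 e (- kappa * speed2 gam 0 * d s).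
  have -> : - kappa * speed2 gam 0 * d s = - kappa * speed2 gam 0 * f k (gam s) -
      1 * (1 * (- kappa * speed2 gam0 0 * g k (gam0 (1 * s + - a)))).
    by rewrite -sp /d !mul1r mulrBr.
  apply: is_derive_sub; first by have [_ []] := Of s.
  have : is_derive s 1 (fun t => 'D_1 (g k \o gam0) (1 * t + - a))
      (1 * (- kappa * speed2 gam0 0 * g k (gam0 (1 * s + - a)))).
    by apply: (@is_derive_affine _ (fun t => 'D_1 (g k \o gam0) t)); have [_ []] := Og (1 * s + (- a)).
  move=> H; have := is_derive_mulr (is_derive_const (1 : R) s 1) H; rewrite mul0r add0r.
  exact.
have d0 : d a = 0 by rewrite /d mul1r subrr g0 mq subrr.
have e0 : e a = 0.
  rewrite /e mul1r mul1r subrr; have j0 : domain j (gam0 0) by rewrite g0.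
  have [-> _] := geodesic_obata Hg (Ff.1 k) ip; have [-> _] := geodesic_obata Hg0 (Fg.1 k) j0.
  rewrite gv g0 -/v; have /row_matrixP/(_ k) := XA; rewrite row_mul !rowK => <-.
  by rewrite inner_mulmx AA /inner subrr.
by have := harmonic_unique t Dd De d0 e0; rewrite /d mul1r => /eqP; rewrite subr_eq0 => /eqP ->.
Qed.

End Normal.

(** * The covering defined by equality of values *)

Section Development.
Context {R : realType} {n : nat}.
Variable M : oriented_riemannian_manifold R n.
Implicit Types (p q : M) (i j : idx M) (u v w : 'rV[R]_n) (f g : 'I_(1 + n) -> M -> R).
Variable kappa : R.
Hypothesis M_complete : geodesically_complete M.
Local Notation is_frame := (@is_frame R n M kappa).
Local Notation hform := (@hform R n M kappa).

Lemma values_injective_near f p : is_frame f -> exists V,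
  [/\ open V, V p & forall q q', V q -> V q' -> values f q = values f q' -> q = q'].
Proof.
move=> Ff; have [r [C [U [H [[r0 oU Up z0] [HU _]]]]]] := normal_nbhd M_complete p Ff.
exists U; split=> // q q' /HU[_ E] /HU[_ E'] V.
by rewrite -E -E' V.
Qed.

Variables f g : 'I_(1 + n) -> M -> R.
Hypotheses (Ff : is_frame f) (Fg : is_frame g).
Hypothesis hfg : forall i j p q, domain i p -> domain j q ->
  forall a b, hform i (f a) (f b) p = hform j (g a) (g b) q.
Local Notation matched := (matched f g).

Lemma matchedE p q : matched p q <-> values g q = values f p.
Proof.
split=> [H|/rowP H k]; first by apply/rowP => k; rewrite !mxE.
by have := H k; rewrite !mxE.
Qed.

Let Sec (U : set M) (s : M -> M) := [/\ open U, forall q, U q -> {for q, continuous s} &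
  forall q, U q -> matched q (s q)].

Lemma sections_agree U V s s' p : Sec U s -> Sec V s' -> U p -> V p ->
  \forall q \near p, s q = s' q <-> s p = s' p.
Proof.
move=> [oU cs ms] [oV cs' ms'] Up Vp.
have nU := open_near oU Up; have nV := open_near oV Vp.
have [E|nE] := pselect (s p = s' p).
  have [W [oW Wp iW]] := values_injective_near (s' p) Fg.
  have h1 : \forall q \near p, W (s q) by apply: (cs p Up); rewrite E; exact: open_near.
  have h2 : \forall q \near p, W (s' q) by apply: (cs' p Vp); exact: open_near.
  have h12 : \forall q \near p, W (s q) /\ W (s' q) by apply: filterS2 h1 h2.
  have hUV : \forall q \near p, U q /\ V q by apply: filterS2 nU nV.
  apply: filterS2 h12 hUV => q [Ws Ws'] [Uq Vq]; split=> // _; apply: iW => //.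
  have /matchedE -> := ms q Uq; have /matchedE -> := ms' q Vq.
  by [].
have hT := @hausdorff_carrier _ _ M; rewrite open_hausdorff in hT.
have /hT[[A B] /= [/set_mem Aa /set_mem Bb] [oA oB /eqP AB]] : s p != s' p by apply/eqP.
have h1 : \forall q \near p, A (s q) by apply: (cs p Up); exact: open_near.
have h2 : \forall q \near p, B (s' q) by apply: (cs' p Vp); exact: open_near.
apply: filterS2 h1 h2 => q Aq Bq; split=> // E; exfalso.
have : (A `&` B) (s q) by split=> //; rewrite E.
by rewrite AB.
Qed.

Lemma ray_lift (H : 'rV[R]_n -> M) (gam : R -> M) (theta : R -> R) (y : 'rV[R]_n) (t0 : R) q :
  is_geodesic gam -> {within itv01, continuous theta} ->
  (forall t, itv01 t -> H (t *: y) = gam (theta t)) -> itv01 t0 -> matched (H (t0 *: y)) q ->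
  exists e : R -> M, [/\ {within itv01, continuous e}, e t0 = q &
    forall t, itv01 t -> matched (H (t *: y)) (e t)].
Proof.
move=> Hg ct Ht t01; rewrite Ht// => /(matched_geodesic M_complete Ff Fg hfg Hg)[gam' [cg g'0 mg]].
exists (gam' \o theta); split=> //; last by move=> t t1; rewrite Ht//; exact: mg.
apply/within_continuous_near => z Kz Q HQ.
by have /within_continuous_near ct' := ct; exact: ct' z Kz _ (cg _ _ HQ).
Qed.

Lemma ray_continuous (H : 'rV[R]_n -> M) (r : R) (y : 'rV[R]_n) :
  (forall y, ball 0 r y -> {for y, continuous H}) -> ball 0 r y ->
  {within itv01, continuous (fun t => H (t *: y))}.
Proof.
move=> cH yr; apply: continuous_in_subspaceT => t; rewrite inE /itv01/= in_itv/= => t01.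
have r0 : 0 < r by apply: le_lt_trans (normr_ge0 _) _; move: yr; rewrite -ball_normE/= => yr; exact: yr.
have bt : ball 0 r (t *: y).
  have b0 : ball (0 : 'rV[R]_n) r 0 by exact: ballxx.
  by have := ball_segment t01 b0 yr; rewrite add0r subr0.
have c1 : {for t, continuous (fun t : R => t *: y)} by exact: scalel_continuous.
exact: (continuous_comp c1 (cH _ bt)).
Qed.

Lemma ball0_scale (r t : R) (y : 'rV[R]_n) : ball 0 r y -> 0 <= t <= 1 -> ball 0 r (t *: y).
Proof.
move=> yr t01.
have r0 : 0 < r by apply: le_lt_trans (normr_ge0 _) _; move: yr; rewrite -ball_normE/= => yr; exact: yr.
have b0 : ball (0 : 'rV[R]_n) r 0 by exact: ballxx.
by have := ball_segment t01 b0 yr; rewrite add0r subr0.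
Qed.

(** The candidate is read off in normal coordinates at q. Since [C'] retains only n combinations of
    the 1 + n values, matching is not automatic: it is checked along rays, where the lift by a
    geodesic has the same coordinates and hence coincides with the candidate. *)
Lemma local_section p q : matched p q -> exists U s, [/\ Sec U s, U p & s p = q].
Proof.
move=> mpq.
have [r [C [U [H [[r0 oU Up z0] [HU HB]]]]]] := normal_nbhd M_complete p Ff.
have [r' [C' [U' [H' [[r'0 oU' Uq z0'] [HU' HB']]]]]] := normal_nbhd M_complete q Fg.
have H0 : H 0 = p by have [_] := HU p Up; rewrite z0.
have H0' : H' 0 = q by have [_] := HU' q Uq; rewrite z0'.
have zp : values f p *m C' = 0 by have /matchedE <- := mpq.
have cH y : ball (0 : 'rV[R]_n) r y -> {for y, continuous H} by move=> /HB[].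
have cH' y : ball (0 : 'rV[R]_n) r' y -> {for y, continuous H'} by move=> /HB'[].
have b0 : ball (0 : 'rV[R]_n) r 0 by exact: ballxx.
have cN (C0 : 'M[R]_(1 + n, n)) x := @valuesC_continuous R n M kappa f C0 x Ff.
have : \forall y \near (0 : 'rV[R]_n), ball 0 r' (values f (H y) *m C').
  have c2 : {for H 0, continuous (fun x => values f x *m C')} by exact: cN.
  apply: (continuous_comp (cH 0 b0) c2); rewrite /= H0 zp; exact: nbhsx_ballx.
move=> /nbhs_ballP[r1 /= r10 Hr1].
pose r2 := Num.min r r1.
have r20 : 0 < r2 by rewrite lt_min r0.
have b2 (y : 'rV[R]_n) : ball 0 r2 y -> ball 0 r y by apply: le_ball; rewrite ge_min lexx.
have b2' (y : 'rV[R]_n) : ball 0 r2 y -> ball 0 r' (values f (H y) *m C').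
  by move=> yb; apply: Hr1; apply: le_ball yb; rewrite ge_min lexx orbT.
pose s x := H' (values f x *m C').
pose W := U `&` [set x | ball 0 r2 (values f x *m C)].
have oW : open W.
  apply: openI => //; rewrite openE => x bx.
  suff : \forall x' \near x, ball 0 r2 (values f x' *m C) by [].
  exact: (cN C x _ (open_near (ball_open _ _) bx)).
exists W, s; split; last first.
- by rewrite /s zp.
- by split=> //=; rewrite z0; exact: ballxx.
have bW x : W x -> ball 0 r' (values f x *m C').
  by move=> [Ux /= bx]; have [_ E] := HU x Ux; have := b2' _ bx; rewrite E.
split=> // x Wx.
  by apply: (continuous_comp (cN C' x)); apply: cH'; exact: bW.
have [Ux /= bx] := Wx; have [_ E] := HU x Ux; set y := values f x *m C in bx E.
have [_ _ _ [gam [theta [Hg ct Ht]]]] := HB y (@b2 _ bx).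
have mp : matched (H (0 *: y)) q by rewrite scale0r H0.
have [e [ce e0 me]] := ray_lift Hg ct Ht itv01_0 mp.
have bt t : itv01 t -> ball 0 r2 (t *: y).
  by rewrite /itv01/= in_itv/= => t01; exact: ball0_scale.
have Ee : e 1 = s (H (1 *: y)).
  apply: (@agree_on_connected R M _ itv01 e (fun t => s (H (t *: y))) (fun z => values g z *m C') 0) => //.
  - exact: hausdorff_carrier.
  - exact: connected_itv01.
  - apply: continuous_in_subspaceT => t; rewrite inE => t01.
    have c1 : {for t, continuous (fun t : R => t *: y)} by exact: scalel_continuous.
    have c2 := continuous_comp c1 (cH _ (b2 _ (bt t t01))).
    have c3 := continuous_comp c2 (cN C' _).
    exact: (continuous_comp c3 (cH' _ (b2' _ (bt t t01)))).
  - move=> t t01; exists U'; have [h _ _ _] := HB' _ (b2' _ (bt t t01)); split=> //.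
    by move=> a a' /HU'[_ Ea] /HU'[_ Ea'] Eaa; rewrite -Ea -Ea' Eaa.
  - move=> t t01; have [_ -> _ _] := HB' _ (b2' _ (bt t t01)).
    by have /matchedE -> := me t t01.
  - exact: itv01_0.
  - by rewrite e0 scale0r H0 /s zp.
  - exact: itv01_1.
by have := me 1 itv01_1; rewrite Ee scale1r E.
Qed.

(** A continuous matched map follows local sections, because [values g] is injective near each of
    its values. *)
Lemma matched_lift (X : topologicalType) (K : set X) (h e : X -> M) :
  {within K, continuous h} -> {within K, continuous e} -> (forall z, K z -> matched (h z) (e z)) ->
  lift_on Sec K h e.
Proof.
move=> /within_continuous_near ch /within_continuous_near ce me z Kz.
have [U [s [Us Uh sz]]] := local_section (me z Kz).
exists U, s; split=> //; have [oU cs ms] := Us.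
have [W [oW We iW]] := values_injective_near (e z) Fg.
have Ws : \forall x \near h z, W (s x) by apply: (cs _ Uh); rewrite sz; exact: open_near.
have nh : \forall x \near h z, U x /\ W (s x) by apply: filterS2 (open_near oU Uh) Ws.
have h1 := ch z Kz _ nh.
apply: filterS2 h1 (ce z Kz _ (open_near oW We)) => y H1 H2 Ky.
have [Uy Wy] := H1 Ky; apply: iW => //; first exact: H2.
have /matchedE -> := me y Ky; have /matchedE -> := ms _ Uy.
by [].
Qed.

(** Unlike the neighbourhood in [local_section], U must serve for all q in U and all e matched with
    q. A section over all of U is built by lifting along the rays from p; completeness makes every
    ray liftable to its end. *)
Lemma section_cover p : exists U, [/\ open U, U p,
  forall q e, U q -> matched q e -> exists2 s, Sec U s & s q = e &
  forall q r, U q -> U r -> exists gam : R -> M,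
    [/\ {within itv01, continuous gam}, gam 0 = q, gam 1 = r &
        forall t, itv01 t -> U (gam t)]].
Proof.
have [r [C [U [H [[r0 oU Up z0] [HU HB]]]]]] := normal_nbhd M_complete p Ff.
have cH y : ball (0 : 'rV[R]_n) r y -> {for y, continuous H} by move=> /HB[].
exists U; split=> //; last first.
  move=> q q' Uq Uq'; have [bq Eq] := HU q Uq; have [bq' Eq'] := HU q' Uq'.
  set y := values f q *m C in bq Eq; set y' := values f q' *m C in bq' Eq'.
  pose l (t : R) := y + t *: (y' - y).
  have lb t : itv01 t -> ball 0 r (l t).
    by rewrite /itv01/= in_itv/= => t01; exact: ball_segment.
  exists (H \o l); split.
  - apply: continuous_in_subspaceT => t; rewrite inE => /lb/cH ch.
    have cl : {for t, continuous l}.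
      apply: differentiable_continuous; apply/derivable1_diffP.
      by have [] := is_derive_line y (y' - y) t.
    exact: (continuous_comp cl ch).
  - by rewrite /= /l scale0r addr0.
  - by rewrite /= /l scale1r addrC subrK.
  - by move=> t /lb/HB[].
move=> q e Uq mq; have [bq Eq] := HU q Uq; set y := values f q *m C in bq Eq.
have [_ _ _ [gam [theta [Hg ct Ht]]]] := HB y bq.
have m1 : matched (H (1 *: y)) e by rewrite scale1r Eq.
(* The ray through q is lifted from its end value e back to the centre; all rays are then lifted
   from [ep 0], and uniqueness along this one returns e at q. *)
have [ep [cep ep1 mep]] := ray_lift Hg ct Ht itv01_1 m1.
pose K : set 'rV[R]_n := ball 0 r.
have starK z t : K z -> 0 <= t <= 1 -> K (t *: z) by exact: ball0_scale.
have cHK : {within K, continuous H}.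
  by apply: continuous_in_subspaceT => z; rewrite inE; exact: cH.
have K0 : K 0 by exact: ballxx.
have lift_ray z e' : K z -> {within itv01, continuous e'} ->
    (forall t, itv01 t -> matched (H (t *: z)) (e' t)) -> lift_on Sec itv01 (fun t => H (t *: z)) e'.
  by move=> Kz ce' me'; apply: matched_lift => //; exact: ray_continuous cH Kz.
have [||E lE E0] := @star_lift R M M Sec _ sections_agree 'rV[R]_n K H (ep 0) starK cHK.
- by move=> V s [].
- move=> z Kz; have [_ _ _ [gam' [theta' [Hg' ct' Ht']]]] := HB z Kz.
  have m0 : matched (H (0 *: z)) (ep 0).
    by have := mep 0 itv01_0; rewrite !scale0r.
  have [e' [ce' e'0 me']] := ray_lift Hg' ct' Ht' itv01_0 m0.
  by exists e' => //; exact: lift_ray.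
pose s x := E (values f x *m C).
have cE z : K z -> {for z, continuous E}.
  move=> Kz; have [V [s' [[oV cs' ms'] VH He]]] := lE z Kz.
  have c := continuous_comp (cH z Kz) (cs' _ VH).
  have EE : \forall x \near z, (s' \o H) x = E x.
    apply: filterS2 He (open_near (ball_open _ _) Kz : \forall x \near z, K x) => x h Kx.
    by rewrite h.
  move=> A; rewrite -(nbhs_singleton EE) => /c h.
  have {}h : \forall x \near z, A ((s' \o H) x) := h.
  by apply: filterS2 EE h => x Ex Ax; rewrite /= -Ex.
exists s.
  split=> //.
    move=> x Ux; have [bx _] := HU x Ux.
    exact: (continuous_comp (@valuesC_continuous R n M kappa f C x Ff) (cE _ bx)).
  move=> x Ux; have [bx Ex] := HU x Ux.
  have [V [s' [[oV cs' ms'] VH He]]] := lE _ bx.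
  by rewrite /s (nbhs_singleton He bx) -{1}Ex; exact: ms'.
rewrite /s -/y -[y]scale1r -ep1.
have sc (t : R) : itv01 t -> K (t *: y).
  by rewrite /itv01/= in_itv/= => t01; exact: ball0_scale.
apply: (@lift_unique M M Sec sections_agree R itv01 (fun t => H (t *: y)) (fun t => E (t *: y)) ep 0 1) => //.
- exact: connected_itv01.
- exact: ray_continuous cH bq.
- by apply: (lift_comp _ sc lE) => t; exact: scalel_continuous.
- exact: lift_ray.
- exact: itv01_0.
- exact: itv01_1.
- by rewrite scale0r E0.
Qed.

Hypothesis M_connected : connected [set: M].
Hypothesis M_simply_connected : simply_connected M.

Theorem developing_map p0 q0 : matched p0 q0 -> exists iota : M -> M,
  [/\ continuous iota, iota p0 = q0 & forall p, matched p (iota p)].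
Proof.
move=> m0; have [||||iota [i0 Hi]] := @global_section R M M matched Sec _ _ _ _ p0 q0 m0
  M_simply_connected M_connected.
- by move=> U s [].
- by move=> U s p [_ _ h]; exact: h.
- exact: sections_agree.
- exact: section_cover.
exists iota; split=> //.
  move=> p; have [U [s [oU [_ cs _] Up E]]] := Hi p.
  have EE : \forall x \near p, s x = iota x by apply: filterS (open_near oU Up) => x /E.
  move=> A; rewrite -(nbhs_singleton EE) => /(cs p Up) h.
  have {}h : \forall x \near p, A (s x) := h.
  by apply: filterS2 EE h => x Ex Ax; rewrite /= -Ex.
by move=> p; have [U [s [oU [_ _ ms] Up E]]] := Hi p; rewrite E//; exact: ms.
Qed.

End Development.

Lemma sign_near {R : realType} (T : topologicalType) (d : T -> R) z :
  {for z, continuous d} -> d z != 0 -> \forall y \near z, (0 < d y) = (0 < d z).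
Proof.
move=> cd; case: (ltgtP 0 (d z)) => [h _|h _|//].
  by apply: (cd [set x | (0 < x) = true]); exact: lt_nbhsr.
apply: (cd [set x | (0 < x) = false]).
have hn : \forall x \near d z, x < 0 by exact: lt_nbhsl.
by apply: filterS hn => x x0; rewrite /= ltNge (ltW x0).
Qed.

(** * Smoothness, orientation and invertibility of the developing map *)

Section Isometry.
Context {R : realType} {n : nat}.
Variable M : oriented_riemannian_manifold R n.
Implicit Types (p q : M) (i j : idx M) (u v w : 'rV[R]_n) (f g : 'I_(1 + n) -> M -> R).
Variable kappa : R.
Hypothesis M_complete : geodesically_complete M.
Local Notation is_frame := (@is_frame R n M kappa).
Local Notation hform := (@hform R n M kappa).

Local Opaque jacobian.

Section Smooth.
Variables f g : 'I_(1 + n) -> M -> R.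
Hypotheses (Ff : is_frame f) (Fg : is_frame g).
Hypothesis hfg : forall i j p q, domain i p -> domain j q ->
  forall a b, hform i (f a) (f b) p = hform j (g a) (g b) q.
Local Notation matched := (matched f g).

Lemma gradients_inj i p (A B : 'M[R]_n) : domain i p ->
  gradients f i p *m A = gradients f i p *m B -> A = B.
Proof.
move=> ip; have [_ [L [_ _ _ LX]]] := frame_split Ff ip => /(congr1 (mulmx L)).
by rewrite !mulmxA LX !mul1mx.
Qed.

Variable iota : M -> M.
Hypotheses (ci : continuous iota) (mi : forall p, matched p (iota p)).
Local Notation lrep := (local_rep iota).

Lemma lrep_near i j p : domain i p -> domain j (iota p) ->
  \forall y \near coord i p, [/\ domain i (coord_inv i y), domain j (iota (coord_inv i y)) &
    coord i (coord_inv i y) = y].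
Proof.
move=> ip jq; have oj : open (iota @^-1` domain j).
  by apply: open_comp => [x _|]; [exact: ci|exact: domain_open].
have ojp : (iota @^-1` domain j) p by [].
apply: filterS (open_near (@image_open _ _ _ i _ oj) (coord_image ip ojp)) => y /imageP[_ h1 h2 h3].
by split.
Qed.

Lemma lrepE i j p : domain i p -> lrep i j (coord i p) = coord j (iota p).
Proof. by move=> ip; rewrite /local_rep /= [phi_inv _ _]coordK. Qed.

Lemma lrep_diff i j p : domain i p -> domain j (iota p) ->
  [/\ differentiable (lrep i j) (coord i p),
     gradients f i p *m 'J (lrep i j) (coord i p) = gradients g j (iota p) &
     'J (lrep i j) (coord i p) *m metric_at j (iota p) *m ('J (lrep i j) (coord i p))^T
      = metric_at i p].
Proof.
move=> ip jq; set h := lrep i j; set x := coord i p.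
have hx : h x = coord j (iota p) by exact: lrepE.
have [_ [B [_ _ BV BX]]] := frame_split Fg jq.
have [_ EC DC] := normal_coordinates Fg jq BV BX.
move: (B^T *m _) EC DC => C EC DC.
have dV (F : 'I_(1 + n) -> M -> R) k q : is_frame F -> domain k q ->
    differentiable (fun y => values F (coord_inv k y) *m C) (coord k q).
  move=> [HF _] kq; apply: differentiable_mx => a l; rewrite ord1.
  have -> : (fun y => (values F (coord_inv k y) *m C) 0 l) =
      \sum_b (C b l *: rep k (F b)).
    apply/funext => y; rewrite fct_sumE mxE; apply: eq_bigr => b _.
    by rewrite mxE mulrC.
  apply: differentiable_sum => b; apply: differentiableZ.
  exact: rep_differentiable (HF b) I kq.
have J1 : 'J (fun y => values g (coord_inv j y) *m C) (h x) = 1%:M.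
  apply: eq_mx_mull => v; rewrite mul_jacobian mulmx1 hx.
  exact: is_derive_unique (is_derive_diff v (dV g j _ Fg jq)) (DC v).
have near := lrep_near ip jq.
have ch : {for x, continuous h}.
  have c1 := @coord_inv_continuous _ _ _ i x (coord_image ip I).
  have ci' : {for coord_inv i x, continuous iota} by exact: ci.
  have c2 := continuous_comp c1 ci'.
  apply: (continuous_comp c2); rewrite /= coordK//; exact: coord_continuous.
have [||||dh _] := @implicit_diff R n n h (fun y => values g (coord_inv j y) *m C)
   (fun y => values f (coord_inv i y) *m C) x ch.
- by rewrite hx; exact: dV Fg jq.
- by rewrite J1 unitmx1.
- exact: dV Ff ip.
- apply: filterS near => y [iy jy Ey]; rewrite /h /local_rep /=.
  rewrite [coord_inv j (phi _ _)]coordK//.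
  by have /matchedE -> := mi (coord_inv i y).
have [A [XA AA]] := matched_isometry Ff Fg hfg ip jq (mi p).
suff -> : 'J h x = A by split.
apply: eq_mx_mull => v; apply/eqP; rewrite -subr_eq0; apply/eqP.
have uG : metric_at j (iota p) \in unitmx.
  by apply: (mo_unit (metric_on_image j)); exact: coord_image.
apply: (inner_eq0 uG) => w; rewrite (mo_innerC (metric_on_image j)); last exact: coord_image.
rewrite -/(metric_at j (iota p)).
have -> : w = w *m B *m gradients g j (iota p) by rewrite -mulmxA BX mulmx1.
(* The gradients of the g_k span, so the Jacobian and A are compared by testing against them; both
   sides are the derivative of f_k = g_k o iota. *)
have E0 k : inner (metric_at j (iota p)) (row k (gradients g j (iota p))) (v *m 'J h x - v *m A) = 0.
  rewrite innerBr rowK mul_jacobian; apply/eqP; rewrite subr_eq0; apply/eqP.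
  have -> : gradient j (g k) (iota p) = gradient i (f k) p *m A.
    by rewrite -[LHS](rowK (fun k => gradient j (g k) (iota p))) -/(gradients g j (iota p)) -XA row_mul rowK.
  rewrite [RHS]inner_mulmx AA -/(inner _ _ _) (inner_gradient v (Ff.1 k) I ip).
  have -> : gradient i (f k) p *m A = gradient j (g k) (iota p).
    by rewrite -[RHS](rowK (fun k => gradient j (g k) (iota p))) -/(gradients g j (iota p)) -XA row_mul rowK.
  rewrite (inner_gradient _ (Fg.1 k) I jq) -hx.
  have dg : differentiable (rep j (g k)) (h x) by rewrite hx; exact: rep_differentiable (Fg.1 k) I jq.
  apply: is_derive_unique (is_derive_comp_diff (is_derive_diff v dh) dg) _.
  apply: near_eq_is_derive (is_derive_diff v (rep_differentiable (Ff.1 k) I ip)).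
  apply: filterS near => y [iy jy Ey]; rewrite /rep /h /local_rep /=.
  by rewrite [coord_inv j (phi _ _)]coordK// mi.
have -> : w *m B *m gradients g j (iota p) =
    \sum_k (w *m B) 0 k *: row k (gradients g j (iota p)) by rewrite mulmx_sum_row.
elim/big_rec : _ => [|k y _ Ey]; first exact: inner0l.
by rewrite innerDl innerZl E0 mulr0 add0r.
Qed.

Definition jets_coord (F : 'I_(1 + n) -> M -> R) i y := frame_jets F i (coord_inv i y).

Lemma rep_smooth (F : M -> R) i : obata_on kappa setT F ->
  smooth_on (cimage i setT) (rep i F) /\ smooth_mx (cimage i setT) (grad (metric i) (rep i F)).
Proof.
move=> HF; apply: (obata_smooth (metric_on_image i) (@image_openT _ _ _ i) (@subset_refl _ _)).
by move=> y [q [iq _] <-]; exact: HF.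
Qed.

Lemma jets_coord_smooth F i : is_frame F -> smooth_mx (cimage i setT) (jets_coord F i).
Proof.
move=> [HF _] a b k; have oI := @image_openT _ _ _ i.
have [s1 s2] := rep_smooth i (HF a).
case: (split_ordP b) => b' ->.
  apply: (Ck_eq oI _ (s1 k)) => y _.
  by rewrite /jets_coord /frame_jets row_mxEl !mxE.
apply: (Ck_eq oI _ (s2 0 b' k)) => y /imageP[_ iy _ Ey].
by rewrite /jets_coord /frame_jets row_mxEr [RHS]mxE /gradient Ey.
Qed.

(** The Jacobian is expressed by the jets of f at the point and those of g at its image, without any
    derivative of iota on the right. *)
Lemma lrep_jacobian i j y : cimage i (iota @^-1` domain j) y ->
  'J (lrep i j) y = dsubmx (invmx (jets_coord f i y)) *m rsubmx (jets_coord g j (lrep i j y)).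
Proof.
move=> /imageP[_ iy jy Ey]; have [_ XJ _] := lrep_diff iy jy.
have E2 : lrep i j y = coord j (iota (coord_inv i y)) by rewrite -{1}Ey lrepE.
rewrite {2}/jets_coord E2 coordK// /frame_jets row_mxKr -XJ Ey mulmxA.
have := mulVmx (Ff.2 i _ iy); rewrite -{1}[invmx _]vsubmxK {2}/frame_jets mul_col_row (@scalar_mx_block _ 1 n 1).
by move=> /eq_block_mx[_ _ _]; rewrite /jets_coord => ->; rewrite mul1mx.
Qed.

(** Bootstrap through [lrep_jacobian]: if iota is of class C^k, so is its Jacobian. *)
Lemma lrep_smooth i j : smooth_mx (cimage i (iota @^-1` domain j)) (lrep i j).
Proof.
have oj : open (iota @^-1` domain j).
  by apply: open_comp => [x _|]; [exact: ci|exact: domain_open].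
have oO := @image_open _ _ _ i _ oj.
have sub : cimage i (iota @^-1` domain j) `<=` cimage i setT by move=> y /imageP[].
have dl y : cimage i (iota @^-1` domain j) y -> differentiable (lrep i j) y.
  by move=> /imageP[_ iy jy <-]; have [] := lrep_diff iy jy.
move=> a l k; rewrite ord1 {a}; elim: k l => [|k IH] l.
  by move=> y /dl/differentiable_continuous; exact: continuous_mxE.
move=> a; split=> [y Oy|].
  by apply: diff_derivable; apply: differentiable_mxE; exact: dl.
apply: (@Ck_eq _ _ k _ (fun y => (dsubmx (invmx (jets_coord f i y)) *m
   rsubmx (jets_coord g j (lrep i j y))) a l)) => //.
  by move=> y Oy; rewrite -lrep_jacobian// partialE_jacobian//; exact: dl.
apply: Ck_mulmx => // b c.
  apply: (@Ck_eq _ _ k _ (fun y => invmx (jets_coord f i y) (rshift 1 b) c)) => //.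
    by move=> y _; rewrite [RHS]mxE.
  apply: Ck_invmx => //; first by move=> y /imageP[_ iy _ _]; exact: Ff.2.
  by move=> b' c'; apply: Ck_sub sub _; exact: jets_coord_smooth.
apply: (@Ck_eq _ _ k _ (fun y => jets_coord g j (lrep i j y) b (rshift 1 c))) => //.
  by move=> y _; rewrite [RHS]mxE.
have maps y : cimage i (iota @^-1` domain j) y -> cimage j setT (lrep i j y).
  by move=> [q [iq jq] <-]; rewrite lrepE//; exact: coord_image.
exact: (@Ck_comp R n k n _ _ (lrep i j) (fun z => jets_coord g j z b (rshift 1 c)) oO
  (@image_openT _ _ _ j) maps IH (jets_coord_smooth j Fg b (rshift 1 c) k)).
Qed.

Local Opaque coord_change local_rep.

Lemma lrep_jacobian_change i i' j j' p : domain i p -> domain i' p -> domain j (iota p) ->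
  domain j' (iota p) -> coord_change i i' p *m 'J (lrep i' j') (coord i' p) =
  'J (lrep i j) (coord i p) *m coord_change j j' (iota p).
Proof.
move=> ip ip' jq jq'; apply: (gradients_inj ip).
have [_ X1 _] := lrep_diff ip jq; have [_ X2 _] := lrep_diff ip' jq'.
have alg (X X' Y Y' : 'M[R]_(1 + n, n)) (c d J J' : 'M[R]_n) : X *m c = X' ->
    X' *m J' = Y' -> X *m J = Y -> Y *m d = Y' -> X *m (c *m J') = X *m (J *m d).
  by move=> <- E1 E2 E3; rewrite !mulmxA E1 E2 E3.
exact: alg (gradients_change Ff.1 ip ip') X2 X1 (gradients_change Fg.1 jq jq').
Qed.

Lemma lrep_det i j p : domain i p -> domain j (iota p) -> \det ('J (lrep i j) (coord i p)) != 0.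
Proof.
move=> ip jq; have [_ _ E] := lrep_diff ip jq.
have uG : metric_at i p \in unitmx by apply: (mo_unit (metric_on_image i)); exact: coord_image.
by move: uG; rewrite -E !unitmx_mul => /andP[/andP[+ _] _]; rewrite unitmxE unitfE.
Qed.

Lemma lrep_det_change i i' j j' p : domain i p -> domain i' p -> domain j (iota p) ->
  domain j' (iota p) -> 0 < \det ('J (lrep i j) (coord i p)) ->
  0 < \det ('J (lrep i' j') (coord i' p)).
Proof.
move=> ip ip' jq jq' d0.
have alg (A B C D : 'M[R]_n) : A *m B = C *m D -> 0 < \det A -> 0 < \det D ->
    0 < \det C -> 0 < \det B.
  move=> /(congr1 determinant); rewrite !det_mulmx => E A0 D0 C0.
  by rewrite -(pmulr_rgt0 _ A0) E mulr_gt0.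
apply: alg (lrep_jacobian_change ip ip' jq jq') _ _ d0; exact: atlas_oriented.
Qed.

Hypothesis M_connected : connected [set: M].

(** The determinant is continuous and never zero, so its sign is locally constant; the oriented
    atlas makes the sign independent of the charts. *)
Lemma lrep_oriented i0 j0 p0 : domain i0 p0 -> domain j0 (iota p0) ->
  0 < \det ('J (lrep i0 j0) (coord i0 p0)) -> preserves_orientation iota.
Proof.
move=> ip0 jq0 d0 i j p ip jq.
pose P p := forall i j, domain i p -> domain j (iota p) -> 0 < \det ('J (lrep i j) (coord i p)).
suff Pp : P p by exact: Pp.
apply: (@connected_ind M setT P p0 p M_connected _ I I _); last first.
  move=> i' j' ip' jq'; exact: lrep_det_change ip0 ip' jq0 jq' d0.
move=> z _; set k := some_chart z; set l := some_chart (iota z).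
have kz : domain k z := some_chartP z; have lz : domain l (iota z) := some_chartP (iota z).
have oj : open (iota @^-1` domain l).
  by apply: open_comp => [x _|]; [exact: ci|exact: domain_open].
have oO := @image_open _ _ _ k _ oj.
have Oz : cimage k (iota @^-1` domain l) (coord k z) by exact: coord_image.
have cdet : {for coord k z, continuous (fun y => \det ('J (lrep k l) y))}.
  apply: (@Ck_continuous _ _ 0 _ _ _ oO _ Oz); apply: Ck_det => // a b.
  apply: (@Ck_eq _ _ 0 _ (partial a (fun y => lrep k l y 0 b))) => //.
    move=> y /imageP[_ iy jy <-]; rewrite partialE_jacobian//.
    by have [] := lrep_diff iy jy.
  exact: (@lrep_smooth k l 0 b 1%N a).2.
have nonz := lrep_det kz lz.
have E q : domain k q -> domain l (iota q) -> P q <-> 0 < \det ('J (lrep k l) (coord k q)).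
  move=> kq lq; split=> [H|h i' j' iq' jq']; first exact: H k l kq lq.
  exact: lrep_det_change kq iq' lq jq' h.
have nl : \forall q \near z, domain l (iota q) := open_near oj lz.
have sgn : \forall y \near coord k z,
    (0 < \det ('J (lrep k l) y)) = (0 < \det ('J (lrep k l) (coord k z))).
  exact: sign_near cdet nonz.
apply: filterS2 nl (coord_nbhs kz sgn) => q lq [kq Eq] _.
by split=> [/(E q kq lq)|/(E z kz lz)]; [rewrite Eq => /(E z kz lz)|rewrite -Eq => /(E q kq lq)].
Qed.

End Smooth.

Hypothesis M_connected : connected [set: M].
Hypothesis M_simply_connected : simply_connected M.
Hypothesis HK : forall i p u v w, domain i p ->
  curvature (metric i) (coord i p) u v w =
  kappa *: (inner (metric i (coord i p)) v w *: u - inner (metric i (coord i p)) u w *: v).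

Lemma frame_exists i p0 (W : 'M[R]_(1 + n)) : domain i p0 -> W \in unitmx ->
  exists2 f, is_frame f & frame_jets f i p0 = W.
Proof.
move=> ip0 uW.
have H (k : 'I_(1 + n)) : exists f : M -> R, obata_on kappa setT f /\ jet_at i f p0 = row k W.
  by have [f h1 h2] := obata_exists HK M_connected M_simply_connected (row k W) ip0; exists f.
have {H}[f Hf] := choice H.
have E : frame_jets f i p0 = W.
  by apply/row_matrixP => k; rewrite row_frame_jets; have [] := Hf k.
exists f => //; apply: (frame_unit HK M_connected (i := i) (p0 := p0)) => //.
  by move=> k; have [] := Hf k.
by rewrite E.
Qed.

Lemma frame_pair i j p0 q0 (A : 'M[R]_n) : domain i p0 -> domain j q0 ->
  A *m metric_at j q0 *m A^T = metric_at i p0 -> exists f g,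
  [/\ is_frame f, is_frame g, matched f g p0 q0, gradients f i p0 *m A = gradients g j q0 &
  forall i j p q, domain i p -> domain j q ->
    forall a b, hform i (f a) (f b) p = hform j (g a) (g b) q].
Proof.
move=> ip jq AA.
have uA : A \in unitmx.
  have : metric_at i p0 \in unitmx by apply: (mo_unit (metric_on_image i)); exact: coord_image.
  by rewrite -AA !unitmx_mul => /andP[/andP[]].
(* The jets of f at p0 form the identity matrix, those of g at q0 their image under A, that is
   diag(1, A). Since A is an isometry, the constant values of [hform] agree. *)
have [f Ff Ef] := frame_exists ip (unitmx1 _ _).
have [|g Fg Eg] := @frame_exists j q0 (block_mx 1%:M 0 0 A) jq.
  by rewrite unitmxE det_ublock det1 mul1r -unitmxE.
move: Ef Eg; rewrite /frame_jets (@scalar_mx_block _ 1 n 1) !block_mxEh.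
move=> /eq_row_mx[Vf Xf] /eq_row_mx[Vg Xg].
have mpq : matched f g p0 q0.
  move=> k; have /matrixP/(_ k 0) := etrans Vg (esym Vf); rewrite !mxE.
  by [].
have XA : gradients f i p0 *m A = gradients g j q0.
  by rewrite Xf Xg mul_col_mx mul0mx mul1mx.
exists f, g; split=> // i' j' p q ip' jq' a b.
rewrite (hform_cst M_connected (Ff.1 a) (Ff.1 b) ip' ip) (hform_cst M_connected (Fg.1 a) (Fg.1 b) jq' jq).
rewrite /hform !mpq; congr (_ + _).
have E k : gradient j (g k) q0 = gradient i (f k) p0 *m A.
  by rewrite -[LHS](rowK (fun k => gradient j (g k) q0)) -/(gradients g j q0) -XA row_mul rowK.
by rewrite !E inner_mulmx AA.
Qed.

(** The composite and the identity have the same values of the f_k and agree at p0; local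
    injectivity of the values and connectedness of M do the rest. *)
Lemma developing_inverse f g (iota iota' : M -> M) p0 : is_frame f ->
  continuous iota -> continuous iota' -> iota' (iota p0) = p0 ->
  (forall p, matched f g p (iota p)) -> (forall q, matched g f q (iota' q)) ->
  cancel iota iota'.
Proof.
move=> Ff ci ci' E0 mi mi' p.
apply: (@agree_on_connected M M _ setT (iota' \o iota) id (values f) p0) => //.
- exact: hausdorff_carrier.
- by apply: continuous_subspaceT => x; apply: continuous_comp; [exact: ci|exact: ci'].
- by apply: continuous_subspaceT => x; exact: cvg_id.
- by move=> z _; exact: (values_injective_near M_complete z Ff).
- by move=> z _; have /matchedE -> := mi' (iota z); have /matchedE -> := mi z.
Qed.

(** The inverse is the developing map of the exchanged pair (g, f), hence equally smooth. At p0 the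
    differential is A, whose determinant decides the orientation. *)
Theorem developing_isometry f g i j p0 q0 (A : 'M[R]_n) : is_frame f -> is_frame g ->
  matched f g p0 q0 -> domain i p0 -> domain j q0 -> gradients f i p0 *m A = gradients g j q0 ->
  (forall i j p q, domain i p -> domain j q ->
    forall a b, hform i (f a) (f b) p = hform j (g a) (g b) q) -> 0 < \det A ->
  exists iota, [/\ orientation_preserving_isometry iota, iota p0 = q0 &
    forall p, matched f g p (iota p)].
Proof.
move=> Ff Fg m0 ip jq XA hfg dA.
have hgf i' j' p q : domain i' p -> domain j' q ->
    forall a b, hform i' (g a) (g b) p = hform j' (f a) (f b) q.
  by move=> ip' jq' a b; rewrite -(hfg j' i' q p jq' ip').
have m0' : matched g f q0 p0 by move=> k; rewrite m0.
have [iota [ci i0 mi]] := developing_map M_complete Ff Fg hfg M_connected M_simply_connected m0.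
have [iota' [ci' i0' mi']] := developing_map M_complete Fg Ff hgf M_connected M_simply_connected m0'.
exists iota; split=> //; split.
- exists iota'; split.
  + by apply: (developing_inverse (p0 := p0) Ff ci ci' _ mi mi'); rewrite i0 i0'.
  + by apply: (developing_inverse (p0 := q0) Fg ci' ci _ mi' mi); rewrite i0' i0.
  + split=> // a b k; exact: (lrep_smooth Ff Fg hfg ci mi).
  + split=> // a b k; exact: (lrep_smooth Fg Ff hgf ci' mi').
- by move=> i' j' p ip' jq' J; have [_ _ ->] := lrep_diff Ff Fg hfg ci mi ip' jq'.
- have jq' : domain j (iota p0) by rewrite i0.
  apply: (lrep_oriented Ff Fg hfg ci mi M_connected ip jq').
  have [_ XJ _] := lrep_diff Ff Fg hfg ci mi ip jq'.
  suff -> : 'J (local_rep iota i j) (coord i p0) = A by [].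
  by apply: (gradients_inj Ff ip); rewrite XJ i0 XA.
Qed.

End Isometry.

(** * Absolutely continuous functions *)

Section AbsoluteContinuity.
Context {R : realType}.
Implicit Types (f F : R -> R) (a b : R).

(* Absolute continuity on the whole line. *)
Definition gac f := forall e : R, 0 < e -> exists2 d : R, 0 < d &
  forall (m : nat) (u v : 'I_m -> R), (forall k, u k <= v k) ->
    trivIset [set: 'I_m] (fun k => `]u k, v k[%classic) ->
    \sum_(k < m) (v k - u k) < d ->
    \sum_(k < m) `|f (v k) - f (u k)| < e.

Definition clamp a b (x : R) := Num.max a (Num.min b x).

Lemma clampP a b x : a <= b -> [/\ a <= clamp a b x, clamp a b x <= b &
  a <= x <= b -> clamp a b x = x].
Proof.
move=> ab; rewrite /clamp /Num.max /Num.min; split.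
- by case: ifP; case: ifP; lra.
- by case: ifP; case: ifP; lra.
- by case: ifP; case: ifP; lra.
Qed.

(** Constant extension outside [a, b] removes the endpoint conditions. Clamped intervals stay
    disjoint, because a point strictly between clamped ends lies in the original open interval. *)
Lemma ac_gac a b f : a <= b -> abs_continuous a b f -> gac (f \o clamp a b).
Proof.
move=> ab H e /H[d d0 {}H]; exists d => // m u v uv tI sd.
have P x := clampP x ab.
have mono x y : x <= y -> clamp a b x <= clamp a b y.
  by rewrite /clamp /Num.max /Num.min; do 4 case: ifP; lra.
apply: H.
- by move=> k; have [h1 _ _] := P (u k); have [_ h2 _] := P (v k); split=> //; split=> //; exact: mono.
- move=> i j _ _ [y [/=]]; rewrite !in_itv/= => /andP[h1 h2] /andP[h3 h4].
  have lo x z : clamp a b x < z -> z < b -> x < z.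
    by rewrite /clamp /Num.max /Num.min; do 2 case: ifP; lra.
  have hi x z : z < clamp a b x -> a < z -> z < x.
    by rewrite /clamp /Num.max /Num.min; do 2 case: ifP; lra.
  have yb : y < b by have [_ h _] := P (v i); lra.
  have ay : a < y by have [h _ _] := P (u i); lra.
  apply: (tI i j I I); exists y; split=> /=; rewrite in_itv/=; apply/andP; split.
  - exact: lo h1 yb.
  - exact: hi h2 ay.
  - exact: lo h3 yb.
  - exact: hi h4 ay.
- apply: le_lt_trans sd; apply: ler_sum => k _; have := uv k.
  by rewrite /clamp /Num.max /Num.min; do 4 case: ifP; lra.
Qed.

(** Arbitrary finite index types are allowed because the pieces of several subdivisions are indexed
    by a dependent sum. *)
Lemma gacI f : gac f -> forall e : R, 0 < e -> exists2 d : R, 0 < d &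
  forall (I : finType) (u v : I -> R), (forall k, u k <= v k) ->
    trivIset [set: I] (fun k => `]u k, v k[%classic) ->
    \sum_k (v k - u k) < d -> \sum_k `|f (v k) - f (u k)| < e.
Proof.
move=> H e /H[d d0 {}H]; exists d => // I u v uv tI sd.
have E (F : I -> R) : \sum_k F k = \sum_(k < #|I|) F (enum_val k).
  by rewrite (reindex _ (onW_bij _ (@enum_val_bij I))).
rewrite E; apply: (H _ (u \o enum_val) (v \o enum_val)) => //=.
- by move=> i j _ _ h; apply: enum_val_inj; exact: tI h.
- by have sd' := sd; rewrite E in sd'.
Qed.

Lemma gac_continuous f : gac f -> continuous f.
Proof.
move=> H x; apply/cvgrPdist_lt => e /H[d d0 {}H].
apply: filterS (nbhsx_ballx x d d0) => y; rewrite -ball_normE/= => yd.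
have key u v : u <= v -> v - u < d -> `|f v - f u| < e.
  move=> uv uvd; have := H 1%N (fun=> u) (fun=> v); rewrite !big_ord1; apply=> //.
  by move=> i j _ _ _; rewrite (ord1 i) (ord1 j).
have [xy|/ltW yx] := leP x y; last by apply: key => //; apply: le_lt_trans (ler_norm _) yd.
by rewrite distrC; apply: key => //; apply: le_lt_trans (ler_norm _) _; rewrite distrC.
Qed.

(** The pieces of the partitions of all the intervals form one disjoint family of the same total
    length, to which absolute continuity applies directly. *)
Lemma gac_variation f : gac f -> forall e : R, 0 < e -> exists2 d : R, 0 < d &
  forall (m : nat) (u v : 'I_m -> R) (s : 'I_m -> seq R),
    (forall k, itv_partition (u k) (v k) (s k)) ->
    trivIset [set: 'I_m] (fun k => `]u k, v k[%classic) ->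
    \sum_(k < m) (v k - u k) < d -> \sum_(k < m) variation (u k) (v k) f (s k) < e.
Proof.
move=> /gacI H e /H[d d0 {}H]; exists d => // m u v s ps tI sd.
pose I := {k : 'I_m & 'I_(size (s k))}.
pose x k j := nth (v k) (u k :: s k) j.
have xS k (j : nat) : (j < size (s k))%N -> x k j < x k j.+1.
  move=> js; have [/(pathP (v k)) p _] := ps k; exact: p.
have xle k (i j : nat) : (i <= j)%N -> (j <= size (s k))%N -> x k i <= x k j.
  elim: j => [|j IH]; first by rewrite leqn0 => /eqP ->.
  rewrite leq_eqVlt => /predU1P[->//|ij js]; apply: le_trans (IH ij (ltnW js)) _.
  exact/ltW/xS.
have x0 k : x k 0%N = u k by [].
have xl k : x k (size (s k)) = v k.
  by have [_ /eqP E] := ps k; rewrite /x -[RHS]E (last_nth (v k)).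
have varE k : variation (u k) (v k) f (s k) = \sum_(j < size (s k)) `|f (x k j.+1) - f (x k j)|.
  by rewrite /variation big_mkord.
have lenE k : v k - u k = \sum_(j < size (s k)) (x k j.+1 - x k j).
  by rewrite -(big_mkord xpredT (fun j => x k j.+1 - x k j)) telescope_sumr// xl.
under eq_bigr do rewrite varE.
have sumE (F : forall k, 'I_(size (s k)) -> R) :
    \sum_(k < m) \sum_j F k j = \sum_(p : I) F (tag p) (tagged p).
  by rewrite sig_big_dep.
rewrite sumE; apply: (H I (fun p => x (tag p) (tagged p)) (fun p => x (tag p) (tagged p).+1)).
- by move=> [k j]; apply: ltW; exact: xS.
- move=> [k i] [l j] _ _ [y [/=]]; rewrite !in_itv/= => /andP[h1 h2] /andP[h3 h4].
  have kl : k = l.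
    apply: tI => //; exists y; split=> /=; rewrite in_itv/=; apply/andP; split.
    + by apply: le_lt_trans h1; rewrite -x0; apply: xle => //; exact/ltnW.
    + by apply: lt_le_trans h2 _; rewrite -xl; exact: xle.
    + by apply: le_lt_trans h3; rewrite -x0; apply: xle => //; exact/ltnW.
    + by apply: lt_le_trans h4 _; rewrite -xl; exact: xle.
  subst l; congr Tagged; apply: val_inj => /=.
  have [ij|ji|//] := ltngtP i j.
    by exfalso; have := xle k i.+1 j ij (ltnW (ltn_ord j)); lra.
  by exfalso; have := xle k j.+1 i ji (ltnW (ltn_ord i)); lra.
- by rewrite -(sumE (fun k j => x k j.+1 - x k j)); under eq_bigr do rewrite -lenE.
Qed.

Lemma gac_TV1 f : gac f -> forall e : R, 0 < e -> exists2 d : R, 0 < d &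
  forall u v, u <= v -> v - u < d -> (total_variation u v f <= e%:E)%E.
Proof.
move=> /gac_variation H e /H[d d0 {}H]; exists d => // u v uv uvd.
apply: ge_ereal_sup => _ [_ [s ps <-] <-]; rewrite lee_fin; apply: ltW.
have := H 1%N (fun=> u) (fun=> v) (fun=> s); rewrite !big_ord1; apply=> //.
by move=> i j _ _ _; rewrite (ord1 i) (ord1 j).
Qed.

(** The interval is cut from the right into pieces of length at most d / 2, each of total variation
    at most 1; the induction is on the number of pieces. *)
Lemma gac_TV_fin f a b : gac f -> a <= b -> total_variation a b f \is a fin_num.
Proof.
move=> /gac_TV1/(_ 1 ltr01)[d d0 H] ab.
have d20 : 0 < d / 2 by rewrite divr_gt0.
suff : forall N : nat, forall b, a <= b -> b - a < N%:R * (d / 2) -> total_variation a b f \is a fin_num.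
  move=> /(_ (Num.bound ((b - a) / (d / 2))) b ab); apply.
  by rewrite -ltr_pdivrMr//; apply: archi_boundP; rewrite divr_ge0 ?subr_ge0// ltW.
elim=> [|N IH] {b ab}b ab; first by rewrite mul0r; lra.
rewrite -natr1 mulrDl mul1r => bd.
pose c := Num.max a (b - d / 2).
have [ac cb] : a <= c /\ c <= b by rewrite /c /Num.max; case: ifP; split; lra.
rewrite (total_variationD f ac cb) fin_numD; apply/andP; split.
  have [->|cd] : c = a \/ c = b - d / 2 by rewrite /c /Num.max; case: ifP; auto.
    by rewrite total_variationxx.
  by apply: IH => //; rewrite cd; move: (N%:R * _) bd => z; lra.
rewrite ge0_fin_numE ?total_variation_ge0//; apply: le_lt_trans (ltry 1); apply: H => //.
by rewrite /c /Num.max; case: ifP; lra.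
Qed.

Lemma gac_TV f : gac f -> forall e : R, 0 < e -> exists2 d : R, 0 < d &
  forall (m : nat) (u v : 'I_m -> R), (forall k, u k <= v k) ->
    trivIset [set: 'I_m] (fun k => `]u k, v k[%classic) ->
    \sum_(k < m) (v k - u k) < d ->
    \sum_(k < m) fine (total_variation (u k) (v k) f) < e.
Proof.
move=> gf e e0; have e20 : 0 < e / 2 by rewrite divr_gt0.
have [d d0 H] := gac_variation gf e20; exists d => // m u v uv tI sd.
have fin k : total_variation (u k) (v k) f \is a fin_num by exact: gac_TV_fin.
(* The m chosen partitions miss their total variations by at most e / 2 altogether; [m.+1] also
   covers m = 0. *)
pose eta := e / 2 / m.+1%:R.
have eta0 : 0 < eta by rewrite divr_gt0.
have Hs k : exists s, itv_partition (u k) (v k) s /\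
    fine (total_variation (u k) (v k) f) <= variation (u k) (v k) f s + eta.
  have [_ [_ [s ps <-] <-] h] := ub_ereal_sup_adherent eta0 (fin k); exists s; split=> //.
  have := h; rewrite -/(total_variation (u k) (v k) f) -[X in (X - _ < _)%E](fineK (fin k)).
  by rewrite -EFinB lte_fin ltrBlDr => /ltW.
have {Hs}[s Hs] := choice Hs.
apply: (@le_lt_trans _ _ (\sum_(k < m) (variation (u k) (v k) f (s k) + eta))).
  by apply: ler_sum => k _; have [] := Hs k.
rewrite big_split/= sumr_const card_ord -mulr_natl [ltRHS]splitr; apply: ltr_leD.
  by apply: H => // k; have [] := Hs k.
rewrite /eta mulrCA; apply: ler_piMr; first exact: ltW.
by rewrite ler_pdivrMr// mul1r ler_nat.
Qed.

(** [Num.max] makes the variation function constant on the left of a, so that it is nondecreasing on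
    the whole line, as a Stieltjes measure requires. *)
Definition Vf a f x := fine (total_variation a (Num.max a x) f).

Lemma VfB a f x y : gac f -> x <= y ->
  Vf a f y - Vf a f x = fine (total_variation (Num.max a x) (Num.max a y) f).
Proof.
move=> gf xy; have ax : a <= Num.max a x by rewrite le_max lexx.
have xy' : Num.max a x <= Num.max a y.
  by rewrite ge_max !le_max lexx/= xy orbT.
rewrite /Vf (total_variationD f ax xy') fineD ?gac_TV_fin//.
by rewrite addrC addKr.
Qed.

Lemma Vf_nondecreasing a f : gac f -> {homo Vf a f : x y / x <= y}.
Proof.
move=> gf x y xy; rewrite -subr_ge0 VfB//; apply/fine_ge0/total_variation_ge0.
by rewrite ge_max !le_max lexx/= xy orbT.
Qed.

Lemma Vf_gac a f : gac f -> gac (Vf a f).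
Proof.
move=> gf e /(gac_TV gf)[d d0 H]; exists d => // m u v uv tI sd.
under eq_bigr do rewrite VfB// ger0_norm ?fine_ge0 ?total_variation_ge0 ?ge_max ?le_max ?lexx ?uv ?orbT//.
apply: H.
- by move=> k; rewrite ge_max !le_max lexx/= uv orbT.
- move=> i j _ _ [y [/=]]; rewrite !in_itv/= !gt_max !lt_max => /andP[/andP[h1 h2] h3] /andP[/andP[h4 h5] h6].
  apply: tI => //; exists y; split=> /=; rewrite in_itv/=; apply/andP; split=> //.
  + by case/orP: h3 => //; rewrite ltNge (ltW h1).
  + by case/orP: h6 => //; rewrite ltNge (ltW h1).
- apply: le_lt_trans sd; apply: ler_sum => k _; have := uv k.
  by rewrite /Num.max; case: ifP; case: ifP; lra.
Qed.

Lemma gacB f F : gac f -> gac F -> gac (fun x => f x - F x).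
Proof.
move=> gf gF e e0; have e20 : 0 < e / 2 by rewrite divr_gt0.
have [d1 d10 H1] := gf _ e20; have [d2 d20 H2] := gF _ e20.
exists (Num.min d1 d2); first by rewrite lt_min d10.
move=> m u v uv tI; rewrite lt_min => /andP[s1 s2].
rewrite [ltRHS]splitr; apply: le_lt_trans (ltrD (H1 _ _ _ uv tI s1) (H2 _ _ _ uv tI s2)).
rewrite -big_split/=; apply: ler_sum => k _.
have -> : f (v k) - F (v k) - (f (u k) - F (u k)) = f (v k) - f (u k) - (F (v k) - F (u k)) by ring.
exact: ler_normB.
Qed.

Lemma Vf_ge a f x y : gac f -> a <= x -> x <= y -> f y - f x <= Vf a f y - Vf a f x.
Proof.
move=> gf ax xy; rewrite VfB// (max_idPr ax) (max_idPr (le_trans ax xy)).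
apply: le_trans (ler_norm _) _; rewrite -lee_fin fineK ?gac_TV_fin//.
exact: total_variation_ge.
Qed.

End AbsoluteContinuity.

(** * Densities and differentiation almost everywhere *)

Section Density.
Context {R : realType}.
Implicit Types (f F : R -> R) (a b : R).
Local Notation leb := (@lebesgue_measure R).

(** Finite measure forces finite ends. The half-open interval is included because Stieltjes measures
    are evaluated on such intervals, and adding the right end does not change the length. *)
Lemma open_interval_bounds (J : set R) : open J -> is_interval J -> (leb J < +oo)%E ->
  exists u v, [/\ u <= v, `]u, v[%classic `<=` J, J `<=` `]u, v]%classic & leb J = (v - u)%:E].
Proof.
move=> oJ /is_intervalP JE; have {}JE : J = [set` Rhull J] by [].
have ball_in z : J z -> exists2 e : R, 0 < e & forall y, `|z - y| < e -> J y.
  move=> Jz; have /nbhs_ballP[e /= e0 He] := open_near oJ Jz.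
  by exists e => // y yz; apply: He; rewrite -ball_normE.
have empty : (forall z, ~ J z) -> exists u v, [/\ u <= v, `]u, v[%classic `<=` J, J `<=` `]u, v]%classic & leb J = (v - u)%:E].
  move=> J0; have -> : J = set0 by apply/seteqP; split=> // z /J0.
  by exists (0 : R), (0 : R); split=> //; [move=> z /=; rewrite in_itv/= => /andP[h1 h2]; have := lt_trans h1 h2; rewrite ltxx|rewrite measure0 subrr].
have [[z Jz]|nJ] := pselect (exists z, J z); last by move=> _; apply: empty => z Jz; apply: nJ; exists z.
have [e e0 He] := ball_in z Jz.
have Jl : J (z - e / 2) by apply: He; rewrite opprB addrC subrK ger0_norm; lra.
have Jr : J (z + e / 2) by apply: He; rewrite opprD addrA subrr sub0r normrN ger0_norm; lra.
rewrite JE lebesgue_measure_itv.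
move: JE; case: (Rhull J) => [[x u|[|]] [y v|[|]]] JE /=; rewrite ?ltry ?ltNyr ?ltNyy ?ltxx//=; try by exfalso; move: Jz; rewrite JE /= in_itv/= ?andbF.
move=> _.
have uz t : J t -> u <= t /\ t <= v.
  by rewrite JE /= in_itv/=; case: (x); case: (y) => /= /andP[h1 h2]; lra.
have uv : u < v by have [? ?] := uz _ Jl; have [? ?] := uz _ Jr; lra.
rewrite lte_fin uv; exists u, v; rewrite -JE; split=> //; first exact: ltW.
  move=> t /=; rewrite JE /= !in_itv/= => /andP[h1 h2].
  by case: (x); case: (y) => /=; apply/andP; split; lra.
move=> t Jt /=; rewrite in_itv/=; have [h1 h2] := uz _ Jt; rewrite h2 andbT lt_neqAle h1 andbT.
apply/eqP => E; have [e' e'0 He'] := ball_in t Jt.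
have [] := uz (t - e' / 2); last lra.
by apply: He'; rewrite opprB addrC subrK ger0_norm; lra.
Qed.

(* Absolute continuity of F makes its Lebesgue-Stieltjes measure on ]a, b] absolutely
   continuous, so that Radon-Nikodym provides the density. *)
Lemma gac_mono_density F a b : gac F -> {homo F : x y / x <= y} -> a <= b ->
  exists h : R -> R, leb.-integrable setT (EFin \o h) /\
    forall x, a <= x <= b -> F x - F a = (\int[leb]_(t in `]a, x]) h t)%R.
Proof.
move=> gF mF ab.
have rF : forall x, F @ at_right x --> F x by exact/right_continuousW/gac_continuous.
pose C := isCumulative.Build R _ R F mF rF.
pose Fc : cumulative R R := HB.pack F C.
pose mu : {measure set (measurableTypeR R) -> \bar R} := lebesgue_stieltjes_measure Fc.
have muE u v : u <= v -> mu `]u, v]%classic = (F v - F u)%:E.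
  move=> uv; apply: etrans (measurable_mu_extE (wlength Fc) (is_ocitv u v)) _.
  exact: wlength_itv_bnd.
have mD : measurable (`]a, b]%classic : set (measurableTypeR R)) by exact: measurable_itv.
have moo : (mu `]a, b]%classic < +oo)%E by rewrite muE// ltry.
pose nu : {finite_measure set (measurableTypeR R) -> \bar R} := mfrestr mD moo.
(* A null set is enclosed in an open set of measure below d, a countable disjoint union of open
   intervals; absolute continuity bounds every finite sum of increments of F over these by e. *)
have dom : nu `<< leb.
  apply/null_content_dominatesP => A mA A0.
  suff mu0 : mu A = 0%E.
    apply/eqP; rewrite eq_le measure_ge0 andbT -mu0 /nu /= /mfrestr /mrestr.
    by apply: le_measure; rewrite ?inE//; exact: measurableI.
  apply/eqP; rewrite eq_le measure_ge0 andbT; apply/lee_addgt0Pr => e e0; rewrite add0e.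
  have [d d0 Hd] := gF e e0.
  have A0' : (leb A < +oo)%E by rewrite A0.
  have [U [oU AU Ud]] := lebesgue_regularity_outer mA A0' d0.
  have mU : measurable U by exact: measurable_realfun.open_measurable.
  have lU : (leb U < d%:E)%E.
    apply: le_lt_trans Ud; rewrite -[leRHS]adde0 -A0.
    have {1}-> : U = (U `\` A) `|` A by rewrite setUC setDUK.
    by apply: measureU2 => //; exact: measurableD.
  apply: (@le_trans _ _ (mu U)); first by apply: le_measure; rewrite ?inE.
  pose J := open_disjoint_itv oU.
  have oJ q : open (J q) by exact: open_disjoint_itv_open.
  have mJ q : measurable (J q) by exact: measurable_realfun.open_measurable.
  have UJ : U = \bigcup_q J q by exact: open_disjoint_itv_bigcup.
  have tJ : trivIset setT J by exact: open_disjoint_itv_trivIset.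
  have JU q : J q `<=` U by rewrite UJ; exact: bigcup_sup.
  have HJ q : exists uv : R * R, [/\ uv.1 <= uv.2, `]uv.1, uv.2[%classic `<=` J q,
      J q `<=` `]uv.1, uv.2]%classic & leb (J q) = (uv.2 - uv.1)%:E].
    have [||u [v H]] := open_interval_bounds (oJ q); last by exists (u, v).
    - exact: open_disjoint_itv_is_interval.
    - apply: le_lt_trans (lt_trans lU (ltry _)); apply: le_measure; rewrite ?inE//; exact: mJ.
  have {HJ}[w Hw] := choice HJ.
  rewrite UJ measure_semi_bigcup//; last by rewrite -UJ.
  apply: lime_le; first exact: is_cvg_nneseries.
  apply: nearW => N; rewrite big_mkord.
  apply: (@le_trans _ _ (\sum_(k < N) `|F (w k).2 - F (w k).1|%:E)%E).
    apply: lee_sum => k _; have [wk _ Jw _] := Hw k.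
    rewrite ger0_norm ?subr_ge0; last exact: (mF _ _ wk).
    by rewrite -muE//; apply: le_measure; rewrite ?inE//; exact: mJ.
  rewrite sumEFin lee_fin; apply: ltW; apply: Hd.
  - by move=> k; have [] := Hw k.
  - move=> i j _ _ [y [yi yj]]; apply: val_inj; apply: (tJ _ _ I I).
    have [_ hi _ _] := Hw i; have [_ hj _ _] := Hw j.
    by exists y; split; [exact: hi|exact: hj].
  - rewrite -lte_fin -sumEFin; apply: le_lt_trans lU.
    under eq_bigr => k _ do (have [_ _ _ <-] := Hw k).
    rewrite [in leRHS]UJ measure_semi_bigcup//; last by rewrite -UJ.
    by rewrite -(big_mkord xpredT (fun k => leb (J k))); exact: nneseries_lim_ge.
have [g [g0 gfin gint gE]] := radon_nikodym_sigma_finite dom.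
exists (fine \o g).
have gE' : EFin \o (fine \o g) = g by apply/funext => x /=; rewrite fineK.
split; first by rewrite gE'.
move=> x /andP[ax xb]; have mx : measurable (`]a, x]%classic : set R) by exact: measurable_itv.
rewrite /Rintegral -[RHS]/(fine (\int[leb]_(t in `]a, x]) (EFin \o (fine \o g)) t)) gE' -gE//.
rewrite /nu/= /mfrestr /mrestr setIidl ?muE//.
by move=> y /=; rewrite !in_itv/= => /andP[-> /le_trans]; exact.
Qed.

(* f is the difference of the nondecreasing functions [Vf a f] and [Vf a f - f], the
   latter being made constant on the left of a. *)
Lemma gac_density f a b : gac f -> a <= b ->
  exists h : R -> R, leb.-integrable setT (EFin \o h) /\
    forall x, a <= x <= b -> f x - f a = (\int[leb]_(t in `]a, x]) h t)%R.
Proof.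
move=> gf ab; have gV := Vf_gac a gf.
have [h1 [i1 E1]] := gac_mono_density gV (Vf_nondecreasing a gf) ab.
pose W x := Vf a f (Num.max a x) - f (Num.max a x).
have gW : gac W.
  have gVf : gac (fun x => Vf a f x - f x) by exact: gacB.
  move=> e /gVf[d d0 H]; exists d => // m u v uv tI sd.
  apply: (H _ (fun k => Num.max a (u k)) (fun k => Num.max a (v k))).
  - by move=> k; rewrite ge_max !le_max lexx/= uv orbT.
  - move=> i j _ _ [y [/=]]; rewrite !in_itv/= !gt_max !lt_max => /andP[/andP[g1 g2] g3] /andP[/andP[g4 g5] g6].
    apply: tI => //; exists y; split=> /=; rewrite in_itv/=; apply/andP; split=> //.
    + by case/orP: g3 => //; rewrite ltNge (ltW g1).
    + by case/orP: g6 => //; rewrite ltNge (ltW g1).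
  - apply: le_lt_trans sd; apply: ler_sum => k _; have := uv k.
    by rewrite /Num.max; case: ifP; case: ifP; lra.
have mW : {homo W : x y / x <= y}.
  move=> x y xy; rewrite /W.
  have mm : Num.max a x <= Num.max a y by rewrite ge_max !le_max lexx/= xy orbT.
  have am : a <= Num.max a x by rewrite le_max lexx.
  by have := Vf_ge gf am mm; lra.
have [h2 [i2 E2]] := gac_mono_density gW mW ab.
exists (fun t => h1 t - h2 t); split.
  have -> : EFin \o (fun t => h1 t - h2 t) = ((EFin \o h1) \- (EFin \o h2))%E by apply/funext.
  exact: integrableB.
move=> x axb; have /andP[ax xb] := axb.
rewrite RintegralB//; last 2 first.
- exact: integrableS i1.
- exact: integrableS i2.
rewrite -E1// -E2// /W (max_idPr ax) maxxx; ring.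
Qed.

(** Near an interior point f is a constant plus the integral of its density, so Lebesgue's
    differentiation theorem applies. *)
Lemma gac_derivable_ae f a b : gac f -> a <= b -> exists h : R -> R,
  [/\ leb.-integrable setT (EFin \o h),
    forall x, a <= x <= b -> f x - f a = (\int[leb]_(t in `]a, x]) h t)%R &
    {ae leb, forall x, a < x < b -> is_derive x 1 f (h x)}].
Proof.
move=> gf ab; have [h [ih Eh]] := gac_density gf ab; exists h; split=> //.
have loc : locally_integrable [set: R] h.
  by apply: open_integrable_locally; [exact: openT|].
have := @FTC1 R h (BRight a) _ loc.
have ih' y : leb.-integrable [set` Interval (BRight a) (BRight y)] (EFin \o h).
  exact: integrableS ih.
move=> /(_ ih'); apply: filterS; first exact: (ae_filter_ringOfSetsType leb).
move=> x H /andP[ax xb]; have ax' : (BRight a < BRight x)%O by rewrite bnd_simp.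
have [d1 d2] := H ax'.
have D : is_derive x 1 (fun x => f a + \int[leb]_(t in `]a, x]) h t)%R (h x).
  have D1 : is_derive x 1 (fun x => \int[leb]_(t in `]a, x]) h t)%R (h x).
    by apply: DeriveDef d1 _; rewrite -d2 derive1E.
  by have := is_derive_add (is_derive_const (f a) x 1) D1; rewrite add0r.
apply: near_eq_is_derive D.
have n1 : \forall y \near x, a < y by exact: lt_nbhsr.
have n2 : \forall y \near x, y < b by exact: lt_nbhsl.
by apply: filterS2 n1 n2 => y ay yb; rewrite -Eh ?(ltW ay) ?(ltW yb)//; ring.
Qed.

(** The density is the derivative almost everywhere, so its integral vanishes. Continuity with zero
    derivative almost everywhere would not suffice. *)
Lemma gac_constant f a b : gac f -> a <= b ->
  {ae leb, forall x, a < x < b -> is_derive x 1 f 0} -> f b = f a.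
Proof.
move=> gf ab f0; have [h [ih Eh dh]] := gac_derivable_ae gf ab.
apply/eqP; rewrite -subr_eq0 Eh ?ab ?lexx//; apply/eqP.
rewrite -Rintegral_itv_bndo_bndc; last exact: integrableS ih.
have -> : (\int[leb]_(t in `]a, b[) h t = \int[leb]_(t in `]a, b[) 0)%R.
  rewrite /Rintegral; congr fine; apply: ae_eq_integral => //.
  - by apply: measurable_funS (measurable_int _ ih).
  - apply: (@filterS2 _ _ (ae_filter_ringOfSetsType leb) _ _ _ _ f0 dh) => x h1 h2; rewrite /= in_itv/= => xab; congr EFin.
    exact: is_derive_unique (h2 xab) (h1 xab).
by rewrite /Rintegral integral0.
Qed.

End Density.

(** * Calculus of absolutely continuous curves *)

Section AbsContinuousRules.
Context {R : realType}.
Implicit Types (a b : R).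
Local Notation leb := (@lebesgue_measure R).

Lemma ae_imp (P Q : R -> Prop) : (forall t, P t -> Q t) ->
  {ae leb, forall t, P t} -> {ae leb, forall t, Q t}.
Proof. by move=> PQ; apply: filterS; first exact: (ae_filter_ringOfSetsType leb). Qed.

Lemma ae_imp2 (P P' Q : R -> Prop) : (forall t, P t -> P' t -> Q t) ->
  {ae leb, forall t, P t} -> {ae leb, forall t, P' t} -> {ae leb, forall t, Q t}.
Proof. by move=> PQ; apply: filterS2; first exact: (ae_filter_ringOfSetsType leb). Qed.

(** A filter replaces the number d, so that finitely many such conditions can be imposed at once. *)
Lemma ac_near (V : normedModType R) a b (f : R -> V) : abs_continuous a b f <->
  forall e, 0 < e -> \forall d \near (0 : R), forall (m : nat) (u v : 'I_m -> R),
    (forall k, a <= u k /\ u k <= v k /\ v k <= b) ->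
    trivIset [set: 'I_m] (fun k => `]u k, v k[%classic) ->
    \sum_(k < m) (v k - u k) < d -> \sum_(k < m) `|f (v k) - f (u k)| < e.
Proof.
split=> H e /H {}H.
  have [d d0 {}H] := H; apply: filterS (near_dist 0 d0) => d'; rewrite sub0r normrN => d'd m u v uv tI s.
  by apply: (H m u v uv tI); apply: lt_trans s (le_lt_trans (ler_norm _) d'd).
have /nbhs_ballP[r /= r0 {}H] := H; exists (r / 2); first by rewrite divr_gt0.
by apply: H; rewrite -ball_normE/= sub0r normrN gtr0_norm; lra.
Qed.

Lemma ac_sub (V : normedModType R) a b a' b' (f : R -> V) : a <= a' -> b' <= b ->
  abs_continuous a b f -> abs_continuous a' b' f.
Proof.
move=> aa bb H e /H[d d0 {}H]; exists d => // m u v uv; apply: H => k.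
by have [h1 [h2 h3]] := uv k; split; [exact: le_trans h1|split=> //; exact: le_trans bb].
Qed.

Lemma ac_eq (V : normedModType R) a b (f g : R -> V) : (forall t, a <= t <= b -> f t = g t) ->
  abs_continuous a b f -> abs_continuous a b g.
Proof.
move=> fg H e /H[d d0 {}H]; exists d => // m u v uv tI sd.
have -> : \sum_(k < m) `|g (v k) - g (u k)| = \sum_(k < m) `|f (v k) - f (u k)|; last exact: H.
apply: eq_bigr => k _.
have [h1 [h2 h3]] := uv k; rewrite !fg// ?h1 ?h3 ?andbT.
  exact: le_trans h3.
exact: le_trans h2.
Qed.

Lemma ac_cst (V : normedModType R) a b (c : V) : abs_continuous a b (fun=> c).
Proof. by move=> e e0; exists 1 => // m u v _ _ _; rewrite big1// => k _; rewrite subrr normr0. Qed.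

Lemma ac_uniform (V : normedModType R) a b (f : R -> V) : abs_continuous a b f ->
  forall e, 0 < e -> exists2 d, 0 < d &
    forall s t, a <= s <= b -> a <= t <= b -> `|s - t| < d -> `|f s - f t| < e.
Proof.
move=> H e /H[d d0 {}H]; exists d => //.
have key u v : a <= u -> u <= v -> v <= b -> v - u < d -> `|f v - f u| < e.
  move=> au uv vb uvd; have := H 1%N (fun=> u) (fun=> v); rewrite !big_ord1; apply=> //.
  by move=> x y _ _ _; rewrite (ord1 x) (ord1 y).
move=> s t /andP[sa sb] /andP[ta tb]; case: (leP s t) => st std.
  by rewrite distrC; apply: key => //; move: std; rewrite distrC ger0_norm ?subr_ge0.
by apply: key => //; [exact: ltW|move: std; rewrite ger0_norm ?subr_ge0// ltW].
Qed.

Lemma ac_mxP m n (F : R -> 'M[R]_(m, n)) a b :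
  abs_continuous a b F <-> forall i j, abs_continuous a b (fun t => F t i j).
Proof.
split=> H.
  move=> i j e /H[d d0 {}H]; exists d => // N u v uv tI sd.
  apply: le_lt_trans (H N u v uv tI sd); apply: ler_sum => k _.
  by have := mxE_le_norm (F (v k) - F (u k)) i j; rewrite !mxE.
apply/ac_near => e e0; pose c : R := #|{: 'I_m * 'I_n}|%:R.
have c0 : 0 < c + 1 by rewrite ltr_wpDl.
have ec : 0 < e / (c + 1) by rewrite divr_gt0.
have := near_forall_fin (fun ij : 'I_m * 'I_n => (ac_near a b _).1 (H ij.1 ij.2) _ ec).
apply: filterS => d Hd N u v uv tI sd.
apply: (@le_lt_trans _ _ (\sum_(k < N) \sum_(ij : 'I_m * 'I_n)
    `|F (v k) ij.1 ij.2 - F (u k) ij.1 ij.2|)).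
  apply: ler_sum => k _; apply: mx_norm_le => [|i j]; first exact: sumr_ge0.
  by rewrite !mxE (bigD1 (i, j))//= lerDl sumr_ge0.
rewrite exchange_big/=; apply: (@le_lt_trans _ _ (\sum_(ij : 'I_m * 'I_n) e / (c + 1))).
  by apply: ler_sum => ij _; apply: ltW; exact: Hd.
by rewrite sumr_const -mulr_natl -/c mulrCA gtr_pMr// ltr_pdivrMr// mul1r ltrDl.
Qed.

(** A C^1 function is Lipschitz only locally; compactness of [a, b] yields one integer N valid
    everywhere, with N + 1 both as Lipschitz constant and as inverse of the admissible distance. *)
Lemma ac_lipschitz n U (h : 'rV[R]_n -> R) (c : R -> 'rV[R]_n) a b : open U -> Ck 1 U h ->
  (forall t, a <= t <= b -> U (c t)) -> abs_continuous a b c ->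
  exists L d : R, [/\ 0 < L, 0 < d & forall s t, a <= s <= b -> a <= t <= b -> `|s - t| < d ->
    `|h (c s) - h (c t)| <= L * `|c s - c t|].
Proof.
move=> oU Hh cU cac; have cptK : compact (`[a, b]%classic : set R) by exact: segment_compact.
pose P (N : nat) (s : R) := a <= s <= b -> forall t, a <= t <= b -> `|s - t| < N.+1%:R^-1 ->
  `|h (c s) - h (c t)| <= N.+1%:R * `|c s - c t|.
have Q : near_covering (`[a, b]%classic : set R) by apply/compact_near_coveringP.
have : \forall N \near \oo, forall s, (`[a, b]%classic : set R) s -> P N s.
  apply: (Q nat \oo P) => s0 /=; rewrite in_itv/= => s0ab.
  have [L L0 HL] := C1_lipschitz oU Hh (cU _ s0ab).
  have [d [d0 {}HL]] : exists d, 0 < d /\ forall x y, ball (c s0) d x -> ball (c s0) d y ->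
      `|h y - h x| <= L * `|y - x|.
    near ((0 : R)^'+) => d; exists d; split; first by near: d; exact: nbhs_right_gt.
    by near: d.
  have [r r0 Hr] := ac_uniform cac d0.
  have r20 : 0 < r / 2 by rewrite divr_gt0.
  have n1 : \forall N \near \oo, (N.+1%:R : R)^-1 < r / 2 by exact: near_infty_natSinv_lt (PosNum r20).
  have n2 : \forall N \near \oo, L <= N.+1%:R :> R.
    have := nbhs_infty_ger L; apply: filterS => N /le_trans; apply.
    by rewrite ler_nat.
  have n3 : \forall s \near s0, `|s0 - s| < r / 2 by exact: near_dist.
  exists ([set s : R | `|s0 - s| < r / 2], [set N : nat | (N.+1%:R : R)^-1 < r / 2 /\ L <= N.+1%:R :> R]).
    by split=> //=; exact: filterI.
  move=> [s N] /= [s0s [Nr LN]] sab t tab st.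
  apply: le_trans (_ : L * `|c s - c t| <= _); last by rewrite ler_wpM2r.
  apply: HL; rewrite -ball_normE/=; apply: Hr => //; last by apply: lt_trans s0s _; rewrite ltr_pdivrMr// mulr_natr mulr2n ltrDl.
  have := ltrD s0s (lt_trans st Nr); rewrite -splitr; apply: le_lt_trans.
  by have := ler_normD (s0 - s) (s - t); rewrite subrKA.
rewrite /P => -[N _ /(_ N (leqnn N)) H]; exists N.+1%:R, (N.+1%:R)^-1.
split=> //.
by move=> s t sab; apply: H => //; rewrite /= in_itv.
Unshelve. all: by end_near. Qed.

Lemma ac_comp n U (h : 'rV[R]_n -> R) (c : R -> 'rV[R]_n) a b : open U -> Ck 1 U h ->
  (forall t, a <= t <= b -> U (c t)) -> abs_continuous a b c ->
  abs_continuous a b (fun t => h (c t)).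
Proof.
move=> oU Hh cU cac; have [L [d1 [L0 d10 HL]]] := ac_lipschitz oU Hh cU cac.
move=> e e0; have eL : 0 < e / L by rewrite divr_gt0.
have [d2 d20 H2] := cac _ eL; exists (Num.min d1 d2); first by rewrite lt_min d10.
move=> m u v uv tI; rewrite lt_min => /andP[s1 s2].
apply: (@le_lt_trans _ _ (\sum_(k < m) L * `|c (v k) - c (u k)|)); last first.
  by rewrite -mulr_sumr -ltr_pdivlMl// mulrC; exact: H2.
apply: ler_sum => k _; have [h1 [h2 h3]] := uv k; apply: HL.
- by rewrite h3 (le_trans h1).
- by rewrite h1 (le_trans h2).
rewrite ger0_norm ?subr_ge0//; apply: le_lt_trans s1.
by rewrite (bigD1 k)//= lerDl sumr_ge0// => l _; have [_ [? _]] := uv l; rewrite subr_ge0.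
Qed.

(** Each entry is a polynomial in a row of A and a column of B put side by side, so [ac_comp]
    applies. *)
Lemma ac_mulmx m n p (A : R -> 'M[R]_(m, n)) (B : R -> 'M[R]_(n, p)) a b :
  abs_continuous a b A -> abs_continuous a b B -> abs_continuous a b (fun t => A t *m B t).
Proof.
move=> /ac_mxP hA /ac_mxP hB; apply/ac_mxP => i j.
pose h (y : 'rV[R]_(n + n)) := \sum_k y 0 (lshift n k) * y 0 (rshift n k).
pose c t : 'rV[R]_(n + n) := row_mx (row i (A t)) (row j (B t)^T).
have -> : (fun t => (A t *m B t) i j) = (fun t => h (c t)).
  by apply/funext => t; rewrite mxE; apply: eq_bigr => k _; rewrite row_mxEl row_mxEr !mxE.
apply: (@ac_comp _ setT) => //; first exact: openT.
  by apply: Ck_sum => [|k _]; [exact: openT|apply: CkM; [exact: openT|exact: Ck_coord openT|exact: Ck_coord openT]].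
apply/ac_mxP => i0 k; rewrite (ord1 i0).
case: (splitP k) => l kl.
  have -> : k = lshift n l by exact: val_inj.
  by apply: ac_eq (hA i l) => t _; rewrite /c row_mxEl !mxE.
have -> : k = rshift n l by exact: val_inj.
by apply: ac_eq (hB l j) => t _; rewrite /c row_mxEr !mxE.
Qed.

Lemma ae_forall_fin (I : finType) (P : I -> R -> Prop) :
  (forall i, {ae leb, forall t, P i t}) -> {ae leb, forall t, forall i, P i t}.
Proof.
move=> H; pose Q (k : nat) t := forall i : I, enum_rank i = k :> nat -> P i t.
have : {ae leb, forall t k, Q k t}.
  apply/ae_foralln => k; have [kI|kI] := ltnP k #|I|.
    apply: (ae_imp _ (H (enum_val (Ordinal kI)))) => t Pt i ik.
    by have -> : i = enum_val (Ordinal kI) by apply: enum_rank_inj; rewrite enum_valK; exact: val_inj.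
  by apply: aeW => t i ik; have := ltn_ord (enum_rank i); rewrite ik ltnNge kI.
by apply: ae_imp => t h i; exact: h.
Qed.

Lemma ac_derivable m n (F : R -> 'M[R]_(m, n)) a b : a <= b -> abs_continuous a b F ->
  {ae leb, forall t, a < t < b -> derivable F t 1}.
Proof.
move=> ab /ac_mxP Fac.
have H (ij : 'I_m * 'I_n) : {ae leb, forall t, a < t < b ->
    exists d, is_derive t 1 (fun s => F s ij.1 ij.2) d}.
  have [h [_ _ Hh]] := gac_derivable_ae (ac_gac ab (Fac ij.1 ij.2)) ab.
  apply: (ae_imp _ Hh) => t /= + tab => /(_ tab) D; exists (h t).
  apply: near_eq_is_derive D; have /andP[at_ tb] := tab.
  have n1 : \forall y \near t, a < y by exact: lt_nbhsr.
  have n2 : \forall y \near t, y < b by exact: lt_nbhsl.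
  apply: filterS2 n1 n2 => y ay yb /=.
  by have [_ _ ->] := clampP y ab; rewrite ?(ltW ay) ?(ltW yb).
apply: (ae_imp _ (ae_forall_fin H)) => t {}H tab.
pose D := \matrix_(i, j) xget 0 [set d | is_derive t 1 (fun s => F s i j) d].
suff : is_derive t 1 F D by case.
apply/is_derive_mxP => i j; rewrite mxE; have [d Hd] := H (i, j) tab.
by case: xgetP => [_ _ //|/(_ d)]; case.
Qed.

Lemma ac_constant m n (F : R -> 'M[R]_(m, n)) a b : abs_continuous a b F ->
  {ae leb, forall t, a < t < b -> is_derive t 1 F 0} ->
  forall s t, a <= s <= b -> a <= t <= b -> F s = F t.
Proof.
move=> Fac F0.
suff key s : a <= s <= b -> F s = F a by move=> s t /key -> /key ->.
move=> /andP[as_ sb]; apply/matrixP => i j.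
have Fs := (ac_mxP _ _ _).1 (ac_sub (lexx a) sb Fac) i j.
have E t : a <= t <= s -> ((fun t => F t i j) \o clamp a s) t = F t i j.
  by move=> /= ats; have [_ _ ->] := clampP t as_.
rewrite -E ?as_ ?lexx// -[RHS]E ?as_ ?lexx//.
apply: (gac_constant (ac_gac as_ Fs) as_); apply: (ae_imp _ F0) => t D ats.
have /andP[at_ ts] := ats.
have {}D : is_derive t 1 F 0 by apply: D; rewrite at_ (lt_le_trans ts).
have {}D := (is_derive_mxP _ _ _ _).1 D i j; rewrite mxE in D.
apply: near_eq_is_derive D.
have n1 : \forall y \near t, a < y by exact: lt_nbhsr.
have n2 : \forall y \near t, y < s by exact: lt_nbhsl.
by apply: filterS2 n1 n2 => y ay yb; rewrite E ?(ltW ay) ?(ltW yb).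
Qed.

(** With [P t] restricting the claim to s <= t, connectedness of [a, b] takes the place of a finite
    subcover. *)
Lemma ae_local (Q : R -> Prop) a b :
  (forall t, a <= t <= b -> exists2 d, 0 < d &
    {ae leb, forall s, `|t - s| < d -> a <= s <= b -> Q s}) ->
  {ae leb, forall s, a <= s <= b -> Q s}.
Proof.
move=> H; have [ab|ba] := leP a b; last first.
  by apply: aeW => s /andP[h1 h2]; exfalso; lra.
have K : connected (`[a, b]%classic : set R) by apply/connected_intervalP; exact: interval_is_interval.
pose P t := {ae leb, forall s, s <= t -> a <= s <= b -> Q s}.
have Pa : P a.
  have aab : a <= a <= b by rewrite lexx.
  have [d d0] := H a aab; apply: ae_imp => s h sa sab.
  by apply: h => //; have /andP[as_ _] := sab; rewrite (_ : a - s = 0) ?normr0//; lra.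
suff : P b by apply: ae_imp => s h sab; apply: h => //; case/andP: sab.
apply: (@connected_ind _ _ P a b K) => //; rewrite /= ?in_itv/= ?lexx ?ab//.
move=> z; rewrite in_itv/= => /H[d d0 Hd]; apply: filterS (near_dist z d0) => y zy _.
split=> Py.
  apply: (ae_imp2 _ Py Hd) => s h1 h2 sz sab; have [sy|ys] := leP s y; first exact: h1.
  by apply: h2 => //; move: zy; rewrite !ltr_norml => /andP[? ?]; apply/andP; split; lra.
apply: (ae_imp2 _ Py Hd) => s h1 h2 sz sab; have [sy|ys] := leP s z; first exact: h1.
by apply: h2 => //; move: zy; rewrite !ltr_norml => /andP[? ?]; apply/andP; split; lra.
Qed.

End AbsContinuousRules.

(** * Rollings *)

Section Curves.
Context {R : realType} {n : nat}.
Variable M : oriented_riemannian_manifold R n.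
Implicit Types (p q : M) (i j : idx M) (g : R -> M).
Variable tau : R.
Local Notation leb := (@lebesgue_measure R).
Local Notation curve g := {within `[0, tau], continuous g}.

Lemma ae_neq (c : R) : {ae leb, forall t, t != c}.
Proof.
exists [set c]; split=> //; first exact: lebesgue_measure_set1.
by move=> t /= /negP/negPn/eqP.
Qed.

(** Derivatives at 0 and tau involve values of the curve outside [0, tau], about which nothing is
    known; these two points form a null set. *)
Lemma ae_interior (Q : R -> Prop) : {ae leb, forall t, 0 < t < tau -> Q t} ->
  {ae leb, forall t, t \in `[0, tau] -> Q t}.
Proof.
move=> H; have n0 : {ae leb, forall t, t != 0 /\ t != tau}.
  by apply: (ae_imp2 _ (ae_neq 0) (ae_neq tau)).
apply: (ae_imp2 _ H n0) => t Qt [t0 tt]; rewrite in_itv/= => /andP[h1 h2].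
by apply: Qt; rewrite !lt_neqAle eq_sym t0 h1 tt h2.
Qed.

Lemma curve_near g (U : set M) t : curve g -> nbhs (g t) U -> 0 <= t <= tau ->
  exists2 d, 0 < d & forall s, `|t - s| < d -> 0 <= s <= tau -> U (g s).
Proof.
move=> /within_continuous_near gc Ug tt.
have /nbhs_ballP[d /= d0 H] := gc t tt _ Ug.
by exists d => // s ts ss; apply: H; rewrite -?ball_normE/=.
Qed.

Lemma curve_continuous g t : curve g -> 0 < t < tau -> {for t, continuous g}.
Proof.
move=> gc /andP[t0 tt] U Ug; have [|d d0 H] := curve_near gc Ug; first by rewrite !ltW.
have n1 : \forall y \near t, 0 < y by exact: lt_nbhsr.
have n2 : \forall y \near t, y < tau by exact: lt_nbhsl.
have n3 : \forall y \near t, 0 < y /\ y < tau by apply: filterS2 n1 n2.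
by apply: filterS2 n3 (near_dist t d0) => y [y0 yt] ty; apply: H => //; rewrite !ltW.
Qed.

(** [a, b] is a neighbourhood of t relative to [0, tau]. The last clause has a closed version, for
    values, and an open one, for derivatives, which are known only inside ]a, b[. *)
Lemma curve_charts g g' t : curve g -> curve g' -> 0 <= t <= tau -> exists i j a b d,
  [/\ 0 <= a, a <= b, b <= tau & a <= t <= b] /\ 0 < d /\
  (forall s, a <= s <= b -> domain i (g s) /\ domain j (g' s)) /\
  forall s, `|t - s| < d -> (0 <= s <= tau -> a <= s <= b) /\ (0 < s < tau -> a < s < b).
Proof.
move=> gc gc' tt; exists (some_chart (g t)), (some_chart (g' t)).
have [d1 d10 H1] := curve_near gc (open_near (domain_open _) (some_chartP (g t))) tt.
have [d2 d20 H2] := curve_near gc' (open_near (domain_open _) (some_chartP (g' t))) tt.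
pose d := Num.min d1 d2 / 2.
have m0 : 0 < Num.min d1 d2 by rewrite lt_min d10.
have d0 : 0 < d by rewrite divr_gt0.
have dd1 : d < d1 by apply: (@lt_le_trans _ _ (Num.min d1 d2)); rewrite ?ge_min ?lexx// /d; lra.
have dd2 : d < d2 by apply: (@lt_le_trans _ _ (Num.min d1 d2)); rewrite ?ge_min ?lexx ?orbT// /d; lra.
have /andP[t0 tt'] := tt.
exists (Num.max 0 (t - d)), (Num.min tau (t + d)), d; split; last split=> //; last split.
- have h1 : t - d <= t by lra.
  have h2 : t <= t + d by lra.
  have h3 : Num.max 0 (t - d) <= t by rewrite ge_max t0 h1.
  have h4 : t <= Num.min tau (t + d) by rewrite le_min tt' h2.
  by split; rewrite ?le_max ?lexx ?ge_min ?lexx ?h3 ?h4//; exact: (le_trans h3 h4).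
- move=> s; rewrite ge_max le_min => /andP[/andP[s0 sd] /andP[st sd']].
  have h : `|t - s| <= d by rewrite ler_norml; apply/andP; split; lra.
  by split; [apply: H1|apply: H2]; rewrite ?s0//; exact: le_lt_trans h _.
- move=> s; rewrite ltr_norml => /andP[h1 h2]; split=> /andP[h3 h4].
    by rewrite ge_max le_min h3 h4/=; apply/andP; split; lra.
  by rewrite gt_max lt_min h3 h4/=; apply/andP; split; lra.
Qed.

Lemma ae_charts g g' (Q : R -> Prop) : curve g -> curve g' ->
  (forall i j a b, 0 <= a -> a <= b -> b <= tau ->
    (forall s, a <= s <= b -> domain i (g s) /\ domain j (g' s)) ->
    {ae leb, forall s, a < s < b -> Q s}) ->
  {ae leb, forall s, 0 < s < tau -> Q s}.
Proof.
move=> gc gc' H; suff : {ae leb, forall s, 0 <= s <= tau -> (0 < s < tau -> Q s)}.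
  by apply: ae_imp => s h /andP[h1 h2]; apply: h; rewrite ?h1 ?h2// !ltW.
apply: ae_local => t tt.
have [i [j [a [b [d [[a0 ab bt tab] [d0 [ij dab]]]]]]]] := curve_charts gc gc' tt.
exists d => //; have := H i j a b a0 ab bt ij; apply: ae_imp => s h ts _ st; apply: h.
by have [_] := dab s ts; apply.
Qed.

Lemma ac_curveP g i a b : ac_curve tau g -> 0 <= a -> a <= b -> b <= tau ->
  (forall s, a <= s <= b -> domain i (g s)) -> abs_continuous a b (fun s => coord i (g s)).
Proof.
by move=> [_ H] a0 ab bt gi; apply: H => // s; rewrite in_itv/=; exact: gi.
Qed.

(** The index type of the atlas is arbitrary, so the null sets of the single charts cannot simply be
    united. Derivability in one chart at time t is instead carried to all charts around the
    point. *)
Lemma ac_curve_derivable g : ac_curve tau g ->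
  {ae leb, forall t, 0 < t < tau -> forall i, domain i (g t) ->
    derivable (fun s => coord i (g s)) t 1}.
Proof.
move=> gac; have [gc _] := gac.
suff : {ae leb, forall t, 0 < t < tau -> exists i, domain i (g t) /\
    derivable (fun s => coord i (g s)) t 1}.
  apply: ae_imp => t h tt i gi; have [j [gj D]] := h tt.
  by have [] := velocity_change (curve_continuous gc tt) gj gi D.
apply: (ae_charts gc gc) => i j a b a0 ab bt gi.
have gi' s : a <= s <= b -> domain i (g s) by move=> /gi[].
have := ac_derivable ab (ac_curveP gac a0 ab bt gi'); apply: ae_imp => t D tab.
exists i; split; last exact: D.
by apply: gi'; case/andP: tab => h1 h2; rewrite !ltW.
Qed.

Lemma ac_coord_comp (k l : nat) (F : 'rV[R]_n -> 'M[R]_(k, l)) (A : set M) g i a b : open A ->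
  smooth_mx (cimage i A) F -> (forall s, a <= s <= b -> domain i (g s) /\ A (g s)) ->
  abs_continuous a b (fun s => coord i (g s)) ->
  abs_continuous a b (fun s => F (coord i (g s))).
Proof.
move=> oA Fs gi gac; apply/ac_mxP => c d.
apply: (@ac_comp _ _ (cimage i A) (fun y => F y c d) _ _ _ (image_open oA) (Fs c d 1%N) _ gac).
by move=> s /gi[h1 h2]; exact: coord_image.
Qed.

Lemma derive1_unique (V : normedModType R) (F : R -> V) (t : R) dF : is_derive t 1 F dF -> derive1 F t = dF.
Proof. by move=> D; rewrite derive1E; exact: derive_val. Qed.

Lemma velocity_is_derive g i t : derivable (fun s => coord i (g s)) t 1 ->
  is_derive t 1 (fun s => coord i (g s)) (velocity g t i).
Proof. by move=> D; apply: DeriveDef; [exact: D|rewrite /velocity derive1E]. Qed.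

Lemma covariantE g (Z : R -> components M) t i : covariant_derivative g Z t i =
  derive1 (fun s => Z s i) t + gamma (metric i) (coord i (g t)) (velocity g t i) (Z t i).
Proof. by []. Qed.

Lemma config_appE (q : config M M) v i j : is_tangent (src q) v -> domain i (src q) ->
  domain j (tgt q) -> config_app q v j = v i *m mx q i j.
Proof.
move=> tv di dj; have ds := some_chartP (src q).
rewrite /config_app (tv _ _ ds di) -mulmxA; congr (_ *m _).
by rewrite -(mx_compat ds di dj dj) coord_change1// mulmx1.
Qed.

End Curves.

Lemma is_derive_rows {R : realType} (V : normedModType R) m n (F : V -> 'M[R]_(m, n)) x v dF :
  (forall k, is_derive x v (fun y => row k (F y)) (row k dF)) -> is_derive x v F dF.
Proof.
move=> H; apply/is_derive_mxP => i j; have := (is_derive_mxP _ _ _ _).1 (H i) 0 j.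
by rewrite mxE; under eq_fun do rewrite mxE.
Qed.

Lemma is_derive_rowE {R : realType} (V : normedModType R) m n (F : V -> 'M[R]_(m, n)) x v dF k :
  is_derive x v F dF -> is_derive x v (fun y => row k (F y)) (row k dF).
Proof.
move=> /is_derive_mxP H; apply/is_derive_mxP => i j; rewrite mxE.
by have := H k j; under [X in _ -> is_derive _ _ X _]eq_fun do rewrite mxE.
Qed.

(** For U' = U L and W' = W L the conclusion says that U W^-1 has derivative zero. The derivative D
    of W^-1 is known only from differentiating W^-1 W = 1. *)
Lemma inverse_rate {R : realType} m p (U : 'M[R]_(m, p)) (W Wi L D : 'M[R]_p) :
  Wi *m W = 1%:M -> W *m Wi = 1%:M -> D *m W + Wi *m (W *m L) = 0 -> U *m L *m Wi + U *m D = 0.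
Proof.
move=> WiW WWi /(congr1 (mulmx^~ Wi)); rewrite mul0mx mulmxDl -(mulmxA D) WWi mulmx1 (mulmxA Wi) WiW mul1mx.
by move=> E; rewrite -mulmxA -mulmxDr [L *m Wi + D]addrC E mulmx0.
Qed.

Lemma jets_coord_derive {R : realType} n (M : oriented_riemannian_manifold R n) kappa
    (g : 'I_(1 + n) -> M -> R) (c : R -> M) (t : R) j : is_frame kappa g ->
  {for t, continuous c} -> domain j (c t) -> derivable (fun s => coord j (c s)) t 1 ->
  is_derive t 1 (fun s => jets_coord g j (coord j (c s))) (jets_coord g j (coord j (c t)) *m
    lconn (tractor (metric j) kappa) (coord j (c t)) (velocity c t j)).
Proof.
move=> Fg cc dj D; have v := velocity_is_derive D; apply: is_derive_rows => k; rewrite row_mul.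
pose u y := jet (rep j (g k) y) (grad (metric j) (rep j (g k)) y).
have uE p : domain j p -> row k (jets_coord g j (coord j p)) = u (coord j p).
  move=> dp; have Ip := coordK dp.
  by rewrite /jets_coord row_frame_jets /jet_at /u /gradient Ip -[in RHS]/(coord_inv j) /rep/= Ip.
have P := obata_on_parallel (Fg.1 k) (@subset_refl _ (cimage j setT)).
have [d E] := P _ (coord_image dj I).
rewrite uE// -E; have nc : \forall s \near t, domain j (c s) := cc _ (open_near (@domain_open R n M j) dj).
apply: near_eq_is_derive (is_derive_comp_diff v d).
by apply: filterS nc => s ds; rewrite uE.
Qed.

(** * From a rolling to an isometry *)

Section Rolling.
Context {R : realType} {n : nat}.
Variable M : oriented_riemannian_manifold R n.
Implicit Types (i j : idx M).
Variables (kappa tau : R) (f : 'I_(1 + n) -> M -> R) (q : R -> config M M).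
Hypothesis Ff : is_frame kappa f.
Let Hf : forall k, obata_on kappa setT (f k) := Ff.1.
Hypothesis qac : ac_config tau q.
Local Notation x t := (src (q t)).
Local Notation y t := (tgt (q t)).

(** The vector fields along x to which the no-twist condition is applied. *)
Definition gradfield (F : M -> R) (s : R) : components M := fun i => gradient i F (x s).

Lemma gradfield_tangent F t : obata_on kappa setT F -> is_tangent (x t) (gradfield F t).
Proof. by move=> HF i j di dj; rewrite /gradfield -(gradient_change openT HF I di dj). Qed.

Lemma gradfield_ac F : obata_on kappa setT F -> ac_field tau (fun s => x s) (gradfield F).
Proof.
move=> HF; split; first by move=> t _; exact: gradfield_tangent.
move=> i a b a0 ab bt di; have [_ sX] := rep_smooth i HF.
have di' s : a <= s <= b -> domain i (x s) /\ setT (x s).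
  by move=> h; split=> //; apply: di; rewrite in_itv.
have [xac _ _] := qac.
exact: (ac_coord_comp openT sX di' (ac_curveP xac a0 ab bt (fun s h => (di' s h).1))).
Qed.

(* Row k is the jet (f_k(x t), q(t) grad f_k) at xhat(t), in the chart j. *)
Definition carried t j : 'M[R]_(1 + n) :=
  row_mx (values f (x t))^T (\matrix_k config_app (q t) (gradfield (f k) t) j).

Lemma row_carried t j k : row k (carried t j) = jet (f k (x t)) (config_app (q t) (gradfield (f k) t) j).
Proof.
rewrite /carried row_row_mx rowK; congr row_mx.
by apply/matrixP => a b; rewrite !mxE (ord1 b) (ord1 a) eqxx.
Qed.

Lemma carriedE t i j : domain i (x t) -> domain j (y t) ->
  carried t j = frame_jets f i (x t) *m block_mx 1%:M 0 0 (mx (q t) i j).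
Proof.
move=> di dj; rewrite /frame_jets mul_row_block mulmx1 !mulmx0 addr0 add0r; congr row_mx.
apply/row_matrixP => k; rewrite row_mul !rowK.
exact: (config_appE (gradfield_tangent (Hf k)) di dj).
Qed.

Lemma carried_change t j j' : domain j (y t) -> domain j' (y t) ->
  carried t j' = carried t j *m block_mx 1%:M 0 0 (coord_change j j' (y t)).
Proof.
move=> dj dj'; have ds := some_chartP (x t).
rewrite (carriedE ds dj) (carriedE ds dj') -mulmxA mulmx_block !mulmx0 !mul0mx mulmx1 !addr0 !add0r.
by rewrite (mx_compat ds ds dj dj') coord_change1// mul1mx.
Qed.

Lemma carried_ac i j a b : 0 <= a -> a <= b -> b <= tau ->
  (forall s, a <= s <= b -> domain i (x s) /\ domain j (y s)) ->
  abs_continuous a b (fun s => carried s j).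
Proof.
move=> a0 ab bt dij; have [xac _ mac] := qac.
have dij' s : s \in `[a, b] -> domain i (x s) /\ domain j (y s).
  by rewrite in_itv/=; exact: dij.
have mij := mac i j a b a0 ab bt dij'.
have di s : a <= s <= b -> domain i (x s) by move=> /dij[].
have xij := ac_curveP xac a0 ab bt di.
apply: (@ac_eq _ _ a b (fun s => jets_coord f i (coord i (x s)) *m block_mx 1%:M 0 0 (mx (q s) i j))).
  move=> s /dij[ds dj]; rewrite (carriedE ds dj); congr (_ *m _).
  by rewrite /jets_coord coordK.
apply: ac_mulmx.
  have fs := jets_coord_smooth i Ff.
  exact: (ac_coord_comp openT fs (fun s h => conj (di s h) I) xij).
apply/ac_mxP => k l; case: (splitP k) => k' kk; case: (splitP l) => l' ll.
- have -> : k = lshift n k' by exact: val_inj.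
  have -> : l = lshift n l' by exact: val_inj.
  by under eq_fun do rewrite block_mxEul; exact: ac_cst.
- have -> : k = lshift n k' by exact: val_inj.
  have -> : l = rshift 1 l' by exact: val_inj.
  by under eq_fun do rewrite block_mxEur; exact: ac_cst.
- have -> : k = rshift 1 k' by exact: val_inj.
  have -> : l = lshift n l' by exact: val_inj.
  by under eq_fun do rewrite block_mxEdl; exact: ac_cst.
- have -> : k = rshift 1 k' by exact: val_inj.
  have -> : l = rshift 1 l' by exact: val_inj.
  by under eq_fun do rewrite block_mxEdr; exact: ((ac_mxP _ _ _).1 mij).
Qed.

Local Opaque jacobian christoffel.

(** The value changes at the rate <grad f_k, x'> = <q grad f_k, q x'>, and q x' = xhat' by no slip.
    For the vector part Obata's equation gives D/dt grad f_k = - kappa f_k x' along x, which no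
    twist carries over to xhat. *)
Lemma carried_derive t j : 0 < t < tau -> domain j (y t) ->
  (forall i, domain i (x t) -> derivable (fun s => coord i (x s)) t 1) ->
  velocity (fun s => y s) t j = config_app (q t) (velocity (fun s => x s) t) j ->
  (forall k, config_app (q t) (covariant_derivative (fun s => x s) (gradfield (f k)) t) j =
    covariant_derivative (fun s => y s) (fun s => config_app (q s) (gradfield (f k) s)) t j) ->
  derivable (fun s => carried s j) t 1 ->
  is_derive t 1 (fun s => carried s j) (carried t j *m
    lconn (tractor (metric j) kappa) (coord j (y t)) (velocity (fun s => y s) t j)).
Proof.
move=> tt dj xd slip twist cd; have [xac yac _] := qac.
pose i := some_chart (x t); have di : domain i (x t) := some_chartP (x t).
pose v := velocity (fun s => x s) t i.
have dx : is_derive t 1 (fun s => coord i (x s)) v := velocity_is_derive (xd i di).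
have cx : {for t, continuous (fun s => x s)} := curve_continuous xac.1 tt.
have nx : \forall s \near t, domain i (x s) := cx _ (open_near (@domain_open R n M i) di).
have Ui : cimage i setT (coord i (x t)) by exact: coord_image.
apply: is_derive_rows => k; rewrite row_mul row_carried mul_jet_lconn.
have -> : (fun s => row k (carried s j)) =
    (fun s => jet (f k (x s)) (config_app (q s) (gradfield (f k) s) j)).
  by apply/funext => s; rewrite row_carried.
have [rd gd gE] := Hf k I di.
have fE : rep i (f k) (coord i (x t)) = f k (x t) by rewrite /rep/= coordK.
have E1 : config_app (q t) (gradfield (f k) t) j = gradient i (f k) (x t) *m mx (q t) i j by [].
have E2 : velocity (fun s => y s) t j = v *m mx (q t) i j by rewrite slip.
apply: is_derive_jet.
  rewrite E1 E2 inner_mulmx (mx_isometry di dj).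
  have -> : (gradient i (f k) (x t) *m metric_at i (x t) *m v^T) 0 0 =
      'd (rep i (f k)) (coord i (x t)) v by exact: (inner_gradient v (Hf k) I di).
  apply: near_eq_is_derive (is_derive_comp_diff dx rd).
  by apply: filterS nx => s ds; rewrite /rep/= coordK.
have D : is_derive t 1 (fun s => carried s j) (derive1 (fun s => carried s j) t).
  by apply: DeriveDef; [exact: cd|rewrite derive1E].
have {}D := is_derive_rowE k D.
have D' : is_derive t 1 (fun s => config_app (q s) (gradfield (f k) s) j)
    (rsubmx (row k (derive1 (fun s => carried s j) t))).
  have D2 : is_derive t 1 (fun s => row k (carried s j))
      (jet (lsubmx (row k (derive1 (fun s => carried s j) t)) 0 0)
        (rsubmx (row k (derive1 (fun s => carried s j) t)))).
    by rewrite -jet_submx.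
  have [_] := is_derive_jetP D2.
  have -> : (fun s => rsubmx (row k (carried s j))) =
      (fun s => config_app (q s) (gradfield (f k) s) j).
    by apply/funext => s; rewrite row_carried /jet row_mxKr.
  by [].
move: (rsubmx _) D' => d D'; have := twist k.
rewrite [in RHS]covariantE (derive1_unique D').
have -> : config_app (q t) (covariant_derivative (fun s => x s) (gradfield (f k)) t) j =
    - (kappa * f k (x t)) *: velocity (fun s => y s) t j.
  rewrite /config_app -/i covariantE.
  have -> : derive1 (fun s => gradfield (f k) s i) t = 'd (grad (metric i) (rep i (f k))) (coord i (x t)) v.
    by apply: derive1_unique; exact: (is_derive_comp_diff dx gd).
  have aux (a b : 'rV[R]_n) : - a - b + a = - b by rewrite addrAC addNr add0r.
  rewrite gE fE; apply: etrans (congr1 (mulmx^~ (mx (q t) i j)) (aux _ _)) _.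
  by rewrite mulNmx -scalemxAl E2 scaleNr.
move=> Ed; suff -> : - gamma (metric j) (coord j (y t)) (velocity (fun s => y s) t j)
    (config_app (q t) (gradfield (f k) t) j) - (kappa * f k (x t)) *: velocity (fun s => y s) t j = d by [].
by rewrite -scaleNr Ed addrC addrK.
Qed.

Hypotheses (slip : no_slip tau q) (twist : no_twist tau q).
Variable g : 'I_(1 + n) -> M -> R.
Hypothesis Fg : is_frame kappa g.

(** Carried jets and jets of the g_k along xhat solve the same linear equation almost everywhere, so
    their absolutely continuous quotient is constant; it is the identity at time s. *)
Lemma carried_constant i j a b : 0 <= a -> a <= b -> b <= tau ->
  (forall s, a <= s <= b -> domain i (x s) /\ domain j (y s)) ->
  forall s t, a <= s <= b -> a <= t <= b ->
  carried s j = frame_jets g j (y s) -> carried t j = frame_jets g j (y t).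
Proof.
move=> a0 ab bt dij; have [xac yac _] := qac.
have dj s : a <= s <= b -> domain j (y s) by move=> /dij[].
have yij := ac_curveP yac a0 ab bt dj.
have oI := @image_openT _ _ _ j.
have WU z : cimage j setT z -> jets_coord g j z \in unitmx.
  by move=> /imageP[_ dz _ _]; exact: Fg.2.
have iWs : smooth_mx (cimage j setT) (fun z => invmx (jets_coord g j z)).
  by move=> k l r; exact: (Ck_invmx k l oI WU (fun k l => jets_coord_smooth j Fg k l r)).
have iWac := ac_coord_comp openT iWs (fun s h => conj (dj s h) I) yij.
have cac := carried_ac a0 ab bt dij.
have Vac := ac_mulmx cac iWac.
have WE s : a <= s <= b -> jets_coord g j (coord j (y s)) = frame_jets g j (y s).
  by move=> /dj ds; rewrite /jets_coord coordK.
have Wu s : a <= s <= b -> jets_coord g j (coord j (y s)) \in unitmx.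
  by move=> h; rewrite WE//; exact: (Fg.2 _ _ (dj _ h)).
have dV : {ae @lebesgue_measure R, forall t, a < t < b ->
    is_derive t 1 (fun s => carried s j *m invmx (jets_coord g j (coord j (y s)))) 0}.
  have A1 := ae_imp2 (fun t h1 h2 => conj h1 h2) (ac_curve_derivable xac) (ac_curve_derivable yac).
  have A2 := ae_imp2 (fun t h1 h2 => conj h1 h2) (ac_derivable ab cac) (ac_derivable ab iWac).
  (* The exceptional null set of the no-twist condition depends on the field; only the 1 + n
     gradient fields are used, so a finite union suffices. *)
  have A3 := ae_imp2 (fun t h1 h2 => conj h1 h2) slip (ae_forall_fin (fun k => twist (gradfield_ac (Hf k)))).
  have A12 := ae_imp2 (fun t h1 h2 => conj h1 h2) A1 A2.
  apply: (ae_imp2 _ A12 A3) => t [[xd yd] [cd iWd]] [sl tw] tab; have /andP[at_ tb] := tab.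
  have tt : 0 < t < tau by rewrite (le_lt_trans a0 at_) (lt_le_trans tb bt).
  have tt' : t \in `[0, tau] by rewrite in_itv/=; case/andP: tt => /ltW-> /ltW->.
  have tab' : a <= t <= b by rewrite !ltW.
  have djt := dj t tab'.
  have D1 := carried_derive tt djt (xd tt) (sl tt' j djt) (fun k => tw k tt' j djt) (cd tab).
  have D2 := jets_coord_derive Fg (curve_continuous yac.1 tt) djt (yd tt j djt).
  have D3 : is_derive t 1 (fun s => invmx (jets_coord g j (coord j (y s))))
      (derive1 (fun s => invmx (jets_coord g j (coord j (y s)))) t).
    by apply: DeriveDef; [exact: iWd|rewrite derive1E].
  have := is_derive_mulmx D1 D3; move/is_derive_eq; apply.
  apply: (@inverse_rate _ _ _ _ (jets_coord g j (coord j (y t)))).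
  - by rewrite mulVmx//; exact: Wu.
  - by rewrite mulmxV//; exact: Wu.
  - apply: is_derive_unique (is_derive_mulmx D3 D2) _.
    apply: near_eq_is_derive (is_derive_const 1%:M t 1).
    have n1 : \forall s \near t, a < s by exact: lt_nbhsr.
    have n2 : \forall s \near t, s < b by exact: lt_nbhsl.
    by apply: filterS2 n1 n2 => s as_ sb; rewrite mulVmx//; apply: Wu; rewrite !ltW.
move=> s t sab tab Es; have := ac_constant Vac dV sab tab.
rewrite {1}Es -WE// mulmxV; last exact: Wu.
move=> E; have ut := Wu t tab; rewrite -(WE t tab).
by apply: etrans (esym (mulmxKV ut _)) _; rewrite -E mul1mx.
Qed.

(** The equality is independent of the chart, and [carried_constant] makes it locally constant in
    time; [0, tau] is connected. *)
Lemma carried_frame j0 : 0 < tau -> domain j0 (y 0) -> carried 0 j0 = frame_jets g j0 (y 0) ->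
  forall t, 0 <= t <= tau -> forall j, domain j (y t) -> carried t j = frame_jets g j (y t).
Proof.
move=> tau0 dj0 E0; have [xac yac _] := qac.
have ch t j j' : domain j (y t) -> domain j' (y t) -> carried t j = frame_jets g j (y t) ->
    carried t j' = frame_jets g j' (y t).
  move=> dj dj' E; rewrite (carried_change dj dj') E /frame_jets mul_row_block mulmx1 !mulmx0 addr0 add0r.
  by rewrite (gradients_change Fg.1 dj dj').
have K : connected (`[0, tau]%classic : set R).
  by apply/connected_intervalP; exact: interval_is_interval.
have H0 : forall j, domain j (y 0) -> carried 0 j = frame_jets g j (y 0).
  by move=> j dj; exact: (ch 0 j0 j dj0 dj E0).
move=> t tt; pose P t := forall j, domain j (y t) -> carried t j = frame_jets g j (y t).
apply: (@connected_ind _ _ P 0 t K) => //; rewrite /= ?in_itv/= ?lexx ?(ltW tau0)//.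
move=> z; rewrite in_itv/= => zt.
have [i [j [a [b [d [[a0 ab bt zab] [d0 [ij dab]]]]]]]] := curve_charts xac.1 yac.1 zt.
apply: filterS (near_dist z d0) => s zs; rewrite in_itv/= => st.
have sab := (dab s zs).1 st; have [_ js] := ij s sab; have [_ jz] := ij z zab.
have C := carried_constant a0 ab bt ij.
split=> h j' dj'.
  by apply: (ch z j j' jz dj'); apply: (C s z sab zab); exact: h.
by apply: (ch s j j' js dj'); apply: (C z s zab sab); exact: h.
Qed.

End Rolling.

Section Preliminaries.
Context {R : realType} {n : nat}.

Lemma smooth_jacobian m (U : set 'rV[R]_n) (F : 'rV[R]_n -> 'rV[R]_m) : open U -> smooth_mx U F ->
  smooth_mx U (jacobian F).
Proof.
move=> oU sF a k r.
have s := @smooth_partial _ _ U (fun y => F y 0 k) a (sF 0 k) r.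
apply: (Ck_eq oU _ s) => y Uy; rewrite partialE_jacobian//.
exact: smooth_mx_diff oU sF Uy.
Qed.

Lemma jacobian_chain m k l (F : 'rV[R]_m -> 'rV[R]_k) (G : 'rV[R]_k -> 'rV[R]_l) H x :
  differentiable F x -> differentiable G (F x) -> (\forall y \near x, G (F y) = H y) ->
  'J H x = 'J F x *m 'J G (F x).
Proof.
move=> dF dG E; apply: eq_mx_mull => v; rewrite mulmxA [v *m 'J F x]mul_jacobian [RHS]mul_jacobian.
have D := near_eq_is_derive E (is_derive_comp_diff (is_derive_diff v dF) dG).
rewrite mul_jacobian; apply: is_derive_unique (is_derive_diff v _) D.
exact: near_eq_differentiable E (differentiable_comp dF dG).
Qed.

Variable M : oriented_riemannian_manifold R n.
Implicit Types (i j : idx M) (g : R -> M).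
Variable tau : R.

Lemma ac_curve_eq g g' : (forall t, t \in `[0, tau] -> g t = g' t) -> ac_curve tau g -> ac_curve tau g'.
Proof.
move=> E [gc gac]; split; first by apply: (within_continuous_eq _ gc) => t; exact: E.
move=> i a b a0 ab bt gi.
have E' s : a <= s <= b -> g s = g' s.
  by case/andP=> h1 h2; apply: E; rewrite in_itv/= (le_trans a0 h1) (le_trans h2 bt).
have gi' s : s \in `[a, b] -> domain i (g s).
  by move=> h; rewrite E'; [exact: gi|move: h; rewrite in_itv].
by apply: (ac_eq _ (gac i a b a0 ab bt gi')) => s h; rewrite E'.
Qed.

(** As for curves, derivability in one chart is carried to the others: by tangency the components
    change by the transition Jacobian along the curve, which is differentiable where the curve
    is. *)
Lemma ac_field_derivable g (Z : R -> components M) : ac_curve tau g -> ac_field tau g Z ->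
  {ae @lebesgue_measure R, forall t, 0 < t < tau -> forall i, domain i (g t) ->
    derivable (fun s => Z s i) t 1}.
Proof.
move=> gac [Zt Zac]; have [gc _] := gac.
have H : {ae @lebesgue_measure R, forall t, 0 < t < tau -> exists i, domain i (g t) /\
    derivable (fun s => Z s i) t 1}.
  apply: (ae_charts gc gc) => i j a b a0 ab bt gi.
  have gi' s : s \in `[a, b] -> domain i (g s) by rewrite in_itv/= => /gi[].
  have := ac_derivable ab (Zac i a b a0 ab bt gi'); apply: ae_imp => t D tab.
  exists i; split; last exact: D.
  by apply: gi'; rewrite in_itv/=; case/andP: tab => h1 h2; rewrite !ltW.
apply: (ae_imp2 _ H (ac_curve_derivable gac)) => t {}H D tt i gi.
have [j [gj Dj]] := H tt.
have cg := curve_continuous gc tt; have /andP[t0 t1] := tt.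
have dx := velocity_is_derive (D tt j gj).
have sJ := smooth_jacobian (image_open (domain_open i)) (trans_smooth j (@subset_refl _ (domain i))).
have dJ := smooth_mx_diff (image_open (domain_open i)) sJ (coord_image gj gi).
have dZ : is_derive t 1 (fun s => Z s j) (derive1 (fun s => Z s j) t).
  by apply: DeriveDef; [exact: Dj|rewrite derive1E].
have P := is_derive_mulmx dZ (is_derive_comp_diff dx dJ).
suff : is_derive t 1 (fun s => Z s i) (derive1 (fun s => Z s j) t *m 'J (trans j i) (coord j (g t)) +
    Z t j *m 'd (jacobian (trans j i)) (coord j (g t)) (velocity g t j)) by case.
apply: near_eq_is_derive P.
have n1 : \forall s \near t, domain i (g s) := cg _ (open_near (@domain_open R n M i) gi).
have n2 : \forall s \near t, domain j (g s) := cg _ (open_near (@domain_open R n M j) gj).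
have n3 : \forall s \near t, 0 < s by exact: lt_nbhsr.
have n4 : \forall s \near t, s < tau by exact: lt_nbhsl.
have n5 : \forall s \near t, 0 < s /\ s < tau by apply: filterS2 n3 n4.
have n6 : \forall s \near t, domain i (g s) /\ domain j (g s) by apply: filterS2 n1 n2.
apply: filterS2 n5 n6 => s [s0 s1] [si sj].
by rewrite (Zt s _ j i sj si)// in_itv/= !ltW.
Qed.

End Preliminaries.

(** * From an isometry to a rolling *)

Section IsometryRolling.
Context {R : realType} {n : nat}.
Variable M : oriented_riemannian_manifold R n.
Implicit Types (p : M) (i j : idx M).
Variable iota : M -> M.
Hypotheses (si : smooth_self_map iota) (pm : preserves_metric iota) (po : preserves_orientation iota).
Let ci : continuous iota := si.1.
Local Notation lrep := (local_rep iota).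
Local Notation dom i j := (cimage i (iota @^-1` domain j)).

Lemma open_preim j : open (iota @^-1` domain j).
Proof. by apply: open_comp => [x _|]; [exact: ci|exact: domain_open]. Qed.

Lemma lrep_smooth_mx i j : smooth_mx (dom i j) (lrep i j).
Proof. by move=> a b; rewrite (ord1 a); exact: (si.2 i j b). Qed.

Lemma lrep_differentiable i j p : domain i p -> domain j (iota p) ->
  differentiable (lrep i j) (coord i p).
Proof.
move=> di dj; apply: (smooth_mx_diff (image_open (open_preim j)) (@lrep_smooth_mx i j)).
exact: coord_image.
Qed.

Local Opaque jacobian.

Lemma lrep_velocity (c : R -> M) (t : R) i j : {for t, continuous c} -> domain i (c t) ->
  domain j (iota (c t)) -> derivable (fun s => coord i (c s)) t 1 ->
  is_derive t 1 (fun s => coord j (iota (c s)))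
    (velocity c t i *m 'J (lrep i j) (coord i (c t))).
Proof.
move=> cc di dj D; rewrite mul_jacobian.
have := is_derive_comp_diff (velocity_is_derive D) (lrep_differentiable di dj).
apply: near_eq_is_derive.
have nx : \forall s \near t, domain i (c s) := cc _ (open_near (@domain_open R n M i) di).
by apply: filterS nx => s ds; exact: lrepE.
Qed.

Lemma lrep_compat i i' j j' p : domain i p -> domain i' p -> domain j (iota p) ->
  domain j' (iota p) -> 'J (lrep i j) (coord i p) *m coord_change j j' (iota p) =
  coord_change i i' p *m 'J (lrep i' j') (coord i' p).
Proof.
move=> di di' dj dj'; have d1 := lrep_differentiable di dj.
have e1 := lrepE iota j di; have e2 := transE i' di.
have d2 : differentiable (trans j j') (lrep i j (coord i p)).
  by rewrite e1; exact: trans_differentiable.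
have d3 := trans_differentiable di di'.
have d4 : differentiable (lrep i' j') (trans i i' (coord i p)).
  by rewrite e2; exact: lrep_differentiable.
have N := lrep_near ci di dj.
have N' := near_coord di (open_near (@domain_open R n M i') di').
have J1 : 'J (lrep i j') (coord i p) = 'J (lrep i j) (coord i p) *m 'J (trans j j') (lrep i j (coord i p)).
  apply: (jacobian_chain d1 d2); apply: filterS N => y [y1 y2 y3].
  by rewrite -y3 !(lrepE iota _ y1); exact: transE.
have J2 : 'J (lrep i j') (coord i p) =
    'J (trans i i') (coord i p) *m 'J (lrep i' j') (trans i i' (coord i p)).
  apply: (jacobian_chain d3 d4); apply: filterS2 N N' => y [y1 y2 y3] y4.
  by rewrite -y3 (lrepE iota _ y1) (transE i' y1) (lrepE iota _ y4).
rewrite e1 in J1; rewrite e2 in J2; exact: (etrans (esym J1) J2).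
Qed.

Definition isometry_config p : config M M := @Config R n M M p (iota p)
  (fun i j => 'J (lrep i j) (coord i p))
  (fun i i' j j' di di' dj dj' => lrep_compat di di' dj dj')
  (fun i j di dj => esym (pm di dj))
  (fun i j di dj => po di dj).

Variables (tau : R) (x : R -> M).
Hypotheses (xac : ac_curve tau x) (yac : ac_curve tau (fun t => iota (x t))).
Local Notation q := (fun t => isometry_config (x t)).

Lemma isometry_ac_config : ac_config tau q.
Proof.
split=> // i j a b a0 ab bt dij.
have di s : a <= s <= b -> domain i (x s) /\ (iota @^-1` domain j) (x s).
  by move=> h; have /dij[] : s \in `[a, b] by rewrite in_itv.
have sJ := smooth_jacobian (image_open (open_preim j)) (@lrep_smooth_mx i j).
exact: (ac_coord_comp (open_preim j) sJ di (ac_curveP xac a0 ab bt (fun s h => (di s h).1))).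
Qed.

Lemma isometry_no_slip : no_slip tau q.
Proof.
apply: ae_interior; apply: (ae_imp _ (ac_curve_derivable xac)) => t D tt j dj.
have ds := some_chartP (x t).
exact: derive1_unique (lrep_velocity (curve_continuous xac.1 tt) ds dj (D tt _ ds)).
Qed.

(** Differentiating the image field along the curve produces the second derivative of iota;
    [gamma_map] identifies it with the difference of the Christoffel terms at both ends. *)
Lemma isometry_no_twist : no_twist tau q.
Proof.
move=> Z Zac; apply: ae_interior.
apply: (ae_imp2 _ (ac_curve_derivable xac) (ac_field_derivable xac Zac)) => t D DZ tt j dj.
pose i := some_chart (x t); have di : domain i (x t) := some_chartP (x t).
pose v := velocity x t i; pose c := coord i (x t); pose z := Z t i.
have cx := curve_continuous xac.1 tt.
have dx : is_derive t 1 (fun s => coord i (x s)) v := velocity_is_derive (D tt i di).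
have dy := lrep_velocity cx di dj (D tt i di).
have dZ : is_derive t 1 (fun s => Z s i) (derive1 (fun s => Z s i) t).
  by apply: DeriveDef; [exact: DZ|rewrite derive1E].
have oU := image_open (i := i) (open_preim j); have sl := @lrep_smooth_mx i j.
have sJ := smooth_jacobian oU sl.
have Uc : dom i j c by exact: coord_image.
have dJ := smooth_mx_diff oU sJ Uc.
have HG := @metric_on_sub R n M i _ (open_preim j).
have HH := @metric_on_image R n M j.
have UV w : dom i j w -> cimage j setT (lrep i j w).
  by move=> [p [dp djp] <-]; rewrite lrepE//; exact: coord_image.
have isom w : dom i j w -> metric i w = 'J (lrep i j) w *m metric j (lrep i j w) *m ('J (lrep i j) w)^T.
  by move=> [p [dp djp] <-]; rewrite lrepE//; exact: pm.
have G := gamma_map HG HH sl UV isom v z Uc.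
have mJ w u : dom i j w -> u *m 'J (lrep i j) w = mderiv (lrep i j) w u.
  by move=> Uw; exact: (mderiv_jacobian HG sl u Uw).
(* The second derivative of iota in two guises: as an iterated [mderiv], for [gamma_map], and as the
   derivative of the Jacobian, for the product rule. *)
have E : mderiv (fun w => mderiv (lrep i j) w z) c v = z *m 'd (jacobian (lrep i j)) c v.
  have D1 : is_derive c v (fun w => z *m 'J (lrep i j) w) (z *m 'd (jacobian (lrep i j)) c v).
    have := is_derive_mulmx (is_derive_const z c v) (is_derive_diff v dJ).
    by rewrite mul0mx add0r.
  apply: is_derive_unique (mderiv_is_derive v oU (smooth_mderiv z oU sl) Uc) _.
  apply: near_eq_is_derive D1.
  by apply: filterS (open_near oU Uc) => w; exact: mJ.
have DqZ : is_derive t 1 (fun s => config_app (q s) (Z s) j)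
    (derive1 (fun s => Z s i) t *m 'J (lrep i j) c + z *m 'd (jacobian (lrep i j)) c v).
  apply: near_eq_is_derive (is_derive_mulmx dZ (is_derive_comp_diff dx dJ)).
  have /andP[t0 t1] := tt.
  have n1 : \forall s \near t, domain i (x s) := cx _ (open_near (@domain_open R n M i) di).
  have n2 : \forall s \near t, domain j (iota (x s)) := cx _ (open_near (open_preim j) dj).
  have n3 : \forall s \near t, 0 < s by exact: lt_nbhsr.
  have n4 : \forall s \near t, s < tau by exact: lt_nbhsl.
  have n5 : \forall s \near t, 0 < s /\ s < tau by apply: filterS2 n3 n4.
  have n6 : \forall s \near t, domain i (x s) /\ domain j (iota (x s)) by apply: filterS2 n1 n2.
  apply: filterS2 n5 n6 => s [s0 s1] [sdi sdj].
  have ts : is_tangent (src (q s)) (Z s) by apply: Zac.1; rewrite in_itv/= !ltW.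
  exact: esym (config_appE ts sdi sdj).
rewrite [RHS]covariantE (derive1_unique DqZ).
have -> : velocity (fun s => tgt (q s)) t j = v *m 'J (lrep i j) c by exact: derive1_unique dy.
have -> : config_app (q t) (Z t) j = z *m 'J (lrep i j) c by [].
have -> : coord j (tgt (q t)) = lrep i j c by rewrite lrepE.
have -> : config_app (q t) (covariant_derivative (fun s => src (q s)) Z t) j =
    (derive1 (fun s => Z s i) t + gamma (metric i) c v z) *m 'J (lrep i j) c by [].
by rewrite mulmxDl -addrA !mJ// G E.
Qed.

End IsometryRolling.

Theorem corollary3 (R : realType) (n : nat)
    (M : oriented_riemannian_manifold R n)
    (M_connected : connected [set: M])
    (M_simply_connected : simply_connected M)
    (M_complete : geodesically_complete M)
    (M_curvature : has_constant_sectional_curvature M)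
    (tau : R) (tau_gt0 : 0 < tau)
    (x xhat : R -> M)
    (x_ac : ac_curve tau x) (xhat_ac : ac_curve tau xhat) :
  (exists q : R -> config M M,
     is_rolling tau q /\
     forall t, t \in `[0, tau] -> src (q t) = x t /\ tgt (q t) = xhat t)
  <->
  (exists iota : M -> M,
     orientation_preserving_isometry iota /\
     forall t, t \in `[0, tau] -> iota (x t) = xhat t).
Proof.
split=> [[q [[qac slip twist] qxy]]|[iota [[[iota' [_ _ si _]] pm po] ix]]]; last first.
  have yac : ac_curve tau (fun t => iota (x t)).
    by apply: ac_curve_eq xhat_ac => t /ix.
  exists (fun t => isometry_config si pm po (x t)); split; last by move=> t tt; split=> //; exact: ix.
  by split; [exact: isometry_ac_config|exact: isometry_no_slip|exact: isometry_no_twist].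
have [kappa Hk] := M_curvature.
have HK (i : idx M) (p : M) u v w (dp : domain i p) :=
  constant_curvatureE (metric_on_image i) (coord_image dp I) (Hk i p dp) u v w.
have di := some_chartP (src (q 0)); have dj := some_chartP (tgt (q 0)).
(* The isometry used to transport jets is the matrix of q(0) in the charts chosen at its two
   ends. *)
have [f [g [Ff Fg m0 E0 hfg]]] := frame_pair M_connected M_simply_connected HK di dj (mx_isometry di dj).
have [iota [Oi i0 mi]] := developing_isometry M_complete M_connected M_simply_connected
  Ff Fg m0 di dj E0 hfg (mx_oriented di dj).
exists iota; split=> // t tt; have [<- <-] := qxy t tt.
(* At time 0 the two families of jets coincide by the choice of g. *)
have C0 : carried f q 0 (some_chart (tgt (q 0))) = frame_jets g (some_chart (tgt (q 0))) (tgt (q 0)).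
  rewrite (carriedE Ff di dj) /frame_jets mul_row_block mulmx1 !mulmx0 addr0 add0r E0; congr row_mx.
  by apply/colP => k; rewrite !mxE m0.
have C := carried_frame Ff qac slip twist Fg tau_gt0 dj C0.
have V s : 0 <= s <= tau -> values g (tgt (q s)) = values f (src (q s)).
  move=> ss; have /eq_row_mx[E _] := C s ss _ (some_chartP (tgt (q s))).
  by apply: trmx_inj; rewrite E.
have [[xc _] [yc _] _] := qac; have [[iota' [_ _ [ci _] _]] _ _] := Oi.
have K : connected (`[0, tau]%classic : set R).
  by apply/connected_intervalP; exact: interval_is_interval.
have ac : {within `[0, tau], continuous (fun s => iota (src (q s)))}.
  apply/within_continuous_near => z Kz Q Qz.
  exact: ((within_continuous_near _ _).1 xc z Kz _ (ci _ _ Qz)).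
have K0 : (`[0, tau]%classic : set R) 0 by rewrite /= in_itv/= lexx ltW.
have VK (z : R) : (`[0, tau]%classic : set R) z -> values g (iota (src (q z))) = values g (tgt (q z)).
  rewrite /= in_itv/= => zt; rewrite (V z zt).
  by apply/rowP => k; rewrite !mxE mi.
(* Equal values of the g_k give equal points only locally; with iota (x 0) = xhat 0, connectedness
   of [0, tau] extends the equality to all times. *)
have inj (z : R) : (`[0, tau]%classic : set R) z -> exists U, [/\ open U, U (tgt (q z)) &
    forall p p', U p -> U p' -> values g p = values g p' -> p = p'].
  by move=> _; exact: (values_injective_near M_complete _ Fg).
exact: (@agree_on_connected _ M _ _ (fun s => iota (src (q s))) (fun s => tgt (q s)) (values g) 0
  (@hausdorff_carrier _ _ M) K ac yc inj VK K0 i0 t tt).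
Qed.
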